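(* Let $k\in\mathbb{Z}_{\ge0}$, let $g'\in\mathbb{Z}_{\geq0}$, and let $d\in H_2(X_k';\mathbb{Z})$ be a homology class such that $d\cdot[L]>0$ and $d\cdot[E]\geq0$. Let $\vec\mu=(\vec\mu_1,\vec\mu_2)$ be an ordered partition of $d\cdot[E]$ and suppose that $n:=d\cdot[L]-1+g'+l(\mu_2)>0$. Then the refined counts of floor diagrams relative to a conic satisfy $$\begin{aligned} N_{q}^{\mu_1,\mu_2}(X_k',d,g')&=\sum_{w:\,w(\mu_2)\neq0} w\cdot N^{\mu_1\cup(w),\,\mu_2\setminus(w)}_{q}(X_k',d,g')\\ &\quad+\sum\frac{1}{\sigma}\binom{d\cdot[L]+g'-2+l(\mu_2)}{d_1\cdot[L]+g_1'-1+l(\mu_2^1),\ldots,d_m\cdot[L]+g_m'-1+l(\mu_2^m)}\binom{\mu_1}{\mu_1^1,\ldots,\mu_1^m}\\ &\qquad\cdot\prod_{j=1}^m\binom{\mu_2^j}{\mu_2^j\setminus\xi^j}\prod_{j=1}^m N_{q}^{\mu_1^j,\mu_2^j}(X_k',d_j,g_j')\prod_{x\in\xi}[x]_q\prod_{y\in\eta}\frac{[y]_q}{y}. \end{aligned}$$ Here $w(\mu_2)$ is the number of entries of $\mu_2$ equal to $w$, and the first sum is over positive integers $w$ with $w(\mu_2)\ne0$. The second sum is over all $m\ge0$, all collections of classes $d_1,\ldots,d_m\in H_2(X_k';\mathbb{Z})$, of integers $g_1',\ldots,g_m'\ge0$, of partitions $\mu^j=(\mu_1^j,\mu_2^j)$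 of $d_j\cdot[E]$, and of partitions $\xi^j\subset\mu_2^j$ ($1\le j\le m$), such that $$\bigcup_{j=1}^m\mu_1^j\subset\mu_1,\qquad \mu_2\cup\Big(\bigcup_{j=1}^m\xi^j\Big)=\bigcup_{j=1}^m\mu_2^j,\qquad |\xi^j|\neq0,$$ $$d_1+\cdots+d_m=d-[E],\qquad \sum_{j=1}^m\big(l(\xi^j)+g_j'\big)-m=g',$$ and such that $d_i\neq l[E_a]$ for all $l\geq2$, and if $d_i=[E_a]$ then $d_j\neq[E_a]$ for all $j\neq i$ ($i,j\in\{1,\ldots,m\}$, $a\in\{1,\ldots,k\}$). Moreover $\xi=\bigcup_{j}\xi^j$ and $\eta=\mu_1\setminus\bigcup_{j}\mu_1^j$. The collections $\{(d_j,g_j',\mu^j)\}_{j}$ are taken up to reordering (one numbering being fixed for each), $(\xi^1,\dots,\xi^m)$ then runs over all admissible tuples, and $\sigma$ is the product of the factorials of the cardinalities of the classes of the equivalence relation on $\{1,\ldots,m\}$ given by $i\sim j$ iff $(d_i,g_i',\mu^i)=(d_j,g_j',\mu^j)$. The non-zero initial data for this recursion are $$N_q^{(2),\emptyset}(X_k',[L],0)=\frac{[2]_q}{2},\quad N_q^{(1,1),\emptyset}(X_k',[L],0)=1,\quad N_q^{\emptyset,(1)}(X_k',[E_i],0)=1,\quad N_q^{(1),\emptyset}(X_k',[L]-[E_i],0)=1.$$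
   Context: Geometry. $E$ is a smooth conic in $\mathbb{P}^2$ and $X_k'$ is the blow-up of $\mathbb{P}^2$ at $k$ general points of $E$; the strict transform of $E$ in $X_k'$ is again denoted $E$. $E_1,\ldots,E_k$ are the exceptional divisors and $L$ is the strict transform of a general line, so $[E]=2[L]-\sum_i[E_i]$. Partitions. $l(\mu)$ is the number of parts and $|\mu|$ the sum of parts; $\cup$ is concatenation (multiset union), $\setminus$ removal of parts, $\lambda\subset\mu$ means inclusion of multisets of entries, and $i(\mu)$ is the number of entries equal to $i$. For integers, $\binom{n}{a_1,\ldots,a_m}:=\frac{n!}{a_1!\cdots a_m!(n-a_1-\cdots-a_m)!}$, and for partitions with $\bigcup_j\mu_j\subset\mu$, $\binom{\mu}{\mu_1,\ldots,\mu_m}:=\prod_i\binom{i(\mu)}{i(\mu_1),\ldots,i(\mu_m)}$. An ordered partition $\vec\mu=(\vec\mu_1,\vec\mu_2)$ of $d\cdot[E]$ is a concatenation of $\vec\mu_1=(\mu_1^{(1)},\ldots)$ and $\vec\mu_2=(\mu_2^{(1)},\ldots)$ (possibly empty) with $|\mu_1|+|\mu_2|=d\cdot[E]$; the refined counts depend only on the underlying unordered partitions $\mu_1,\mu_2$. Quantum integers: $[n]_q=\frac{q^{n/2}-q^{-n/2}}{q^{1/2}-q^{-1/2}}$. Floor diagrams. Let $\Gamma$ be a finite oriented graph with positive integer edge weights $w$. The divergence $\mathrm{div}(v)$ of a vertex is the sum of weights of incoming edges minus the sum of weights of outgoing edges. $\mathrm{Vert}^\infty(\Gamma)$ is the set of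 leaves (vertices adjacent to exactly one edge) whose adjacent edge is outgoing, and $\mathrm{Edge}^\infty(\Gamma)$ is the set of edges adjacent to them. A floor diagram $\mathcal{D}$ of genus $g$ and degree $d_{\mathcal{D}}$ is a connected weighted oriented graph such that: (1) it has no nontrivial oriented cycle; (2) its first Betti number is $g$; (3) $\mathrm{div}(v)\in\{2,4\}$ for $v\notin\mathrm{Vert}^\infty(\mathcal{D})$, and $\mathrm{div}(v)\le -1$ for $v\in\mathrm{Vert}^\infty(\mathcal{D})$; (4) if $\mathrm{div}(v)=2$, all edges adjacent to $v$ are oriented toward $v$; (5) $\sum_{v\in\mathrm{Vert}^\infty(\mathcal{D})}\mathrm{div}(v)=-2d_{\mathcal{D}}$. A vertex $v\notin\mathrm{Vert}^\infty(\mathcal{D})$ is called a floor of degree $\mathrm{div}(v)/2$. The orientation induces a partial order on $\mathcal{D}$ (vertices and edges). Markings. Given $d$, $g$ and $(\vec\mu_1,\vec\mu_2)$, choose disjoint sets $A_0=\{1,\ldots,d\cdot[L]-1+g+l(\mu_1)+l(\mu_2)\}$ and $A_1,\ldots,A_k$ with $|A_i|=d\cdot[E_i]$ (no marking exists if some $d\cdot[E_i]<0$). A $d$-marking of type $(\vec\mu_1,\vec\mu_2)$ of a floor diagram $\mathcal{D}$ of genus $g$ and degree $d\cdot[L]$ is a map $m:\bigcup_{i=0}^kA_i\to\mathcal{D}$ (to vertices and edges) such that: (1) $m$ is injective and increasing ($m(i)>m(j)$ implies $i>j$; only the natural order of $A_0$ matters, the $A_i$ with $i\ge1$ being unordered),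 and its image contains no floor of degree 1; (2) for each $v\in\mathrm{Vert}^\infty(\mathcal{D})$ with adjacent edge $e$, exactly one of $v,e$ is in the image of $m$; (3) $m(\bigcup_{i\ge1}A_i)\subset\mathrm{Vert}^\infty(\mathcal{D})$ and $m(\{1,\ldots,l(\mu_1)\})=m(A_0)\cap\mathrm{Vert}^\infty(\mathcal{D})$; (4) for each $i\in\{1,\dots,k\}$, a floor is adjacent to at most one edge that is adjacent to a vertex of $m(A_i)$; (5) for $1\le i\le l(\mu_1)$, the edge adjacent to $m(i)$ has weight $\mu_1^{(i)}$; (6) exactly $l(\mu_2)$ edges of $\mathrm{Edge}^\infty(\mathcal{D})$ are in $m(A_0)$, and their weights are $\mu_2^{(1)},\ldots,\mu_2^{(l(\mu_2))}$. Two markings are equivalent if they differ by an automorphism of the weighted oriented graph $\mathcal{D}$ and a bijection of the marking sets that is the identity on $A_0$ and maps each $A_i$ ($i\ge1$) bijectively to the corresponding set. Refined count. Let $\mathrm{Edge}^{\vec\mu_1}$ be the set of edges adjacent to $m(\{1,\ldots,l(\mu_1)\})$, $\mathrm{Edge}^{\vec\mu_2}$ the set of edges in (6), $\mathrm{Edge}^\circ(\mathcal{D})=\mathrm{Edge}(\mathcal{D})\setminus\mathrm{Edge}^\infty(\mathcal{D})$, and $$\mathrm{mult}_q(\mathcal{D},m)=\prod_{e\in\mathrm{Edge}^{\vec\mu_2}}\frac{[w(e)]_q}{w(e)}\prod_{e\in\mathrm{Edge}^{\vec\mu_1}}\frac{[w(e)]_q}{w(e)}\prod_{e\in\mathrm{Edge}^{\vec\mu_2}}w(e)\prod_{e\in\mathrm{Edge}^\circ(\mathcal{D})}[w(e)]_q^2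 .$$ For $d\cdot[L]>0$, $N_q^{\mu_1,\mu_2}(X_k',d,g)=\sum_{[\mathcal{D},m]}\mathrm{mult}_q(\mathcal{D},m)$, summed over equivalence classes of $d$-marked floor diagrams of genus $g$ and type $(\vec\mu_1,\vec\mu_2)$. Floor diagrams have positive degree, so by convention $N_q^{\emptyset,(1)}(X_k',[E_i],0):=1$, and $N_q^{\mu_1,\mu_2}(X_k',d,g):=0$ in all other cases with $d\cdot[L]\le 0$.
   Formalization: The printed list of non-zero initial data is incomplete for k ≥ 2: the formal list adds N^{∅,∅}(X_k',[L]-[E_i]-[E_j],0)=1 for i≠j, where n=0 and exactly one marked floor diagram exists. *)

(* Defs.v *)
From HB Require Import structures.
From mathcomp Require Import all_boot all_order all_algebra.
From mathcomp Require Import finmap multiset.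
From mathcomp Require Import boolp classical_sets cardinality fsbigop.

Set Implicit Arguments.
Unset Strict Implicit.
Unset Printing Implicit Defensive.

Import Order.TTheory GRing.Theory Num.Theory.

Local Open Scope classical_set_scope.
Local Open Scope ring_scope.
Local Open Scope mset_scope.

(* H_2(X'_k; Z) is free on [L], [E_1], ..., [E_k]; the pair (a, b) stands for
   a [L] + \sum_i b_i [E_i]. *)
Notation H2 k := (int * {ffun 'I_k -> int})%type.

Definition clsL (k : nat) : H2 k := (1, 0).
Definition clsEi (k : nat) (i : 'I_k) : H2 k := (0, [ffun j => (j == i)%:R]).
Definition clsE (k : nat) : H2 k := clsL k *+ 2 - \sum_(i < k) clsEi i.

(* [L].[L] = 1, [E_i].[E_i] = -1, all other products of basis elements vanish *)
Definition dot (k : nat) (x y : H2 k) : int :=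
  x.1 * y.1 - \sum_(i < k) x.2 i * y.2 i.

(* An ordered partition is a sequence, an unordered one a multiset, of positive
   integers; [sumn mu] is |mu|, [size mu] is l(mu) and [mu i] is i(mu). *)
Definition parts_pos (mu : seq nat) : Prop := 0%N \notin mu.

Definition multinomial (F : fieldType) (n : nat) (a : seq nat) : F :=
  n`!%:R / ((\prod_(x <- a) x`!%:R) * (n - sumn a)`!%:R).

Definition pmultinomial (F : fieldType) (mu : {mset nat})
    (nus : seq {mset nat}) : F :=
  \prod_(i <- finsupp mu) multinomial F (mu i) [seq (nu : {mset nat}) i | nu <- nus].

(* The field Q(q^{1/2}), with qh the variable q^{1/2} *)
Definition Kq : fieldType := {fraction {poly rat}}.
Definition qh : Kq := tofrac ('X : {poly rat}).
Definition qint (n : nat) : Kq := (qh ^+ n - qh ^- n) / (qh - qh^-1).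

(* Every finite oriented weighted multigraph is isomorphic to one of this form. *)
Record wgraph := WGraph {
  nv : nat;
  ne : nat;
  src : 'I_ne -> 'I_nv;
  tgt : 'I_ne -> 'I_nv;
  wt : 'I_ne -> nat }.

Notation elt D := ('I_(nv D) + 'I_(ne D))%type.

Section Graph.
Variable D : wgraph.
Implicit Types (u v : 'I_(nv D)) (e : 'I_(ne D)).

Definition adjacent e v : bool := (src e == v) || (tgt e == v).

Definition divergence v : int :=
  \sum_(e | tgt e == v) (wt e)%:Z - \sum_(e | src e == v) (wt e)%:Z.

Definition vert_inf v : bool :=
  (#|[pred e | adjacent e v]| == 1%N) && [exists e, src e == v].
Definition edge_inf e : bool := [exists v, vert_inf v && adjacent e v].

Definition arrow u v : bool := [exists e, (src e == u) && (tgt e == v)].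
Definition neighbor u v : bool := arrow u v || arrow v u.

(* b_1 = b_0 - chi *)
Definition betti1 : int :=
  (ne D)%:Z - (nv D)%:Z + (n_comp neighbor predT)%:Z.

Definition floor_diagram (g : nat) (deg : int) : Prop :=
  [/\ (forall e, 0 < wt e)%N,
      (0 < nv D)%N /\ (forall u v, connect neighbor u v),
      (forall v p, path arrow v p -> last v p = v -> p = [::]),
      betti1 = g%:Z &
   [/\ forall v, ~~ vert_inf v -> divergence v = 2 \/ divergence v = 4,
       forall v, vert_inf v -> divergence v <= -1,
       forall v, divergence v = 2 -> forall e, adjacent e v -> tgt e = v &
       \sum_(v | vert_inf v) divergence v = - (2 * deg)]].

Definition is_floor v : bool := ~~ vert_inf v.

(* The order induced by the orientation on vertices and edges: an edge lies
   above its source and below its target. *)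
Definition elt_step (x y : elt D) : bool :=
  match x, y with
  | inl v, inr e => src e == v
  | inr e, inl v => tgt e == v
  | _, _ => false
  end.
Definition elt_lt (x y : elt D) : bool := (x != y) && connect elt_step x y.

End Graph.

(* The disjoint union of A_0 = {0, ..., a0 - 1} (so numbered from 0) and of the
   sets A_i, with a i elements. *)
Definition marks (k a0 : nat) (a : 'I_k -> nat) : Type :=
  ('I_a0 + {i : 'I_k & 'I_(a i)})%type.

Record mgraph (k a0 : nat) (a : 'I_k -> nat) := MGraph {
  diag : wgraph;
  mark : marks a0 a -> elt diag }.

HB.instance Definition _ (k a0 : nat) (a : 'I_k -> nat) :=
  gen_eqMixin (mgraph a0 a).
HB.instance Definition _ (k a0 : nat) (a : 'I_k -> nat) :=
  gen_choiceMixin (mgraph a0 a).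

Section Marking.
Variables (k a0 : nat) (a : 'I_k -> nat) (X : mgraph a0 a).
Local Notation D := (diag X).
Local Notation m := (@mark k a0 a X).
Implicit Types (u v : 'I_(nv D)) (e : 'I_(ne D)).

(* the edges of Edge^\infty marked by A_0, which make up Edge^{mu_2} *)
Definition edge_mu2 e : bool :=
  edge_inf e && [exists p : 'I_a0, m (inl p) == inr e].

(* Edge^{mu_1}, where l1 is the length of mu_1 *)
Definition edge_mu1 (l1 : nat) e : bool :=
  [exists p : 'I_a0, [exists v,
    [&& (p < l1)%N, m (inl p) == inl v & adjacent e v]]].

Definition marked_by (i : 'I_k) v : bool :=
  [exists p : 'I_(a i), m (inr (existT _ i p)) == inl v].

Definition marking (mu1 mu2 : seq nat) : Prop :=
  [/\ [/\ injective m,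
          forall p r : 'I_a0, elt_lt (m (inl r)) (m (inl p)) -> (r < p)%N &
          forall v x, is_floor v -> divergence v = 2 -> m x <> inl v],
      forall v e, vert_inf v -> adjacent e v ->
        (exists x, m x = inl v) /\ ~ (exists x, m x = inr e) \/
        ~ (exists x, m x = inl v) /\ (exists x, m x = inr e),
      (forall x, exists2 v, vert_inf v & m (inr x) = inl v) /\
      ([set m (inl p) | p in [set p : 'I_a0 | (p < size mu1)%N]] =
       range (fun p : 'I_a0 => m (inl p)) `&`
         [set (inl v : elt D) | v in [set v | vert_inf v]])%classic,
      forall (i : 'I_k) v, is_floor v ->
        (#|[pred e | adjacent e v &&
                     [exists u, adjacent e u && marked_by i u]]| <= 1)%N &
   [/\ forall (p : 'I_a0) v e, (p < size mu1)%N -> m (inl p) = inl v ->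
         adjacent e v -> wt e = nth 0%N mu1 p &
       perm_eq [seq wt e | e <- enum [pred e | edge_mu2 e]] mu2]].

Definition mult_q (l1 : nat) : Kq :=
  (\prod_(e : 'I_(ne D) | edge_mu2 e) (qint (wt e) / (wt e)%:R)) *
  (\prod_(e : 'I_(ne D) | edge_mu1 l1 e) (qint (wt e) / (wt e)%:R)) *
  (\prod_(e : 'I_(ne D) | edge_mu2 e) (wt e)%:R) *
  (\prod_(e : 'I_(ne D) | ~~ edge_inf e) qint (wt e) ^+ 2).

End Marking.

Definition mequiv (k a0 : nat) (a : 'I_k -> nat) (X Y : mgraph a0 a) : Prop :=
  exists (fV : 'I_(nv (diag X)) -> 'I_(nv (diag Y)))
         (fE : 'I_(ne (diag X)) -> 'I_(ne (diag Y)))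
         (s : forall i : 'I_k, 'I_(a i) -> 'I_(a i)),
    [/\ bijective fV, bijective fE, forall i, bijective (s i),
        forall e, [/\ src (fE e) = fV (src e), tgt (fE e) = fV (tgt e)
                    & wt (fE e) = wt e] &
        let f (x : elt (diag X)) : elt (diag Y) :=
          match x with inl v => inl (fV v) | inr e => inr (fE e) end in
        (forall p : 'I_a0, mark Y (inl p) = f (mark X (inl p))) /\
        (forall i (p : 'I_(a i)), mark Y (inr (existT _ i (s i p))) =
                                  f (mark X (inr (existT _ i p))))].

(* a chosen representative of the equivalence class of X *)
Definition mrepr (k a0 : nat) (a : 'I_k -> nat) (X : mgraph a0 a) : mgraph a0 a :=
  xget X [set Y | mequiv X Y].

Definition marked_diagrams (k : nat) (d : H2 k) (g : nat) (mu1 mu2 : seq nat)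
    (a0 : nat) (a : 'I_k -> nat) : set (mgraph a0 a) :=
  [set X | [/\ a0%:Z = dot d (clsL k) - 1 + g%:Z + (size mu1)%:Z + (size mu2)%:Z,
               forall i, (a i)%:Z = dot d (clsEi i),
               floor_diagram (diag X) g (dot d (clsL k)) &
               marking X mu1 mu2]].

(* When dot d (clsL k) > 0, the absolute value in a0 is exact; if dot d [E_i] is
   negative for some i, [marked_diagrams] is empty. The sum has one term for each
   equivalence class. *)
Definition Nord (k : nat) (d : H2 k) (g : nat) (mu1 mu2 : seq nat) : Kq :=
  if 0 < dot d (clsL k) then
    let a0 := absz (dot d (clsL k) - 1 + g%:Z + (size mu1)%:Z + (size mu2)%:Z) in
    let a := fun i : 'I_k => absz (dot d (clsEi i)) in
    \sum_(X \in [set mrepr X | X in @marked_diagrams k d g mu1 mu2 a0 a])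
      mult_q X (size mu1)
  else if [&& [exists i : 'I_k, d == clsEi i], g == 0%N,
              mu1 == [::] & mu2 == [:: 1%N]] then 1
  else 0.

(* For unordered partitions, with an arbitrary ordering of the parts *)
Definition Nq (k : nat) (d : H2 k) (g : nat) (mu1 mu2 : {mset nat}) : Kq :=
  Nord d g (enum_mset mu1) (enum_mset mu2).

(* the data (d_j, g_j', (mu_1^j, mu_2^j)) *)
Record component (k : nat) := Component {
  cls : H2 k;
  gen : nat;
  part1 : {mset nat};
  part2 : {mset nat} }.

Definition component_tuple (k : nat) (c : component k) :=
  (cls c, gen c, part1 c, part2 c).
Definition tuple_component (k : nat) (x : H2 k * nat * {mset nat} * {mset nat}) :=
  Component x.1.1.1 x.1.1.2 x.1.2 x.2.
Lemma component_tupleK (k : nat) :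
  cancel (@component_tuple k) (@tuple_component k).
Proof. by case. Qed.
HB.instance Definition _ (k : nat) :=
  Choice.copy (component k) (can_type (@component_tupleK k)).

Definition mset_union (T : choiceType) (s : seq {mset T}) : {mset T} :=
  \big[msetD/mset0]_(A <- s) A.

(* A collection taken up to reordering is a multiset C; its fixed numbering is
   the sequence [enum_mset C]. An index of the sum is such a C together with the
   tuple xi = (xi^1, ..., xi^m). *)
Notation sum_index k := ({mset component k} * seq {mset nat})%type.

Definition admissible (k : nat) (d : H2 k) (g : nat) (mu1 mu2 : {mset nat})
    (I : sum_index k) : Prop :=
  let C := enum_mset I.1 in
  let xi := I.2 in
  [/\ size xi = size C,
      forall c, c \in C ->
        [/\ parts_pos (part1 c), parts_pos (part2 c) &
            (sumn (part1 c))%:Z + (sumn (part2 c))%:Z = dot (cls c) (clsE k)],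
      forall (c : component k) (x : {mset nat}), (c, x) \in zip C xi ->
        x `<=` part2 c /\ sumn x != 0%N,
      [/\ mset_union [seq part1 c | c <- C] `<=` mu1,
          mu2 `+` mset_union xi = mset_union [seq part2 c | c <- C],
          \sum_(c <- C) cls c = d - clsE k &
          \sum_(p <- zip C xi) ((size p.2)%:Z + (gen p.1)%:Z) - (size C)%:Z = g%:Z] &
      (forall c (a : 'I_k) (l : nat), c \in C -> (2 <= l)%N -> cls c <> clsEi a *+ l) /\
      (forall (a : 'I_k) (i j : 'I_(size C)),
         cls (tnth (in_tuple C) i) = clsEi a -> cls (tnth (in_tuple C) j) = clsEi a ->
         i = j)].

(* the product of the factorials of the multiplicities of the elements of C *)
Definition sigma (k : nat) (C : {mset component k}) : nat :=
  (\prod_(c <- finsupp C) (C c)`!)%N.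

(* The integers under the absolute values are nonnegative in every admissible
   term in which all the factors [Nq] are nonzero. *)
Definition second_term (k : nat) (d : H2 k) (g : nat) (mu1 mu2 : {mset nat})
    (I : sum_index k) : Kq :=
  let C := enum_mset I.1 in
  let xi := I.2 in
  let eta := mu1 `\` mset_union [seq part1 c | c <- C] in
  (sigma I.1)%:R^-1 *
  multinomial Kq (absz (dot d (clsL k) + g%:Z - 2 + (size mu2)%:Z))
    [seq absz (dot (cls c) (clsL k) + (gen c)%:Z - 1 + (size (part2 c))%:Z) | c <- C] *
  pmultinomial Kq mu1 [seq part1 c | c <- C] *
  (\prod_(p <- zip C xi) pmultinomial Kq (part2 p.1) [:: part2 p.1 `\` p.2]) *
  (\prod_(c <- C) Nq (cls c) (gen c) (part1 c) (part2 c)) *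
  (\prod_(x <- mset_union xi) qint x) *
  (\prod_(y <- eta) (qint y / y%:R)).

(* Main.v *)
Require Import Defs.
From HB Require Import structures.
From mathcomp Require Import all_boot all_order all_algebra.
From mathcomp Require Import finmap multiset.
From mathcomp Require Import boolp classical_sets cardinality fsbigop.
From mathcomp Require Import zify ring.
(* imported last: the set notations are then those of finset *)
From mathcomp Require Import fintype finset.

Set Implicit Arguments.
Unset Strict Implicit.
Unset Printing Implicit Defensive.

Import Order.TTheory GRing.Theory Num.Theory.

Local Open Scope ring_scope.
Local Open Scope mset_scope.

(* By floor-marking, a marked diagram is rigid: an Euler characteristic count shows that
   [A_0] marks every floor of degree 2, every bounded edge, and one end of each leaf edge
   that is not marked by some [A_i]. So an equivalence class is the same thing as a
   structure on the ordered set of labels [A_0], which records for every label the floor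
   its edge leaves, the floor it enters, its weight, and the set of [A_i] attached to its
   target. Isomorphisms disappear and the refined count is a sum over such structures.

   The recursion looks at the smallest label that is not a leaf of type mu_1. If it is an
   edge, it is a leaf edge, and declaring its leaf to be marked instead gives the first
   sum, with a factor w. If it is a floor, it is the first floor of degree 2: every edge
   entering it is a leaf edge, belonging to eta or marked by some [A_a], and deleting it
   splits the rest of the label set into connected structures, each joined to it by edges
   leaving it (the xi^j). A class [E_a] occurs among the d_j exactly when no edge marked by
   [A_a] enters the floor. Distributing the labels over the components gives the multinomial
   coefficients. *)

(** * Multisets of weights *)

(** Cutting and regluing is awkward on isomorphism classes of graphs; on a fixed label set,
    restriction and gluing are mutually inverse and components are plain subsets. For the sums to be
    finite, weights must be bounded: [B] is chosen at least twice the degree, because by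
    conservation of flow an edge weighs no more than the total divergence of the floors above it. A
    component occupies an arbitrary subset of the labels, so structures are defined over any finite
    type with any ranking [rk] and any set [S1], and a relabelling compares them with the standard
    ones. Unordered collections with the factor 1/sigma are handled through ordered lists of
    component types: sigma is the number of orderings of the components of one structure that agree
    with the fixed numbering. Free labels get the colour 0 and the labels of mu_1 their weight as
    colour, so that both multinomial coefficients of the formula count one splitting of a coloured
    set. The equation for the degrees of the d_j is the divergence condition at the removed floor,
    and the genus equation is the count of labels. *)

Lemma Kq_natr_neq0 (n : nat) : (0 < n)%N -> (n%:R : Kq) != 0.
Proof.
move=> n0; have -> : (n%:R : Kq) = tofrac (n%:R : {poly rat}) by rewrite rmorph_nat.
by rewrite tofrac_eq0 -polyC_natr polyC_eq0 pnatr_eq0 -lt0n.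
Qed.

Lemma mset_unionE (T : choiceType) (s : seq {mset T}) x :
  mset_union s x = sumn [seq (A : {mset T}) x | A <- s].
Proof.
rewrite /mset_union; elim: s => [|A s IH] /=; first by rewrite big_nil mset0E.
by rewrite big_cons msetE2 IH.
Qed.

Section Weights.
Variable T : finType.
Implicit Types (f : T -> nat) (A U : {set T}).

Definition wts f A : {mset nat} := seq_mset [seq f p | p <- enum A].

Lemma wtsE f A x : wts f A x = #|[set p in A | f p == x]|.
Proof.
rewrite mset_seqE count_map -size_filter cardE; congr size.
by rewrite {2}/enum_mem -filter_predI -enumT; apply: eq_filter => p /=; rewrite !inE andbC.
Qed.

Lemma eq_wts f g A : {in A, f =1 g} -> wts f A = wts g A.
Proof.
move=> fg; congr seq_mset; apply/eq_in_map => p; rewrite mem_enum; exact: fg.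
Qed.

Lemma wts0 f : wts f set0 = mset0.
Proof. by apply/msetP => x; rewrite wtsE mset0E; apply: eq_card0 => p; rewrite !inE. Qed.

Lemma wtsU f A U : [disjoint A & U] -> wts f (A :|: U) = wts f A `+` wts f U.
Proof.
move=> dAU; apply/msetP => x; rewrite msetE2 !wtsE -cardsUI.
rewrite [X in (_ + X)%N]eq_card0 ?addn0 => [|p].
  by apply: eq_card => p; rewrite !inE andb_orl.
rewrite !inE; case: (boolP (p \in A)) => //= pA.
by rewrite (disjointFr dAU pA) andbF.
Qed.

Lemma wtsU1 f a A : a \notin A -> wts f (a |: A) = [mset f a] `+` wts f A.
Proof.
move=> aA; rewrite wtsU; last by rewrite disjoints1.
congr msetD; apply/msetP => x; rewrite wtsE msetnE.
have -> : [set p in [set a] | f p == x] = if x == f a then [set a] else set0.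
  apply/setP => p; rewrite !inE; case: (x =P f a) => [->|ne]; rewrite !inE;
    case: (p =P a) => [->|//] /=; first exact: eqxx.
  by apply/eqP => /esym.
by case: ifP; rewrite ?cards1 ?cards0.
Qed.

Lemma wtsD f A U : U \subset A -> wts f A = wts f U `+` wts f (A :\: U).
Proof.
move=> UA; rewrite -wtsU; last by apply/pred0P => p; rewrite /= !inE; case: (p \in U).
by rewrite -{1}(setID A U) (setIidPr UA).
Qed.

Lemma wtsS f A U : U \subset A -> wts f U `<=` wts f A.
Proof.
move=> UA; rewrite (wtsD f UA); apply/msubsetP => x; rewrite msetE2; exact: leq_addr.
Qed.

Lemma size_wts f A : size (wts f A) = #|A|.
Proof. by rewrite (perm_size (perm_eq_seq_mset _)) size_map -cardE. Qed.

Lemma big_wts (R : Type) (idx : R) (op : Monoid.com_law idx) f A (F : nat -> R) :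
  \big[op/idx]_(x <- wts f A) F x = \big[op/idx]_(p in A) F (f p).
Proof. by rewrite (perm_big _ (perm_eq_seq_mset _)) big_map big_enum. Qed.

Lemma sumn_wts f A : sumn (wts f A) = \sum_(p in A) f p.
Proof. by rewrite sumnE big_wts. Qed.

Lemma mem_wts f A x : x \in wts f A -> exists2 p, p \in A & f p = x.
Proof.
rewrite (perm_mem (perm_eq_seq_mset _)) => /mapP[p]; rewrite mem_enum => pA ->.
by exists p.
Qed.

Lemma sum_subsetU1 (R : Type) (idx : R) (op : Monoid.com_law idx) a A (g : {set T} -> R) :
  a \notin A ->
  \big[op/idx]_(U : {set T} | U \subset a |: A) g U =
  \big[op/idx]_(U : {set T} | U \subset A) op (g U) (g (a |: U)).
Proof.
move=> aA; rewrite (bigID (fun U : {set T} => a \notin U)) /= big_split /=; congr (op _ _).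
  apply: eq_bigl => U; apply/andP/idP => [[UA aU]|UA].
    apply/subsetP => p pU; have := subsetP UA p pU; rewrite !inE.
    by case: eqP => // pa; rewrite -pa pU in aU.
  by rewrite (subset_trans UA (subsetUr _ _)) (contra (subsetP UA a)).
rewrite (reindex_onto (fun U => a |: U) (fun U => U :\ a)) /=; last first.
  by move=> U /andP[_]; rewrite negbK => aU; rewrite setD1K.
apply: eq_bigl => U; rewrite !inE eqxx /= !andbT.
apply/andP/idP => [[UA /eqP <-]|UA].
  rewrite subUset sub1set !inE eqxx /= in UA.
  apply/subsetP => p; rewrite !inE => /andP[pa /orP[/eqP E|pU]].
    by rewrite E eqxx in pa.
  by have := subsetP UA p pU; rewrite !inE (negbTE pa).
rewrite setUS //; split => //; apply/eqP; rewrite setU1K //.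
by apply: contra aA => /(subsetP UA).
Qed.

(** Induction on [A]: a chosen element [a] is either left out or taken, and taking it lowers the
    requested multiplicity of the colour [f a] by one. On that colour this is Pascal's rule, and the
    other factors do not move. The range [S] of the product is a parameter so that it stays fixed
    while [A] and [nu] shrink. *)
Lemma card_subsets_wts_bin f A (nu : {mset nat}) (S : {fset nat}) :
  (forall p, p \in A -> f p \in S) -> (forall x, nu x != 0%N -> x \in S) ->
  (\sum_(U : {set T} | U \subset A) (wts f U == nu) = \prod_(x <- S) 'C(wts f A x, nu x))%N.
Proof.
move: {2}#|A| (erefl #|A|) => n; elim: n A nu => [|n IH] A nu nA fS nuS.
  move/eqP: nA; rewrite cards_eq0 => /eqP ->.
  rewrite (eq_bigl (pred1 set0)) => [|U]; last by rewrite finset.subset0.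
  rewrite big_pred1_eq wts0; case: eqP => [<-|nu0].
    by rewrite big1 // => x _; rewrite mset0E.
  have /existsP[x] : [exists x : S, nu (val x) != 0%N].
    apply: contra_notT nu0 => /existsPn H; apply/esym/msetP => x; rewrite mset0E.
    by apply/eqP/negPn/negP => /[dup] /nuS xS; have /negP := H [` xS]%fset.
  rewrite -lt0n => nux; rewrite (big_fsetD1 (val x)) ?fsvalP //= mset0E.
  by rewrite bin_small ?mul0n.
have [a aA] : exists a, a \in A by apply/set0Pn; rewrite -cards_eq0 nA.
have aA' : a \notin A :\ a by rewrite !inE eqxx.
have EA := setD1K aA; rewrite -EA sum_subsetU1 // big_split /=.
have cA' : #|A :\ a| = n by have := cardsD1 a A; rewrite aA nA => -[].
have fS' p : p \in A :\ a -> f p \in S by rewrite !inE => /andP[_ /fS].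
have aS : f a \in S by apply: fS.
rewrite wtsU1 // IH //.
have sumE : (\sum_(U : {set T} | U \subset A :\ a) (wts f (a |: U) == nu) =
   if (0 < nu (f a)) then \sum_(U : {set T} | U \subset A :\ a) (wts f U == nu `\ f a) else 0)%N.
  case: posnP => [nu0|nu0].
    rewrite big1 // => U UA; case: eqP => // E.
    move: nu0; rewrite -E wtsU1 ?(contra (subsetP UA a)) //.
    by rewrite msetE2 msetnxx.
  apply: eq_bigr => U UA; rewrite wtsU1 ?(contra (subsetP UA a)) //.
  congr nat_of_bool; apply/eqP/eqP => [<-|->]; first by rewrite msetDKB.
  by rewrite msetB1K // in_mset.
have DS (F : nat -> nat) : (\prod_(x <- S) F x = F (f a) * \prod_(x <- (S `\ f a)%fset) F x)%N.
  exact: big_fsetD1.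
rewrite sumE !DS msetE2 msetnxx add1n.
have rest : (\prod_(x <- S `\ f a) 'C(([mset f a] `+` wts f (A :\ a)) x, nu x) =
             \prod_(x <- S `\ f a) 'C(wts f (A :\ a) x, nu x))%fset%N.
  apply: eq_big_seq => x /fsetD1P[xa _].
  by rewrite mset1DE (negbTE xa).
rewrite rest; case: posnP => [->|nu0]; first by rewrite !bin0 addn0.
rewrite IH //; last first.
  by move=> x; rewrite msetB1E => H; apply: nuS; lia.
rewrite DS msetB1E eqxx.
have -> : (\prod_(x <- (S `\ f a)%fset) 'C(wts f (A :\ a) x, (nu `\ f a) x) =
           \prod_(x <- (S `\ f a)%fset) 'C(wts f (A :\ a) x, nu x))%N.
  by apply: eq_big_seq => x /fsetD1P[xa _]; rewrite msetB1E (negbTE xa) subn0.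
rewrite -mulnDl; congr muln.
by case: (nu (f a)) nu0 => // m _; rewrite binS subn1.
Qed.

End Weights.

(** * Multinomial coefficients *)

Lemma mulf_div_cancel (F : fieldType) (a b c p x : F) : a != 0 -> p != 0 -> c != 0 ->
  b * (a * x) / (a * p * c) = b * (x / (p * c)).
Proof. by move=> a0 p0 c0; field; rewrite a0 p0 c0. Qed.

(** The first entry is chosen by a binomial coefficient, the others from what remains. The bound on
    [a] matters: subtraction being truncated, [multinomial] does not vanish when its entries exceed
    [n]. *)
Lemma multinomial_cons n a L : (a <= n)%N ->
  multinomial Kq n (a :: L) = 'C(n, a)%:R * multinomial Kq (n - a) L.
Proof.
move=> an; rewrite /multinomial /= big_cons subnDA.
set P := \prod_(x <- L) _; set c := (n - a - sumn L)`!%:R.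
rewrite -(bin_fact an) !natrM.
have Pn0 : P != 0 by rewrite prodf_seq_neq0; apply/allP => x _ /=; rewrite Kq_natr_neq0 ?fact_gt0.
have cn0 : c != 0 by rewrite Kq_natr_neq0 ?fact_gt0.
have an0 : a`!%:R != 0 :> Kq by rewrite Kq_natr_neq0 ?fact_gt0.
exact: mulf_div_cancel.
Qed.

Lemma multinomial_nil n : multinomial Kq n [::] = 1.
Proof. by rewrite /multinomial big_nil mul1r subn0 divff // Kq_natr_neq0 ?fact_gt0. Qed.

Lemma multinomial_bin n a : (a <= n)%N -> multinomial Kq n [:: a] = 'C(n, a)%:R.
Proof. by move=> an; rewrite multinomial_cons // multinomial_nil mulr1. Qed.

Lemma multinomial0 L : all (pred1 0%N) L -> multinomial Kq 0 L = 1.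
Proof.
elim: L => [|a L IH] /=; first by rewrite multinomial_nil.
by case/andP => /eqP -> aL; rewrite multinomial_cons // bin0 mul1r IH.
Qed.

(** Outside the support of [mu] the inclusion forces all entries to be 0, so the additional factors
    are 1. A common range [S] makes products over different supports comparable. *)
Lemma pmultinomialE (S : {fset nat}) (mu : {mset nat}) (nus : seq {mset nat}) :
  {subset finsupp mu <= S} -> mset_union nus `<=` mu ->
  pmultinomial Kq mu nus =
  \prod_(x <- S) multinomial Kq (mu x) [seq (nu : {mset nat}) x | nu <- nus].
Proof.
move=> muS /msubsetP le; rewrite /pmultinomial; apply: big_fset_incl; first exact/fsubsetP.
move=> x xS; rewrite memNfinsupp => /eqP mx; rewrite mx multinomial0 //.
have := le x; rewrite mx leqn0 mset_unionE => /eqP; elim: nus {le} => //= nu nus IH.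
by move/eqP; rewrite addn_eq0 => /andP[-> /eqP/IH].
Qed.

Lemma pmultinomial_cons (mu nu : {mset nat}) (nus : seq {mset nat}) :
  mset_union (nu :: nus) `<=` mu ->
  pmultinomial Kq mu (nu :: nus) =
  pmultinomial Kq mu [:: nu] * pmultinomial Kq (mu `\` nu) nus.
Proof.
move=> le; have lex x := msubsetP le x.
have lenu x : (nu x <= mu x)%N by have := lex x; rewrite mset_unionE /=; lia.
have sub : {subset finsupp (mu `\` nu) <= finsupp mu}.
  by move=> x; rewrite !mem_finsupp msetE2; have := lenu x; lia.
rewrite (pmultinomialE (S := finsupp mu)) //.
rewrite (@pmultinomialE (finsupp mu) mu [:: nu]) //; last first.
  by apply/msubsetP => x; rewrite mset_unionE /= addn0.
rewrite (@pmultinomialE (finsupp mu) (mu `\` nu)) //; last first.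
  apply/msubsetP => x; have := lex x; by rewrite !mset_unionE /= msetE2 leq_subRL.
rewrite -big_split /=; apply: eq_bigr => x _.
by rewrite !multinomial_cons // multinomial_nil mulr1 msetE2.
Qed.

Lemma pmultinomial_nil (mu : {mset nat}) : pmultinomial Kq mu [::] = 1.
Proof. by rewrite /pmultinomial big1 // => x _; rewrite multinomial_nil. Qed.

Lemma card_subsets_wts (T : finType) (f : T -> nat) (A : {set T}) (nu : {mset nat}) :
  nu `<=` wts f A ->
  \sum_(U : {set T} | (U \subset A) && (wts f U == nu)) 1 = pmultinomial Kq (wts f A) [:: nu].
Proof.
move=> le; have lex x := msubsetP le x.
rewrite (@pmultinomialE (finsupp (wts f A))) //; last first.
  by apply/msubsetP => x; rewrite mset_unionE /= addn0.
have E : \sum_(U : {set T} | (U \subset A) && (wts f U == nu)) 1 =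
         (\sum_(U : {set T} | U \subset A) (wts f U == nu))%:R :> Kq.
  rewrite natr_sum big_mkcondr; apply: eq_bigr => U _; by case: eqP.
rewrite E (card_subsets_wts_bin (S := finsupp (wts f A))).
- by rewrite natr_prod; apply: eq_bigr => x _; rewrite multinomial_bin.
- move=> p pA; rewrite msuppE (perm_mem (perm_eq_seq_mset _)).
  by apply: map_f; rewrite mem_enum.
- by move=> x; rewrite -lt0n => nux; rewrite mem_finsupp -lt0n; apply: leq_trans (lex x).
Qed.

(** Symmetry of the binomial coefficients: the formula of the theorem selects the complement of xi
    in mu_2^j, while the enumeration of cut edges selects xi itself. *)
Lemma pmultinomial_compl (mu nu : {mset nat}) : nu `<=` mu ->
  pmultinomial Kq mu [:: mu `\` nu] = pmultinomial Kq mu [:: nu].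
Proof.
move=> /msubsetP le; rewrite /pmultinomial; apply: eq_bigr => x _ /=.
by rewrite msetE2 !multinomial_bin ?leq_subr // bin_sub.
Qed.

(** No part of [mu] is 0, so 0 is free to serve as the colour of [N] further objects. Distributing
    labels and distributing parts then become a single distribution of coloured objects. *)
Lemma pmultinomial_hat (N : nat) (mu : {mset nat}) (L : seq (nat * {mset nat})) :
  mu 0%N = 0%N -> (sumn (unzip1 L) <= N)%N -> mset_union (unzip2 L) `<=` mu ->
  pmultinomial Kq (msetn N 0%N `+` mu) [seq msetn x.1 0%N `+` x.2 | x <- L] =
  multinomial Kq N (unzip1 L) * pmultinomial Kq mu (unzip2 L).
Proof.
move=> mu0 sN /msubsetP le; have le0 x : (x \in L -> x.2 0%N = 0%N).
  move=> xL; have := le 0%N; rewrite mu0 leqn0 mset_unionE -map_comp.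
  by rewrite sumnE big_map => /eqP/eqP; rewrite sum_nat_seq_eq0 => /allP/(_ _ xL)/eqP.
pose S := (0%N |` finsupp mu)%fset.
have n0 : 0%N \notin finsupp mu by rewrite mem_finsupp mu0.
rewrite (@pmultinomialE S); first last.
- apply/msubsetP => x; rewrite mset_unionE msetE2 msetnE -map_comp.
  have := le x; rewrite mset_unionE -map_comp.
  case: (eqVneq x 0%N) => [->|x0].
    rewrite mu0 leqn0 addn0 => /eqP E; apply: leq_trans sN.
    rewrite !sumnE !big_map !big_seq leq_sum // => y yL /=.
    by rewrite msetE2 msetnxx le0 // addn0.
  rewrite add0n; apply: leq_trans; rewrite !sumnE !big_map leq_sum // => y _ /=.
  by rewrite msetE2 msetnE (negbTE x0).
- move=> x; rewrite /S in_fset1U !mem_finsupp msetE2 msetnE.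
  by case: (x == 0%N) => //=; rewrite add0n.
rewrite (perm_big (0%N :: finsupp mu)) /=; last first.
  apply: uniq_perm; rewrite /= ?fset_uniq ?n0 // => x.
  by rewrite /S in_fset1U inE.
rewrite big_cons msetE2 msetnxx mu0 addn0; congr (_ * _).
  congr multinomial; rewrite -map_comp; apply/eq_in_map => x xL /=.
  by rewrite msetE2 msetnxx le0 // addn0.
rewrite /pmultinomial; apply: eq_big_seq => x xmu.
have x0 : x != 0%N by apply: contraTneq xmu => ->.
rewrite msetE2 msetnE (negbTE x0) add0n; congr multinomial; rewrite -!map_comp.
by apply: eq_map => y /=; rewrite msetE2 msetnE (negbTE x0).
Qed.

Lemma sum_permutations_cons (A : eqType) (R : nmodType) (s : seq A) (F : seq A -> R) :
  uniq s -> s != [::] ->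
  \sum_(u <- permutations s) F u = \sum_(y <- s) \sum_(u <- permutations (rem y s)) F (y :: u).
Proof.
move=> Us s0; rewrite (perm_big _ (permutationsE _)) /=; last by case: s s0 {Us}.
by rewrite big_allpairs_dep undup_id.
Qed.

(** The orderings with a given colour sequence differ by permutations of elements of equal colour.
    With components as elements and their data as colours, this is the number that cancels
    1/sigma. *)
Lemma card_colour_permutations (A X : eqType) (st : A -> X) (t S : seq X) (s : seq A) :
  uniq s -> uniq S -> {subset t <= S} -> perm_eq (map st s) t ->
  (\sum_(u <- permutations s) (map st u == t) = \prod_(x <- S) (count_mem x t)`!)%N.
Proof.
move=> + US; elim: t s => [|x t IH] s Us tS.
  move/perm_nilP => /(congr1 size); rewrite size_map => /size0nil ->.
  by rewrite big_cons big_nil /= big1.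
move=> pst; have s0 : s != [::] by apply/eqP => s0; have := perm_size pst; rewrite s0.
have -> : (\sum_(u <- permutations s) (map st u == x :: t))%N =
  (\sum_(y <- s) \sum_(u <- permutations (rem y s)) ((st y == x) && (map st u == t)))%N.
  exact: (@sum_permutations_cons _ nat s (fun u => (map st u == x :: t) : nat)).
have xS : x \in S by apply: tS; rewrite mem_head.
have tS' : {subset t <= S} by move=> z zt; apply: tS; rewrite inE zt orbT.
transitivity (\sum_(y <- s | st y == x) \prod_(z <- S) (count_mem z t)`!)%N.
  rewrite [RHS]big_mkcond /=; apply: eq_big_seq => y ys; case: eqP => [yx|_]; last by rewrite big1.
  rewrite IH ?rem_uniq // -(perm_cons x) -(permPr pst) -yx -map_cons.
  by apply: perm_map; rewrite perm_sym perm_to_rem.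
rewrite big_const_seq iter_addn_0 -(count_map st (pred1 x)) (permP pst) /= eqxx add1n.
rewrite (bigD1_seq x) //= [RHS](bigD1_seq x) //= eqxx add1n factS.
rewrite [X in _ = (_ * X)%N](eq_bigr (fun z => (count_mem z t)`!)) => [|z]; last by rewrite eq_sym => /negbTE ->.
by rewrite mulnC mulnA.
Qed.

(** * Label structures *)

Lemma connect_map (T T' : finType) (r : rel T) (r' : rel T') (f : T -> T') x y :
  (forall a b, r a b -> connect r' (f a) (f b)) -> connect r x y -> connect r' (f x) (f y).
Proof.
move=> H /connectP[p + ->]; elim: p x => [|b p IH] x /=; first by rewrite connect0.
by case/andP => xb /IH; apply: connect_trans; apply: H.
Qed.

Lemma connect_closed_sub (T : finType) (r : rel T) (A : pred T) x y :
  (forall a b, A a -> r a b -> A b) -> A x -> connect r x y -> A y.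
Proof.
move=> H + /connectP[p + ->]; elim: p x => //= b p IH x Ax /andP[xb].
by apply: IH; apply: H xb.
Qed.

(* A maximal vertex set spanned by fewer edges than vertices exhausts the graph:
   otherwise an edge leaving it could be added. *)
Lemma connected_card_le (T E : finType) (A : {set T}) (F : {set E}) (s t : E -> T) :
  (forall a b, a \in A -> b \in A ->
     connect (fun x y => [exists e in F, (s e == x) && (t e == y) || (s e == y) && (t e == x)]) a b) ->
  (#|A| <= #|F|.+1)%N.
Proof.
set r := (fun x y => _) => conA; have [->|[a aA]] := set_0Vmem A; first by rewrite cards0.
pose sp (W : {set T}) := (a \in W) && (#|W| <= #|[set e in F | (s e \in W) && (t e \in W)]|.+1)%N.
have sp1 : sp [set a] by rewrite /sp set11 cards1.
case: (arg_maxnP (fun W : {set T} => #|W|) sp1) => W /andP[aW cW] maxW.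
suff AW : A \subset W.
  apply: leq_trans (subset_leq_card AW) _; apply: leq_trans cW _.
  by rewrite ltnS subset_leq_card //; apply/subsetP => e; rewrite inE => /andP[].
apply/subsetP => b bA; apply: (@connect_closed_sub _ r (mem W) a) => //; last exact: conA.
move=> x y /= xW /existsP[e /andP[eF exy]]; apply: contraT => yW.
suff : (#|y |: W| <= #|W|)%N by rewrite cardsU1 yW ltnn.
apply: maxW; rewrite /sp !inE aW orbT cardsU1 yW /=.
have xy : x != y by apply: contraNneq yW => <-.
apply: leq_ltn_trans (_ : #|e |: [set e in F | (s e \in W) && (t e \in W)]| < _)%N; last first.
  rewrite ltnS subset_leq_card //; apply/subsetP => e'; rewrite !inE.
  case/orP => [/eqP->|/and3P[-> -> ->]]; last by rewrite !orbT.
  by rewrite eF /=; case/orP: exy => /andP[/eqP-> /eqP->]; rewrite ?eqxx xW ?orbT.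
by rewrite cardsU1 !inE eF /=; case/orP: exy => /andP[/eqP-> /eqP->];
  rewrite (negbTE yW) ?andbF.
Qed.

Section Structures.
Variables (k B : nat) (T : finType).

(* The record of a label [p] is (source, target, weight, attached classes). If [p]
   marks a floor of degree 2, the source and the target are [p] itself and the weight is 0.
   If [p] marks an edge or its leaf, the source is [Some s] when the edge leaves the floor
   marked by [s], and [None] when it starts at a leaf. Floors of degree 1 carry no label:
   such a floor has at most two incoming edges with a label, and the target of [p] is the
   other of these edges, or [p] when there is none. The last entry is the set of the [i]
   such that an edge marked by [A_i] enters the floor; on a floor of degree 1 it is stored
   at its only labelled edge, if there is only one. *)
Definition ldata : finType := (option T * T * 'I_B.+1 * {set 'I_k})%type.
Definition str := {ffun T -> ldata}.
(** Record of every label outside the set under consideration. With this normalization, structures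
    on a subset are functions on all of [T], and two of them are equal as soon as they agree on the
    subset. *)
Definition dflt (p : T) : ldata := (None, p, ord0, set0).

Implicit Types (Y : str) (p q : T) (U V : {set T}).

Definition lsrc Y p : option T := (Y p).1.1.1.
Definition ltgt Y p : T := (Y p).1.1.2.
Definition lwt Y p : nat := (Y p).1.2.
Definition lset Y p : {set 'I_k} := (Y p).2.
Definition isfl Y p : bool := lsrc Y p == Some p.

Definition outw Y q : nat := \sum_(p | (lsrc Y p == Some q) && (p != q)) lwt Y p.
Definition inw Y q : nat := \sum_(p | (ltgt Y p == q) && (p != q)) lwt Y p.

(** Adjacency that survives when floors of degree 1 carry no label: an edge and the floor of degree
    2 that it leaves, or a label and the label recorded as its target. A removed floor has the
    default record, so [isfl] fails there and the edges that left it are not linked through it. *)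
Definition lnk Y p q : bool :=
  [|| (lsrc Y p == Some q) && isfl Y q, (lsrc Y q == Some p) && isfl Y p,
      ltgt Y p == q | ltgt Y q == p].

Definition conn U Y : bool :=
  (U != set0) && [forall p in U, forall q in U, connect (lnk Y) p q].

(* a label standing for the floor that [p] marks or enters *)
Definition rt Y p : T :=
  let q := ltgt Y p in
  if isfl Y q then q else if (enum_rank p <= enum_rank q)%N then p else q.

(* [S1] is the set of the labels of leaves, with weights [w1], and [rk] is the order of
   the labels. [e = Some z] stands for a floor [z] that has been removed: the edges leaving
   it have become leaf edges. *)
Variables (e : option T) (S1 : {set T}) (w1 rk : T -> nat).

(** At a floor of degree 2 the last condition is the divergence 4, an edge marked by some A_i
    counting with weight 1. At a floor of degree 1 the divergence 2 leaves two possibilities: one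
    labelled edge whose weight and number of attached classes add up to 2, or two edges of weight 1
    exchanged by [ltgt]. The inequalities on [rk] say that the marking is increasing; labels in [S1]
    are exempt, as they precede all others in the standard order. *)
Definition okl U Y p : bool :=
  if isfl Y p then
    [&& p \notin S1, ltgt Y p == p, lwt Y p == 0%N & inw Y p + #|lset Y p| == 4 + outw Y p]%N
  else
    [&& (0 < lwt Y p)%N,
        (p \in S1) ==> (lwt Y p == w1 p),
        (if lsrc Y p is Some s then
           (p \notin S1) && ((Some s == e) || [&& s \in U, isfl Y s & (rk s < rk p)%N])
         else true) &
        let q := ltgt Y p in
        if q == p then (lwt Y p + #|lset Y p| == 2)%N
        else [&& q \in U, lset Y p == set0 &
          if isfl Y q then (p \in S1) || (rk p < rk q)%N
          else (ltgt Y q == p) && (lwt Y p == 1%N)]].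

Definition ok U Y : bool := [forall p, if p \in U then okl U Y p else Y p == dflt p].

Definition isleaf Y p : bool := (lsrc Y p == None) || (lsrc Y p == e).

Definition edge2 U Y : {set T} := [set p in U | (p \notin S1) && isleaf Y p].

(** Share of the label [p] in the multiplicity; on leaf edges of mu_2 the factors [w]/w and w
    combine to [w]. An edge that left a removed floor still has a source, so it keeps the factor
    [w]^2 of the whole diagram. Compared with the factor [w] of a leaf edge of its component, the
    surplus produces the product of the [x]_q over xi. *)
Definition fac Y p : Kq :=
  if p \in S1 then qint (lwt Y p) / (lwt Y p)%:R
  else if isfl Y p then 1
  else if lsrc Y p is Some _ then qint (lwt Y p) ^+ 2 else qint (lwt Y p).

Definition mult U Y : Kq := \prod_(p in U) fac Y p.

Lemma lnkC Y p q : lnk Y p q = lnk Y q p.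
Proof. by rewrite /lnk orbCA; congr (_ || (_ || _)); rewrite orbC. Qed.

Lemma connect_lnkC Y : connect_sym (lnk Y).
Proof. by apply: sym_connect_sym => p q; rewrite lnkC. Qed.

Section Ok.
Variables (U : {set T}) (Y : str).
Hypothesis okY : ok U Y.

Lemma ok_in p : p \in U -> okl U Y p.
Proof. by move=> pU; have := forallP okY p; rewrite pU. Qed.

Lemma ok_out p : p \notin U -> Y p = dflt p.
Proof. by move=> pU; have := forallP okY p; rewrite (negbTE pU) => /eqP. Qed.

Lemma ok_out_src p : p \notin U -> lsrc Y p = None.
Proof. by move=> /ok_out; rewrite /lsrc => ->. Qed.
Lemma ok_out_tgt p : p \notin U -> ltgt Y p = p.
Proof. by move=> /ok_out; rewrite /ltgt => ->. Qed.
Lemma ok_src_in p s : lsrc Y p = Some s -> p \in U.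
Proof. by move=> ps; apply: contraT => /ok_out_src; rewrite ps. Qed.

Lemma isfl_in p : isfl Y p -> p \in U.
Proof. by move/eqP/ok_src_in. Qed.

Lemma isfl_S1 p : isfl Y p -> p \notin S1.
Proof. by move=> fp; have := ok_in (isfl_in fp); rewrite /okl fp => /andP[]. Qed.

Lemma isfl_tgt p : isfl Y p -> ltgt Y p = p.
Proof. by move=> fp; have := ok_in (isfl_in fp); rewrite /okl fp => /and4P[_ /eqP]. Qed.

Lemma isfl_wt p : isfl Y p -> lwt Y p = 0%N.
Proof. by move=> fp; have := ok_in (isfl_in fp); rewrite /okl fp => /and4P[_ _ /eqP]. Qed.

Lemma isfl_div p : isfl Y p -> (inw Y p + #|lset Y p| = 4 + outw Y p)%N.
Proof. by move=> fp; have := ok_in (isfl_in fp); rewrite /okl fp => /and4P[_ _ _ /eqP]. Qed.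

Lemma tgt_in p : p \in U -> ltgt Y p \in U.
Proof.
move=> pU; case: (boolP (isfl Y p)) => fp; first by rewrite isfl_tgt.
have := ok_in pU; rewrite /okl (negbTE fp) => /and4P[_ _ _] /=.
by case: eqP => [->|_ /andP[]].
Qed.

Lemma wt_gt0 p : p \in U -> ~~ isfl Y p -> (0 < lwt Y p)%N.
Proof. by move=> pU fp; have := ok_in pU; rewrite /okl (negbTE fp) => /andP[]. Qed.

Lemma wt_S1 p : p \in U -> p \in S1 -> lwt Y p = w1 p.
Proof.
move=> pU pS; have fp : ~~ isfl Y p by apply: contraL pS => /isfl_S1.
by have := ok_in pU; rewrite /okl (negbTE fp) pS => /and4P[_ /eqP].
Qed.

Lemma src_S1 p : p \in S1 -> lsrc Y p = None.
Proof.
move=> pS; have fp : ~~ isfl Y p by apply: contraL pS => /isfl_S1.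
case E : (lsrc Y p) => [s|//]; have := ok_in (ok_src_in E).
by rewrite /okl (negbTE fp) E pS => /and4P[].
Qed.

Lemma src_fl p s : lsrc Y p = Some s -> p != s -> Some s != e ->
  [/\ p \in U, ~~ isfl Y p, s \in U, isfl Y s & (rk s < rk p)%N].
Proof.
move=> ps nps nse; have fp : ~~ isfl Y p.
  by rewrite /isfl ps; apply: contra nps => /eqP[->].
have := ok_in (ok_src_in ps); rewrite /okl (negbTE fp) ps (negbTE nse) /=.
by case/and4P => _ _ /and4P[_ -> -> ->] _; rewrite (ok_src_in ps).
Qed.

Lemma tgt_cases p : p \in U -> ~~ isfl Y p ->
  [\/ ltgt Y p = p /\ (lwt Y p + #|lset Y p| = 2)%N,
      [/\ isfl Y (ltgt Y p), ltgt Y p != p, lset Y p = set0 & (p \in S1) || (rk p < rk (ltgt Y p))%N] |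
      [/\ ~~ isfl Y (ltgt Y p), ltgt Y p != p, ltgt Y p \in U, lset Y p = set0 &
          ltgt Y (ltgt Y p) = p /\ lwt Y p = 1%N]].
Proof.
move=> pU fp; have := ok_in pU; rewrite /okl (negbTE fp) => /and4P[_ _ _] /=.
case: eqP => [E /eqP|/eqP ne /and3P[qU /eqP J]]; first by constructor 1.
by case: ifP => fq; [constructor 2 | case/andP => /eqP E /eqP w1p; constructor 3].
Qed.

Lemma tgt_out p q : ltgt Y p = q -> p != q -> p \in U.
Proof. by move=> E; apply: contraR => /ok_out_tgt; rewrite E => ->. Qed.

Lemma ok_lnk p q : p \in U -> lnk Y p q -> q \in U.
Proof.
move=> pU /or4P[/andP[_]|/andP[/eqP]|/eqP <-|/eqP E]; first exact: isfl_in.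
- by move=> /ok_src_in.
- exact: tgt_in.
by case: (eqVneq q p) => [->//|]; apply: tgt_out.
Qed.

Lemma ok_lnk_out p q : p \notin U -> lnk Y p q -> q = p.
Proof.
move=> pU pq; have qU : q \notin U by apply: contra pU => /ok_lnk; apply; rewrite lnkC.
case/or4P: pq => [/andP[_ /isfl_in]|/andP[_ /isfl_in]|/eqP|/eqP]; rewrite ?(negbTE pU) ?(negbTE qU) //;
by rewrite ok_out_tgt.
Qed.

Lemma rt_fl p : isfl Y p -> rt Y p = p.
Proof. by move=> fp; rewrite /rt isfl_tgt // fp. Qed.

Lemma rt_out p : p \notin U -> rt Y p = p.
Proof. by move=> pU; rewrite /rt ok_out_tgt // leqnn; case: ifP. Qed.

Lemma rt_in p : p \in U -> rt Y p \in U.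
Proof. by move=> pU; rewrite /rt; case: ifP => _; last case: ifP => _ //; apply: tgt_in. Qed.

Lemma rt_tgt p : rt Y (ltgt Y p) = rt Y p.
Proof.
case: (boolP (p \in U)) => pU; last by rewrite ok_out_tgt.
case: (boolP (isfl Y p)) => fp; first by rewrite isfl_tgt.
case: (tgt_cases pU fp) => [[-> //]|[fq _ _ _]|[fq ne qU _ [E _]]].
  by rewrite rt_fl // /rt /= fq.
rewrite /rt /= E (negbTE fq) (negbTE fp).
case: (ltngtP (enum_rank p) (enum_rank (ltgt Y p))) => // /val_inj/enum_rank_inj E2.
by rewrite -E2 eqxx in ne.
Qed.

Lemma rt_or p : rt Y p = p \/ rt Y p = ltgt Y p.
Proof. by rewrite /rt; case: ifP => _; [right|case: ifP => _; [left|right]]. Qed.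

Lemma rt_idem p : rt Y (rt Y p) = rt Y p.
Proof. by case: (rt_or p) => E; rewrite {1}E ?rt_tgt. Qed.

Lemma fix_nfl_rt p f : rt Y f = f -> ~~ isfl Y f -> (rt Y p == f) = (p == f) || (p == ltgt Y f).
Proof.
move=> rf ff; apply/idP/idP => [/eqP rp|]; last first.
  by case/orP => /eqP ->; rewrite ?rt_tgt rf eqxx.
case: (eqVneq p f) => //= npf; case: (rt_or p) => E; first by rewrite -E rp eqxx in npf.
have tp : ltgt Y p = f by rewrite -E.
have pU := tgt_out tp npf.
have fp : ~~ isfl Y p by apply: contraNN npf => fp; rewrite -tp isfl_tgt.
case: (tgt_cases pU fp) => [[tp' _]|[]|[_ _ _ _ [<- _]]]; rewrite ?tp //.
  by rewrite -tp tp' eqxx in npf.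
by rewrite (negbTE ff).
Qed.

Lemma lset_rt p : rt Y p != p -> lset Y p = set0.
Proof.
move=> rp; have pU : p \in U by apply: contraR rp => /rt_out ->.
have fp : ~~ isfl Y p by apply: contraNN rp => /rt_fl ->.
case: (tgt_cases pU fp) => [[tp _]|[]|[]] //.
by case: (rt_or p) => E; rewrite E ?tp eqxx in rp.
Qed.

Lemma outw_nfl f : Some f != e -> ~~ isfl Y f -> outw Y f = 0%N.
Proof.
move=> fe ff; apply: big1 => p /andP[/eqP pf npf].
by case: (src_fl pf npf fe) => _ _ _; rewrite (negbTE ff).
Qed.

(** The labelled edges entering a floor form the fibre of [rt] over its representative, so both
    kinds of floor satisfy one divergence equation, with 4 or 2 on the right. *)
Lemma floor_div f : Some f != e -> f \in U -> rt Y f = f ->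
  (\sum_(p | (rt Y p == f) && ~~ isfl Y p) lwt Y p + #|lset Y f| =
   (if isfl Y f then 4 else 2) + outw Y f)%N.
Proof.
move=> fe fU rf; case: ifP => ff.
  rewrite -isfl_div //; congr addn; apply: eq_bigl => p.
  case: (eqVneq p f) => [->|npf] /=; first by rewrite ff !andbF.
  rewrite andbT; apply/andP/idP => [[/eqP rp fp]|/eqP tp].
    case: (rt_or p) => E; last by rewrite -E rp.
    by rewrite -E rp eqxx in npf.
  rewrite -rt_tgt tp rf eqxx; split=> //.
  by apply: contraNN npf => fp; rewrite -tp isfl_tgt.
move/negbT in ff; rewrite outw_nfl // addn0.
rewrite (eq_bigl (fun p => ((p == f) || (p == ltgt Y f)) && ~~ isfl Y p)); last first.
  by move=> p; rewrite fix_nfl_rt.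
case: (tgt_cases fU ff) => [[tf]|[fq _ _ _]|[fq ne qU J [tq wf]]].
- rewrite tf (big_pred1 f) // => p /=; rewrite orbb; by case: (eqVneq p f) => [->|//]; rewrite ff.
- by move: ff; rewrite -rf /rt fq fq.
rewrite (bigD1 f) ?eqxx ?ff //= (big_pred1 (ltgt Y f)); last first.
  move=> p; case: (eqVneq p f) => [->|_] /=; first by rewrite andbF eq_sym (negbTE ne).
  by case: (eqVneq p (ltgt Y f)) => [->|//]; rewrite fq.
rewrite J cards0 wf; case: (tgt_cases qU fq) => [[tq']|[]|[_ _ _ _ [_ ->]]] //.
- by move: ne; rewrite -tq' tq eqxx.
- by rewrite tq (negbTE ff).
Qed.

End Ok.

(** * Degree, genus and the number of labels *)

Definition leafw U Y : nat := \sum_(p in U | isleaf Y p) lwt Y p.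
Definition nset U Y : nat := \sum_(p in U) #|lset Y p|.
(** Floors correspond to the fixed points of [rt]; those of degree 2 are counted a second time, so
    this is the sum of the degrees of the floors. *)
Definition cdeg U Y : nat := (#|[set f in U | rt Y f == f]| + #|[set f in U | isfl Y f]|)%N.
Definition nint U Y : nat := #|[set p in U | ~~ isfl Y p & ~~ isleaf Y p]|.

Lemma isleaf_nfl U Y p : ok U Y -> (forall z, e = Some z -> z \notin U) ->
  isleaf Y p -> ~~ isfl Y p.
Proof.
move=> okY eU; apply: contraL => fp; rewrite /isleaf (eqP fp) /=.
by apply/negP => /eqP /esym /eU; rewrite (isfl_in okY).
Qed.

(** Sum of the divergences of all floors: an internal edge enters one floor and leaves another, so
    only the leaf edges and the edges marked by the A_i remain. *)
Lemma degree_sum U Y : ok U Y -> (forall z, e = Some z -> z \notin U) ->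
  (leafw U Y + nset U Y = 2 * cdeg U Y)%N.
Proof.
move=> okY eU; have fe f : f \in U -> Some f != e.
  by move=> fU; apply/eqP => /esym/eU; rewrite fU.
have /eqP E : (\sum_(f in U | rt Y f == f)
    (\sum_(p | (rt Y p == f) && ~~ isfl Y p) lwt Y p + #|lset Y f|) ==
    \sum_(f in U | rt Y f == f) ((if isfl Y f then 4 else 2) + outw Y f))%N.
  by apply/eqP; apply: eq_bigr => f /andP[fU /eqP rf]; rewrite (floor_div okY) // fe.
move: E; rewrite !big_split /=.
have -> : (\sum_(f in U | rt Y f == f) \sum_(p | (rt Y p == f) && ~~ isfl Y p) lwt Y p =
           \sum_(p in U | ~~ isfl Y p) lwt Y p)%N.
  rewrite [RHS](partition_big (rt Y) (fun f => (f \in U) && (rt Y f == f))) /=; last first.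
    by move=> p /andP[pU _]; rewrite (rt_in okY) // (rt_idem okY) eqxx.
  apply: eq_bigr => f /andP[fU /eqP rf]; apply: eq_bigl => p.
  case: (boolP (p \in U)) => pU /=; first by rewrite andbC.
  case: eqP => //= rp; move: fU; rewrite -rp (rt_out okY) // (negbTE pU) //.
have -> : (\sum_(f in U | rt Y f == f) #|lset Y f| = nset U Y)%N.
  rewrite /nset big_mkcondr; apply: eq_bigr => f fU; case: eqP => // /eqP rf.
  by rewrite (lset_rt okY) ?cards0.
have -> : (\sum_(f in U | rt Y f == f) outw Y f = \sum_(p in U | ~~ isfl Y p && ~~ isleaf Y p) lwt Y p)%N.
  rewrite (bigID (isfl Y)) /= [X in (_ + X)%N]big1 ?addn0; last first.
    by move=> f /andP[/andP[fU _] ff]; rewrite (outw_nfl okY) // fe.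
  rewrite [RHS](partition_big (fun p => odflt p (lsrc Y p))
     (fun f => (f \in U) && (rt Y f == f) && isfl Y f)) /=; last first.
    move=> p /andP[pU /andP[fp]]; rewrite /isleaf; case E : (lsrc Y p) => [s|//] /= se.
    have ps : p != s by apply: contraNneq fp => E2; rewrite /isfl E -E2.
    by have [_ _ -> fs _] := src_fl okY E ps se; rewrite (rt_fl okY) // eqxx fs.
  apply: eq_bigr => f /andP[/andP[fU _] ff]; apply: eq_bigl => p.
  apply/andP/andP => [[/eqP E npf]|[/andP[pU /andP[fp lp]]]].
    have [-> fp _ _ _] := src_fl okY E npf (fe _ fU).
    by rewrite fp /isleaf E /= eqxx fe.
  move: lp; rewrite /isleaf; case E : (lsrc Y p) => [s|//] /= se /eqP sf; subst s.
  by rewrite eqxx; split=> //; apply: contraNneq fp => E2; rewrite /isfl E -E2.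
have -> : (\sum_(f in U | rt Y f == f) (if isfl Y f then 4 else 2) = 2 * cdeg U Y)%N.
  rewrite /cdeg mulnDr -!sum1dep_card !big_distrr /=.
  rewrite [X in (_ + X)%N](eq_bigl (fun f => (f \in U) && (rt Y f == f) && isfl Y f)); last first.
    move=> f; case: (boolP (isfl Y f)) => ff; rewrite ?andbF //= !andbT.
    by rewrite (rt_fl okY) // eqxx andbT.
  rewrite [X in (_ + X)%N]big_mkcondr -big_split /=.
  by apply: eq_bigr => f _; case: (isfl Y f).
have : (leafw U Y + \sum_(p in U | ~~ isfl Y p && ~~ isleaf Y p) lwt Y p =
           \sum_(p in U | ~~ isfl Y p) lwt Y p)%N.
  rewrite /leafw [RHS](bigID (isleaf Y)) /=; congr addn; apply: eq_bigl => p.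
    by case: (boolP (isleaf Y p)) => lp; rewrite ?andbF // (isleaf_nfl okY) ?andbT.
  by rewrite andbA.
by move=> /eqP; lia.
Qed.

(** Links become paths in the graph of floors and internal edges: a label and its target have the
    same representative, and an internal edge joins the floor it leaves to the one it enters. *)
Lemma connect_rt U Y p q : ok U Y -> (forall z, e = Some z -> z \notin U) ->
  connect (lnk Y) p q ->
  connect (fun x y => [exists a in [set p in U | ~~ isfl Y p & ~~ isleaf Y p],
     (odflt a (lsrc Y a) == x) && (rt Y a == y) || (odflt a (lsrc Y a) == y) && (rt Y a == x)])
    (rt Y p) (rt Y q).
Proof.
move=> okY eU; apply: connect_map => {p q}.
set r := (X in connect X); have rC : connect_sym r.
  apply: sym_connect_sym => x y; apply: eq_existsb => a; by rewrite orbC.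
have H p q : (lsrc Y p == Some q) && isfl Y q -> connect r (rt Y p) (rt Y q).
  case/andP => /eqP pq fq; case: (eqVneq p q) => [->|npq]; first exact: connect0.
  have qe : Some q != e by apply/eqP => /esym/eU; rewrite (isfl_in okY).
  have [pU fp qU _ _] := src_fl okY pq npq qe.
  apply: connect1; apply/existsP; exists p; rewrite inE pU fp /isleaf pq /= qe /=.
  by rewrite (rt_fl okY fq) !eqxx orbT.
have H' p q : ltgt Y p == q -> connect r (rt Y p) (rt Y q).
  by move/eqP <-; rewrite (rt_tgt okY) connect0.
move=> p q /or4P[/H|/H|/H'|/H'] //; by rewrite rC.
Qed.

Lemma card_fix_le U Y : ok U Y -> (forall z, e = Some z -> z \notin U) -> conn U Y ->
  (#|[set f in U | rt Y f == f]| <= (nint U Y).+1)%N.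
Proof.
move=> okY eU /andP[_ /forall_inP conY].
apply: (connected_card_le (s := fun a => odflt a (lsrc Y a)) (t := rt Y)).
move=> a b; rewrite !inE => /andP[aU /eqP ra] /andP[bU /eqP rb].
rewrite -[a in connect _ a]ra -[b in connect _ _ b]rb; apply: connect_rt => //.
by have /forall_inP := conY a aU; apply.
Qed.

Lemma card_labels U Y : ok U Y -> (forall z, e = Some z -> z \notin U) ->
  #|U :\: S1| = (#|[set f in U | isfl Y f]| + nint U Y + #|edge2 U Y|)%N.
Proof.
move=> okY eU; rewrite /nint /edge2 -!sum1_card.
rewrite (bigID (isfl Y)) /= [X in (_ + X)%N](bigID (isleaf Y)) /= addnA addnAC.
congr (_ + _ + _)%N; apply: eq_bigl => p; rewrite !inE.
- case: (boolP (isfl Y p)) => fp; rewrite ?andbF // !andbT.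
  by rewrite (isfl_S1 okY).
- case: (boolP (p \in S1)) => //= pS; case: (boolP (p \in U)) => //= pU.
  by rewrite /isleaf (src_S1 okY) // andbF.
- case: (boolP (isleaf Y p)) => lp; rewrite ?andbF // !andbT.
  by rewrite (isleaf_nfl okY) // andbT andbC.
Qed.

(** A connected graph has at most one vertex more than it has edges, applied to floors and internal
    edges. It makes the natural-number subtraction that defines the genus in [comp_of] exact. *)
Lemma genus_ge0 U Y : ok U Y -> (forall z, e = Some z -> z \notin U) -> conn U Y ->
  (cdeg U Y + #|edge2 U Y| <= #|U :\: S1| + 1)%N.
Proof.
move=> okY eU conY; have := card_fix_le okY eU conY.
rewrite (card_labels okY eU) /cdeg; lia.
Qed.

Lemma cdeg_gt0 U Y : ok U Y -> conn U Y -> (0 < cdeg U Y)%N.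
Proof.
move=> okY /andP[/set0Pn[p pU] _]; rewrite /cdeg addn_gt0; apply/orP; left.
apply/card_gt0P; exists (rt Y p); rewrite inE (rt_in okY) //=.
by rewrite (rt_idem okY).
Qed.

End Structures.

(** * Restriction and gluing *)

Lemma connect_in (T : finType) (r r' : rel T) (A : pred T) x y :
  (forall a b, A a -> r a b -> A b /\ r' a b) -> A x -> connect r x y -> connect r' x y.
Proof.
move=> H + /connectP[p + ->]; elim: p x => [|b p IH] x /= Ax; first by rewrite connect0.
by case/andP => /(H _ _ Ax)[Ab xb] /(IH _ Ab); apply: connect_trans; apply: connect1.
Qed.

Section Glue.
Variables (k B : nat) (T : finType).
Local Notation str := (str k B T).
Implicit Types (Y : str) (p q : T) (U V W : {set T}).

Definition glue U Y1 Y2 : str := [ffun p => if p \in U then Y1 p else Y2 p].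
Definition str0 : str := [ffun p => dflt k B p].
Definition restr U Y : str := glue U Y str0.
Definition lnk_closed U Y : bool := [forall p, forall q, lnk Y p q ==> ((p \in U) == (q \in U))].

Lemma closedP U Y p q : lnk_closed U Y -> lnk Y p q -> (p \in U) = (q \in U).
Proof. by move=> /forallP/(_ p)/forallP/(_ q)/implyP H /H/eqP. Qed.

Lemma glue_in U Y1 Y2 p : p \in U -> glue U Y1 Y2 p = Y1 p.
Proof. by move=> pU; rewrite ffunE pU. Qed.
Lemma glue_out U Y1 Y2 p : p \notin U -> glue U Y1 Y2 p = Y2 p.
Proof. by move=> pU; rewrite ffunE (negbTE pU). Qed.
Lemma restr_out U Y p : p \notin U -> restr U Y p = dflt k B p.
Proof. by move=> pU; rewrite /restr glue_out // ffunE. Qed.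

Lemma eq_lsrc Y Y' p : Y p = Y' p -> lsrc Y p = lsrc Y' p.
Proof. by rewrite /lsrc => ->. Qed.
Lemma eq_ltgt Y Y' p : Y p = Y' p -> ltgt Y p = ltgt Y' p.
Proof. by rewrite /ltgt => ->. Qed.
Lemma eq_lwt Y Y' p : Y p = Y' p -> lwt Y p = lwt Y' p.
Proof. by rewrite /lwt => ->. Qed.
Lemma eq_lset Y Y' p : Y p = Y' p -> lset Y p = lset Y' p.
Proof. by rewrite /lset => ->. Qed.
Lemma eq_isfl Y Y' p : Y p = Y' p -> isfl Y p = isfl Y' p.
Proof. by move=> E; rewrite /isfl (eq_lsrc E). Qed.

Variables (e : option T) (S1 : {set T}) (w1 rk : T -> nat).
Local Notation ok := (ok e S1 w1 rk).
Local Notation okl := (okl e S1 w1 rk).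

(** The condition at [p] reads only the records of [p], of its target and of its source, and, if [p]
    marks a floor, the total weights entering and leaving it. It therefore transfers between
    structures that agree there. *)
Lemma eq_okl U U' Y Y' p :
  Y p = Y' p -> Y (ltgt Y p) = Y' (ltgt Y p) -> (ltgt Y p \in U) = (ltgt Y p \in U') ->
  (forall s, lsrc Y p = Some s -> Some s != e -> (s \in U) = (s \in U') /\ Y s = Y' s) ->
  (isfl Y p -> inw Y p = inw Y' p /\ outw Y p = outw Y' p) ->
  okl U Y p = okl U' Y' p.
Proof.
move=> E Et EtU Es Ew; rewrite /okl.
rewrite -(eq_isfl E) -(eq_ltgt E) -(eq_lwt E) -(eq_lset E) -(eq_lsrc E).
rewrite -(eq_isfl Et) -(eq_ltgt Et) EtU.
case: ifP => [/Ew[-> ->]//|_]; congr [&& _, _, _ & _].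
case Ep : (lsrc Y p) => [s|//] /=.
by case: eqP => //= /eqP /(Es _ Ep)[-> /eq_isfl ->].
Qed.

Lemma closed_compl V U Y : ok V Y -> lnk_closed U Y -> lnk_closed (V :\: U) Y.
Proof.
move=> okY cU; apply/forallP => p; apply/forallP => q; apply/implyP => pq.
rewrite !inE (closedP cU pq); suff -> : (p \in V) = (q \in V) by [].
case: (boolP (p \in V)) => pV; first by rewrite (ok_lnk okY pV pq).
by rewrite (ok_lnk_out okY pV pq) (negbTE pV).
Qed.

Lemma lnk_tgt Y p : lnk Y p (ltgt Y p).
Proof. by rewrite /lnk eqxx !orbT. Qed.

Lemma ok_restr V U Y : ok V Y -> (forall z, e = Some z -> z \notin V) ->
  U \subset V -> lnk_closed U Y -> ok U (restr U Y).
Proof.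
move=> okY eV UV cU; apply/forallP => p; case: ifP => [pU|/negbT pU]; last by rewrite restr_out.
have pV := subsetP UV _ pU.
rewrite -(eq_okl (U := V) (Y := Y)); first exact: (ok_in okY).
- by rewrite /restr glue_in.
- by rewrite /restr glue_in // -(closedP cU (lnk_tgt Y p)).
- by rewrite (tgt_in okY) // -(closedP cU (lnk_tgt Y p)) pU.
- move=> s ps se; suff pqs : lnk Y p s.
    by rewrite (ok_lnk okY pV pqs) /restr glue_in -(closedP cU pqs).
  rewrite /lnk ps eqxx /=; case: (eqVneq p s) => [E|nps].
    by rewrite -E /isfl ps E eqxx.
  by have [_ _ _ ->] := src_fl okY ps nps se.
- move=> fp; split; rewrite /inw /outw.
    rewrite [RHS](eq_bigl (fun a => (ltgt Y a == p) && (a != p))) => [|a].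
      apply: eq_bigr => a /andP[/eqP ta _]; apply: eq_lwt; rewrite /restr glue_in //.
      by rewrite (closedP cU (lnk_tgt Y a)) ta.
    case: (boolP (a \in U)) => aU; first by rewrite (eq_ltgt (Y' := Y)) // /restr glue_in.
    rewrite /ltgt restr_out //= andbN; apply/esym/negbTE; apply: contra aU => /andP[/eqP ta _].
    by rewrite (closedP cU (lnk_tgt Y a)) [X in X \in _]ta.
  have L a : lsrc Y a = Some p -> lnk Y a p by move=> E; rewrite /lnk E eqxx fp.
  rewrite [RHS](eq_bigl (fun a => (lsrc Y a == Some p) && (a != p))) => [|a].
    apply: eq_bigr => a /andP[/eqP/L ta _]; apply: eq_lwt; rewrite /restr glue_in //.
    by rewrite (closedP cU ta).
  case: (boolP (a \in U)) => aU; first by rewrite (eq_lsrc (Y' := Y)) // /restr glue_in.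
  rewrite /lsrc restr_out //=; apply/esym/negbTE; apply: contra aU => /andP[/eqP/L ta _].
  by rewrite (closedP cU ta).
Qed.

Lemma glueC U W Y1 Y2 : ok U Y1 -> ok W Y2 -> [disjoint U & W] ->
  glue U Y1 Y2 = glue W Y2 Y1.
Proof.
move=> ok1 ok2 dUW; apply/ffunP => p; rewrite !ffunE.
case: (boolP (p \in U)) => pU; first by rewrite (disjointFr dUW pU).
case: (boolP (p \in W)) => pW //.
by rewrite (ok_out ok1 pU) (ok_out ok2 pW).
Qed.

Lemma okl_glue U W Y1 Y2 p : ok U Y1 -> ok W Y2 -> [disjoint U & W] ->
  (forall z, e = Some z -> z \notin U) -> p \in U -> okl (U :|: W) (glue U Y1 Y2) p.
Proof.
move=> ok1 ok2 dUW eU pU; have pW : p \notin W by rewrite (disjointFr dUW pU).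
rewrite -(eq_okl (U := U) (Y := Y1)); first exact: (ok_in ok1).
- by rewrite glue_in.
- by rewrite glue_in // (tgt_in ok1).
- by rewrite inE (tgt_in ok1).
- move=> s ps se; suff sU : s \in U by rewrite inE sU glue_in.
  case: (eqVneq p s) => [<-//|nps]; by have [] := src_fl ok1 ps nps se.
- move=> fp; split; rewrite /inw /outw.
    rewrite [RHS](eq_bigl (fun a => (ltgt Y1 a == p) && (a != p))) => [|a].
      by apply: eq_bigr => a /andP[/eqP ta nap]; apply: eq_lwt; rewrite glue_in // (tgt_out ok1 ta).
    case: (boolP (a \in U)) => aU; first by rewrite (eq_ltgt (Y' := Y1)) // glue_in.
    rewrite (ok_out_tgt ok1 aU) andbN (eq_ltgt (Y' := Y2)) ?glue_out //.
    apply/negbTE; apply: contra pW => /andP[/eqP ta nap].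
    by rewrite -ta (tgt_in ok2) // (tgt_out ok2 ta).
  rewrite [RHS](eq_bigl (fun a => (lsrc Y1 a == Some p) && (a != p))) => [|a].
    by apply: eq_bigr => a /andP[/eqP ta nap]; apply: eq_lwt; rewrite glue_in // (ok_src_in ok1 ta).
  case: (boolP (a \in U)) => aU; first by rewrite (eq_lsrc (Y' := Y1)) // glue_in.
  rewrite (ok_out_src ok1 aU) (eq_lsrc (Y' := Y2)) ?glue_out //=.
  apply/negbTE; apply: contra pW => /andP[/eqP ta nap].
  have pe : Some p != e by apply/eqP => /esym/eU; rewrite pU.
  by have [] := src_fl ok2 ta nap pe.
Qed.

Lemma ok_glue U W Y1 Y2 : ok U Y1 -> ok W Y2 -> [disjoint U & W] ->
  (forall z, e = Some z -> z \notin U :|: W) -> ok (U :|: W) (glue U Y1 Y2).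
Proof.
move=> ok1 ok2 dUW eV.
have eU z : e = Some z -> z \notin U by move=> /eV; rewrite inE; case/norP.
have eW z : e = Some z -> z \notin W by move=> /eV; rewrite inE; case/norP.
apply/forallP => p; case: ifP => [|/negbT]; rewrite inE.
  case/orP => pUW; first exact: okl_glue.
  by rewrite (glueC ok1 ok2 dUW) setUC; apply: okl_glue; rewrite // disjoint_sym.
by case/norP => pU pW; rewrite glue_out // (ok_out ok2 pW).
Qed.

Lemma closed_glue U W Y1 Y2 : ok U Y1 -> ok W Y2 -> [disjoint U & W] ->
  (forall z, e = Some z -> z \notin U :|: W) -> lnk_closed U (glue U Y1 Y2).
Proof.
move=> ok1 ok2 dUW eV.
have H p q : p \in U -> lnk (glue U Y1 Y2) p q -> q \in U.
  move=> pU; apply: contraTT => qU; have pW := negbT (disjointFr dUW pU).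
  have gq : glue U Y1 Y2 q = Y2 q by rewrite glue_out.
  have gp : glue U Y1 Y2 p = Y1 p by rewrite glue_in.
  have npq : p != q by apply: contraNneq qU => <-.
  rewrite /lnk (eq_isfl gq) (eq_isfl gp) (eq_lsrc gq) (eq_lsrc gp) (eq_ltgt gp) (eq_ltgt gq).
  apply/negP => /or4P[/andP[/eqP E fq]|/andP[/eqP E fp]|/eqP E|/eqP E].
  - have qe : Some q != e by apply/eqP => /esym/eV; rewrite inE (isfl_in ok2 fq) orbT.
    by have [_ _] := src_fl ok1 E npq qe; rewrite (negbTE qU).
  - have pe : Some p != e by apply/eqP => /esym/eV; rewrite inE pU.
    by rewrite eq_sym in npq; have [_ _] := src_fl ok2 E npq pe; rewrite (negbTE pW).
  - by have := tgt_in ok1 pU; rewrite E (negbTE qU).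
  rewrite eq_sym in npq; have := tgt_in ok2 (tgt_out ok2 E npq).
  by rewrite E (negbTE pW).
apply/forallP => p; apply/forallP => q; apply/implyP => pq; apply/eqP.
by apply/idP/idP => /H; apply=> //; rewrite lnkC.
Qed.

Lemma restr_glue_l U Y1 Y2 : ok U Y1 -> restr U (glue U Y1 Y2) = Y1.
Proof.
move=> ok1; apply/ffunP => p; case: (boolP (p \in U)) => pU.
  by rewrite /restr !glue_in.
by rewrite restr_out // (ok_out ok1 pU).
Qed.

Lemma restr_glue_r U W Y1 Y2 : ok W Y2 -> [disjoint U & W] -> restr W (glue U Y1 Y2) = Y2.
Proof.
move=> ok2 dUW; apply/ffunP => p; case: (boolP (p \in W)) => pW.
  by rewrite /restr glue_in // glue_out // (disjointFl dUW pW).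
by rewrite restr_out // (ok_out ok2 pW).
Qed.

Lemma glue_restr V U Y : ok V Y -> U \subset V -> glue U (restr U Y) (restr (V :\: U) Y) = Y.
Proof.
move=> okY UV; apply/ffunP => p; rewrite !ffunE inE; case: (boolP (p \in U)) => //= pU.
case: (boolP (p \in V)) => //= pV; by rewrite (ok_out okY pV).
Qed.

Lemma mult_glue U W Y1 Y2 : [disjoint U & W] ->
  mult S1 (U :|: W) (glue U Y1 Y2) = mult S1 U Y1 * mult S1 W Y2.
Proof.
have facE Y Y' p : Y p = Y' p -> fac S1 Y p = fac S1 Y' p.
  by move=> E; rewrite /fac (eq_isfl E) (eq_lwt E) (eq_lsrc E).
move=> dUW; rewrite /mult (eq_bigl [predU U & W]) => [|p]; last by rewrite !inE.
rewrite bigU //=; congr (_ * _); apply: eq_bigr => p pU; apply: facE; first by rewrite glue_in.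
by rewrite glue_out // (disjointFl dUW pU).
Qed.

Lemma lnk_restr U Y p q : p \in U -> q \in U -> lnk (restr U Y) p q = lnk Y p q.
Proof.
move=> pU qU; have Ep : restr U Y p = Y p by rewrite /restr glue_in.
have Eq : restr U Y q = Y q by rewrite /restr glue_in.
by rewrite /lnk (eq_lsrc Ep) (eq_lsrc Eq) (eq_isfl Ep) (eq_isfl Eq) (eq_ltgt Ep) (eq_ltgt Eq).
Qed.

Lemma connect_restr U U' Y p q : lnk_closed U' Y -> U' \subset U -> lnk_closed U Y -> p \in U' ->
  connect (lnk (restr U Y)) p q = connect (lnk Y) p q.
Proof.
move=> cU' U'U cU pU'; have pU := subsetP U'U _ pU'.
apply/idP/idP; apply: (connect_in (A := mem U)) => // a b /= aU ab.
  have bU : b \in U.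
    case/or4P: ab => [/andP[_]|/andP[/eqP E _]|/eqP E|/eqP E].
    - by apply: contraLR => bU; rewrite /isfl /lsrc restr_out.
    - by apply: contraT => bU; move: E; rewrite /lsrc restr_out.
    - have E2 : ltgt Y a = b by rewrite -E; apply: eq_ltgt; rewrite /restr glue_in.
      by rewrite -E2 -(closedP cU (lnk_tgt Y a)).
    by apply: contraT => bU; move: E aU; rewrite /ltgt restr_out //= => <-; rewrite (negbTE bU).
  by split=> //; rewrite -(lnk_restr Y aU bU).
have bU : b \in U by rewrite -(closedP cU ab).
by split=> //; rewrite lnk_restr.
Qed.

Lemma conn_restr U U' Y : lnk_closed U' Y -> U' \subset U -> lnk_closed U Y ->
  conn U' (restr U Y) = conn U' Y.
Proof.
move=> cU' U'U cU; rewrite /conn; congr (_ && _); apply: eq_forallb => p.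
case: (boolP (p \in U')) => //= pU'; apply: eq_forallb => q.
by rewrite (connect_restr q cU').
Qed.

Lemma lnk_restrW U Y p q : lnk_closed U Y -> lnk (restr U Y) p q -> lnk Y p q \/ p = q.
Proof.
move=> cU pq; case: (boolP (p \in U)) => pU.
  have [bU E] : q \in U /\ lnk (restr U Y) p q = lnk Y p q.
    suff qU : q \in U by rewrite lnk_restr.
    case/or4P: pq => [/andP[_]|/andP[/eqP E _]|/eqP E|/eqP E].
    - by apply: contraLR => bU; rewrite /isfl /lsrc restr_out.
    - by apply: contraT => bU; move: E; rewrite /lsrc restr_out.
    - have E2 : ltgt Y p = q by rewrite -E; apply: eq_ltgt; rewrite /restr glue_in.
      by rewrite -E2 -(closedP cU (lnk_tgt Y p)).
    by apply: contraT => bU; move: E pU; rewrite /ltgt restr_out //= => <-; rewrite (negbTE bU).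
  by left; rewrite -E.
right; case/or4P: pq => [/andP[/eqP]|/andP[_]|/eqP|/eqP].
- by rewrite /lsrc restr_out.
- by rewrite /isfl /lsrc restr_out.
- by rewrite /ltgt restr_out.
case: (boolP (q \in U)) => qU; last by rewrite /ltgt restr_out.
rewrite (eq_ltgt (Y' := Y)) => [E|]; last by rewrite /restr glue_in.
by have := closedP cU (lnk_tgt Y q); rewrite E qU (negbTE pU).
Qed.

Lemma closed_restr U U' Y : lnk_closed U Y -> U' \subset U -> lnk_closed U' (restr U Y) = lnk_closed U' Y.
Proof.
move=> cU U'U; apply/forallP/forallP => H p; apply/forallP => q; apply/implyP => pq.
  case: (boolP (p \in U)) => pU.
    have qU : q \in U by rewrite -(closedP cU pq).
    by have /forallP/(_ q)/implyP := H p; apply; rewrite lnk_restr.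
  have qU : q \notin U by rewrite -(closedP cU pq).
  by rewrite (contraNF (subsetP U'U p)) // (contraNF (subsetP U'U q)).
case: (lnk_restrW cU pq) => [pq'|->//].
by have /forallP/(_ q)/implyP := H p; apply.
Qed.

(** Restriction to [U] and to its complement is inverse to gluing, so structures on [V] with no link
    across the boundary of [U] are pairs of structures. The removed floor lies outside [V], hence
    the edges that left it do not tie the two halves together. *)
Lemma sum_glue (R : nmodType) V U (F : str -> R) : U \subset V ->
  (forall z, e = Some z -> z \notin V) ->
  \sum_(Y | ok V Y && lnk_closed U Y) F Y =
  \sum_(Y1 | ok U Y1) \sum_(Y2 | ok (V :\: U) Y2) F (glue U Y1 Y2).
Proof.
move=> UV eV; have dUW : [disjoint U & V :\: U].
  by apply/pred0P => p; rewrite /= !inE; case: (p \in U).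
have EV : U :|: (V :\: U) = V by rewrite -{1}(setIidPr UV) setID.
rewrite pair_big /=.
rewrite (reindex_onto (fun YY => glue U YY.1 YY.2) (fun Y => (restr U Y, restr (V :\: U) Y))) /=.
  apply: eq_bigl => -[Y1 Y2] /=; apply/andP/andP => [[/andP[okY cU] /eqP[E1 E2]]|[ok1 ok2]].
    split; first by rewrite -E1; exact: ok_restr okY eV UV cU.
    by rewrite -E2; apply: (ok_restr okY eV); [exact: subsetDl | exact: closed_compl cU].
  rewrite restr_glue_l // (restr_glue_r _ ok2 dUW); split=> //.
  rewrite (closed_glue ok1 ok2) ?EV // andbT -{1}EV.
  by apply: ok_glue => //; rewrite EV.
by move=> Y /andP[okY _]; rewrite glue_restr.
Qed.

End Glue.

(** * Connected components *)

Section CountOrderings.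
Variables (A X : eqType).
Implicit Types (s : seq A) (g : A -> X) (L : seq X).

Definition norder s g L : nat := \sum_(u <- permutations s) (map g u == L).

Lemma norder_cons s g x L : uniq s ->
  norder s g (x :: L) = (\sum_(y <- s | g y == x) norder (rem y s) g L)%N.
Proof.
move=> Us; case: (eqVneq s [::]) => [->|s0].
  by rewrite /norder big_nil (big_cons _ _ [::]) big_nil.
rewrite /norder [LHS](@sum_permutations_cons _ nat s (fun u => (map g u == x :: L) : nat)) //.
rewrite [RHS]big_mkcond /=; apply: eq_bigr => y _.
rewrite (eq_bigr (fun u => nat_of_bool ((g y == x) && (map g u == L)))) => [|u _]; last first.
  by rewrite -eqseq_cons.
by case: ifP => // _; rewrite big1.
Qed.

Lemma norder_nil s g : norder s g [::] = (s == [::]).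
Proof.
case: s => [|y s]; first by rewrite /norder big_cons big_nil.
rewrite /norder big_seq big1 // => u; rewrite mem_permutations => /perm_size.
by case: u.
Qed.

Lemma eq_norder s s' g g' L : perm_eq s s' -> {in s, g =1 g'} -> norder s g L = norder s' g' L.
Proof.
move=> ss' gg'; rewrite /norder (perm_big _ (perm_permutations ss')) /=.
rewrite [LHS]big_seq [RHS]big_seq; apply: eq_bigr => u; rewrite mem_permutations => us'.
congr (nat_of_bool (_ == _)); apply/eq_in_map => y yu; apply: gg'.
by rewrite (perm_mem ss') -(perm_mem us').
Qed.

End CountOrderings.

Section Components.
Variables (k B : nat) (T : finType).
Local Notation str := (str k B T).
Implicit Types (Y : str) (p q : T) (U V W : {set T}).

Variables (e : option T) (S1 : {set T}) (w1 rk : T -> nat).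
Local Notation ok := (ok e S1 w1 rk).

Definition comps V Y : {set {set T}} := [set U : {set T} | [&& U \subset V, lnk_closed U Y & conn U Y]].
Definition cc V Y p : {set T} := [set q in V | connect (lnk Y) p q].

Lemma cc_comps V Y p : ok V Y -> p \in V -> cc V Y p \in comps V Y.
Proof.
move=> okY pV; rewrite inE; apply/and3P; split.
- by apply/subsetP => q; rewrite inE => /andP[].
- apply/forallP => a; apply/forallP => b; apply/implyP => ab; rewrite !inE.
  case: (boolP (a \in V)) => aV; last by rewrite (ok_lnk_out okY aV ab) (negbTE aV).
  rewrite (ok_lnk okY aV ab) /=; apply/eqP; apply/idP/idP => pa.
    by apply: connect_trans pa (connect1 ab).
  by apply: connect_trans pa (connect1 _); rewrite lnkC.
apply/andP; split; first by apply/set0Pn; exists p; rewrite inE pV connect0.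
apply/forall_inP => a; rewrite inE => /andP[aV pa]; apply/forall_inP => b.
rewrite inE => /andP[bV pb]; apply: connect_trans pb.
by rewrite connect_lnkC.
Qed.

Lemma comps_cc V Y U p : ok V Y -> U \in comps V Y -> p \in U -> U = cc V Y p.
Proof.
move=> okY; rewrite inE => /and3P[UV cU /andP[_ /forall_inP conU]] pU.
apply/setP => q; rewrite inE; apply/idP/andP => [qU|[qV pq]].
  by rewrite (subsetP UV) //; split=> //; have /forall_inP := conU p pU; apply.
apply: (connect_closed_sub (A := mem U)) pq => //= a b aU ab.
by rewrite -(closedP cU ab).
Qed.

Lemma big_comps (R : Type) (idx : R) (op : Monoid.com_law idx) V Y (F : T -> R) : ok V Y ->
  \big[op/idx]_(p in V) F p = \big[op/idx]_(U in comps V Y) \big[op/idx]_(p in U) F p.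
Proof.
move=> okY; rewrite (partition_big (cc V Y) (mem (comps V Y))) /=; last first.
  by move=> p; apply: cc_comps.
apply: eq_bigr => U UC; apply: eq_bigl => p; apply/andP/idP => [[pV /eqP <-]|pU].
  by rewrite inE pV connect0.
rewrite -(comps_cc okY UC pU) eqxx; split=> //.
by move: UC; rewrite inE => /and3P[/subsetP/(_ p pU)].
Qed.

Lemma comps_eq0 V Y : ok V Y -> (comps V Y == set0) = (V == set0).
Proof.
move=> okY; apply/idP/idP => /eqP E; last first.
  apply/eqP/setP => U; rewrite !inE E subset0; case: eqP => //= ->.
  by rewrite /conn eqxx andbF.
apply/negPn/negP => /set0Pn[p pV]; have := cc_comps okY pV.
by rewrite E inE.
Qed.

Lemma comps_restr V Y U : ok V Y -> (forall z, e = Some z -> z \notin V) ->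
  U \in comps V Y -> comps (V :\: U) (restr (V :\: U) Y) = comps V Y :\ U.
Proof.
move=> okY eV UC; have := UC; rewrite inE => /and3P[UV cU conU].
have cW := closed_compl okY cU.
apply/setP => U'; rewrite !inE.
case: (boolP (U' \subset V :\: U)) => [U'W|nU'] /=; last first.
  apply/esym/negbTE; apply: contra nU' => /and4P[ne U'V cU' conU'].
  apply/subsetP => q qU'; rewrite inE (subsetP U'V) // andbT; apply: contraNN ne => qU.
  have U'C : U' \in comps V Y by rewrite inE U'V cU' conU'.
  by rewrite (comps_cc okY U'C qU') (comps_cc okY UC qU).
rewrite closed_restr // (subset_trans U'W (subsetDl _ _)) /=.
case: (boolP (lnk_closed U' Y)) => cU' /=; last by rewrite andbF.
rewrite conn_restr //; case: (boolP (conn U' Y)) => conU'; rewrite ?andbF // andbT.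
apply/esym/eqP => E; case/andP: conU' => /set0Pn[q qU'] _.
by have := subsetP U'W q qU'; rewrite inE -E qU'.
Qed.

(** For [e = Some z] these are the edges left dangling by the removal of [z]; on a component their
    weights form the partition xi. *)
Definition cut U Y : {set T} := [set p in U | lsrc Y p == e].

(** Data (d, g, mu_1, mu_2) read off a connected structure. The coefficient of [E_i] is minus
    d.[E_i]; the genus is obtained by solving for g the equation that the number of free labels is
    d.[L] - 1 + g + l(mu_2). *)
Definition comp_of U Y : component k :=
  Component ((cdeg U Y)%:Z, [ffun i : 'I_k => - #|[set p in U | i \in lset Y p]|%:Z])
    (#|U :\: S1| + 1 - cdeg U Y - #|edge2 e S1 U Y|)%N
    (wts w1 (U :&: S1)) (wts (lwt Y) (edge2 e S1 U Y)).

Definition st U Y : component k * {mset nat} := (comp_of U Y, wts (lwt Y) (cut U Y)).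

Lemma eq_st U Y Y' : {in U, forall p, Y p = Y' p} -> {in U, forall p, ltgt Y p \in U} ->
  st U Y = st U Y'.
Proof.
move=> E tU.
have Er p : p \in U -> rt Y p = rt Y' p.
  move=> pU; rewrite /rt -(eq_ltgt (E p pU)) (eq_isfl (E _ (tU p pU))) //.
have Ed : cdeg U Y = cdeg U Y'.
  congr addn; apply: eq_card => p; rewrite !inE; case: (boolP (p \in U)) => //= pU.
    by rewrite Er.
  by rewrite (eq_isfl (E p pU)).
have E2 : edge2 e S1 U Y = edge2 e S1 U Y'.
  apply/setP => p; rewrite !inE; case: (boolP (p \in U)) => //= pU.
  by rewrite /isleaf (eq_lsrc (E p pU)).
have Ec : cut U Y = cut U Y'.
  apply/setP => p; rewrite !inE; case: (boolP (p \in U)) => //= pU.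
  by rewrite (eq_lsrc (E p pU)).
rewrite /st /comp_of Ed E2 Ec; congr (Component (_, _) _ _ _, _).
- apply/ffunP => i; rewrite !ffunE; congr (- (Posz _)); apply: eq_card => p; rewrite !inE.
  by case: (boolP (p \in U)) => //= pU; rewrite (eq_lset (E p pU)).
- by apply: eq_wts => p; rewrite !inE => /andP[pU _]; apply: eq_lwt; apply: E.
- by apply: eq_wts => p; rewrite !inE => /andP[pU _]; apply: eq_lwt; apply: E.
Qed.

(** Type of a component of class [E_a], with mu_2 = xi = (1). It uses no label and stands for an
    index [a] such that no edge marked by A_a enters the removed floor. *)
Definition stE (a : 'I_k) : component k * {mset nat} :=
  (Component (clsEi a) 0 mset0 [mset 1%N], [mset 1%N]).

(* a generalized component is a connected component or a class [E_a] *)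
Definition gst Y (x : {set T} + 'I_k) : component k * {mset nat} :=
  match x with inl U => st U Y | inr a => stE a end.

Definition gcomps V Y (J : {set 'I_k}) : seq ({set T} + 'I_k) :=
  [seq inl U | U <- enum (comps V Y)] ++ [seq inr a | a <- enum J].

Lemma mem_gcomps_l V Y J U : (inl U \in gcomps V Y J) = (U \in comps V Y).
Proof.
rewrite mem_cat [X in _ || X](_ : _ = false) ?orbF; last by apply/negbTE/mapP => -[].
by rewrite mem_map ?mem_enum // => x y [].
Qed.

Lemma mem_gcomps_r V Y J a : (inr a \in gcomps V Y J) = (a \in J).
Proof.
rewrite mem_cat [X in X || _](_ : _ = false) /=; last by apply/negbTE/mapP => -[].
by rewrite mem_map ?mem_enum // => x y [].
Qed.

Lemma gcomps_uniq V Y J : uniq (gcomps V Y J).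
Proof.
rewrite cat_uniq !map_inj_uniq ?enum_uniq ?andbT //=; try by move=> x y [].
by apply/hasPn => x /mapP[a _ ->]; apply/mapP => -[].
Qed.

Lemma big_gcomps (R : Type) (idx : R) (op : Monoid.com_law idx) V Y J P F :
  \big[op/idx]_(x <- gcomps V Y J | P x) F x =
  op (\big[op/idx]_(U in comps V Y | P (inl U)) F (inl U))
     (\big[op/idx]_(a in J | P (inr a)) F (inr a)).
Proof. by rewrite big_cat !big_map /= !big_enum_cond. Qed.

Definition wsum U (x : component k * {mset nat}) : Kq :=
  \sum_(Y | [&& ok U Y, conn U Y & st U Y == x]) mult S1 U Y.

(** Sum over structures on [V] together with an ordering of their generalized components of
    prescribed types, written recursively: the first type is realized either by a connected
    structure on a subset [U] or by an index of [J], the set of indices still to be used up. *)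
Fixpoint zsum V (J : {set 'I_k}) L : Kq :=
  if L is x :: L' then
    \sum_(U : {set T} | U \subset V) wsum U x * zsum (V :\: U) J L' +
    \sum_(a in J | stE a == x) zsum V (J :\ a) L'
  else ((V == set0) && (J == set0))%:R.

(** Induction on the list of types. The component placed first is split off by [sum_glue]; the
    orderings of the remaining ones are the orderings of the components of the restricted
    structure. *)
Lemma zsumE V J L : (forall z, e = Some z -> z \notin V) ->
  zsum V J L = \sum_(Y | ok V Y) mult S1 V Y * (norder (gcomps V Y J) (gst Y) L)%:R.
Proof.
elim: L V J => [|x L IH] V J eV /=.
  rewrite (eq_bigr (fun Y => mult S1 V Y * ((V == set0) && (J == set0))%:R)); last first.
    move=> Y okY; congr (_ * _%:R); rewrite norder_nil; congr nat_of_bool.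
    rewrite -size_eq0 size_cat !size_map -!cardE addn_eq0 !cards_eq0.
    by rewrite (comps_eq0 okY).
  case: (eqVneq V set0) => [->|_] /=; last by rewrite big1 // => Y _; rewrite mulr0.
  rewrite (big_pred1 (str0 k B T)) => [|Y]; first by rewrite /mult big_set0 mul1r.
  apply/forallP/eqP => [H|->] => [|p]; last by rewrite inE ffunE.
  by apply/ffunP => p; have := H p; rewrite inE ffunE => /eqP.
rewrite (eq_bigr (fun Y =>
    \sum_(U in comps V Y | st U Y == x) mult S1 V Y * (norder (gcomps (V :\: U) (restr (V :\: U) Y) J) (gst (restr (V :\: U) Y)) L)%:R +
    \sum_(a in J | stE a == x) mult S1 V Y * (norder (gcomps V Y (J :\ a)) (gst Y) L)%:R)); last first.
  move=> Y okY; rewrite norder_cons ?gcomps_uniq // big_gcomps natrD !natr_sum mulrDr !mulr_sumr.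
  congr (_ + _).
    apply: eq_bigr => U /andP[UC _]; congr (_ * _%:R); apply: eq_norder.
      apply: uniq_perm; rewrite ?rem_uniq ?gcomps_uniq // => -[U'|a].
        rewrite mem_rem_uniq ?gcomps_uniq // inE !mem_gcomps_l (comps_restr okY eV UC) !inE.
        by congr (_ && _).
      by rewrite mem_rem_uniq ?gcomps_uniq // inE !mem_gcomps_r.
    move=> [U'|a] //=; rewrite mem_rem_uniq ?gcomps_uniq // inE mem_gcomps_l => /andP[ne U'C].
    have U'W : U' \in comps V Y :\ U by apply/setD1P; split=> //; apply: contraNneq ne => ->.
    rewrite -(comps_restr okY eV UC) inE in U'W; have {U'W}/and3P[U'W _ _] := U'W.
    move: U'C; rewrite inE => /and3P[U'V cU' _]; apply: eq_st => p pU'.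
      by rewrite /restr glue_in // (subsetP U'W).
    by rewrite -(closedP cU' (lnk_tgt Y p)).
  apply: eq_bigr => a /andP[aJ _]; congr (_ * _%:R); apply: eq_norder => //.
  apply: uniq_perm; rewrite ?rem_uniq ?gcomps_uniq // => -[U'|b].
    by rewrite mem_rem_uniq ?gcomps_uniq // inE !mem_gcomps_l.
  by rewrite mem_rem_uniq ?gcomps_uniq // inE !mem_gcomps_r !inE; congr (_ && _).
rewrite big_split /=; congr (_ + _); last first.
  by rewrite exchange_big /=; apply: eq_bigr => a _; rewrite IH.
(* Being a component means having no link to the complement and being connected. Exchanging the sums
   fixes [U], and the first of these properties is what gluing requires. *)
transitivity (\sum_(U : {set T} | U \subset V) \sum_(Y | ok V Y && lnk_closed U Y)
   (if conn U Y && (st U Y == x) then mult S1 V Y *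
      (norder (gcomps (V :\: U) (restr (V :\: U) Y) J) (gst (restr (V :\: U) Y)) L)%:R else 0)); last first.
  rewrite (exchange_big_dep (fun Y => ok V Y)) /=; last by move=> U Y _ /andP[].
  apply: eq_bigr => Y okY; rewrite -big_mkcondr /=; apply: eq_bigl => U.
  by rewrite inE okY /=; case: (U \subset V); case: (lnk_closed U Y); case: (conn U Y).
apply: eq_bigr => U UV; rewrite sum_glue //.
have dUW : [disjoint U & V :\: U].
  by apply/pred0P => p; rewrite /= !inE; case: (p \in U).
have EV : U :|: (V :\: U) = V by rewrite -{1}(setIidPr UV) setID.
rewrite /wsum big_mkcondr /= big_distrl /=; apply: eq_bigr => Y1 ok1.
rewrite IH; last by move=> z /eV; apply: contra; rewrite inE => /andP[].
rewrite big_distrr /=; apply: eq_bigr => Y2 ok2.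
have cU : lnk_closed U (glue U Y1 Y2) by apply: (closed_glue ok1 ok2) => //; rewrite EV.
rewrite (restr_glue_r _ ok2 dUW).
have -> : conn U (glue U Y1 Y2) = conn U Y1.
  by rewrite -(conn_restr cU (subxx U) cU) (restr_glue_l _ ok1).
have -> : st U (glue U Y1 Y2) = st U Y1.
  apply/esym/eq_st => p pU; first by rewrite glue_in.
  exact: (tgt_in ok1).
rewrite -[in mult _ _ (glue _ _ _)]EV mult_glue //.
by case: ifP => _; rewrite ?mul0r // mulrA.
Qed.

End Components.

(** * Intersection numbers in the basis [L], [E_1], ..., [E_k] *)

Lemma dotL (k : nat) (d : H2 k) : dot d (clsL k) = d.1.
Proof.
rewrite /dot /clsL /= mulr1 big1 ?subr0 // => i _.
by rewrite [X in _ * X]ffunE mulr0.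
Qed.

Lemma dotEi (k : nat) (d : H2 k) i : dot d (clsEi i) = - d.2 i.
Proof.
rewrite /dot /= mulr0 sub0r (bigD1 i) //= ffunE eqxx mulr1 big1 ?addr0 // => j ji.
by rewrite ffunE (negbTE ji) mulr0.
Qed.

Lemma clsE_fst (k : nat) : (clsE k).1 = 2.
Proof.
rewrite /clsE [LHS]/= (_ : (\sum_i clsEi i).1 = 0) ?subr0 //.
by rewrite (big_morph fst (id1 := 0) (op1 := +%R)) ?big1.
Qed.

Lemma clsE_snd (k : nat) i : (clsE k).2 i = -1.
Proof.
rewrite /clsE [LHS]/= (_ : (\sum_i clsEi i).2 = \sum_i (clsEi i).2); last first.
  by rewrite (big_morph snd (id1 := 0) (op1 := +%R)).
rewrite !ffunE sum_ffunE (bigD1 i) //= ffunE eqxx big1 ?addr0.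
  by rewrite /= ?ffunE ?mul0rn ?add0r.
by move=> j ji; rewrite ffunE eq_sym (negbTE ji).
Qed.

Lemma dotE (k : nat) (d : H2 k) : dot d (clsE k) = 2 * d.1 + \sum_i d.2 i.
Proof.
rewrite /dot clsE_fst mulrC; congr (_ + _); rewrite -sumrN; apply: eq_bigr => i _.
by rewrite clsE_snd mulrN1 opprK.
Qed.

(** * Turning the edges that left the removed floor into ordinary leaf edges *)

Section Erase.
Variables (k B : nat) (T : finType).
Local Notation str := (str k B T).
Implicit Types (Y : str) (p q : T) (U : {set T}).
Variables (z : T) (S1 : {set T}) (w1 rk : T -> nat).

Local Notation okz := (ok (Some z) S1 w1 rk).
Local Notation ok0 := (ok None S1 w1 rk).

(** Label model of the refined count. Neither degree nor genus appears: the degree is forced by the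
    leaf weights and the numbers d.[E_i], the genus by the number of labels. *)
Definition nsum U (a : 'I_k -> int) (mu2 : {mset nat}) : Kq :=
  \sum_(Y : str | [&& ok0 U Y, conn U Y,
      [forall i, #|[set p in U | i \in lset Y p]|%:Z == a i] &
      wts (lwt Y) (edge2 None S1 U Y) == mu2]) mult S1 U Y.

Definition set_src (o : option T) (R : {set T}) Y : str :=
  [ffun p => if p \in R then (o, ltgt Y p, (Y p).1.2, lset Y p) else Y p].

Lemma set_src_lsrc o R Y p : lsrc (set_src o R Y) p = if p \in R then o else lsrc Y p.
Proof. by rewrite /lsrc ffunE; case: ifP. Qed.
Lemma set_src_ltgt o R Y p : ltgt (set_src o R Y) p = ltgt Y p.
Proof. by rewrite /ltgt ffunE; case: ifP. Qed.
Lemma set_src_lwt o R Y p : lwt (set_src o R Y) p = lwt Y p.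
Proof. by rewrite /lwt ffunE; case: ifP. Qed.
Lemma set_src_lset o R Y p : lset (set_src o R Y) p = lset Y p.
Proof. by rewrite /lset ffunE; case: ifP. Qed.

Definition set_srcE := (set_src_lsrc, set_src_ltgt, set_src_lwt, set_src_lset).

Lemma str_ext Y Y' : lsrc Y =1 lsrc Y' -> ltgt Y =1 ltgt Y' -> lwt Y =1 lwt Y' ->
  lset Y =1 lset Y' -> Y = Y'.
Proof.
move=> H1 H2 H3 H4; apply/ffunP => p; move: (H1 p) (H2 p) (H3 p) (H4 p).
rewrite /lsrc /ltgt /lwt /lset; case: (Y p) => [[[a b] c] d]; case: (Y' p) => [[[a' b'] c'] d'] /=.
by move=> -> -> /val_inj -> ->.
Qed.

Lemma isfl_set_src e o (R : {set T}) U Y q : ok e S1 w1 rk U Y -> {subset R <= U} ->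
  (forall p, p \in R -> isleaf e Y p) ->
  (forall x, e = Some x -> x \notin U) -> (forall x, o = Some x -> x \notin U) ->
  isfl (set_src o R Y) q = isfl Y q.
Proof.
move=> okY RU leafR eU oU; rewrite /isfl set_src_lsrc; case: ifP => // qR.
have /negbTE := isleaf_nfl okY eU (leafR q qR); rewrite /isfl => ->.
by apply/eqP => /oU; rewrite RU.
Qed.

Lemma src_set_src e o (R : {set T}) U Y p q : ok e S1 w1 rk U Y -> {subset R <= U} ->
  (forall p, p \in R -> isleaf e Y p) ->
  (forall x, e = Some x -> x \notin U) -> (forall x, o = Some x -> x \notin U) ->
  q \in U -> (lsrc (set_src o R Y) p == Some q) = (lsrc Y p == Some q).
Proof.
move=> okY RU leafR eU oU qU; rewrite set_src_lsrc; case: ifP => // pR.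
have -> : (o == Some q) = false by apply/eqP => /oU; rewrite qU.
apply/esym/eqP => E; have := leafR p pR; rewrite /isleaf E /= => /eqP/esym/eU.
by rewrite qU.
Qed.

Lemma lnk_set_src e o (R : {set T}) U Y p q : ok e S1 w1 rk U Y -> {subset R <= U} ->
  (forall p, p \in R -> isleaf e Y p) ->
  (forall x, e = Some x -> x \notin U) -> (forall x, o = Some x -> x \notin U) ->
  lnk (set_src o R Y) p q = lnk Y p q.
Proof.
move=> okY RU leafR eU oU; rewrite /lnk !set_srcE.
have H a b : (lsrc (set_src o R Y) a == Some b) && isfl (set_src o R Y) b =
             (lsrc Y a == Some b) && isfl Y b.
  rewrite (isfl_set_src b okY RU leafR eU oU); case: (boolP (isfl Y b)) => fb; rewrite ?andbF //.
  by rewrite (src_set_src _ okY RU leafR eU oU) // (isfl_in okY).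
by have := H p q; have := H q p; rewrite !set_src_lsrc => -> ->.
Qed.

(** For a leaf edge outside [S1] the sources [None] and [Some z] are interchangeable: the local
    condition accepts both, and no weight leaving a floor of [U] changes. The lemma is general
    enough to be applied in both directions. *)
Lemma ok_set_src e e' o (R : {set T}) U Y : ok e S1 w1 rk U Y -> {subset R <= U} ->
  (forall p, p \in R -> p \notin S1) ->
  (forall p, p \in R -> isleaf e Y p) ->
  (forall x, e = Some x -> x \notin U) -> (forall x, e' = Some x -> x \notin U) ->
  o = None \/ o = e' ->
  (forall p, p \notin R -> lsrc Y p != None -> lsrc Y p != e) ->
  ok e' S1 w1 rk U (set_src o R Y).
Proof.
move=> okY RU RS1 leafR eU e'U oe' ne.
have oU x : o = Some x -> x \notin U by case: oe' => [->//|->]; apply: e'U.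
have fE q := isfl_set_src q okY RU leafR eU oU.
apply/forallP => p; case: ifP => [pU|/negbT pU]; last first.
  rewrite ffunE [p \in R](_ : _ = false); first by rewrite (ok_out okY pU).
  by apply: contraNF pU => /RU.
have := ok_in okY pU; rewrite /okl fE !set_srcE; case: ifP => fp.
  suff [-> ->] : inw (set_src o R Y) p = inw Y p /\ outw (set_src o R Y) p = outw Y p by [].
  split; first by apply: eq_big => [a|a _]; rewrite !set_srcE.
  apply: eq_big => [a|a _]; rewrite ?set_src_lwt //.
  by rewrite (src_set_src _ okY RU leafR eU oU).
rewrite fE; case/and4P => -> -> srcp /= ->; rewrite andbT.
case: ifP => pR.
  case: o oe' {oU fE} => [s|//] [//|<-]; by rewrite eqxx (RS1 p pR).
case E : (lsrc Y p) srcp => [s|//]; rewrite fE.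
by have := ne p (negbT pR); rewrite E => /(_ isT)/negbTE -> /= /andP[-> ->]; rewrite orbT.
Qed.

Section Sum.
Variable U : {set T}.
Hypothesis zU : z \notin U.
Let zUs x : Some z = Some x -> x \notin U. Proof. by case=> <-. Qed.
Let noU x : None = Some x -> x \notin U. Proof. by []. Qed.

Lemma src_ne_z Y p : ok0 U Y -> (lsrc Y p == Some z) = false.
Proof.
move=> okY; apply/eqP => E; have pU := ok_src_in okY E.
have npz : p != z by apply: contraNneq zU => <-.
by have [_ _] := src_fl okY E npz isT; rewrite (negbTE zU).
Qed.

Lemma isleaf_add Y p : ok0 U Y -> isleaf None Y p = (lsrc Y p == None).
Proof. by rewrite /isleaf orbb. Qed.

Section Add.
Variables (Y : str) (R : {set T}).
Hypotheses (okY : ok0 U Y) (RE : R \subset edge2 None S1 U Y).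
Local Notation Yz := (set_src (Some z) R Y).

Let RU : {subset R <= U}.
Proof. by move=> p pR; have := subsetP RE p pR; rewrite inE => /andP[]. Qed.
Let RS1 p : p \in R -> p \notin S1.
Proof. by move=> pR; have := subsetP RE p pR; rewrite inE => /and3P[]. Qed.
Let leafR p : p \in R -> isleaf None Y p.
Proof. by move=> pR; have := subsetP RE p pR; rewrite inE => /and3P[]. Qed.

Lemma ok_add : okz U Yz.
Proof.
apply: (ok_set_src okY RU RS1 leafR noU zUs); first by right.
by [].
Qed.

Lemma cut_add : cut (Some z) U Yz = R.
Proof.
apply/setP => p; rewrite inE set_src_lsrc; case: ifP => pR; first by rewrite RU ?eqxx.
by rewrite src_ne_z // andbF.
Qed.

Lemma edge2_add : edge2 (Some z) S1 U Yz = edge2 None S1 U Y.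
Proof.
apply/setP => p; rewrite !inE /isleaf set_src_lsrc; case: ifP => pR; last by rewrite src_ne_z ?orbF ?orbb.
by rewrite eqxx orbT RU // RS1 //; have := leafR pR; rewrite /isleaf => ->.
Qed.

Lemma comp_of_add : comp_of (Some z) S1 w1 U Yz = comp_of None S1 w1 U Y.
Proof.
have fE q := isfl_set_src q okY RU leafR noU zUs.
have Ed : cdeg U Yz = cdeg U Y.
  congr addn; apply: eq_card => p; rewrite !inE ?fE //.
  by rewrite /rt set_src_ltgt fE.
rewrite /comp_of Ed edge2_add; congr (Component (_, _) _ _ _).
  by apply/ffunP => i; rewrite !ffunE; congr (- (Posz _)); apply: eq_card => p; rewrite !inE set_src_lset.
by apply: eq_wts => p _; rewrite set_src_lwt.
Qed.

Lemma conn_add : conn U Yz = conn U Y.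
Proof.
rewrite /conn; congr (_ && _); apply: eq_forallb => p; congr (_ ==> _).
apply: eq_forallb => q; congr (_ ==> _); apply: eq_connect => a b.
exact: (lnk_set_src _ _ okY RU leafR noU zUs).
Qed.

Lemma mult_add : mult S1 U Yz = mult S1 U Y * \prod_(p in R) qint (lwt Y p).
Proof.
rewrite /mult (big_setID R) [in RHS](big_setID R) /= (setIidPr _); last exact/subsetP.
rewrite mulrAC; congr (_ * _); last first.
  apply: eq_bigr => p; rewrite inE => /andP[pR _].
  have E : Yz p = Y p by rewrite ffunE (negbTE pR).
  by rewrite /fac (eq_isfl E) (eq_lwt E) (eq_lsrc E).
rewrite -big_split /=; apply: eq_bigr => p pR; rewrite /fac.
rewrite (isfl_set_src p okY RU leafR noU zUs) (negbTE (RS1 pR)) set_src_lwt set_src_lsrc pR.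
rewrite (negbTE (isleaf_nfl okY noU (leafR pR))).
by have := leafR pR; rewrite isleaf_add // => /eqP ->; rewrite expr2.
Qed.

Lemma erase_add : set_src None R Yz = Y.
Proof.
apply: str_ext => p; rewrite !set_srcE //; case: (boolP (p \in R)) => // pR.
by have := leafR pR; rewrite isleaf_add // => /eqP.
Qed.

End Add.

Lemma ok_erase Y : okz U Y -> ok0 U (set_src None (cut (Some z) U Y) Y).
Proof.
move=> okY; have RU : {subset cut (Some z) U Y <= U} by move=> p; rewrite inE => /andP[].
apply: (ok_set_src okY RU _ _ zUs noU); try by left.
- move=> p; rewrite inE => /andP[_ /eqP E]; apply: contraTN isT => pS.
  by have := src_S1 okY pS; rewrite E.
- by move=> p; rewrite inE /isleaf => /andP[_ ->]; rewrite orbT.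
move=> p; rewrite inE negb_and => /orP[pU|//]; by rewrite (ok_out_src okY pU).
Qed.

Lemma cut_edge2 Y : okz U Y ->
  cut (Some z) U Y \subset edge2 None S1 U (set_src None (cut (Some z) U Y) Y).
Proof.
move=> okY; apply/subsetP => p pR; rewrite inE /isleaf set_src_lsrc pR eqxx andbT.
move: pR; rewrite inE => /andP[-> /eqP E] /=; apply: contraTN isT => pS.
by have := src_S1 okY pS; rewrite E.
Qed.

Lemma add_erase Y : set_src (Some z) (cut (Some z) U Y) (set_src None (cut (Some z) U Y) Y) = Y.
Proof.
apply: str_ext => p; rewrite !set_srcE //.
case: (boolP (p \in cut _ _ _)) => //; by rewrite inE => /andP[_ /eqP].
Qed.

(** A structure in the presence of the removed floor is a structure without it, together with the
    set [R] of those mu_2 edges that used to leave it. The edges of [R] trade the factor [w] for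
    [w]^2, whence the additional product. *)
Lemma wsum_pairs x :
  wsum B (Some z) S1 w1 rk U x =
  \sum_(Y : str | [&& ok0 U Y, conn U Y & comp_of None S1 w1 U Y == x.1])
   \sum_(R : {set T} | (R \subset edge2 None S1 U Y) && (wts (lwt Y) R == x.2))
     mult S1 U Y * \prod_(p in R) qint (lwt Y p).
Proof.
rewrite pair_big_dep /wsum /=.
rewrite (reindex_onto (fun YR : str * {set T} => set_src (Some z) YR.2 YR.1)
   (fun Y => (set_src None (cut (Some z) U Y) Y, cut (Some z) U Y))) /=; last first.
  by move=> Y _; apply: add_erase.
have key (Y : str) (R : {set T}) : [&& okz U (set_src (Some z) R Y), conn U (set_src (Some z) R Y) &
       st (Some z) S1 w1 U (set_src (Some z) R Y) == x] &&
     ((set_src None (cut (Some z) U (set_src (Some z) R Y)) (set_src (Some z) R Y),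
       cut (Some z) U (set_src (Some z) R Y)) == (Y, R)) =
   [&& [&& ok0 U Y, conn U Y & comp_of None S1 w1 U Y == x.1],
       R \subset edge2 None S1 U Y & wts (lwt Y) R == x.2].
  apply/idP/idP.
    case/andP => /and3P[okY cY stY] /eqP[EY ER].
    have ok0Y : ok0 U Y by rewrite -EY; apply: ok_erase.
    have RE : R \subset edge2 None S1 U Y.
      by have := cut_edge2 okY; rewrite EY ER.
    move: stY; rewrite /st (comp_of_add ok0Y RE) (cut_add ok0Y RE) => /eqP <- /=.
    rewrite conn_add // in cY; rewrite ok0Y cY RE !eqxx /=.
    by apply/eqP/eq_wts => p _; rewrite set_src_lwt.
  case/andP => /and3P[okY cY /eqP cE] /andP[RE /eqP wE].
  rewrite ok_add // conn_add // cY /st comp_of_add // cut_add // erase_add // cE eqxx andbT /=.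
  case: x cE wE => c xi /= _ <-; rewrite xpair_eqE eqxx /=.
  by apply/eqP/eq_wts => p _; rewrite set_src_lwt.
apply: eq_big => [[Y R]|[Y R]] /=; first exact: key.
by rewrite key => /andP[/and3P[okY _ _] /andP[RE _]]; rewrite mult_add.
Qed.

End Sum.
End Erase.

(** * Closed form of the sum over connected structures of a given type *)

Section ClosedForm.
Variables (k B : nat) (T : finType).
Local Notation str := (str k B T).
Implicit Types (Y : str) (p q : T) (U : {set T}).
Variables (S1 : {set T}) (w1 rk : T -> nat).

Lemma leafwE e U Y : ok e S1 w1 rk U Y ->
  leafw e U Y = (sumn (wts w1 (U :&: S1)) + sumn (wts (lwt Y) (edge2 e S1 U Y)))%N.
Proof.
move=> okY; rewrite !sumn_wts /leafw (bigID (mem S1)) /=; congr addn.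
  rewrite (eq_bigl (mem (U :&: S1))) => [|p].
    by apply: eq_bigr => p /setIP[pU pS]; rewrite (wt_S1 okY).
  rewrite !inE; case: (boolP (p \in S1)) => pS; rewrite ?andbF // !andbT.
  by rewrite /isleaf (src_S1 okY) // andbT.
by apply: eq_bigl => p; rewrite inE; case: (p \in U) => //=; rewrite andbC.
Qed.

Lemma nsetE U Y : nset U Y = (\sum_(i < k) #|[set p in U | i \in lset Y p]|)%N.
Proof.
rewrite /nset (eq_bigr (fun p => \sum_(i | i \in lset Y p) 1)%N) => [|p _]; last by rewrite sum1_card.
rewrite (exchange_big_dep predT) //=; apply: eq_bigr => i _.
by rewrite sum1dep_card; apply: eq_card => p; rewrite !inE.
Qed.

(** Depends only on how many labels of each kind [U] contains; this is why sharing the labels among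
    components is a problem of coloured counting. *)
Definition label_data U (c : component k) : bool :=
  (wts w1 (U :&: S1) == part1 c) &&
  (#|U :\: S1|%:Z == dot (cls c) (clsL k) - 1 + (gen c)%:Z + (size (part2 c))%:Z).

(** Degree and genus take care of themselves: [degree_sum] gives the degree from the leaf weights
    and the attached classes, and the number of free labels then gives the genus. *)
Lemma comp_ofE U Y (c : component k) : ok None S1 w1 rk U Y -> conn U Y ->
  (sumn (part1 c))%:Z + (sumn (part2 c))%:Z = dot (cls c) (clsE k) ->
  (comp_of None S1 w1 U Y == c) =
  [&& label_data U c, [forall i, #|[set p in U | i \in lset Y p]|%:Z == dot (cls c) (clsEi i)] &
      wts (lwt Y) (edge2 None S1 U Y) == part2 c].
Proof.
move=> okY conY sumc; have gen0 := genus_ge0 okY (fun z (E : None = Some z) => ltac:(by [])) conY.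
have deg := degree_sum okY (fun z (E : None = Some z) => ltac:(by [])).
have lw := leafwE okY.
have sz : size (wts (lwt Y) (edge2 None S1 U Y)) = #|edge2 None S1 U Y| by rewrite size_wts.
apply/eqP/and3P => [<- | [/andP[/eqP P1 /eqP N] /forallP A /eqP P2]].
  split => //=; first rewrite /label_data eqxx /= dotL /= sz.
    by apply/eqP; move: gen0; lia.
  by apply/forallP => i; rewrite dotEi /= ffunE opprK.
rewrite /comp_of P1 P2; case: c => [[x b] g p1 p2] /= in sumc P1 N A P2 *.
have Eb i : b i = - (#|[set p in U | i \in lset Y p]|)%:Z.
  by rewrite (eqP (A i)) dotEi opprK.
have Es : \sum_i b i = - (nset U Y)%:Z.
  by rewrite nsetE (eq_bigr _ (fun i _ => Eb i)) sumrN (big_morph Posz PoszD (erefl _)).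
move: sumc N; rewrite dotE dotL /= Es -sz P2 => sumc N.
rewrite P1 P2 in lw.
have Ex : x = cdeg U Y by lia.
subst x; congr (Component (_, _) _ _ _); first by apply/ffunP => i; rewrite ffunE Eb.
move: N; set s2 := size _; lia.
Qed.

(** By [wsum_pairs] the only freedom besides the structure itself is the choice of cut edges of
    weights [xi] among the mu_2 edges, and the number of choices does not depend on the
    structure. *)
Lemma wsumE z U c xi : z \notin U ->
  (sumn (part1 c))%:Z + (sumn (part2 c))%:Z = dot (cls c) (clsE k) ->
  xi `<=` part2 c ->
  wsum B (Some z) S1 w1 rk U (c, xi) =
  if label_data U c then
    pmultinomial Kq (part2 c) [:: part2 c `\` xi] *
    nsum B S1 w1 rk U (fun i => dot (cls c) (clsEi i)) (part2 c) * \prod_(x <- xi) qint x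
  else 0.
Proof.
move=> zU sumc xic; rewrite wsum_pairs //=.
rewrite pmultinomial_compl //.
transitivity (\sum_(Y : str | [&& ok None S1 w1 rk U Y, conn U Y & comp_of None S1 w1 U Y == c])
   mult S1 U Y * (pmultinomial Kq (part2 c) [:: xi] * \prod_(x <- xi) qint x)).
  apply: eq_bigr => Y /and3P[okY conY /eqP cY]; rewrite -big_distrr /=; congr (_ * _).
  have P2 : wts (lwt Y) (edge2 None S1 U Y) = part2 c by rewrite -cY.
  rewrite -P2 -card_subsets_wts ?P2 // big_distrl /=.
  by apply: eq_bigr => R /andP[_ /eqP <-]; rewrite big_wts mul1r.
rewrite -big_distrl /=; case: ifP => lab.
  rewrite mulrA; congr (_ * _); rewrite mulrC; congr (_ * _).
  apply: eq_bigl => Y; case: (boolP (ok _ _ _ _ _ _)) => //= okY.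
  by case: (boolP (conn U Y)) => //= conY; rewrite comp_ofE // lab.
rewrite big1 ?mul0r // => Y /and3P[okY conY]; by rewrite comp_ofE // lab.
Qed.

End ClosedForm.

(** * Invariance under relabelling *)

Section Transport.
Variables (k B : nat) (T T' : finType) (h : T -> T').
Hypothesis hI : injective h.
Implicit Types (Y : str k B T).

(** Partial inverse of [h]. The argument [p] supplies the default value, as [T] need not have a
    distinguished element. *)
Let pull (p : T) (p' : T') : T := odflt p [pick q | h q == p'].

Let pullK p q : pull p (h q) = q.
Proof. by rewrite /pull; case: pickP => [x /eqP/hI|/(_ q)] //=; rewrite eqxx. Qed.

Definition push Y : str k B T' :=
  [ffun p' => if [pick q | h q == p'] is Some p
     then (omap h (lsrc Y p), h (ltgt Y p), (Y p).1.2, lset Y p) else dflt k B p'].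

Let pullY (Y' : str k B T') : str k B T :=
  [ffun p => (omap (pull p) (lsrc Y' (h p)), pull p (ltgt Y' (h p)), (Y' (h p)).1.2, lset Y' (h p))].

Lemma push_h Y p : push Y (h p) = (omap h (lsrc Y p), h (ltgt Y p), (Y p).1.2, lset Y p).
Proof. by rewrite ffunE; case: pickP => [x /eqP/hI-> //|/(_ p)]; rewrite eqxx. Qed.

Lemma push_out Y (p' : T') : p' \notin [set h p | p : T] -> push Y p' = dflt k B p'.
Proof.
move=> Hp; rewrite ffunE; case: pickP => [x /eqP E|//].
by rewrite -E imset_f in Hp.
Qed.

Lemma push_src Y p : lsrc (push Y) (h p) = omap h (lsrc Y p). Proof. by rewrite /lsrc push_h. Qed.
Lemma push_tgt Y p : ltgt (push Y) (h p) = h (ltgt Y p). Proof. by rewrite /ltgt push_h. Qed.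
Lemma push_wt Y p : lwt (push Y) (h p) = lwt Y p. Proof. by rewrite /lwt push_h. Qed.
Lemma push_set Y p : lset (push Y) (h p) = lset Y p. Proof. by rewrite /lset push_h. Qed.

Lemma push_src_eq Y p q : (lsrc (push Y) (h p) == Some (h q)) = (lsrc Y p == Some q).
Proof. by rewrite push_src; case: (lsrc Y p) => [s|//] /=; rewrite !(inj_eq Some_inj) (inj_eq hI). Qed.

Lemma push_isfl Y p : isfl (push Y) (h p) = isfl Y p.
Proof. by rewrite /isfl push_src_eq. Qed.

Lemma big_codom (R : Type) (idx : R) (op : Monoid.com_law idx) (P : pred T') (F : T' -> R) :
  (forall p', P p' -> p' \in [set h p | p : T]) ->
  \big[op/idx]_(p' | P p') F p' = \big[op/idx]_(p | P (h p)) F (h p).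
Proof.
move=> H; rewrite (eq_bigl (fun p' => (p' \in [set h p | p in [set p | P (h p)]]))).
  by rewrite big_imset => [|x y _ _ /hI //]; apply: eq_bigl => p; rewrite inE.
move=> p'; apply/idP/imsetP => [Pp'|[p]]; last by rewrite inE => Pp ->.
by have /imsetP[p _ E] := H p' Pp'; exists p; rewrite // inE -E.
Qed.

Lemma push_inw Y p : inw (push Y) (h p) = inw Y p.
Proof.
rewrite /inw big_codom => [|p' /andP[/eqP E ne]].
  by apply: eq_big => [a|a _]; rewrite ?push_wt // push_tgt !(inj_eq hI).
by apply: contraT => Hp'; rewrite -E /ltgt push_out ?eqxx in ne.
Qed.

Lemma push_outw Y p : outw (push Y) (h p) = outw Y p.
Proof.
rewrite /outw big_codom => [|p' /andP[E _]].
  by apply: eq_big => [a|a _]; rewrite ?push_wt // push_src_eq (inj_eq hI).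
by apply: contraLR E => Hp'; rewrite /lsrc push_out.
Qed.

Variables (S1 : {set T}) (w1 rk : T -> nat) (S1' : {set T'}) (w1' rk' : T' -> nat).
Hypotheses (hS : forall p, (h p \in S1') = (p \in S1))
  (hw : forall p, p \in S1 -> w1' (h p) = w1 p)
  (hrk : forall p q, p \notin S1 -> q \notin S1 -> (rk' (h p) < rk' (h q))%N = (rk p < rk q)%N).
Local Notation U' := [set h p | p : T].

Lemma push_okl Y p : (forall q, isfl Y q -> q \notin S1) ->
  okl None S1' w1' rk' U' (push Y) (h p) = okl None S1 w1 rk [set: T] Y p.
Proof.
move=> flS; rewrite /okl push_isfl hS push_wt push_tgt push_set push_inw push_outw (inj_eq hI).
case: ifP => // _; congr [&& _, _, _ & _].
- by case: (boolP (p \in S1)) => //= pS; rewrite hw.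
- rewrite push_src; case: (lsrc Y p) => [s|//] /=; rewrite imset_f // inE push_isfl.
  case: (boolP (p \in S1)) => //= pS; case: (boolP (isfl Y s)) => //= fs.
  by rewrite hrk // flS.
rewrite /= imset_f // inE push_isfl push_tgt (inj_eq hI).
case: ifP => // _; congr (_ && _); case: ifP => // fq.
by case: (boolP (p \in S1)) => //= pS; rewrite hrk // flS.
Qed.

Lemma push_ok Y : ok None S1' w1' rk' U' (push Y) = ok None S1 w1 rk [set: T] Y.
Proof.
apply/idP/idP => okY.
  have flS q : isfl Y q -> q \notin S1.
    by move=> fq; rewrite -hS; apply: (isfl_S1 okY); rewrite push_isfl.
  apply/forallP => p; rewrite inE -push_okl //; apply: (ok_in okY); exact: imset_f.
apply/forallP => p'; case: ifP => [/imsetP[p _ ->]|/negbT Hp']; last by rewrite push_out.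
rewrite push_okl; last by move=> q; apply: (isfl_S1 okY).
exact: (ok_in okY).
Qed.

Lemma push_lnk Y p q : lnk (push Y) (h p) (h q) = lnk Y p q.
Proof. by rewrite /lnk !push_src_eq !push_isfl !push_tgt !(inj_eq hI). Qed.

(** Labels outside the image of [h] are linked only to themselves, so a path that starts in the
    image stays in it and can be pulled back. *)
Lemma push_connect Y p q : connect (lnk (push Y)) (h p) (h q) = connect (lnk Y) p q.
Proof.
apply/idP/idP; last by apply: connect_map => a b ab; apply: connect1; rewrite push_lnk.
move=> C; rewrite -[p](pullK p) -[q](pullK p); move: C; apply: connect_map => a b ab.
have out x : x \notin U' -> isfl (push Y) x = false /\ ltgt (push Y) x = x.
  by move=> Hx; rewrite /isfl /ltgt /lsrc push_out.
case: (boolP (a \in U')) => [/imsetP[a' _ Ea]|aU].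
  suff /imsetP[b' _ Eb] : b \in U'.
    by move: ab; rewrite Ea Eb push_lnk !pullK => ab; apply: connect1.
  apply: contraT => bU; have [fb tb] := out b bU; move: ab.
  rewrite /lnk fb tb andbF Ea push_tgt /=; case/or3P => [/andP[/eqP E _]|/eqP E|/eqP E].
  - by move: E; rewrite /lsrc push_out.
  - by rewrite -E imset_f in bU.
  - by rewrite E imset_f in bU.
have [fa ta] := out a aU.
suff -> : b = a by exact: connect0.
move: ab; rewrite /lnk fa ta andbF /=; case/or3P => [/andP[/eqP E _]|/eqP ->|/eqP E] //.
  by move: E; rewrite /lsrc push_out.
case: (boolP (b \in U')) => [/imsetP[b' _ Eb]|bU]; last by have [_ <-] := out b bU.
by rewrite -E Eb push_tgt imset_f in aU.
Qed.

Lemma push_conn Y : conn U' (push Y) = conn [set: T] Y.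
Proof.
rewrite /conn; congr (_ && _).
  apply/set0Pn/set0Pn => -[p]; last by exists (h p); apply: imset_f.
  by case/imsetP => q _ _; exists q; rewrite inE.
have hU a : h a \in U' by exact: imset_f.
apply/forall_inP/forall_inP => H p.
  move=> _; apply/forall_inP => q _; rewrite -push_connect.
  by have /forall_inP := H (h p) (hU p); apply.
case/imsetP => a _ ->; apply/forall_inP => _ /imsetP[b _ ->]; rewrite push_connect.
by have /forall_inP := H a (in_setT _); apply.
Qed.

Lemma push_pull (Y' : str k B T') : ok None S1' w1' rk' U' Y' -> push (pullY Y') = Y'.
Proof.
move=> okY; apply/ffunP => p'; case: (boolP (p' \in U')) => [/imsetP[p _ ->]|Hp']; last first.
  by rewrite push_out // (ok_out okY).
rewrite push_h /lsrc /ltgt /lset ffunE /= -/(lsrc _ _) -/(ltgt _ _) -/(lset _ _).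
have hpull q : q \in U' -> h (pull p q) = q by case/imsetP => x _ ->; rewrite pullK.
rewrite hpull; last by apply: (tgt_in okY); apply: imset_f.
rewrite (_ : omap h (omap (pull p) (lsrc Y' (h p))) = lsrc Y' (h p)).
  by rewrite /lsrc /ltgt /lset; case: (Y' (h p)) => [[[]]].
case E : (lsrc Y' (h p)) => [s|//] /=; rewrite hpull //.
case: (eqVneq (h p) s) => [<-|ne]; first exact: imset_f.
by have [] := src_fl okY E ne isT.
Qed.

Lemma pull_push Y : pullY (push Y) = Y.
Proof.
apply/ffunP => p; rewrite ffunE push_src push_tgt push_set pullK push_h /=.
have -> : omap (pull p) (omap h (lsrc Y p)) = lsrc Y p.
  by case: (lsrc Y p) => //= s; rewrite pullK.
by rewrite /lsrc /ltgt /lset; case: (Y p) => [[[]]].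
Qed.

Lemma wts_imset (f : T' -> nat) (A : {set T}) : wts f [set h p | p in A] = wts (f \o h) A.
Proof.
apply/msetP => x; rewrite !wtsE -(card_imset _ hI); apply: eq_card => p'; rewrite !inE.
apply/andP/imsetP => [[/imsetP[p pA ->] fx]|[p]]; first by exists p; rewrite // inE pA.
by rewrite inE => /andP[pA fx] ->; rewrite imset_f.
Qed.

(** [push] is a bijection onto the structures on the image of [h]. Ranks have to be compared only
    outside [S1] and weights only on [S1], since these are the places where the local conditions
    read them. *)
Lemma nsum_push (a : 'I_k -> int) mu2 :
  nsum B S1 w1 rk [set: T] a mu2 = nsum B S1' w1' rk' U' a mu2.
Proof.
rewrite /nsum [RHS](reindex_onto push pullY) /=; last by move=> Y' /and4P[okY _ _ _]; apply: push_pull.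
have E2 Y : edge2 None S1' U' (push Y) = [set h p | p in edge2 None S1 [set: T] Y].
  apply/setP => p'; apply/idP/imsetP => [|[p]].
    rewrite inE => /and3P[/imsetP[p _ ->] pS lp]; exists p => //.
    rewrite !inE -hS pS; move: lp; rewrite /isleaf push_src; by case: (lsrc Y p).
  rewrite !inE /= => /andP[pS lp] ->; rewrite imset_f // hS pS /=.
  by move: lp; rewrite /isleaf push_src; case: (lsrc Y p).
apply: eq_big => [Y|Y _].
  rewrite push_ok push_conn pull_push eqxx andbT E2 wts_imset.
  rewrite (eq_wts (g := lwt Y)); last by move=> p _; rewrite /= push_wt.
  congr [&& _, _, _ & _]; apply: eq_forallb => i; congr (Posz _ == _).
  rewrite -(card_imset _ hI); apply: eq_card => p'; rewrite inE.
  apply/imsetP/andP => [[p]|[/imsetP[p _ ->]]].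
    by rewrite !inE /= => ip ->; rewrite push_set imset_f.
  by rewrite push_set => ip; exists p; rewrite // !inE.
rewrite /mult [RHS]big_codom => [|p' //]; apply: eq_big => [p|p _]; first by rewrite inE imset_f.
rewrite /fac hS push_wt push_isfl push_src; by case: (lsrc Y p).
Qed.

End Transport.

(** * Distributing the labels over a list of component types *)

Lemma mset_union_cons (A : choiceType) (a : {mset A}) s : mset_union (a :: s) = a `+` mset_union s.
Proof. by rewrite /mset_union big_cons. Qed.

Lemma mset_union_nil (A : choiceType) : mset_union [::] = mset0 :> {mset A}.
Proof. by rewrite /mset_union big_nil. Qed.

Lemma msubset_addr (A : choiceType) (a b : {mset A}) : a `<=` a `+` b.
Proof. by apply/msubsetP => x; rewrite msetE2 leq_addr. Qed.

Lemma pmultinomial_cons0 (mu : {mset nat}) (nus : seq {mset nat}) :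
  mset_union nus `<=` mu -> pmultinomial Kq mu (mset0 :: nus) = pmultinomial Kq mu nus.
Proof.
move=> le; have lex x := msubsetP le x; rewrite /pmultinomial; apply: eq_bigr => x _ /=.
by rewrite mset0E multinomial_cons // bin0 mul1r subn0.
Qed.

Lemma mulf_div_cancelr (F : fieldType) (b p r x : F) : p != 0 -> r != 0 ->
  b * (x / p) = b * (r * x) / (p * r).
Proof. by move=> p0 r0; field; rewrite p0 r0. Qed.

(** A multinomial coefficient does not change when its implicit remainder is listed as one more
    entry. The remainder will be eta, the part of mu_1 attached to the removed floor. *)
Lemma pmultinomial_rest (mu : {mset nat}) (nus : seq {mset nat}) :
  mset_union nus `<=` mu ->
  pmultinomial Kq mu ((mu `\` mset_union nus) :: nus) = pmultinomial Kq mu nus.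
Proof.
move=> le; have lex x := msubsetP le x; rewrite /pmultinomial; apply: eq_bigr => x _ /=.
rewrite msetE2 mset_unionE; move: (lex x); rewrite mset_unionE.
set L := [seq _ | _ <- nus]; move=> lx.
rewrite multinomial_cons ?leq_subr // /multinomial subKn // subnn fact0 mulr1.
rewrite -(bin_fact (leq_subr (sumn L) (mu x))) subKn //.
rewrite !natrM; apply: mulf_div_cancelr; last by rewrite Kq_natr_neq0 ?fact_gt0.
by rewrite prodf_seq_neq0; apply/allP => y _ /=; rewrite Kq_natr_neq0 ?fact_gt0.
Qed.

Section ZClosed.
Variables (k B : nat) (T : finType).
Variables (e : option T) (S1 : {set T}) (w1 rk : T -> nat) (col : T -> nat).
Implicit Types (U V : {set T}) (J : {set 'I_k}).
Local Notation X := (component k * {mset nat})%type.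
Local Notation zsum := (@zsum k B T e S1 w1 rk).
Local Notation wsum := (@wsum k B T e S1 w1 rk).

Lemma stE_inj : injective (@stE k).
Proof.
move=> a b; rewrite /stE => -[/ffunP/(_ a)]; rewrite !ffunE eqxx.
by case: eqP => // -> .
Qed.

Lemma wsum_deg0 U (x : X) : ((cls x.1).1 <= 0) -> wsum U x = 0.
Proof.
move=> x0; apply: big1 => Y /and3P[okY conY /eqP stY].
by have := cdeg_gt0 okY conY; move: x0; rewrite -stY /=; lia.
Qed.

Lemma zsum_bad V J (L : seq X) x : x \in L -> (forall U, wsum U x = 0) ->
  (forall a, stE a != x) -> zsum V J L = 0.
Proof.
move=> xL W0 nE; elim: L V J xL => [//|y L IH] V J; rewrite inE => /orP[/eqP <-|xL] /=.
  rewrite big1 => [|U _]; last by rewrite W0 mul0r.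
  by rewrite big_pred0 ?addr0 // => a; rewrite (negbTE (nE a)) andbF.
by rewrite !big1 ?addr0 // => [a _|U _]; rewrite IH ?mulr0.
Qed.

Definition isE (x : X) : bool := [exists a, stE a == x].

Variables (V0 : {set T}) (hat : X -> {mset nat}) (K : X -> Kq).

(** When the sum over connected structures sees [U] only through its colours, sharing [V] among the
    types of the list is counted by a multinomial coefficient. Types of class [E_a] take no label;
    they only impose that they occur in the list exactly for the indices in [J]. *)
Lemma zsum_closed V J (L : seq X) : V \subset V0 ->
  (forall x, x \in L -> isE x -> hat x = mset0 /\ K x = 1) ->
  (forall x U, x \in L -> ~~ isE x -> U \subset V0 ->
     wsum U x = if wts col U == hat x then K x else 0) ->
  zsum V J L = (perm_eq (map (@stE k) (enum J)) (filter isE L))%:R *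
    (if wts col V == mset_union (map hat L) then
       pmultinomial Kq (wts col V) (map hat L) * \prod_(x <- L) K x else 0).
Proof.
elim: L V J => [|x L IH] V J VV0 HE HR /=.
  rewrite mset_union_nil big_nil pmultinomial_nil mulr1.
  have -> : (wts col V == mset0) = (V == set0).
    apply/eqP/eqP => [E|->]; last exact: wts0.
    by apply/eqP; rewrite -cards_eq0 -(size_wts col) E enum_mset0.
  have -> : perm_eq [seq stE i | i <- enum J] [::] = (J == set0).
    rewrite -cards_eq0 cardE -(size_map (@stE k)).
    by apply/perm_nilP/eqP => [->|/size0nil].
  by case: (V == set0); case: (J == set0); rewrite ?mulr0 ?mulr1 ?mul0r.
have HE' y : y \in L -> isE y -> hat y = mset0 /\ K y = 1.
  by move=> yL; apply: HE; rewrite inE yL orbT.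
have HR' y U : y \in L -> ~~ isE y -> U \subset V0 ->
    wsum U y = if wts col U == hat y then K y else 0.
  by move=> yL; apply: HR; rewrite inE yL orbT.
have xL : x \in x :: L by rewrite mem_head.
rewrite mset_union_cons big_cons; case: (boolP (isE x)) => [Ex|nEx].
  have [-> ->] := HE x xL Ex; rewrite mset0D mul1r.
  have /existsP[a0 /eqP Ea0] := Ex.
  rewrite big1 ?add0r => [|U _]; last by rewrite wsum_deg0 ?mul0r // -Ea0.
  rewrite (eq_bigl (fun a => (a \in J) && (a == a0))); last first.
    by move=> a; rewrite -Ea0 (inj_eq stE_inj).
  case: (boolP (a0 \in J)) => aJ.
    rewrite (big_pred1 a0) => [|a]; last by rewrite /=; case: eqP => [->|_]; rewrite ?aJ ?andbF.
    have pJ : perm_eq [seq stE i | i <- enum J] (stE a0 :: [seq stE i | i <- enum (J :\ a0)]).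
      rewrite -map_cons; apply: perm_map; apply: uniq_perm; rewrite /= ?mem_enum ?enum_uniq //.
        by rewrite !inE eqxx.
      move=> a; rewrite inE !mem_enum !inE; by case: eqP => [->|].
    rewrite (permPl pJ) Ea0 perm_cons (IH V (J :\ a0) VV0 HE' HR'); case: eqP => [E|_]; last by [].
    rewrite pmultinomial_cons0; first by [].
    by rewrite E; exact: msubset_refl.
  rewrite big_pred0 => [|a]; last by case: eqP => [->|_]; rewrite ?(negbTE aJ) ?andbF.
  rewrite (_ : perm_eq _ _ = false) ?mul0r //; apply: contraNF aJ => /perm_mem/(_ x).
  by rewrite mem_head -Ea0 => /mapP[a]; rewrite mem_enum => aJ /stE_inj ->.
rewrite [X in _ + X]big_pred0 ?addr0 => [|a]; last first.
  by apply/negbTE; rewrite negb_and orbC; apply/orP; left; apply: contraNN nEx => Ea; apply/existsP; exists a.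
rewrite (eq_bigr (fun U : {set T} => (if wts col U == hat x then 1 else 0) *
   ((perm_eq [seq stE i | i <- enum J] [seq x <- L | isE x])%:R *
    (if wts col V == hat x `+` mset_union (map hat L) then
       pmultinomial Kq (wts col V `\` hat x) (map hat L) * (K x * \prod_(x <- L) K x) else 0)))); last first.
  move=> U UV; rewrite HR ?(subset_trans UV) //; case: eqP => [Ex|_]; last by rewrite !mul0r.
  rewrite (IH _ J (subset_trans (subsetDl V U) VV0) HE' HR') mul1r mulrCA; congr (_ * _).
  rewrite (wtsD col UV) Ex msetDKB.
  have -> : (hat x `+` wts col (V :\: U) == hat x `+` mset_union [seq hat i | i <- L]) =
            (wts col (V :\: U) == mset_union [seq hat i | i <- L]).
    by apply/eqP/eqP => [/(congr1 (msetB^~ (hat x)))|->//]; rewrite !msetDKB.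
  by case: eqP; rewrite ?mulr0 // mulrCA.
rewrite -big_distrl /= mulrCA; congr (_ * _); case: eqP => [E|_]; last by rewrite mulr0.
rewrite -big_mkcondr /= card_subsets_wts; last by rewrite E; exact: msubset_addr.
rewrite [in RHS]pmultinomial_cons ?mulrA // mset_union_cons E; exact: msubset_refl.
Qed.

End ZClosed.

(** * The terms of the second sum *)

Lemma qint1 : qint 1 = 1.
Proof.
rewrite /qint !expr1 divff //; apply/negP; rewrite subr_eq0 => /eqP E.
have q0 : qh != 0 by rewrite /qh tofrac_eq0 polyX_eq0.
have : qh ^+ 2 = 1 by rewrite expr2 {1}E mulVf.
(* If the denominator of [qint] vanished, the polynomials X^2 and 1 would agree; their values at 0
   differ. *)
rewrite /qh -tofracXn -tofrac1 => /eqP; rewrite tofrac_eq => /eqP/(congr1 (fun p : {poly rat} => p.[0])).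
by rewrite !hornerE /= => /eqP.
Qed.

Lemma big_mset_union (R : Type) (idx : R) (op : Monoid.com_law idx) (A : choiceType)
  (s : seq {mset A}) (F : A -> R) :
  \big[op/idx]_(x <- mset_union s) F x = \big[op/idx]_(m <- s) \big[op/idx]_(x <- m) F x.
Proof.
elim: s => [|m s IH]; first by rewrite mset_union_nil big_mset0 big_nil.
rewrite mset_union_cons big_cons -IH -big_cat; apply: perm_big.
by apply/permP => P; rewrite count_cat; have /permP/(_ P) := perm_eq_seq_mset (m ++ mset_union s) ; rewrite count_cat => <-;
  congr (count P (enum_mset _)); apply/msetP => x; rewrite mset_seqE count_cat !count_mem_mset msetE2.
Qed.

Lemma enum_mset_nil (A : choiceType) (m : {mset A}) : (m : seq A) = [::] -> m = mset0.
Proof. by move=> E; rewrite -[m]seq_mset_id E; apply/msetP => x; rewrite mset_seqE mset0E. Qed.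

Lemma Nq_nonpos (k : nat) (d : H2 k) g (mu1 mu2 : {mset nat}) :
  (dot d (clsL k) <= 0) -> Nq d g mu1 mu2 != 0 ->
  exists a, [/\ d = clsEi a, g = 0%N, mu1 = mset0 & mu2 = [mset 1%N]].
Proof.
rewrite /Nq /Nord leNgt => /negbTE ->; case: ifP => [/and4P[/existsP[a /eqP da] /eqP g0 /eqP m1 /eqP m2] _|]; last by rewrite eqxx.
exists a; split => //; first exact: enum_mset_nil.
by rewrite -[mu2]seq_mset_id m2; apply/msetP => x; rewrite mset_seqE msetnE /= eq_sym addn0; case: eqP.
Qed.

Lemma enum_mset1 (A : choiceType) (a : A) : enum_mset [mset a] = [:: a].
Proof. by rewrite enum_msetn. Qed.

Lemma Nq_Ei (k : nat) (a : 'I_k) : Nq (clsEi a) 0 mset0 [mset 1%N] = 1.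
Proof.
rewrite /Nq /Nord dotL ltxx enum_mset0 enum_mset1 !eqxx !andbT.
by case: existsP => // -[]; exists a.
Qed.

Lemma fst_sum (k : nat) (I : Type) (s : seq I) (F : I -> H2 k) :
  (\sum_(i <- s) F i).1 = \sum_(i <- s) (F i).1.
Proof. by rewrite (big_morph fst (id1 := 0) (op1 := +%R)). Qed.

Lemma snd_sum (k : nat) (I : Type) (s : seq I) (F : I -> H2 k) a :
  (\sum_(i <- s) F i).2 a = \sum_(i <- s) (F i).2 a.
Proof.
elim: s => [|x s IH]; first by rewrite !big_nil ffunE.
by rewrite !big_cons /= -IH ffunE.
Qed.

Lemma sum_split3 (I : Type) (s : seq I) (a b c : I -> int) :
  \sum_(i <- s) (a i + b i - 1 + c i) =
  \sum_(i <- s) a i + \sum_(i <- s) b i - (size s)%:Z + \sum_(i <- s) c i.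
Proof.
elim: s => [|x s IH]; first by rewrite !big_nil.
by rewrite !big_cons IH /= -add1n PoszD; ring.
Qed.

Lemma abs_nfree (a : int) (b c : nat) : 0 < a ->
  (absz (a + b%:Z - 1 + c%:Z))%:Z = a + b%:Z - 1 + c%:Z.
Proof. lia. Qed.

Section SecondTerm.
Variables (k B : nat) (T : finType) (z : T) (S1 : {set T}) (w1 rk : T -> nat).
Implicit Types (U V H : {set T}) (J : {set 'I_k}).
Local Notation X := (component k * {mset nat})%type.
Local Notation zsum := (@zsum k B T (Some z) S1 w1 rk).
Local Notation wsum := (@wsum k B T (Some z) S1 w1 rk).
Local Notation V0 := (~: [set z]).

(** Weights of mu_1 being positive, the colour 0 of the free labels is never confused with the
    colour of a label in [S1]. *)
Definition col p : nat := if p \in S1 then w1 p else 0.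
Definition nfree (c : component k) : nat :=
  absz (dot (cls c) (clsL k) + (gen c)%:Z - 1 + (size (part2 c))%:Z).
(** Colours consumed by a component of type [x]: its free labels and its share of mu_1. *)
Definition hat (x : X) : {mset nat} := msetn (nfree x.1) 0%N `+` part1 x.1.
Definition Kfac (x : X) : Kq :=
  pmultinomial Kq (part2 x.1) [:: part2 x.1 `\` x.2] *
  Nq (cls x.1) (gen x.1) (part1 x.1) (part2 x.1) * \prod_(y <- x.2) qint y.

Hypotheses (zS1 : z \notin S1) (w1pos : forall p, p \in S1 -> (0 < w1 p)%N).

Lemma wts_col U : wts col U = msetn #|U :\: S1| 0%N `+` wts w1 (U :&: S1).
Proof.
rewrite (wtsD _ (subsetIl U S1)) msetDC; congr msetD.
  rewrite setDIr setDv set0U.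
  apply/msetP => x; rewrite wtsE msetnE; case: eqP => [->|x0].
    apply: eq_card => p; rewrite !inE /col; by case: (p \in S1) => //=; rewrite eqxx andbT.
  apply: eq_card0 => p; rewrite !inE /col; case: (p \in S1) => //=.
  by rewrite eq_sym; move/eqP/negbTE: x0 => ->; rewrite andbF.
by apply: eq_wts => p; rewrite !inE /col => /andP[_ ->].
Qed.

Lemma wts_w1_0 U : wts w1 (U :&: S1) 0%N = 0%N.
Proof.
rewrite wtsE; apply: eq_card0 => p; rewrite !inE -andbA; apply/negP => /and3P[_ pS].
by rewrite eqn0Ngt w1pos.
Qed.

Lemma label_col U (x : X) : parts_pos (part1 x.1) -> 0 < dot (cls x.1) (clsL k) ->
  (wts col U == hat x) = label_data S1 w1 U x.1.
Proof.
rewrite /parts_pos -mset_eq0 => /eqP P0 L0; rewrite wts_col /hat /label_data.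
have nE : (#|U :\: S1|%:Z == dot (cls x.1) (clsL k) - 1 + (gen x.1)%:Z + (size (part2 x.1))%:Z) =
          (#|U :\: S1| == nfree x.1).
  rewrite /nfree; apply/eqP/eqP; lia.
rewrite nE; apply/eqP/andP => [E|[/eqP -> /eqP ->]] //.
have E0 : #|U :\: S1| = nfree x.1.
  by have /msetP/(_ 0%N) := E; rewrite !msetE2 !msetnxx wts_w1_0 P0 !addn0.
split; last by rewrite E0.
by move/(congr1 (msetB^~ (msetn (nfree x.1) 0%N))): E; rewrite E0 !msetDKB => ->.
Qed.

Variables (d : H2 k) (g : nat) (mu1 mu2 : {mset nat}).
(** [NqE] identifies the label count of a component with [Nq]. Its bound on the degree lets the
    components share the weight bound [B] of the whole problem, and its condition that mu_2 is
    nonempty, which follows from the nonempty xi, guarantees that the component has a label. *)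
Hypotheses (mu1E : mu1 = wts w1 S1)
  (cardS2 : #|V0 :\: S1|%:Z = dot d (clsL k) + g%:Z - 2 + (size mu2)%:Z)
  (NqE : forall (c : component k) U, U \subset V0 ->
     parts_pos (part1 c) -> parts_pos (part2 c) ->
     (sumn (part1 c))%:Z + (sumn (part2 c))%:Z = dot (cls c) (clsE k) ->
     0 < dot (cls c) (clsL k) -> dot (cls c) (clsL k) <= dot d (clsL k) ->
     part2 c != mset0 -> label_data S1 w1 U c ->
     nsum B S1 w1 rk U (fun i => dot (cls c) (clsEi i)) (part2 c) =
     Nq (cls c) (gen c) (part1 c) (part2 c)).

Section Term.
Variable I : sum_index k.
Hypothesis admI : admissible d g mu1 mu2 I.
Local Notation C := (enum_mset I.1).
Local Notation L := (zip C I.2).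

Let szI : size I.2 = size C. Proof. by case: admI. Qed.
Let L1 : unzip1 L = C. Proof. by rewrite unzip1_zip ?szI. Qed.
Let L2 : unzip2 L = I.2. Proof. by rewrite unzip2_zip ?szI. Qed.

Let inC (x : X) : x \in L -> x.1 \in C.
Proof. by move=> xL; rewrite -L1; apply: map_f. Qed.

Lemma prod_Kfac :
  (\prod_(p <- L) pmultinomial Kq (part2 p.1) [:: part2 p.1 `\` p.2]) *
  (\prod_(c <- C) Nq (cls c) (gen c) (part1 c) (part2 c)) *
  (\prod_(x <- mset_union I.2) qint x) = \prod_(x <- L) Kfac x.
Proof.
rewrite big_mset_union -[in X in _ * _ * X]L2 -[X in _ * \big[_/_]_(c <- X) _ * _]L1 !big_map -!big_split /=.
by [].
Qed.

Lemma Kfac_E a : Kfac (stE a) = 1.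
Proof.
rewrite /Kfac /= Nq_Ei mulr1 enum_mset1 big_cons big_nil mulr1 qint1 mulr1.
rewrite (_ : _ `\` _ = mset0); last by apply/eqP; rewrite msetB_eq0 msubset_refl.
by rewrite pmultinomial_cons0 ?pmultinomial_nil // mset_union_nil msub0set.
Qed.

Lemma hat_E a : hat (stE a) = mset0.
Proof. by rewrite /hat /nfree /= dotL /= enum_mset1; apply/msetP => x; rewrite msetE2 mset0E msetnE if_same. Qed.

Let compC c : c \in C -> [/\ parts_pos (part1 c), parts_pos (part2 c) &
  (sumn (part1 c))%:Z + (sumn (part2 c))%:Z = dot (cls c) (clsE k)].
Proof. by case: admI => _ H _ _ _; apply: H. Qed.

Let xiL (x : X) : x \in L -> x.2 `<=` part2 x.1 /\ sumn x.2 != 0%N.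
Proof. by case: x => c xi; case: admI => _ _ H _ _; apply: H. Qed.

(** In degree at most 0 the only nonzero count is that of a class [E_a] with mu_2 = (1). Then xi,
    contained in (1) and nonempty, is (1), and the type is [stE a]. *)
Lemma second_term_bad (x : X) : x \in L -> dot (cls x.1) (clsL k) <= 0 -> ~~ isE x ->
  Nq (cls x.1) (gen x.1) (part1 x.1) (part2 x.1) = 0.
Proof.
move=> xL x0; apply: contraNeq => /(Nq_nonpos x0)[a [E1 E2 E3 E4]].
apply/existsP; exists a; apply/eqP; have [] := xiL xL.
case: x xL x0 E1 E2 E3 E4 => [[c gc p1 p2] xi] /= _ _ -> -> -> ->.
rewrite /stE => xi1; have xiE y : xi y = if y == 1%N then xi 1%N else 0%N.
  have := msubsetP xi1 y; rewrite msetnE; case: eqP => [->//|_]; by rewrite leqn0 => /eqP.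
have := msubsetP xi1 1%N; rewrite msetnxx => xi11 xi0; congr (_, _).
suff xi1E : xi 1%N = 1%N by apply/msetP => y; rewrite xiE xi1E msetnE.
apply/eqP; rewrite eqn_leq xi11 lt0n; apply: contraNneq xi0 => xi10.
by rewrite (_ : xi = mset0) ?enum_mset0 //; apply/msetP => y; rewrite xiE xi10 mset0E if_same.
Qed.

(** The expressions for the numbers of free labels are summed over the components. The class and
    genus equations, and the relation between mu_2, the xi^j and the mu_2^j, turn the sum into the
    number of free labels left after removing [z]. *)
Lemma hat_L0 : (forall x : X, x \in L -> isE x || (0 < dot (cls x.1) (clsL k))) ->
  mset_union (map hat L) = msetn #|V0 :\: S1| 0%N `+` mset_union (map (@part1 k) C) /\
  sumn (map nfree C) = #|V0 :\: S1|.
Proof.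
move=> good; have Es : sumn (map nfree C) = #|V0 :\: S1|.
  apply/eqP; rewrite -eqz_nat cardS2 sumnE big_map.
  have -> : Posz (\sum_(c <- C) nfree c)%N = \sum_(c <- C) (dot (cls c) (clsL k) + (gen c)%:Z - 1 + (size (part2 c))%:Z).
    rewrite (big_morph Posz PoszD (erefl _)) -L1 !big_map big_seq [RHS]big_seq.
    apply: eq_bigr => x xL; rewrite /nfree; case/orP: (good x xL) => [/existsP[a /eqP <-]|].
      by rewrite /= dotL enum_mset1.
    exact: abs_nfree.
  case: admI => _ _ _ [_ E2 E3 E4] _.
  have Ecl : \sum_(c <- C) dot (cls c) (clsL k) = dot d (clsL k) - 2.
    rewrite (eq_bigr (fun c => (cls c).1)) => [|c _]; last by rewrite dotL.
    by rewrite -fst_sum E3 dotL /= -(clsE_fst k).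
  have Esz : (size mu2)%:Z + \sum_(x <- I.2) (size (x : {mset nat}))%:Z = \sum_(c <- C) (size (part2 c))%:Z.
    have szU (s : seq {mset nat}) : size (mset_union s) = (\sum_(x <- s) size (x : {mset nat}))%N.
      by rewrite -sum1_size big_mset_union; apply: eq_bigr => m _; rewrite sum1_size.
    have szD (a b : {mset nat}) : size (a `+` b) = (size a + size b)%N.
      have := szU [:: a; b]; rewrite !mset_union_cons mset_union_nil msetD0 => ->.
      by rewrite !big_cons big_nil addn0.
    have := congr1 (fun m : {mset nat} => (size m)%:Z) E2; rewrite szD !szU big_map PoszD.
    by rewrite !(big_morph Posz PoszD (erefl _)).
  have EP : \sum_(p <- L) ((size p.2)%:Z + (gen p.1)%:Z) =
            \sum_(x <- I.2) (size (x : {mset nat}))%:Z + \sum_(c <- C) (gen c)%:Z.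
    transitivity (\sum_(x <- unzip2 L) (size (x : {mset nat}))%:Z + \sum_(c <- unzip1 L) (gen c)%:Z).
      by rewrite !big_map -big_split.
    by rewrite L1 L2.
  rewrite EP in E4; rewrite sum_split3 Ecl -Esz.
  move: E4; set a := \sum_(x <- I.2) _; set b := \sum_(c <- C) _; move=> <-; apply/eqP; ring.
split=> //; rewrite -Es; apply/msetP => x.
have EC (F : component k -> nat) : (\sum_(c <- C) F c = \sum_(y <- L) F y.1)%N.
  by rewrite -[in LHS]L1 big_map.
rewrite msetE2 msetnE !mset_unionE !sumnE !big_map !EC.
rewrite (eq_bigr (fun y : X => nfree y.1 * (x == 0%N) + part1 y.1 x)%N) => [|y _]; last first.
  by rewrite /hat msetE2 msetnE; case: (x == 0%N); rewrite ?muln1 ?muln0.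
rewrite big_split -big_distrl /=.
by case: (x == 0%N); rewrite ?muln1 ?muln0.
Qed.

(** A repeated type of class [E_a] would give two different positions of the numbering with that
    class, which admissibility excludes. The positions are recovered from multiplicities by
    filtering an [iota]. *)
Lemma uniq_E : uniq (filter (@isE k) L).
Proof.
have cnt x : x \in L -> isE x -> (count_mem x L <= 1)%N.
  move=> xL /existsP[a /eqP ax]; rewrite leqNgt; apply/negP => c2.
  have : (1 < count (fun c => cls c == clsEi a) C)%N.
    apply: leq_trans c2 _; rewrite -[in X in (_ <= X)%N]L1 count_map; apply: sub_count => y /= /eqP ->.
    by rewrite -ax.
  case: admI => _ _ _ _ [_ U]; rewrite -size_filter => c2'.
  pose c0 := (stE a).1; pose F := [seq i <- iota 0 (size C) | cls (nth c0 C i) == clsEi a].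
  have szF : (1 < size F)%N.
    rewrite /F size_filter -[X in (1 < X)%N]/(count (preim (nth c0 C) (fun c => cls c == clsEi a)) _) -count_map.
    by rewrite -/(mkseq _ _) mkseq_nth -size_filter.
  have FU : uniq F by rewrite filter_uniq ?iota_uniq.
  have F0 : nth 0%N F 0 \in F by rewrite mem_nth // (ltn_trans _ szF).
  have F1 : nth 0%N F 1 \in F by rewrite mem_nth.
  have : nth 0%N F 0 != nth 0%N F 1 by rewrite nth_uniq // (ltn_trans _ szF).
  move: F0 F1; rewrite !mem_filter !mem_iota /= !add0n => /andP[/eqP Ei iC] /andP[/eqP Ej jC] /eqP; apply.
  have := U a (Ordinal iC) (Ordinal jC); rewrite !(tnth_nth c0) /= => /(_ Ei Ej) E.
  exact: (congr1 val E).
apply: count_mem_uniq => x; case: (boolP (x \in filter (@isE k) L)) => [xF|/count_memPn //].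
have := xF; rewrite mem_filter => /andP[xE xL].
have c1 : (count_mem x (filter (@isE k) L) <= 1)%N.
  by apply: leq_trans (cnt x xL xE); rewrite count_filter; apply: sub_count => y /= /andP[].
have c0 : (0 < count_mem x (filter (@isE k) L))%N by rewrite -has_count has_pred1.
by case: (count_mem _ _) c1 c0 => [|[|]].
Qed.

Lemma enumE_perm J : perm_eq (map (@stE k) (enum J)) (filter (@isE k) L) =
  (J == [set a | stE a \in L]).
Proof.
have U := uniq_E; apply/idP/eqP => [/perm_mem P|->].
  apply/setP => a; rewrite inE.
  have := P (stE a); rewrite mem_map ?mem_enum; last exact: stE_inj.
  move=> ->; rewrite mem_filter andb_idl // => _.
  by apply/existsP; exists a.
apply: uniq_perm => // [|x]; first by rewrite map_inj_uniq ?enum_uniq //; exact: stE_inj.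
rewrite mem_filter; apply/mapP/andP => [[a]|[/existsP[a /eqP <-] aL]].
  by rewrite mem_enum inE => aL ->; split=> //; apply/existsP; exists a.
by exists a; rewrite // mem_enum inE.
Qed.

(** [H] is the set of labels of mu_1 whose edges enter the removed floor, so its weights form eta.
    [J] is the set of indices [a] such that an edge marked by A_a enters it, so the classes [E_a]
    among the components belong to the complement of [J]. *)
Lemma second_term_zsum :
  second_term d g mu1 mu2 I = (sigma I.1)%:R^-1 *
   \sum_(J : {set 'I_k}) \sum_(H : {set T} | H \subset S1)
     (\prod_(p in H) (qint (w1 p) / (w1 p)%:R)) * zsum (V0 :\: H) (~: J) L.
Proof.
pose bad (x : X) := (dot (cls x.1) (clsL k) <= 0) && ~~ isE x.
pose eta := mu1 `\` mset_union (map (@part1 k) C).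
have -> : second_term d g mu1 mu2 I = (sigma I.1)%:R^-1 *
    (multinomial Kq (absz (dot d (clsL k) + g%:Z - 2 + (size mu2)%:Z)) (map nfree C) *
     pmultinomial Kq mu1 (map (@part1 k) C) * \prod_(x <- L) Kfac x *
     \prod_(y <- eta) (qint y / y%:R)).
  by rewrite /second_term -prod_Kfac !mulrA.
congr (_ * _).
(* A component of degree at most 0 that is not of the form [stE a]: its count vanishes on the left,
   and no connected structure has its type on the right. *)
have [/hasP[x xL /andP[x0 xE]]|/hasPn good'] := boolP (has bad L).
  have c0 : \prod_(x <- L) Kfac x = 0.
    apply/eqP; rewrite prodf_seq_eq0; apply/hasP; exists x => //=.
    by rewrite /Kfac second_term_bad ?mulr0 ?mul0r.
  rewrite c0 !(mulr0, mul0r) big1 // => J _; rewrite big1 // => H _.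
  rewrite (zsum_bad _ _ xL) ?mulr0 // => [U|a].
    by apply: wsum_deg0; rewrite dotL in x0.
  by apply: contraNneq xE => Ea; apply/existsP; exists a; rewrite Ea.
have good (x : X) : x \in L -> isE x || (0 < dot (cls x.1) (clsL k)).
  by move=> /good'; rewrite negb_and negbK ltNge orbC.
have [hatE nE] := hat_L0 good.
have Hbound c : c \in C -> dot (cls c) (clsL k) <= dot d (clsL k).
  have pos c' : c' \in C -> 0 <= dot (cls c') (clsL k).
    rewrite -L1 => /mapP[x xL ->]; case/orP: (good x xL) => [/existsP[a /eqP <-]|/ltW //].
    by rewrite /= dotL.
  move=> cC; case: admI => _ _ _ [_ _ E3 _] _.
  have : \sum_(c <- C) dot (cls c) (clsL k) = dot d (clsL k) - 2.
    rewrite (eq_bigr (fun c => (cls c).1)) => [|c' _]; last by rewrite dotL.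
    by rewrite -fst_sum E3 dotL /= -(clsE_fst k).
  rewrite (big_rem c cC) /=; set R := \sum_(_ <- _) _; suff : 0 <= R.
    move: (dot (cls c) _) (dot d _) => x y; lia.
  by rewrite /R big_seq; apply: sumr_ge0 => c' /mem_rem; apply: pos.
have zE H J : zsum (V0 :\: H) (~: J) L = (~: J == [set a | stE a \in L])%:R *
    (if wts col (V0 :\: H) == mset_union (map hat L) then
       pmultinomial Kq (wts col (V0 :\: H)) (map hat L) * \prod_(x <- L) Kfac x else 0).
  rewrite -enumE_perm; apply: (zsum_closed (V0 := V0)) => [|x xL /existsP[a /eqP <-]|x U xL nEx UV].
  - exact: subsetDl.
  - by rewrite hat_E Kfac_E.
  have [P1 P2 P3] := compC (inC xL); have := good x xL; rewrite (negbTE nEx) /= => x0.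
  have zU : z \notin U by apply/negP => /(subsetP UV); rewrite !inE eqxx.
  have [xi1 xi0] := xiL xL; rewrite label_col //.
  case: x xL nEx P1 P2 P3 x0 xi1 xi0 => c xi xL nEx P1 P2 P3 x0 xi1 xi0.
  have p20 : part2 c != mset0.
    apply: contraNneq xi0 => E; move: xi1; rewrite /= E msubset0 => /eqP ->.
    by rewrite enum_mset0.
  rewrite wsumE //; case: ifP => // lab; rewrite /Kfac NqE //; exact: Hbound (inC xL).
(* The list determines the classes [E_a] that occur, so a single [J] contributes. *)
rewrite (bigD1 (~: [set a | stE a \in L])) //= [X in _ = _ + X]big1 ?addr0; last first.
  move=> J JE; rewrite big1 // => H _; rewrite zE (_ : (~: J == _) = false) ?mul0r ?mulr0 //.
  by apply: contraNF JE => /eqP <-; rewrite setCK.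
have Ple : mset_union (map (@part1 k) C) `<=` mu1 by case: admI => _ _ _ [].
set P := mset_union (map (@part1 k) C) in Ple hatE *.
have muE : eta `+` P = mu1.
  by apply/msetP => x; rewrite !msetE2 subnK //; exact: (msubsetP Ple).
have V0S : V0 :&: S1 = S1.
  by apply/setIidPr/subsetP => p pS; rewrite !inE; apply: contraNneq zS1 => <-.
have condE H : H \subset S1 -> (wts col (V0 :\: H) == mset_union (map hat L)) = (wts w1 H == eta).
  move=> HS; have HV : H \subset V0 by apply: subset_trans HS _; rewrite -{1}V0S subsetIl.
  have wH : wts col H = wts w1 H by apply: eq_wts => p pH; rewrite /col (subsetP HS).
  have EV : wts col V0 = msetn #|V0 :\: S1| 0%N `+` (eta `+` P).
    by rewrite wts_col V0S muE mu1E.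
  have := wtsD col HV; rewrite EV wH hatE => E.
  apply/eqP/eqP => [E2|E2].
    move: E; rewrite E2 msetDCA => /(congr1 (msetB^~ (msetn #|V0 :\: S1| 0%N `+` P))).
    by rewrite !msetDKBC.
  move: E; rewrite E2 msetDCA => /(congr1 (msetB^~ eta)).
  by rewrite !msetDKB.
rewrite (eq_bigr (fun H : {set T} => if wts w1 H == eta then
    \prod_(y <- eta) (qint y / y%:R) * (pmultinomial Kq (mset_union (map hat L)) (map hat L) *
      \prod_(x <- L) Kfac x) else 0)); last first.
  move=> H HS; rewrite zE setCK eqxx mul1r -(condE H HS); case: eqP => [E|_]; last by rewrite mulr0.
  have /eqP <- : wts w1 H == eta by rewrite -(condE H HS) E eqxx.
  by rewrite big_wts E.
rewrite -big_mkcondr /= -(mul1r (\prod_(y <- eta) _)).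
under [RHS]eq_bigr do rewrite -mulrA.
rewrite -big_distrl /= card_subsets_wts; last by rewrite -mu1E -muE msubset_addr.
rewrite -mu1E hatE.
have -> : map hat L = [seq msetn x.1 0%N `+` x.2 | x <- map (fun c => (nfree c, part1 c)) C].
  by rewrite -[X in map _ (map _ X)]L1 -!map_comp.
have P0 : P 0%N = 0%N.
  by apply/eqP; rewrite -leqn0 (leq_trans (msubsetP Ple 0%N)) // mu1E -V0S wts_w1_0.
rewrite pmultinomial_hat //; first last.
- rewrite /unzip2 -map_comp; exact: msubset_refl.
- by rewrite /unzip1 -map_comp -[X in (X <= _)%N]/(sumn (map nfree C)) nE.
rewrite /unzip1 /unzip2 -!map_comp.
rewrite -[X in pmultinomial Kq P X]/(map (@part1 k) C) -[X in multinomial Kq #|_| X]/(map nfree C).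
have -> : pmultinomial Kq mu1 (map (@part1 k) C) = pmultinomial Kq mu1 [:: eta] *
    pmultinomial Kq (mu1 `\` eta) (map (@part1 k) C).
  rewrite -(pmultinomial_rest Ple) pmultinomial_cons // mset_union_cons -/P -/eta muE.
  exact: msubset_refl.
have -> : mu1 `\` eta = P by rewrite -muE msetDKB.
rewrite -cardS2 absz_nat mul1r.
set a := multinomial _ _ _; set b := pmultinomial _ _ [:: eta]; set c := pmultinomial _ _ _.
move: a b c (\prod_(y <- eta) _) (\prod_(x <- L) _) => a b c x y.
by rewrite [a * _]mulrCA -!mulrA; congr (_ * _); rewrite [RHS]mulrC !mulrA.
Qed.

End Term.
End SecondTerm.

(** * Admissible collections as configurations around the removed floor *)

Lemma sumn_wts_eq0 (T : finType) (f : T -> nat) (A : {set T}) :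
  (forall p, p \in A -> (0 < f p)%N) -> (sumn (wts f A) != 0%N) = (A != set0).
Proof.
move=> fA; rewrite sumn_wts; apply/idP/set0Pn => [|[p pA]].
  by apply: contraNP => nA; apply/eqP; apply: big1 => p pA; case: nA; exists p.
by rewrite (bigD1 p) //= addn_eq0 negb_and -lt0n fA.
Qed.

Lemma mulEi_fst (k : nat) (a : 'I_k) l : (clsEi a *+ l).1 = 0.
Proof. by elim: l => // n IH; rewrite mulrS /= IH. Qed.

Lemma mulEi_snd (k : nat) (a b : 'I_k) l : (clsEi a *+ l).2 b = ((b == a) * l)%N%:Z.
Proof.
elim: l => [|n IH]; first by rewrite muln0 /= ffunE.
by rewrite mulrS /= ffunE IH ffunE mulnS PoszD; case: (b == a).
Qed.

Section Config.
Variables (k B : nat) (T : finType) (z : T) (S1 : {set T}) (w1 rk : T -> nat).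
Local Notation X := (component k * {mset nat})%type.
Local Notation V0 := (~: [set z]).
Hypotheses (zS1 : z \notin S1) (w1pos : forall p, p \in S1 -> (0 < w1 p)%N).
Variables (d : H2 k) (g : nat) (mu1 mu2 : {mset nat}).
Hypotheses (mu1E : mu1 = wts w1 S1)
  (cardS2 : #|V0 :\: S1|%:Z = dot d (clsL k) + g%:Z - 2 + (size mu2)%:Z)
  (sumd : (sumn mu1)%:Z + (sumn mu2)%:Z = dot d (clsE k)).

Variables (H : {set T}) (J : {set 'I_k}) (Y : str k B T).
Hypotheses (HS : H \subset S1).
Local Notation V := (V0 :\: H).
Local Notation e := (Some z).
Hypothesis okY : ok e S1 w1 rk V Y.
Local Notation CC := (comps V Y).
Local Notation gc := (gcomps V Y (~: J)).
Local Notation gst := (gst e S1 w1 Y).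
Local Notation comp_of := (comp_of e S1 w1).

(** What is needed to put the floor [z] back: divergence 4 at [z], an edge from [z] into every
    component, and the prescribed d.[E_i] and mu_2. In the last condition the cut edges are leaf
    edges of the components but not of the whole diagram. *)
Definition legal : bool :=
  [&& (\sum_(p in H) w1 p + #|J| == 4 + \sum_(p in cut e V Y) lwt Y p)%N,
      [forall U in CC, cut e U Y != set0],
      [forall i, (#|[set p in V | i \in lset Y p]| + (i \in J))%:Z == dot d (clsEi i)] &
      wts (lwt Y) (edge2 e S1 V Y) == mu2 `+` wts (lwt Y) (cut e V Y)].

Let eV x : e = Some x -> x \notin V. Proof. by case=> <-; rewrite !inE eqxx andbF. Qed.

Lemma sum_gc (R : nmodType) (L : seq X) (F : X -> R) : perm_eq L (map gst gc) ->
  \sum_(x <- L) F x = \sum_(U in CC) F (st e S1 w1 U Y) + \sum_(a in ~: J) F (stE a).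
Proof. by move=> pL; rewrite (perm_big _ pL) big_map big_gcomps; congr (_ + _); apply: eq_bigl => x; rewrite andbT. Qed.

Lemma cardV (P : pred T) : (\sum_(U in CC) #|[set p in U | P p]| = #|[set p in V | P p]|)%N.
Proof.
rewrite -sum1dep_card big_mkcondr /= (big_comps _ _ okY); apply: eq_bigr => U _.
by rewrite -sum1dep_card big_mkcondr.
Qed.

Lemma wtsV (f : T -> nat) (P : pred T) x :
  (\sum_(U in CC) wts f [set p in U | P p] x = wts f [set p in V | P p] x)%N.
Proof.
transitivity #|[set p in V | P p && (f p == x)]|; last first.
  by rewrite wtsE; apply: eq_card => p; rewrite !inE andbA.
rewrite -cardV; apply: eq_bigr => U _; rewrite wtsE.
by apply: eq_card => p; rewrite !inE andbA.
Qed.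

Section Comp.
Variable U : {set T}.
Hypothesis UC : U \in CC.

Let UV : U \subset V. Proof. by move: UC; rewrite inE => /and3P[]. Qed.
Let cU : lnk_closed U Y. Proof. by move: UC; rewrite inE => /and3P[]. Qed.
Let conU : conn U (restr U Y).
Proof. by rewrite (conn_restr cU (subxx U) cU); move: UC; rewrite inE => /and3P[]. Qed.
Let okU : ok e S1 w1 rk U (restr U Y). Proof. exact: ok_restr okY eV UV cU. Qed.
Let eU x : e = Some x -> x \notin U.
Proof. by move/eV; apply: contra; apply: (subsetP UV). Qed.
Let stU : st e S1 w1 U (restr U Y) = st e S1 w1 U Y.
Proof.
apply/esym/eq_st => p pU; first by rewrite /restr glue_in.
by rewrite -(closedP cU (lnk_tgt Y p)).
Qed.

Let cdegU : cdeg U (restr U Y) = cdeg U Y.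
Proof. by have := congr1 (fun x : X => (cls x.1).1) stU; rewrite /st /comp_of /=; case. Qed.

Lemma comp_degree : (0 < cdeg U Y)%N.
Proof. by rewrite -cdegU; apply: cdeg_gt0 okU conU. Qed.

Lemma comp_gen : (gen (comp_of U Y))%:Z = #|U :\: S1|%:Z + 1 - (cdeg U Y)%:Z - #|edge2 e S1 U Y|%:Z.
Proof.
have E2 : #|edge2 e S1 U (restr U Y)| = #|edge2 e S1 U Y|.
  by have := congr1 (fun x : X => size (part2 x.1)) stU; rewrite /st /comp_of /= !size_wts.
by have := genus_ge0 okU eU conU; rewrite cdegU E2 /=; lia.
Qed.

Lemma comp_sum : (sumn (part1 (comp_of U Y)))%:Z + (sumn (part2 (comp_of U Y)))%:Z =
  dot (cls (comp_of U Y)) (clsE k).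
Proof.
have Ec : comp_of U (restr U Y) = comp_of U Y := congr1 fst stU.
rewrite -Ec.
rewrite dotE /=; have := degree_sum okU eU; rewrite (leafwE okU) nsetE.
have -> : \sum_i [ffun i : 'I_k => - #|[set p in U | i \in lset (restr U Y) p]|%:Z] i =
   - (\sum_(i < k) #|[set p in U | i \in lset (restr U Y) p]|)%N%:Z.
  rewrite (big_morph Posz PoszD (erefl _)) -sumrN; apply: eq_bigr => i _; by rewrite ffunE.
move: (sumn _) (sumn _) (cdeg _ _) (\sum_(_ < _) _)%N => a b c n; lia.
Qed.

Lemma comp_parts_pos : parts_pos (part1 (comp_of U Y)) /\ parts_pos (part2 (comp_of U Y)).
Proof.
split; apply/negP => /mem_wts[p]; rewrite !inE.
  by case/andP => _ /w1pos/[swap]->.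
case/and3P => pU _ lp; have pV := subsetP UV p pU.
by have /[swap]-> := wt_gt0 okY pV (isleaf_nfl okY eV lp).
Qed.

Lemma cut_edge2_sub : cut e U Y \subset edge2 e S1 U Y.
Proof.
apply/subsetP => p; rewrite !inE => /andP[-> /eqP E] /=; rewrite /isleaf E eqxx orbT andbT.
by apply: contraTN isT => pS; have := src_S1 okY pS; rewrite E.
Qed.

Lemma comp_cut_pos p : p \in cut e U Y -> (0 < lwt Y p)%N.
Proof.
rewrite inE => /andP[pU /eqP E]; have pV := subsetP UV p pU.
by apply: (wt_gt0 okY pV); apply: (isleaf_nfl okY eV); rewrite /isleaf E eqxx orbT.
Qed.

End Comp.

Variable L : seq X.
Hypothesis permL : perm_eq L (map gst gc).

Let Lcases x : x \in L -> (exists2 U, U \in CC & x = st e S1 w1 U Y) \/ (exists2 a, a \notin J & x = stE a).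
Proof.
rewrite (perm_mem permL) => /mapP[[U|a]]; rewrite ?mem_gcomps_l ?mem_gcomps_r => H' ->.
  by left; exists U.
by right; exists a; rewrite // inE in H' *.
Qed.

Lemma union_part1 : mset_union (map (@part1 k) (unzip1 L)) = wts w1 (S1 :\: H).
Proof.
apply/msetP => x; rewrite mset_unionE -!map_comp sumnE big_map.
rewrite (sum_gc (fun y : X => (part1 y.1 x : nat)) permL) /= [X in _ + X]big1 ?addr0; last first.
  by move=> a _; rewrite mset0E.
have -> : S1 :\: H = [set p in V | p \in S1].
  apply/setP => p; rewrite !inE; case: (boolP (p \in S1)) => pS; rewrite ?andbF // !andbT.
  by rewrite [p != z](_ : _ = true) ?andbT //; apply: contraNneq zS1 => <-.
rewrite -wtsV; apply: eq_bigr => U _; congr (wts _ _ _); by apply/setP => p; rewrite !inE.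
Qed.

Lemma union_part2 : mset_union (map (@part2 k) (unzip1 L)) =
  wts (lwt Y) (edge2 e S1 V Y) `+` msetn #|~: J| 1%N.
Proof.
apply/msetP => x; rewrite mset_unionE -!map_comp sumnE big_map msetE2.
rewrite (sum_gc (fun y : X => (part2 y.1 x : nat)) permL) /= /edge2 -wtsV; congr (_ + _)%N.
under eq_bigr do rewrite msetnE.
by rewrite msetnE; case: eqP => _; rewrite ?sum1_card ?big1.
Qed.

Lemma union_xi : mset_union (unzip2 L) = wts (lwt Y) (cut e V Y) `+` msetn #|~: J| 1%N.
Proof.
apply/msetP => x; rewrite mset_unionE -!map_comp sumnE big_map msetE2.
rewrite (sum_gc (fun y : X => (y.2 x : nat)) permL) /= /cut -wtsV; congr (_ + _)%N.
under eq_bigr do rewrite msetnE.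
by rewrite msetnE; case: eqP => _; rewrite ?sum1_card ?big1.
Qed.

Lemma sum_cls1 : \sum_(x <- L) (cls x.1).1 = (cdeg V Y)%:Z.
Proof.
rewrite (sum_gc (fun y : X => (cls y.1).1) permL) /= [X in _ + X]big1 // addr0.
rewrite -(big_morph Posz PoszD (erefl _)); congr Posz.
by rewrite /cdeg big_split /= !cardV.
Qed.

Lemma sum_cls2 i : \sum_(x <- L) (cls x.1).2 i = - #|[set p in V | i \in lset Y p]|%:Z + (i \notin J)%:Z.
Proof.
rewrite (sum_gc (fun y : X => (cls y.1).2 i) permL) /=; congr (_ + _).
  by rewrite -cardV (big_morph Posz PoszD (erefl _)) -sumrN; apply: eq_bigr => U _; rewrite ffunE.
case: (boolP (i \in J)) => iJ /=.
  by rewrite big1 // => a; rewrite inE => aJ; rewrite ffunE; case: eqP => // E; rewrite -E iJ in aJ.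
rewrite (bigD1 i) ?inE //= ffunE eqxx big1 ?addr0 // => a /andP[_ ai].
by rewrite ffunE eq_sym (negbTE ai).
Qed.

Lemma deg2V : (\sum_(p in S1 :\: H) w1 p + \sum_(p in edge2 e S1 V Y) lwt Y p +
  \sum_(i < k) #|[set p in V | i \in lset Y p]| = 2 * cdeg V Y)%N.
Proof.
have := degree_sum okY eV; rewrite (leafwE okY) nsetE !sumn_wts => <-; congr (_ + _ + _)%N.
apply: eq_bigl => p; rewrite !inE; case: (boolP (p \in S1)) => pS; rewrite ?andbF // !andbT.
by rewrite [p != z](_ : _ = true) ?andbT //; apply: contraNneq zS1 => <-.
Qed.

(** Sum of the genus relations of the components. A component of class [E_a] contributes nothing, as
    l(xi) = 1 and its genus is 0. *)
Lemma sum_gen : \sum_(x <- L) ((size x.2)%:Z + (gen x.1)%:Z) - (size L)%:Z =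
  #|cut e V Y|%:Z + #|V0 :\: S1|%:Z - (cdeg V Y)%:Z - #|edge2 e S1 V Y|%:Z.
Proof.
have -> : \sum_(x <- L) ((size x.2)%:Z + (gen x.1)%:Z) - (size L)%:Z =
          \sum_(x <- L) ((size x.2)%:Z + (gen x.1)%:Z - 1).
  by rewrite sumrB; congr (_ - _); rewrite -sum1_size (big_morph Posz PoszD (erefl _)).
rewrite (sum_gc (fun x : X => (size x.2)%:Z + (gen x.1)%:Z - 1) permL).
rewrite [X in _ + X]big1 ?addr0 => [|a _]; last by rewrite /= enum_mset1.
rewrite (eq_bigr (fun U : {set T} => #|cut e U Y|%:Z + #|U :\: S1|%:Z - (cdeg U Y)%:Z - #|edge2 e S1 U Y|%:Z)); last first.
  move=> U UC; rewrite /= size_wts; have /= -> := comp_gen UC.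
  move: #|_| #|_| (cdeg _ _) #|_| => a b c f; lia.
rewrite !big_split /= !sumrN -!(big_morph Posz PoszD (erefl _)); congr (_%:Z + _%:Z - _%:Z - _%:Z).
- exact: cardV.
- have -> : V0 :\: S1 = [set p in V | p \notin S1].
    apply/setP => p; rewrite !inE andbC; case: (boolP (p \in S1)) => pS; rewrite ?andbF // !andbT.
    by rewrite [p \notin H](_ : _ = true) //; apply: contraNN pS => /(subsetP HS).
  rewrite -cardV; apply: eq_bigr => U _; apply: eq_card => p; by rewrite !inE andbC.
- by rewrite /cdeg big_split /= !cardV.
- exact: cardV.
Qed.

(** The class equation splits into the conditions on the d.[E_i] and one equation of degrees, and
    the latter is the divergence condition at [z]. The genus equation then follows from the number
    of labels, and a nonempty xi^j means that the j-th component is joined to [z]. *)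
Lemma adm_legal (I : sum_index k) (u : seq ({set T} + 'I_k)) :
  perm_eq u gc -> L = map gst u -> enum_mset I.1 = unzip1 L -> I.2 = unzip2 L ->
  admissible d g mu1 mu2 I <-> legal.
Proof.
move=> pu Lu E1 E2.
have zipL : zip (enum_mset I.1) I.2 = L by rewrite E1 E2 zip_unzip.
have uu : uniq u by rewrite (perm_uniq pu) gcomps_uniq.
have sumcard1 : \sum_(c <- unzip1 L) cls c = d - clsE k <->
    (cdeg V Y)%:Z = d.1 - 2 /\ forall i, (#|[set p in V | i \in lset Y p]| + (i \in J))%:Z = dot d (clsEi i).
  have F i : (\sum_(c <- unzip1 L) cls c).2 i = - #|[set p in V | i \in lset Y p]|%:Z + (i \notin J)%:Z.
    by rewrite snd_sum big_map sum_cls2.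
  have F1 : (\sum_(c <- unzip1 L) cls c).1 = (cdeg V Y)%:Z by rewrite fst_sum big_map sum_cls1.
  have G1 : (d - clsE k).1 = d.1 - 2 by rewrite -(clsE_fst k).
  have G2 i : (d - clsE k).2 i = d.2 i + 1.
    by rewrite [LHS]ffunE [X in _ + X]ffunE clsE_snd opprK.
  split=> [E|[Ea Eb]].
    split; first by rewrite -F1 E G1.
    move=> i; have := F i; rewrite E G2 dotEi.
    case: (i \in J) => /=; move: (d.2 i) #|_| => x n; lia.
  rewrite [LHS]surjective_pairing [RHS]surjective_pairing F1 G1 Ea; congr pair.
  apply/ffunP => i; rewrite F G2; have := Eb i; rewrite dotEi.
  case: (i \in J) => /=; move: (d.2 i) #|_| => x n; lia.
have E4b : (mu2 `+` mset_union (unzip2 L) = mset_union (map (@part2 k) (unzip1 L))) <->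
    wts (lwt Y) (edge2 e S1 V Y) = mu2 `+` wts (lwt Y) (cut e V Y).
  rewrite union_xi union_part2 msetDA; split=> [/(congr1 (msetB^~ (msetn #|~: J| 1%N)))|-> //].
  by rewrite !msetDKBC.
have sumI : (\sum_(i < k) (i \in J) = #|J|)%N by rewrite -sum1_card [RHS]big_mkcond.
have sumw : (\sum_(p in S1) w1 p = \sum_(p in H) w1 p + \sum_(p in S1 :\: H) w1 p)%N.
  by rewrite (big_setID H) /= (setIidPr HS).
(* Subtracting the degree equation of the components from that of the whole class leaves exactly the
   weights at [z]; the 4 is twice the degree 2 of the removed floor. *)
have divE : wts (lwt Y) (edge2 e S1 V Y) = mu2 `+` wts (lwt Y) (cut e V Y) ->
  (forall i, (#|[set p in V | i \in lset Y p]| + (i \in J))%:Z = dot d (clsEi i)) ->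
  (cdeg V Y)%:Z = d.1 - 2 <-> (\sum_(p in H) w1 p + #|J| = 4 + \sum_(p in cut e V Y) lwt Y p)%N.
  move=> E4 Ea; have := deg2V; rewrite -(sumn_wts (lwt Y)) E4.
  have -> : sumn (mu2 `+` wts (lwt Y) (cut e V Y)) = (sumn mu2 + \sum_(p in cut e V Y) lwt Y p)%N.
    rewrite -sumn_wts !sumnE.
    have := big_mset_union addn [:: mu2; wts (lwt Y) (cut e V Y)] id.
    by rewrite !mset_union_cons mset_union_nil msetD0 !big_cons big_nil /= addn0.
  have := sumd; rewrite mu1E sumn_wts sumw dotE.
  have -> : \sum_i d.2 i = - (\sum_(i < k) #|[set p in V | i \in lset Y p]| + #|J|)%N%:Z.
    rewrite -sumI -big_split (big_morph Posz PoszD (erefl _)) -sumrN; apply: eq_bigr => i _.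
    by rewrite Ea dotEi opprK.
  move: (\sum_(p in H) _)%N (\sum_(p in _ :\: _) _)%N (\sum_(i < k) _)%N (\sum_(p in cut _ _ _) _)%N (cdeg _ _) #|J| (sumn mu2) d.1.
  move=> a b c f n j s x; lia.
split.
  case=> _ _ B3 [_ B4b B4c _] _; rewrite zipL E1 E2 in B3 B4b B4c.
  have {}B4b := proj1 E4b B4b; have [C1 C2] := proj1 sumcard1 B4c.
  apply/and4P; split.
  - by apply/eqP; apply: (proj1 (divE B4b C2)).
  - apply/forall_inP => U UC; rewrite -(sumn_wts_eq0 (f := lwt Y)); last exact: comp_cut_pos UC.
    have := B3 (comp_of U Y) (wts (lwt Y) (cut e U Y)); case=> //.
    rewrite (perm_mem permL); apply/mapP; exists (inl U) => //.
    by rewrite mem_gcomps_l.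
  - by apply/forallP => i; apply/eqP.
  - exact/eqP.
case/and4P => /eqP A1 /forall_inP A2 /forallP A3 /eqP A4.
have A3' i : (#|[set p in V | i \in lset Y p]| + (i \in J))%:Z = dot d (clsEi i) by apply/eqP.
have Ecd := proj2 (divE A4 A3') A1.
split; rewrite ?zipL ?E1 ?E2.
- by rewrite !size_map.
- move=> c /mapP[x xL ->]; case: (Lcases xL) => [[U UC ->]|[a _ ->]].
    by have [P1 P2] := comp_parts_pos UC; split=> //; exact: comp_sum.
  split; rewrite /= ?enum_mset0 // ?enum_mset1 // dotE /= mulr0 add0r (bigD1 a) //= ffunE eqxx big1 ?addr0 //.
  by move=> b ba; rewrite ffunE (negbTE ba).
- move=> c x xL; case: (Lcases xL) => [[U UC [-> ->]]|[a _ [-> ->]]].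
    split; first by apply: wtsS; exact: cut_edge2_sub.
    by rewrite sumn_wts_eq0; [exact: A2 | exact: comp_cut_pos UC].
  by rewrite /= enum_mset1 msubset_refl.
- split.
  + by rewrite union_part1 mu1E; apply: wtsS; exact: subsetDl.
  + exact/E4b.
  + by apply/sumcard1.
  have -> : size (unzip1 L) = size L by rewrite size_map.
  rewrite sum_gen cardS2 Ecd -(size_wts (lwt Y) (edge2 e S1 V Y)) A4.
  have -> : size (mu2 `+` wts (lwt Y) (cut e V Y)) = (size mu2 + #|cut e V Y|)%N.
    rewrite -(size_wts (lwt Y)) -!sum1_size.
    have := big_mset_union addn [:: mu2; wts (lwt Y) (cut e V Y)] (fun=> 1%N).
    by rewrite !mset_union_cons mset_union_nil msetD0 !big_cons big_nil /= addn0.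
  rewrite dotL; move: #|_| (size mu2) d.1 => a b x; lia.
- split=> [c a l /mapP[x xL ->] l2 E|a i j].
    case: (Lcases xL) E => [[U UC ->]|[b _ ->]] E.
      have := comp_degree UC; have := congr1 fst E; rewrite mulEi_fst /= => -[->].
      by rewrite ltnn.
    have := congr1 (fun y : H2 k => y.2 b) E; rewrite mulEi_snd /= ffunE eqxx.
    by case: (b == a) => /=; move: l2; clear; lia.
  have sizeC : size (unzip1 L) = size u by rewrite Lu !size_map.
  have nthC (i0 : 'I_(size (unzip1 L))) : cls (tnth (in_tuple (unzip1 L)) i0) = clsEi a ->
      nth (inr a) u i0 = inr a.
    rewrite (tnth_nth (gst (inr a)).1) /=; have := ltn_ord i0; rewrite [X in (_ < X)%N]sizeC.
    move: (nat_of_ord i0) => n nu; rewrite Lu /unzip1 -map_comp (nth_map (inr a)) //=.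
    have : nth (inr a) u n \in gc by rewrite -(perm_mem pu) mem_nth.
    case: (nth _ _ _) => [U|b]; rewrite ?mem_gcomps_l => UC /= E.
      have := comp_degree UC; have := congr1 fst E; rewrite /= => -[->].
      by rewrite ltnn.
    congr inr; apply: (@stE_inj k); rewrite /stE E //.
  move=> Hi Hj; have Ei := nthC i Hi; have Ej := nthC j Hj; apply/val_inj/eqP => /=.
  have szn (i0 : 'I_(size (unzip1 L))) : (i0 < size u)%N by rewrite -sizeC.
  by rewrite -(nth_uniq (inr a) (szn i) (szn j) uu) Ei Ej.
Qed.

End Config.

(** * Summation over all admissible indices *)

Lemma norder_neq0 (A X : eqType) (s : seq A) (f : A -> X) (L : seq X) :
  norder s f L != 0%N -> exists2 u, perm_eq u s & map f u = L.
Proof.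
rewrite /norder sum_nat_seq_neq0 => /hasP[u]; rewrite mem_permutations => us /=.
by rewrite eqb0 negbK => /eqP E; exists u.
Qed.

Lemma sum_pred1_uniq (A : eqType) (F : nmodType) (r : seq A) (P : pred A) (x : A) (c : A -> F) :
  uniq r -> x \in r -> (forall y, y \in r -> P y = (y == x)) ->
  \sum_(y <- r | P y) c y = c x.
Proof.
move=> ur xr PE; rewrite -big_filter.
rewrite (_ : [seq y <- r | P y] = [:: x]) ?big_seq1 //.
rewrite -(filter_pred1_uniq ur xr); apply: eq_in_filter => y yr; exact: PE.
Qed.

Section SumSecond.
Variables (k B : nat) (T : finType) (z : T) (S1 : {set T}) (w1 rk : T -> nat).
Local Notation X := (component k * {mset nat})%type.
Local Notation V0 := (~: [set z]).
Hypotheses (zS1 : z \notin S1) (w1pos : forall p, p \in S1 -> (0 < w1 p)%N).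
Variables (d : H2 k) (g : nat) (mu1 mu2 : {mset nat}).
Hypotheses (mu1E : mu1 = wts w1 S1)
  (cardS2 : #|V0 :\: S1|%:Z = dot d (clsL k) + g%:Z - 2 + (size mu2)%:Z)
  (sumd : (sumn mu1)%:Z + (sumn mu2)%:Z = dot d (clsE k))
  (NqE : forall (c : component k) (U : {set T}), U \subset V0 ->
     parts_pos (part1 c) -> parts_pos (part2 c) ->
     (sumn (part1 c))%:Z + (sumn (part2 c))%:Z = dot (cls c) (clsE k) ->
     0 < dot (cls c) (clsL k) -> dot (cls c) (clsL k) <= dot d (clsL k) ->
     part2 c != mset0 -> label_data S1 w1 U c ->
     nsum B S1 w1 rk U (fun i => dot (cls c) (clsEi i)) (part2 c) =
     Nq (cls c) (gen c) (part1 c) (part2 c)).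

Local Notation okH H Y := (@ok k B T (Some z) S1 w1 rk (V0 :\: H) Y).
Local Notation gc H J Y := (gcomps (V0 :\: H) Y (~: J)).
Local Notation gstz Y := (gst (Some z) S1 w1 Y).
Local Notation adm := (admissible d g mu1 mu2).
Local Notation Lof I := (zip (enum_mset I.1) I.2).

Let cand (x : {set 'I_k} * {set T} * str k B T) : seq (sum_index k) :=
  [seq (seq_mset (unzip1 (map (gstz x.2) u)), unzip2 (map (gstz x.2) u)) | u <- permutations (gc x.1.2 x.1.1 x.2)].

(** Finite list of the admissible indices that some configuration realizes. The term of any other
    admissible index vanishes, which gives both the finiteness of the support and a finite form of
    the sum. *)
Let r : seq (sum_index k) :=
  filter (fun I => `[< adm I >]) (undup (flatten [seq cand x | x <- enum predT])).

Let r_uniq : uniq r. Proof. by rewrite filter_uniq ?undup_uniq. Qed.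

Let r_adm I : I \in r -> adm I.
Proof. by rewrite mem_filter => /andP[/asboolP]. Qed.

Let ordering_in_r H J (Y : str k B T) u I : perm_eq u (gc H J Y) -> adm I ->
  map (gstz Y) u = Lof I -> I \in r.
Proof.
move=> pu aI E; rewrite mem_filter; apply/andP; split; first exact/asboolP.
have sz : size I.2 = size (enum_mset I.1) by case: aI.
rewrite mem_undup; apply/flattenP; exists (cand (J, H, Y)).
  by apply: map_f; rewrite mem_enum.
apply/mapP; exists u; first by rewrite mem_permutations.
by rewrite /= E unzip1_zip ?sz // unzip2_zip ?sz // seq_mset_id; case: I {aI E sz}.
Qed.

Let term_config I : adm I -> second_term d g mu1 mu2 I =
  \sum_(J : {set 'I_k}) \sum_(H : {set T} | H \subset S1)
     (\prod_(p in H) (qint (w1 p) / (w1 p)%:R)) *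
     \sum_(Y | okH H Y) mult S1 (V0 :\: H) Y *
        ((sigma I.1)%:R^-1 * (norder (gc H J Y) (gstz Y) (Lof I))%:R).
Proof.
move=> aI; rewrite (second_term_zsum zS1 w1pos mu1E cardS2 NqE aI).
rewrite big_distrr /=; apply: eq_bigr => J _; rewrite big_distrr /=; apply: eq_bigr => H _.
rewrite mulrCA; congr (_ * _); rewrite zsumE; last by move=> x [<-]; rewrite !inE eqxx andbF.
by rewrite big_distrr /=; apply: eq_bigr => Y _; rewrite mulrCA.
Qed.

Let term_out I : adm I -> I \notin r -> second_term d g mu1 mu2 I = 0.
Proof.
move=> aI Ir; rewrite term_config // big1 // => J _; rewrite big1 // => H _.
rewrite [X in _ * X]big1 ?mulr0 // => Y _; suff -> : norder (gc H J Y) (gstz Y) (Lof I) = 0%N by rewrite !mulr0.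
apply/eqP; apply: contraNT Ir => /norder_neq0[u pu E]; exact: ordering_in_r pu aI E.
Qed.

(** Every ordering of the components that agrees with the fixed numbering of the collection yields
    one index. There are sigma such orderings, each weighted by 1/sigma, so a legal configuration is
    counted exactly once. *)
Let sum_norder (H : {set T}) (J : {set 'I_k}) (Y : str k B T) : H \subset S1 -> okH H Y ->
  \sum_(I <- r) (sigma I.1)%:R^-1 * (norder (gc H J Y) (gstz Y) (Lof I))%:R =
  (legal z S1 w1 d mu2 H J Y)%:R :> Kq.
Proof.
move=> HS okY; have permE u : u \in permutations (gc H J Y) -> perm_eq (map (gstz Y) u) (map (gstz Y) (gc H J Y)).
  by rewrite mem_permutations => pu; apply: perm_map.
case: (boolP (legal z S1 w1 d mu2 H J Y)) => leg; last first.
  rewrite big_seq big1 // => I /r_adm aI.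
  suff -> : norder (gc H J Y) (gstz Y) (Lof I) = 0%N by rewrite mulr0.
  apply/eqP; apply: contraNT leg => /norder_neq0[u pu E].
  have sz : size I.2 = size (enum_mset I.1) by case: aI.
  apply: (proj1 (adm_legal (L := map (gstz Y) u) zS1 w1pos mu1E cardS2 sumd HS okY _ pu erefl _ _) aI).
  - exact: perm_map.
  - by rewrite E unzip1_zip ?sz.
  - by rewrite E unzip2_zip ?sz.
pose C := seq_mset (unzip1 (map (gstz Y) (gc H J Y))).
have CE u : u \in permutations (gc H J Y) -> seq_mset (unzip1 (map (gstz Y) u)) = C.
  by move=> /permE pu; apply/eq_seq_msetP; apply: perm_map.
(* The collection [C] is the same for all orderings [u], and xi is read off [u]; so [u] contributes
   to one index, provided that it lists the components in the fixed numbering of [C]. *)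
transitivity (\sum_(u <- permutations (gc H J Y)) (map (fun x => (gstz Y x).1) u == enum_mset C)%:R * (sigma C)%:R^-1 : Kq).
  rewrite (eq_bigr (fun I : sum_index k => \sum_(u <- permutations (gc H J Y))
     (if map (gstz Y) u == Lof I then (sigma I.1)%:R^-1 else 0))); last first.
    move=> I _; rewrite /norder natr_sum big_distrr /=; apply: eq_bigr => u _.
    by case: eqP; rewrite ?mulr1 ?mulr0.
  rewrite exchange_big /= big_seq [RHS]big_seq; apply: eq_bigr => u up.
  have pu : perm_eq u (gc H J Y) by rewrite -mem_permutations.
  rewrite -big_mkcond /=; case: eqP => [E|E]; last first.
    rewrite mul0r big_seq_cond big_pred0 // => I; apply/negbTE; apply/andP => -[/r_adm aI /eqP EI].
    have sz : size I.2 = size (enum_mset I.1) by case: aI.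
    case: E; rewrite -(CE u up) EI unzip1_zip ?sz // seq_mset_id.
    by rewrite -[RHS](unzip1_zip (t := I.2)) ?sz // -EI /unzip1 -map_comp.
  have E1 : unzip1 (map (gstz Y) u) = enum_mset C by rewrite -E /unzip1 -map_comp.
  pose I0 : sum_index k := (C, unzip2 (map (gstz Y) u)).
  have L0 : Lof I0 = map (gstz Y) u by rewrite /= -E1 zip_unzip.
  have a0 : adm I0.
    exact: (proj2 (adm_legal (I := I0) zS1 w1pos mu1E cardS2 sumd HS okY (perm_map _ pu) pu erefl (esym E1) erefl) leg).
  rewrite mul1r (@sum_pred1_uniq _ _ _ _ I0) //; first by apply: ordering_in_r pu a0 (esym L0).
  move=> I Ir; have aI := r_adm Ir; have sz : size I.2 = size (enum_mset I.1) by case: aI.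
  apply/eqP/eqP => [EI|->]; last by rewrite L0.
  rewrite /I0 EI unzip2_zip ?sz //; have : enum_mset I.1 = enum_mset C.
    by rewrite -E1 EI unzip1_zip ?sz.
  move/(congr1 (@seq_mset _)); rewrite !seq_mset_id => <-.
  by case: I {Ir aI sz EI}.
rewrite -big_distrl /= -natr_sum.
have -> : (\sum_(u <- permutations (gc H J Y)) (map (fun x => (gstz Y x).1) u == enum_mset C) = sigma C)%N.
  rewrite (@card_colour_permutations _ _ (fun x => (gstz Y x).1) (enum_mset C) (finsupp C)).
  - by apply: eq_bigr => c _; rewrite count_mem_mset.
  - exact: gcomps_uniq.
  - exact: fset_uniq.
  - by move=> c; rewrite msuppE.
  by rewrite perm_sym /C /unzip1 -map_comp perm_eq_seq_mset.
rewrite divff // Kq_natr_neq0 // /sigma prodn_gt0 // => c; exact: fact_gt0.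
Qed.

Lemma sum_second_term :
  finite_set (fun I => adm I /\ second_term d g mu1 mu2 I != 0) /\
  \sum_(I \in (fun I => adm I)) second_term d g mu1 mu2 I =
  \sum_(J : {set 'I_k}) \sum_(H : {set T} | H \subset S1)
     (\prod_(p in H) (qint (w1 p) / (w1 p)%:R)) *
     \sum_(Y | okH H Y && legal z S1 w1 d mu2 H J Y) mult S1 (V0 :\: H) Y.
Proof.
split.
  apply: (sub_finite_set _ (finite_seq r)) => I [aI nz] /=.
  by apply: contraT => /(term_out aI) E; rewrite E eqxx in nz.
have rS : ([set` r] `<=` (fun I => adm I))%classic by move=> I; apply: r_adm.
rewrite (fsbigE r _ r_uniq rS term_out).
rewrite big_seq_cond (eq_bigl (fun I => I \in r)) => [|I]; last first.
  by rewrite andb_idr // => /r_adm aI; apply: mem_set.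
rewrite -big_seq (eq_big_seq _ (fun I Ir => term_config (r_adm Ir))).
rewrite exchange_big /=; apply: eq_bigr => J _; rewrite exchange_big /=; apply: eq_bigr => H HS.
rewrite -big_distrr /=; congr (_ * _); rewrite exchange_big /= big_mkcondr /=; apply: eq_bigr => Y okY.
by rewrite -big_distrr /= sum_norder //; case: ifP; rewrite ?mulr1 ?mulr0.
Qed.

End SumSecond.

(** * Removing the smallest label *)

Section Removal.
Variables (k B : nat) (T : finType) (z : T) (S1 : {set T}) (w1 rk : T -> nat).
Local Notation V0 := (~: [set z]).
Local Notation str := (str k B T).
Hypotheses (zS1 : z \notin S1) (w1pos : forall p, p \in S1 -> (0 < w1 p)%N)
  (w1B : forall p, p \in S1 -> (w1 p <= B)%N)
  (rkz : forall p, p \notin S1 -> p != z -> (rk z < rk p)%N).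
Variables (d : H2 k) (mu2 : {mset nat}).

(** Puts the floor [z] back, entered by the mu_1 leaf edges with labels in [H] and by edges marked
    by the A_i for i in [J]. The use of [inord] is exact because [w1] is bounded by [B] on [S1]. *)
Definition addz (J : {set 'I_k}) (H : {set T}) (Y : str) : str :=
  [ffun p => if p == z then (Some z, z, ord0, J)
             else if p \in H then (None, z, inord (w1 p), set0) else Y p].

Section Fixed.
Variables (J : {set 'I_k}) (H : {set T}) (Y' : str).
Local Notation V := (V0 :\: H).
Local Notation Y := (addz J H Y').
Hypotheses (HS : H \subset S1) (outY : forall p, p \notin V -> Y' p = dflt k B p)
  (tgtz : forall p, p \in V -> ltgt Y' p != z).

Let zH : z \notin H. Proof. by apply: contra zS1 => /(subsetP HS). Qed.
Let zV : z \notin V. Proof. by rewrite !inE eqxx andbF. Qed.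

Lemma addz_z : Y z = (Some z, z, ord0, J). Proof. by rewrite ffunE eqxx. Qed.
Lemma addz_H p : p \in H -> Y p = (None, z, inord (w1 p), set0).
Proof. by move=> pH; rewrite ffunE pH; case: eqP => // pz; by move: zH; rewrite -pz pH. Qed.
Lemma addz_V p : p \in V -> Y p = Y' p.
Proof. by rewrite ffunE !inE => /andP[/negbTE -> /negbTE ->]. Qed.

Lemma cases p : [\/ p = z, p \in H | p \in V].
Proof.
case: (eqVneq p z) => [|pz]; first by constructor 1.
by case: (boolP (p \in H)) => pH; [constructor 2 | constructor 3; rewrite !inE pz pH].
Qed.

Lemma HnV p : p \in H -> p \notin V. Proof. by rewrite !inE => ->. Qed.
Lemma Vnz p : p \in V -> p != z. Proof. by rewrite !inE => /andP[]. Qed.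

Lemma isfl_z : isfl Y z. Proof. by rewrite /isfl /lsrc addz_z. Qed.
Lemma isfl_H p : p \in H -> isfl Y p = false. Proof. by move=> pH; rewrite /isfl /lsrc addz_H. Qed.
Lemma lwt_H p : p \in H -> lwt Y p = w1 p.
Proof. by move=> pH; rewrite /lwt addz_H //= inordK // ltnS w1B // (subsetP HS). Qed.

Lemma inw_z : inw Y z = (\sum_(p in H) w1 p)%N.
Proof.
apply: eq_big => [p|p /andP[/eqP E pz]].
  case: (cases p) => [->|pH|pV].
  - by rewrite eqxx andbF; apply/esym/negbTE.
  - by rewrite pH /ltgt addz_H // eqxx; apply: contraNneq zH => <-.
  - by rewrite (eq_ltgt (addz_V pV)) (negbTE (tgtz pV)); apply/esym/negbTE; apply: contraL pV => /HnV.
case: (cases p) => [E2|pH|pV]; first by rewrite E2 eqxx in pz.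
  exact: lwt_H.
by rewrite (eq_ltgt (addz_V pV)) in E; have := tgtz pV; rewrite E eqxx.
Qed.

Lemma outw_z : outw Y z = (\sum_(p in cut (Some z) V Y') lwt Y' p)%N.
Proof.
have P p : (lsrc Y p == Some z) && (p != z) = (p \in cut (Some z) V Y').
  rewrite inE; case: (cases p) => [->|pH|pV].
  - by rewrite eqxx andbF (negbTE zV).
  - by rewrite /lsrc addz_H //= (negbTE (HnV pH)).
  - by rewrite (eq_lsrc (addz_V pV)) pV Vnz // andbT.
apply: eq_big => // p; rewrite P inE => /andP[pV _]; exact: eq_lwt (addz_V pV).
Qed.

Lemma inw_V p : p \in V -> inw Y p = inw Y' p.
Proof.
move=> pV; have P a : (ltgt Y a == p) && (a != p) = (ltgt Y' a == p) && (a != p).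
  case: (cases a) => [->|aH|aV]; last by rewrite (eq_ltgt (addz_V aV)).
    by rewrite /ltgt addz_z (outY zV).
  by rewrite /ltgt addz_H // (outY (HnV aH)) /= andbN eq_sym (negbTE (Vnz pV)).
apply: eq_big => // a; rewrite P => /andP[/eqP ta na]; apply: eq_lwt; apply: addz_V.
by apply: contraT => aV; move: ta na; rewrite /ltgt (outY aV) /= => ->; rewrite eqxx.
Qed.

Lemma outw_V p : p \in V -> outw Y p = outw Y' p.
Proof.
move=> pV; have P a : (lsrc Y a == Some p) && (a != p) = (lsrc Y' a == Some p) && (a != p).
  case: (cases a) => [->|aH|aV]; last by rewrite (eq_lsrc (addz_V aV)).
    by rewrite /lsrc addz_z (outY zV) /= (inj_eq Some_inj) eq_sym (negbTE (Vnz pV)).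
  by rewrite /lsrc addz_H // (outY (HnV aH)).
apply: eq_big => // a; rewrite P => /andP[/eqP ta na]; apply: eq_lwt; apply: addz_V.
by apply: contraT => aV; move: ta; rewrite /lsrc (outY aV).
Qed.

Lemma okl_V p : p \in V -> okl None S1 w1 rk [set: T] Y p = okl (Some z) S1 w1 rk V Y' p.
Proof.
move=> pV; have E := addz_V pV; rewrite /okl (eq_isfl E) (eq_ltgt E) (eq_lwt E) (eq_lset E) (eq_lsrc E).
rewrite inw_V // outw_V //; case: ifP => // _; congr [&& _, _, _ & _].
  case Es : (lsrc Y' p) => [s|//] /=; case: (boolP (p \in S1)) => //= pS.
  rewrite inE; case: (cases s) => [->|sH|sV] /=.
  - by rewrite isfl_z eqxx /= rkz // Vnz.
  - rewrite isfl_H //= (negbTE (HnV sH)) /= orbF (inj_eq Some_inj).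
    by apply/esym/eqP => E2; move: zH; rewrite -E2 sH.
  - by rewrite (eq_isfl (addz_V sV)) sV (inj_eq Some_inj) (negbTE (Vnz sV)).
rewrite /=; case: ifP => // tp; rewrite inE /=; case: (cases (ltgt Y' p)) => [Ez|tH|tV].
- by have := tgtz pV; rewrite Ez eqxx.
- rewrite isfl_H // (negbTE (HnV tH)) /= {1}/ltgt addz_H //= [z == p]eq_sym (negbTE (Vnz pV)) /=.
  by rewrite andbF.
by rewrite tV (eq_isfl (addz_V tV)) (eq_ltgt (addz_V tV)).
Qed.

Lemma ok_addz : ok None S1 w1 rk [set: T] Y = ok (Some z) S1 w1 rk V Y' &&
  (\sum_(p in H) w1 p + #|J| == 4 + \sum_(p in cut (Some z) V Y') lwt Y' p)%N.
Proof.
have oklz : okl None S1 w1 rk [set: T] Y z =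
  (\sum_(p in H) w1 p + #|J| == 4 + \sum_(p in cut (Some z) V Y') lwt Y' p)%N.
  by rewrite /okl isfl_z zS1 inw_z outw_z /ltgt /lwt /lset addz_z !eqxx.
apply/forallP/andP => [okY|[/forallP okY' divz] p].
  split; last by have := okY z; rewrite inE oklz.
  apply/forallP => p; case: ifP => [pV|/negbT pV]; last by rewrite outY.
  by rewrite -okl_V //; have := okY p; rewrite inE.
rewrite inE; case: (cases p) => [->|pH|pV].
- by rewrite oklz.
- have pS := subsetP HS p pH; rewrite /okl isfl_H // lwt_H // w1pos // pS eqxx.
  rewrite /lsrc /ltgt /lset addz_H //= inE -/(isfl Y z) isfl_z eqxx.
  by case: eqP => // zp; move: zH; rewrite zp pH.
by rewrite okl_V //; have := okY' p; rewrite pV.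
Qed.

Hypothesis okY' : ok (Some z) S1 w1 rk V Y'.

Lemma lnk_V p q : p \in V -> q \in V -> lnk Y p q = lnk Y' p q.
Proof.
move=> pV qV; have Ep := addz_V pV; have Eq := addz_V qV.
by rewrite /lnk (eq_lsrc Ep) (eq_lsrc Eq) (eq_isfl Ep) (eq_isfl Eq) (eq_ltgt Ep) (eq_ltgt Eq).
Qed.

Lemma lnk_Vz p : p \in V -> lnk Y p z = (p \in cut (Some z) V Y').
Proof.
move=> pV; have Ep := addz_V pV; rewrite /lnk isfl_z (eq_lsrc Ep) (eq_ltgt Ep) (negbTE (tgtz pV)) andbT /=.
rewrite /lsrc /ltgt addz_z /= (inj_eq Some_inj) [z == p]eq_sym (negbTE (Vnz pV)) /= orbF inE.
by rewrite pV.
Qed.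

Lemma lnk_VH p q : p \in V -> q \in H -> lnk Y p q = false.
Proof.
move=> pV qH; have Ep := addz_V pV; rewrite /lnk isfl_H // andbF /= (eq_ltgt Ep).
rewrite [X in X || _](_ : _ = false); last by rewrite /lsrc addz_H.
rewrite /= [in X in _ || X]/ltgt addz_H //= [z == p]eq_sym (negbTE (Vnz pV)) orbF.
by apply/negbTE; apply: contraTneq (tgt_in okY' pV) => ->; apply: HnV.
Qed.

(** A component can be left only through an edge coming from [z], so the whole is connected exactly
    when every component has such an edge. The labels in [H] are linked to [z] directly. *)
Lemma conn_addz : conn [set: T] Y = [forall U in comps V Y', cut (Some z) U Y' != set0].
Proof.
apply/idP/forall_inP => [/andP[_ /forall_inP conY] U UC|H'].
  have := UC; rewrite inE => /and3P[UV cU /andP[/set0Pn[p pU] _]].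
  apply/negP => /eqP cut0.
  have /forall_inP/(_ z (in_setT _)) := conY p (in_setT _).
  suff : forall a b, a \in U -> lnk Y a b -> b \in U.
    move=> cl /(connect_closed_sub (A := mem U) cl pU) /(subsetP UV); by rewrite (negbTE zV).
  move=> a b aU ab; have aV := subsetP UV a aU; case: (cases b) => [Eb|bH|bV].
  - move: ab; rewrite Eb lnk_Vz // inE aV /= => ac.
    suff : a \in cut (Some z) U Y' by rewrite cut0 inE.
    by rewrite inE aU ac.
  - by rewrite lnk_VH in ab.
  by rewrite lnk_V // in ab; rewrite -(closedP cU ab).
have toz p : connect (lnk Y) p z.
  case: (cases p) => [->|pH|pV]; first exact: connect0.
    have tp : ltgt Y p = z by rewrite /ltgt addz_H.
    by apply: connect1; rewrite /lnk tp eqxx !orbT.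
  have UC := cc_comps okY' pV; have /set0Pn[r] := H' _ UC.
  rewrite inE => /andP[]; rewrite inE => /andP[rV pr] rz.
  apply: (connect_trans (y := r)).
    apply: (connect_in (A := mem V)) pr => //= a b aV ab.
    have bV := ok_lnk okY' aV ab; by split=> //; rewrite lnk_V.
  by apply: connect1; rewrite lnk_Vz // inE rV.
apply/andP; split; first by apply/set0Pn; exists z; rewrite inE.
apply/forall_inP => p _; apply/forall_inP => q _; apply: connect_trans (toz p) _.
by rewrite connect_lnkC.
Qed.

Lemma lset_addz i : (#|[set p in [set: T] | i \in lset Y p]| =
  #|[set p in V | i \in lset Y' p]| + (i \in J))%N.
Proof.
rewrite (cardsD1 z) inE in_setT /= {1}/lset addz_z addnC; congr addn.
apply: eq_card => p; rewrite !inE; case: (cases p) => [->|pH|pV].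
- by rewrite eqxx andbF.
- have E : lset Y p = set0 by rewrite /lset addz_H.
  by rewrite E in_set0 ?andbF pH /=.
have Ep := addz_V pV; move: pV; rewrite !inE => /andP[-> ->] /=.
by rewrite (eq_lset Ep).
Qed.

Lemma edge2_addz : edge2 None S1 [set: T] Y = edge2 (Some z) S1 V Y' :\: cut (Some z) V Y'.
Proof.
apply/setP => p; case: (cases p) => [->|pH|pV].
- have sz : lsrc Y z = Some z by rewrite /lsrc addz_z.
  by rewrite in_setD [z \in edge2 (Some z) _ _ _]inE (negbTE zV) andbF inE /isleaf sz /= !andbF.
- by rewrite in_setD [p \in edge2 (Some z) _ _ _]inE (negbTE (HnV pH)) andbF inE (subsetP HS p pH) andbF.
rewrite in_setD !inE; have := pV; rewrite !inE => -> /=.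
rewrite /isleaf (eq_lsrc (addz_V pV)) orbb; case: (lsrc Y' p) => [s|] /=; rewrite ?andbF //.
by case: eqP => //=; rewrite !andbF.
Qed.

Lemma wts_addz : (wts (lwt Y) (edge2 None S1 [set: T] Y) == mu2) =
  (wts (lwt Y') (edge2 (Some z) S1 V Y') == mu2 `+` wts (lwt Y') (cut (Some z) V Y')).
Proof.
have sub : cut (Some z) V Y' \subset edge2 (Some z) S1 V Y'.
  apply/subsetP => p; rewrite inE => /andP[pV /eqP E]; rewrite inE pV /isleaf E eqxx orbT andbT /=.
  by apply: contraTN isT => pS; have := src_S1 okY' pS; rewrite E.
rewrite (wtsD _ sub) edge2_addz msetDC (eq_wts (g := lwt Y')); last first.
  by move=> p /setDP[]; rewrite inE => /andP[pV _] _; apply: eq_lwt; apply: addz_V.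
by apply/eqP/eqP => [->//|/(congr1 (msetB^~ (wts (lwt Y') (cut (Some z) V Y'))))]; rewrite !msetDKBC.
Qed.

Lemma mult_addz : mult S1 [set: T] Y = (\prod_(p in H) (qint (w1 p) / (w1 p)%:R)) * mult S1 V Y'.
Proof.
rewrite /mult (bigID (mem V)) /= mulrC; congr (_ * _); last first.
  apply: eq_big => [p|p pV]; first by rewrite inE.
  have Ep := addz_V (andP pV).2; by rewrite /fac (eq_isfl Ep) (eq_lwt Ep) (eq_lsrc Ep).
rewrite (bigD1 z) ?in_setT ?zV //= {1}/fac (negbTE zS1) isfl_z mul1r.
apply: eq_big => [p|p].
  rewrite in_setT /=; case: (cases p) => [->|pH|pV].
  - by rewrite eqxx andbF (negbTE zH).
  - by rewrite HnV // pH; apply: contraNneq zH => <-.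
  - by rewrite pV /=; apply/esym/negbTE; apply: contraL pV => /HnV.
rewrite in_setT /= => /andP[pV pz]; case: (cases p) => [E|pH|pV']; first by rewrite E eqxx in pz.
  by rewrite /fac (subsetP HS) // lwt_H.
by rewrite pV' in pV.
Qed.

End Fixed.

Definition hset (Y : str) : {set T} := [set p | (ltgt Y p == z) && (p != z)].

(** An edge with a free label precedes the floor that it enters, and no free label precedes [z]. *)
Lemma hset_S1 Y : ok None S1 w1 rk [set: T] Y -> isfl Y z -> hset Y \subset S1.
Proof.
move=> okY fz; apply/subsetP => p; rewrite inE => /andP[/eqP tp pz].
have fp : ~~ isfl Y p by apply: contraNN pz => fp; rewrite -tp (isfl_tgt okY).
case: (tgt_cases okY (in_setT p) fp) => [[E _]|[_ _ _]|[]].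
- by rewrite -tp E eqxx in pz.
- by rewrite tp; case: (boolP (p \in S1)) => //= pS; have := rkz pS pz; lia.
by rewrite tp fz.
Qed.

Lemma addz_restr Y : ok None S1 w1 rk [set: T] Y -> isfl Y z ->
  addz (lset Y z) (hset Y) (restr (V0 :\: hset Y) Y) = Y.
Proof.
move=> okY fz; apply/ffunP => p; rewrite ffunE.
have tup (x : ldata k B T) : x = (x.1.1.1, x.1.1.2, x.1.2, x.2) by case: x => [[[]]].
case: eqP => [->|/eqP pz].
  rewrite [RHS]tup -/(lsrc Y z) -/(ltgt Y z) -/(lset Y z) (eqP fz) (isfl_tgt okY fz).
  by congr (_, _, _, _); apply: val_inj; rewrite /= -[RHS]/(lwt Y z) (isfl_wt okY fz).
case: ifP => [pH|/negbT pH]; last by rewrite /restr glue_in // in_setD pH !inE pz.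
have pS := subsetP (hset_S1 okY fz) p pH; move: pH; rewrite inE => /andP[/eqP tp _].
have fp : ~~ isfl Y p by apply: contraNN pz => fp; rewrite -tp (isfl_tgt okY).
rewrite [RHS]tup -/(lsrc Y p) -/(ltgt Y p) -/(lset Y p) (src_S1 okY pS) tp.
congr (_, _, _, _); first by apply: val_inj; rewrite /= inordK ?ltnS ?w1B // -[RHS]/(lwt Y p) (wt_S1 okY) ?in_setT.
case: (tgt_cases okY (in_setT p) fp) => [[E _]|[_ _ -> _]|[_ _ _ ->]] //.
by rewrite -tp E eqxx in pz.
Qed.

Lemma sum_removal :
  \sum_(Y : str | [&& ok None S1 w1 rk [set: T] Y, conn [set: T] Y,
      [forall i, #|[set p in [set: T] | i \in lset Y p]|%:Z == dot d (clsEi i)],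
      wts (lwt Y) (edge2 None S1 [set: T] Y) == mu2 & isfl Y z]) mult S1 [set: T] Y =
  \sum_(J : {set 'I_k}) \sum_(H : {set T} | H \subset S1)
     (\prod_(p in H) (qint (w1 p) / (w1 p)%:R)) *
     \sum_(Y : str | ok (Some z) S1 w1 rk (V0 :\: H) Y && legal z S1 w1 d mu2 H J Y) mult S1 (V0 :\: H) Y.
Proof.
under [RHS]eq_bigr do under eq_bigr do rewrite big_distrr /=.
under [RHS]eq_bigr do rewrite pair_big_dep /=.
rewrite pair_big_dep /=.
rewrite (reindex_onto (fun x : {set 'I_k} * ({set T} * str) => addz x.1 x.2.1 x.2.2)
  (fun Y => (lset Y z, (hset Y, restr (V0 :\: hset Y) Y)))) /=; last first.
  by move=> Y /and5P[okY _ _ _ fz]; apply: addz_restr.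
have key J H (Y' : str) : [&& ok None S1 w1 rk [set: T] (addz J H Y'), conn [set: T] (addz J H Y'),
      [forall i, #|[set p in [set: T] | i \in lset (addz J H Y') p]|%:Z == dot d (clsEi i)],
      wts (lwt (addz J H Y')) (edge2 None S1 [set: T] (addz J H Y')) == mu2 & isfl (addz J H Y') z] &&
    ((lset (addz J H Y') z, (hset (addz J H Y'), restr (V0 :\: hset (addz J H Y')) (addz J H Y'))) == (J, (H, Y'))) =
    (H \subset S1) && (ok (Some z) S1 w1 rk (V0 :\: H) Y' && legal z S1 w1 d mu2 H J Y').
  have aE i (HS : H \subset S1) := lset_addz J Y' HS i.
  apply/idP/idP.
    case/andP => /and5P[okY conY aY mY fz] /eqP[EJ EH EY].
    have HS : H \subset S1 by rewrite -EH; apply: hset_S1.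
    have outY p : p \notin V0 :\: H -> Y' p = dflt k B p.
      by move=> pV; rewrite -EY EH restr_out.
    have tgtz p : p \in V0 :\: H -> ltgt Y' p != z.
      move=> pV; rewrite -(eq_ltgt (addz_V J Y' pV)); move: pV; rewrite -[in X in X -> _]EH !inE.
      by case/andP => + pz; rewrite pz andbT.
    have := okY; rewrite (ok_addz _ HS outY tgtz) => /andP[okY' divz].
    rewrite HS okY' /legal divz -(conn_addz J HS tgtz okY') conY -(wts_addz J HS okY') mY andbT /=.
    by apply/forallP => i; rewrite -aE //; apply: (forallP aY).
  case/and3P => HS okY' /and4P[divz cE aY mY].
  have zV : z \notin V0 :\: H by rewrite !inE eqxx andbF.
  have tgtz p : p \in V0 :\: H -> ltgt Y' p != z.
    by move=> pV; apply: contraTneq (tgt_in okY' pV) => ->.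
  have outY := ok_out okY'.
  rewrite (ok_addz _ HS outY tgtz) okY' divz (conn_addz _ HS tgtz okY') cE (wts_addz J HS okY') mY isfl_z andbT /=.
  have -> /= : [forall i, #|[set p in [set: T] | i \in lset (addz J H Y') p]|%:Z == dot d (clsEi i)].
    by apply/forallP => i; rewrite aE //; apply: (forallP aY).
  have EH : hset (addz J H Y') = H.
    apply/setP => p; rewrite inE; case: (cases H p) => [->|pH|pV].
    - by rewrite eqxx andbF; apply/esym/negbTE; apply: contra zS1 => /(subsetP HS).
    - rewrite /ltgt addz_H // pH eqxx; apply: contraNneq zS1 => <-; exact: (subsetP HS).
    - rewrite (eq_ltgt (addz_V J Y' pV)) (negbTE (tgtz p pV)); apply/esym/negbTE.
      by move: pV; rewrite !inE => /andP[].
  rewrite EH !xpair_eqE eqxx /lset addz_z eqxx /=; apply/eqP/ffunP => p.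
  case: (boolP (p \in V0 :\: H)) => pV; last by rewrite restr_out // outY.
  by rewrite /restr glue_in // addz_V.
apply: eq_big => [[J [H Y']]|[J [H Y']]] /=; first by rewrite key.
by rewrite key => /and3P[HS okY' _]; rewrite mult_addz.
Qed.

End Removal.

(** * The recursion for label structures *)

Lemma perm_map_lift (A X : eqType) (f : A -> X) (s : seq A) (t : seq X) :
  perm_eq (map f s) t -> exists2 s', perm_eq s' s & map f s' = t.
Proof.
case: s => [|x0 s] pst.
  by exists [::] => //; apply/esym; apply: perm_nilP; rewrite perm_sym.
rewrite perm_sym in pst.
have [Is pI tE] := perm_iotaP (f x0) pst.
exists (map (nth x0 (x0 :: s)) Is).
  rewrite -[X in perm_eq _ X](mkseq_nth x0); apply: perm_map.
  by rewrite (perm_trans pI) // size_map.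
rewrite tE -map_comp; apply/eq_in_map => i; rewrite (perm_mem pI) mem_iota size_map => /andP[_ iS].
by rewrite (nth_map x0).
Qed.

Definition std1 (a0 l1 : nat) : {set 'I_a0} := [set p : 'I_a0 | (p < l1)%N].

Section Recursion.
Variables (k B : nat).
(** The passage from marked diagrams to label structures enters the recursion only through this
    statement, which [Nord_encode] supplies after both directions have been constructed. *)
Hypothesis encode : forall (d : H2 k) g (vmu1 vmu2 : seq nat) a0,
  parts_pos vmu1 -> parts_pos vmu2 ->
  (sumn vmu1)%:Z + (sumn vmu2)%:Z = dot d (clsE k) ->
  0 < dot d (clsL k) -> 2 * dot d (clsL k) <= B%:Z ->
  a0%:Z = dot d (clsL k) - 1 + g%:Z + (size vmu1)%:Z + (size vmu2)%:Z -> (0 < a0)%N ->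
  Nord d g vmu1 vmu2 =
  nsum B (std1 a0 (size vmu1)) (fun p => nth 0%N vmu1 p) (fun p => p) [set: 'I_a0]
    (fun i => dot d (clsEi i)) (seq_mset vmu2).

(** The labels of [U] are listed with those in [S1] first, in the order of the parts of mu_1, and
    then the free ones by increasing rank. This listing is the relabelling that carries the standard
    structures to the structures on [U]. *)
Lemma NqE (T : finType) (S1 : {set T}) (w1 rk : T -> nat) (c : component k) (U : {set T}) :
  {in U :\: S1 &, injective rk} ->
  parts_pos (part1 c) -> parts_pos (part2 c) ->
  (sumn (part1 c))%:Z + (sumn (part2 c))%:Z = dot (cls c) (clsE k) ->
  0 < dot (cls c) (clsL k) -> 2 * dot (cls c) (clsL k) <= B%:Z ->
  (part1 c != mset0) || (part2 c != mset0) -> label_data S1 w1 U c ->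
  nsum B S1 w1 rk U (fun i => dot (cls c) (clsEi i)) (part2 c) =
  Nq (cls c) (gen c) (part1 c) (part2 c).
Proof.
move=> rkI P1 P2 sumc c0 cB ne /andP[/eqP wE /eqP nE].
have [s1 ps1 ms1] : exists2 s1, perm_eq s1 (enum (U :&: S1)) & map w1 s1 = enum_mset (part1 c).
  by apply: perm_map_lift; rewrite -wE perm_sym perm_eq_seq_mset.
pose s2 := sort (fun p q => (rk p <= rk q)%N) (enum (U :\: S1)).
have ps2 : perm_eq s2 (enum (U :\: S1)) by rewrite perm_sort.
have m1 p : (p \in s1) = (p \in U) && (p \in S1) by rewrite (perm_mem ps1) mem_enum inE.
have m2 p : (p \in s2) = (p \in U) && (p \notin S1) by rewrite (perm_mem ps2) mem_enum inE andbC.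
pose s := s1 ++ s2.
have us : uniq s.
  rewrite cat_uniq (perm_uniq ps1) (perm_uniq ps2) !enum_uniq andbT /=.
  by apply/hasPn => p; rewrite m2 m1 => /andP[_ /negbTE ->]; rewrite andbF.
have z1 : size s1 = size (part1 c) by rewrite -ms1 size_map.
have z2 : size s2 = #|U :\: S1| by rewrite (perm_size ps2) cardE.
have a0E : (size s)%:Z = dot (cls c) (clsL k) - 1 + (gen c)%:Z + (size (part1 c))%:Z + (size (part2 c))%:Z.
  rewrite size_cat PoszD z1 z2 nE; ring.
have a0pos : (0 < size s)%N.
  have sz0 (m : {mset nat}) : m != mset0 -> (0 < size m)%N.
    by rewrite lt0n; apply: contra_neq => /size0nil; exact: enum_mset_nil.
  rewrite -ltz_nat a0E; case/orP: ne => /sz0; move: (size _) (size _) (gen c) (dot _ _) c0 => a b e x; lia.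
rewrite /Nq (encode P1 P2 sumc c0 cB a0E a0pos) seq_mset_id.
pose h (p : 'I_(size s)) : T := tnth (in_tuple s) p.
have hE x0 p : h p = nth x0 s p by rewrite /h (tnth_nth x0).
have hI : injective h.
  move=> p q; rewrite (hE (h p) p) (hE (h p) q) => /eqP.
  by rewrite nth_uniq // => /eqP/val_inj.
have hS p : (h p \in S1) = (p \in std1 (size s) (size (part1 c))).
  rewrite inE -z1 (hE (h p)) nth_cat; case: ltnP => pl.
    by have := mem_nth (h p) pl; rewrite m1 => /andP[_ ->].
  have pl2 : (p - size s1 < size s2)%N by rewrite ltn_subLR // -size_cat.
  by have := mem_nth (h p) pl2; rewrite m2 => /andP[_ /negbTE ->].
have s2s : sorted (fun p q => (rk p < rk q)%N) s2.
  have : sorted (fun p q => (rk p <= rk q)%N) s2 by apply: sort_sorted => p q; exact: leq_total.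
  have us2 : uniq s2 by rewrite (perm_uniq ps2) enum_uniq.
  have rs2 : uniq (map rk s2).
    rewrite map_inj_in_uniq // => p q; rewrite !m2 => /andP[pU pS] /andP[qU qS]; apply: rkI; rewrite !inE ?pU ?qU ?pS ?qS //.
  have E1 : sorted (fun p q => (rk p <= rk q)%N) s2 = sorted leq (map rk s2) by rewrite sorted_map.
  have E2 : sorted (fun p q => (rk p < rk q)%N) s2 = sorted ltn (map rk s2) by rewrite sorted_map.
  by rewrite E1 E2 ltn_sorted_uniq_leq rs2.
have nth2 x0 p : p \notin std1 (size s) (size (part1 c)) ->
   (p - size s1 < size s2)%N /\ h p = nth x0 s2 (p - size s1).
  rewrite inE -leqNgt -z1 => pl; split; first by rewrite ltn_subLR // -size_cat.
  by rewrite (hE x0) nth_cat ltnNge pl.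
have rkm p q : p \notin std1 (size s) (size (part1 c)) -> q \notin std1 (size s) (size (part1 c)) ->
   (p < q)%N -> (rk (h p) < rk (h q))%N.
  move=> pS qS pq; have [pl ->] := nth2 (h p) p pS; have [ql ->] := nth2 (h p) q qS.
  apply: (sorted_ltn_nth (leT := fun p q => (rk p < rk q)%N)) => //; first by move=> a b c'; apply: ltn_trans.
  by move: pS pq; rewrite inE -leqNgt -z1; lia.
rewrite -[U in LHS](_ : [set h p | p : 'I_(size s)] = U); last first.
  apply/setP => x; apply/imsetP/idP => [[p _ ->]|xU].
    have : h p \in s by rewrite (hE (h p)) mem_nth.
    by rewrite mem_cat m1 m2 -andb_orr orbN andbT.
  have xs : x \in s by rewrite mem_cat m1 m2 xU orbN.
  have xi : (index x s < size s)%N by rewrite index_mem.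
  by exists (Ordinal xi); rewrite // (hE x) /= nth_index.
symmetry; apply: nsum_push => // [p pS|p q pS qS].
  rewrite -ms1; move: pS; rewrite inE -z1 => pl.
  by rewrite (nth_map (h p)) //; congr w1; rewrite {1}(hE (h p)) nth_cat pl.
case: (ltngtP p q) => pq; first exact: rkm.
  by apply/negbTE; rewrite -leqNgt ltnW // rkm.
by rewrite (val_inj pq) ltnn.
Qed.

(** * The smallest free label as a leaf edge *)

Section FirstSum.
Variables (T : finType) (z : T) (S1 : {set T}) (w1 rk : T -> nat).
Hypotheses (zS1 : z \notin S1) (rkz : forall p, p \notin S1 -> p != z -> (rk z < rk p)%N).
Variables (a : 'I_k -> int) (mu2 : {mset nat}).
Implicit Types (Y : str k B T).

Definition upd (w : nat) (p : T) : nat := if p == z then w else w1 p.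

(** Marking the leaf instead of its edge moves [z] into [S1]. This drops the order condition on [z],
    which is automatic because [z] has the smallest rank among the free labels. *)
Lemma ok_upd w Y : ok None (z |: S1) (upd w) rk [set: T] Y =
  [&& ok None S1 w1 rk [set: T] Y, lsrc Y z == None & lwt Y z == w].
Proof.
have oklE p : p != z -> okl None (z |: S1) (upd w) rk [set: T] Y p = okl None S1 w1 rk [set: T] Y p.
  by move=> pz; rewrite /okl !inE (negbTE pz) /upd (negbTE pz).
apply/idP/and3P => [okY|[okY /eqP sz /eqP wz]].
  have zS : z \in z |: S1 by rewrite !inE eqxx.
  have sz := src_S1 okY zS; have wz := wt_S1 okY (in_setT _) zS.
  rewrite sz wz /upd eqxx; split=> //; apply/forallP => p; rewrite inE.
  case: (eqVneq p z) => [->|pz]; last by rewrite -oklE //; have := forallP okY p; rewrite inE.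
  have fz : isfl Y z = false by rewrite /isfl sz.
  have := ok_in okY (in_setT z); rewrite /okl fz zS sz (negbTE zS1) /= => /and3P[-> _].
  case: ifP => // tz; rewrite !inE /= => /andP[-> ]; case: ifP => // ft _.
  apply: rkz; last by rewrite tz.
  by have := isfl_S1 okY ft; rewrite !inE negb_or => /andP[].
apply/forallP => p; rewrite inE; case: (eqVneq p z) => [->|pz]; last first.
  by rewrite oklE //; have := forallP okY p; rewrite inE.
have fz : isfl Y z = false by rewrite /isfl sz.
have := ok_in okY (in_setT z); rewrite /okl fz sz (negbTE zS1) !inE eqxx /upd eqxx wz eqxx /=.
by case/andP => -> /=; case: ifP => // tz /andP[->]; case: ifP.
Qed.

(** When [z] joins [S1] its factor changes from [w] to [w]/w; the coefficient w compensates. *)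
Lemma sum_leaf_first :
  \sum_(Y : str k B T | [&& ok None S1 w1 rk [set: T] Y, conn [set: T] Y,
      [forall i, #|[set p in [set: T] | i \in lset Y p]|%:Z == a i],
      wts (lwt Y) (edge2 None S1 [set: T] Y) == mu2 & lsrc Y z == None]) mult S1 [set: T] Y =
  \sum_(w <- finsupp mu2) w%:R * nsum B (z |: S1) (upd w) rk [set: T] a (mu2 `\ w).
Proof.
have e2z Y : lsrc Y z = None -> edge2 None S1 [set: T] Y = z |: edge2 None (z |: S1) [set: T] Y.
  move=> sz; apply/setP => p; rewrite !inE; case: eqP => [->|_] //=.
  by rewrite zS1 /isleaf sz.
have ze Y : z \notin edge2 None (z |: S1) [set: T] Y by rewrite !inE eqxx.
have memw Y : lsrc Y z = None -> wts (lwt Y) (edge2 None S1 [set: T] Y) = mu2 -> lwt Y z \in mu2.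
  by move=> sz <-; rewrite e2z // wtsU1 // in_msetD in_mset1 eqxx.
have Emu Y : lsrc Y z = None -> lwt Y z \in mu2 ->
   (wts (lwt Y) (edge2 None S1 [set: T] Y) == mu2) =
   (wts (lwt Y) (edge2 None (z |: S1) [set: T] Y) == mu2 `\ (lwt Y z)).
  move=> sz wz; rewrite e2z // wtsU1 //; apply/eqP/eqP => [<-|->]; first by rewrite msetDKB.
  exact: msetB1K.
rewrite (eq_bigr (fun Y => \sum_(w <- finsupp mu2 | lwt Y z == w) mult S1 [set: T] Y)); last first.
  move=> Y /and5P[okY _ _ /eqP m2 /eqP sz].
  rewrite (@sum_pred1_uniq _ _ _ _ (lwt Y z)) ?fset_uniq // ?msuppE ?memw //.
rewrite (exchange_big_dep xpredT) //= big_seq [RHS]big_seq; apply: eq_bigr => w; rewrite msuppE => wm.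
rewrite /nsum big_distrr /=; apply: eq_big => [Y|Y].
  rewrite ok_upd; case: (boolP (ok None S1 w1 rk [set: T] Y)) => //= okY.
  case: (eqVneq (lsrc Y z) None) => [sz|_]; last by rewrite !andbF.
  case: (eqVneq (lwt Y z) w) => [wz|_]; last by rewrite !andbF.
  have wzm : lwt Y z \in mu2 by rewrite wz.
  rewrite (Emu Y sz wzm) wz.
  by case: (conn _ Y); case: [forall i, _]; case: (_ == mu2 `\ w).
case/andP => /and5P[okY _ _ _ /eqP sz] /eqP wz.
have fz : isfl Y z = false by rewrite /isfl sz.
have w0 : w%:R != 0 :> Kq.
  by rewrite Kq_natr_neq0 // -wz; apply: (wt_gt0 okY); rewrite ?in_setT // fz.
rewrite /mult (bigD1 z) //= [in RHS](bigD1 z) //= mulrA; congr (_ * _).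
  by rewrite /fac (negbTE zS1) fz sz !inE eqxx wz /= mulrCA divff // mulr1.
by apply: eq_bigr => p /andP[_ pz]; rewrite /fac !inE (negbTE pz).
Qed.

End FirstSum.

Lemma wts_std1 (s : seq nat) a0 : (size s <= a0)%N ->
  wts (fun p : 'I_a0 => nth 0%N s p) (std1 a0 (size s)) = seq_mset s.
Proof.
move=> le; apply/eq_seq_msetP.
have -> : [seq nth 0%N s (nat_of_ord p) | p <- enum (std1 a0 (size s))] =
          map (nth 0%N s) (map (@nat_of_ord a0) (enum (std1 a0 (size s)))) by rewrite -map_comp.
rewrite (_ : map (@nat_of_ord a0) (enum (std1 a0 (size s))) = iota 0 (size s)).
  by rewrite -/(mkseq _ _) mkseq_nth.
rewrite -(filter_iota_ltn 0 le) -val_enum_ord filter_map.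
congr map; rewrite enumT /enum_mem; apply: eq_filter => p.
by rewrite /= inE.
Qed.

Lemma sumn_mset (s : seq nat) : sumn (seq_mset s) = sumn s.
Proof. by rewrite !sumnE (perm_big _ (perm_eq_seq_mset s)). Qed.

Lemma size_of_seq_mset (s : seq nat) : size (seq_mset s) = size s.
Proof. exact: perm_size (perm_eq_seq_mset s). Qed.

Lemma mset_split (m : {mset nat}) w : w \in m -> perm_eq m (w :: (m `\ w)).
Proof.
move=> wm; apply/allP => x _ /=; rewrite !count_mem_mset msetB1E [w == x]eq_sym; apply/eqP.
by rewrite -mset_gt0 in wm; case: (eqVneq x w) => [->|_] /=; rewrite ?subn0 // subnKC.
Qed.

Lemma recursion (d : H2 k) g (vmu1 vmu2 : seq nat) :
  parts_pos vmu1 -> parts_pos vmu2 ->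
  (sumn vmu1)%:Z + (sumn vmu2)%:Z = dot d (clsE k) ->
  0 < dot d (clsL k) -> 2 * dot d (clsL k) <= B%:Z -> (sumn vmu1 <= B)%N ->
  0 < dot d (clsL k) - 1 + g%:Z + (size vmu2)%:Z ->
  finite_set (fun I => admissible d g (seq_mset vmu1) (seq_mset vmu2) I /\
     second_term d g (seq_mset vmu1) (seq_mset vmu2) I != 0) /\
  Nord d g vmu1 vmu2 =
   \sum_(w <- finsupp (seq_mset vmu2)) w%:R * Nq d g (seq_mset vmu1 `+` [mset w]) (seq_mset vmu2 `\ w) +
   \sum_(I \in (fun I => admissible d g (seq_mset vmu1) (seq_mset vmu2) I))
      second_term d g (seq_mset vmu1) (seq_mset vmu2) I.
Proof.
move=> P1 P2 sumd d0 dB sB n0.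
pose a0 := absz (dot d (clsL k) - 1 + g%:Z + (size vmu1)%:Z + (size vmu2)%:Z).
have a0E : a0%:Z = dot d (clsL k) - 1 + g%:Z + (size vmu1)%:Z + (size vmu2)%:Z.
  by rewrite /a0 gez0_abs //; move: d0; lia.
have l1 : (size vmu1 < a0)%N by rewrite -ltz_nat a0E; move: n0; lia.
rewrite (encode P1 P2 sumd d0 dB a0E (leq_ltn_trans (leq0n _) l1)).
set S1 := std1 a0 (size vmu1); set w1 := (fun p : 'I_a0 => nth 0%N vmu1 p).
(* [z] is the first label after those of mu_1; it exists because the number of free labels is
   positive. *)
pose rk (p : 'I_a0) : nat := p; pose z : 'I_a0 := Ordinal l1.
set mu1 := seq_mset vmu1; set mu2 := seq_mset vmu2.
have mu1E : mu1 = wts w1 S1 by rewrite wts_std1 // ltnW.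
have zS1 : z \notin S1 by rewrite inE ltnn.
have w1pos p : p \in S1 -> (0 < w1 p)%N.
  by rewrite inE => pl; rewrite lt0n; apply: contraNneq P1 => <-; apply: mem_nth.
have w1B p : p \in S1 -> (w1 p <= B)%N.
  rewrite inE => pl; apply: leq_trans sB; rewrite sumnE (big_nth 0%N) big_mkord.
  by rewrite (bigD1 (Ordinal pl)) //= leq_addr.
have rkz p : p \notin S1 -> p != z -> (rk z < rk p)%N.
  rewrite inE -leqNgt /rk => pl pz; rewrite ltn_neqAle pl andbT.
  by apply: contraNneq pz => E; apply/eqP/val_inj.
have cS1 : #|S1| = size vmu1 by rewrite -(size_wts w1) -mu1E size_of_seq_mset.
have cardC : #|~: (z |: S1)|%:Z = dot d (clsL k) + g%:Z - 2 + (size mu2)%:Z.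
  have := cardsC (z |: S1); rewrite cardsU1 zS1 cS1 card_ord size_of_seq_mset => E.
  have E1 : a0%:Z = (true + size vmu1)%N%:Z + #|~: (z |: S1)|%:Z by rewrite -PoszD E.
  rewrite a0E in E1.
  by move: E1; move: (dot _ _) (size vmu1) (size vmu2) #|_| => x a b c /=; lia.
have cardS2 : #|~: [set z] :\: S1|%:Z = dot d (clsL k) + g%:Z - 2 + (size mu2)%:Z.
  by rewrite setDE -setCU.
have sumd' : (sumn mu1)%:Z + (sumn mu2)%:Z = dot d (clsE k) by rewrite !sumn_mset.
have NqE1 (c : component k) (U : {set 'I_a0}) : U \subset ~: [set z] ->
     parts_pos (part1 c) -> parts_pos (part2 c) ->
     (sumn (part1 c))%:Z + (sumn (part2 c))%:Z = dot (cls c) (clsE k) ->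
     0 < dot (cls c) (clsL k) -> dot (cls c) (clsL k) <= dot d (clsL k) ->
     part2 c != mset0 -> label_data S1 w1 U c ->
     nsum B S1 w1 rk U (fun i => dot (cls c) (clsEi i)) (part2 c) =
     Nq (cls c) (gen c) (part1 c) (part2 c).
  move=> _ Q1 Q2 Q3 c0 cd ne lab; apply: NqE => //; last by rewrite ne orbT.
    by move=> p q _ _; apply: val_inj.
  by apply: le_trans dB; rewrite ler_pM2l.
have [fin sum2] := sum_second_term zS1 w1pos mu1E cardS2 sumd' NqE1.
split; first exact: fin.
rewrite sum2 -(sum_removal zS1 w1pos w1B rkz d mu2).
have -> : \sum_(w <- finsupp mu2) w%:R * Nq d g (mu1 `+` [mset w]) (mu2 `\ w) =
    \sum_(w <- finsupp mu2) w%:R * nsum B (z |: S1) (upd z w1 w) rk [set: 'I_a0] (fun i => dot d (clsEi i)) (mu2 `\ w).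
  rewrite big_seq [RHS]big_seq; apply: eq_bigr => w; rewrite msuppE => wm; congr (_ * _).
  pose c := Component d g (mu1 `+` [mset w]) (mu2 `\ w).
  have pw := mset_split wm.
  have w0 : w != 0%N.
    by apply: contraNneq P2 => <-; rewrite -(perm_mem (perm_eq_seq_mset vmu2)).
  rewrite (@NqE _ _ _ _ c) //=.
  - by move=> p q _ _; apply: val_inj.
  - rewrite /parts_pos in_msetD in_mset1 negb_or eq_sym w0 andbT.
    by rewrite (perm_mem (perm_eq_seq_mset vmu1)).
  - rewrite /parts_pos in_msetB1 negb_and orbC (perm_mem (perm_eq_seq_mset vmu2)).
    by rewrite (negbTE (_ : 0%N \notin vmu2)).
  - rewrite -sumd' (perm_sumn pw) /=.
    have -> : sumn (mu1 `+` [mset w]) = (sumn mu1 + w)%N.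
      rewrite !sumnE; have := big_mset_union addn [:: mu1; [mset w]] id.
      by rewrite !mset_union_cons mset_union_nil msetD0 !big_cons big_nil /= addn0 enum_mset1 big_seq1.
    by rewrite -!PoszD; congr Posz; rewrite -addnA.
  - apply/orP; left; apply/eqP => /msetP/(_ w); rewrite msetE2 msetnxx mset0E; lia.
  rewrite /label_data /= setTI wtsU1 // /upd eqxx msetDC; apply/andP; split.
    rewrite mu1E; apply/eqP; congr msetD; apply: eq_wts => p pS.
    by case: eqP => // pz; rewrite -pz pS in zS1.
  apply/eqP.
  have sz : size mu2 = (size (mu2 `\ w)).+1 by rewrite (perm_size pw).
  rewrite setTD cardC sz.
  by move: (dot _ _) (size _) => x a; lia.
rewrite -(sum_leaf_first w1 zS1 rkz).
have andE (b1 b2 b3 b4 b5 : bool) : [&& b1, b2, b3 & b4] && b5 = [&& b1, b2, b3, b4 & b5].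
  by rewrite !andbA.
rewrite /nsum (bigID (fun Y : str k B 'I_a0 => lsrc Y z == None)) /=; congr (_ + _); apply: eq_bigl => Y.
  exact: andE.
rewrite andE; case: (boolP (ok _ _ _ _ _ Y)) => [okY|_]; last by [].
(* The smallest free label cannot mark an internal edge, because the floor which that edge leaves
   would carry a smaller free label. *)
suff -> : (lsrc Y z != None) = isfl Y z by [].
rewrite /isfl; case E : (lsrc Y z) => [s|] //; apply/esym/eqP.
case: (eqVneq z s) => [<- //|zs].
have [_ _ _ fs rks] := src_fl okY E zs isT.
have sS := isfl_S1 okY fs; have := rkz s sS; rewrite eq_sym zs => /(_ isT).
by move: rks; rewrite /rk; lia.
Qed.

End Recursion.

(** * From label structures to marked diagrams *)

Section WGraph.
Variable D : wgraph.
Implicit Types (u v : 'I_(nv D)) (e : 'I_(ne D)).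

Lemma vert_infP v : vert_inf v -> exists2 e, src e = v & forall e', adjacent e' v -> e' = e.
Proof.
case/andP => /eqP c1 /existsP[e /eqP se]; exists e => // e' ae'.
have ae : adjacent e v by rewrite /adjacent se eqxx.
have [x Ex] : exists x, [pred e | adjacent e v] =i pred1 x.
  by apply/card1P/eqP.
by have := Ex e'; have := Ex e; rewrite !inE ae ae' => /esym/eqP -> /esym/eqP ->.
Qed.

Lemma vert_inf_div v : vert_inf v -> divergence v <= 0.
Proof.
move=> /vert_infP[e se ue]; rewrite /divergence.
rewrite [X in _ - X](big_pred1 e) => [|e']; last first.
  by apply/eqP/eqP => [E|->//]; apply: ue; rewrite /adjacent E eqxx.
have [te|te] := eqVneq (tgt e) v.
  rewrite (big_pred1 e) ?subrr // => e'.
  by apply/eqP/eqP => [E|->//]; apply: ue; rewrite /adjacent E eqxx orbT.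
rewrite big_pred0 ?sub0r ?oppr_le0 // => e'; apply: contraNF te => /eqP E.
by rewrite -E (ue e') // /adjacent E eqxx orbT.
Qed.

End WGraph.

Section Build.
Variables (k B a0 : nat) (vmu1 : seq nat) (a : 'I_k -> nat).
Local Notation T := 'I_a0.
Local Notation S1 := (std1 a0 (size vmu1)).
Local Notation w1 := (fun p : 'I_a0 => nth 0%N vmu1 p).
Local Notation rk := (fun p : 'I_a0 => nat_of_ord p).
Variable Y : str k B 'I_a0.
Hypotheses (okY : ok None S1 w1 rk [set: T] Y)
  (cardJ : forall i, #|[set p | i \in lset Y p]| = a i).

(* Vertices: the floor represented by the label [q], the leaf of the edge with label [p],
   the leaf marked by [A_i] attached to the floor represented by [q]; edges likewise. *)
Definition vcode : finType := (T + T + T * 'I_k)%type.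
Definition ecode : finType := (T + T * 'I_k)%type.
Definition vfl (q : T) : vcode := inl (inl q).
Definition vlf (p : T) : vcode := inl (inr p).
Definition vel (q : T) (i : 'I_k) : vcode := inr (q, i).

Definition VA : {set vcode} := [set x : vcode | match x with
  | inl (inl q) => rt Y q == q
  | inl (inr p) => lsrc Y p == None
  | inr (q, i) => i \in lset Y q end].
Definition EA : {set ecode} := [set x : ecode | match x with
  | inl p => ~~ isfl Y p | inr (q, i) => i \in lset Y q end].

Definition esrc (x : ecode) : vcode := match x with
  | inl p => if lsrc Y p is Some s then vfl s else vlf p
  | inr (q, i) => vel q i end.
Definition etgt (x : ecode) : vcode := match x with
  | inl p => vfl (rt Y p) | inr (q, i) => vfl q end.
Definition ewt (x : ecode) : nat := if x is inl p then lwt Y p else 1.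

Let eN (z : T) : None = Some z -> z \notin [set: T]. Proof. by []. Qed.

Lemma vflA q : (vfl q \in VA) = (rt Y q == q). Proof. by rewrite inE. Qed.
Lemma vlfA p : (vlf p \in VA) = (lsrc Y p == None). Proof. by rewrite inE. Qed.
Lemma velA q i : (vel q i \in VA) = (i \in lset Y q). Proof. by rewrite inE. Qed.
Lemma inlEA p : ((inl p : ecode) \in EA) = ~~ isfl Y p. Proof. by rewrite inE. Qed.
Lemma inrEA q i : ((inr (q, i) : ecode) \in EA) = (i \in lset Y q). Proof. by rewrite inE. Qed.

Lemma lset_fix q i : i \in lset Y q -> rt Y q = q.
Proof.
move=> iq; apply/eqP; apply: contraTT iq => /(lset_rt okY) ->; by rewrite inE.
Qed.

Lemma src_floor p s : lsrc Y p = Some s -> isfl Y s.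
Proof.
move=> E; case: (eqVneq p s) => [ps|ps]; first by rewrite /isfl -ps E ps.
by have [] := src_fl okY E ps isT.
Qed.

Lemma esrcA x : x \in EA -> esrc x \in VA.
Proof.
case: x => [p|[q i]]; rewrite ?inlEA ?inrEA /= => H; last by rewrite velA.
case E : (lsrc Y p) => [s|]; last by rewrite vlfA E.
by rewrite vflA (rt_fl okY) // (src_floor E).
Qed.

Lemma etgtA x : x \in EA -> etgt x \in VA.
Proof.
case: x => [p|[q i]]; rewrite ?inlEA ?inrEA /= => H; first by rewrite vflA (rt_idem okY).
by rewrite vflA (lset_fix H).
Qed.

(** Numbering the vertices by ordinals requires one vertex to be known; a label provides it. *)
Variable p0 : T.
Lemma p0A : vfl (rt Y p0) \in VA. Proof. by rewrite vflA (rt_idem okY). Qed.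
Definition rkV (x : vcode) : 'I_#|VA| := enum_rank_in p0A x.
Definition evV (v : 'I_#|VA|) : vcode := enum_val v.
Definition evE (e : 'I_#|EA|) : ecode := enum_val e.

Lemma evVA v : evV v \in VA. Proof. exact: enum_valP. Qed.
Lemma evEA e : evE e \in EA. Proof. exact: enum_valP. Qed.
Lemma rkVK x : x \in VA -> evV (rkV x) = x. Proof. exact: enum_rankK_in. Qed.
Lemma evVK v : rkV (evV v) = v. Proof. exact: enum_valK_in. Qed.
Lemma evV_inj : injective evV. Proof. exact: enum_val_inj. Qed.
Lemma evE_inj : injective evE. Proof. exact: enum_val_inj. Qed.
Lemma evE_surj x : x \in EA -> exists e, evE e = x.
Proof. by move=> xA; exists (enum_rank_in xA x); apply: enum_rankK_in. Qed.
Lemma eq_rkV x v : x \in VA -> (rkV x == v) = (x == evV v).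
Proof. by move=> xA; rewrite -(inj_eq evV_inj) rkVK. Qed.

Definition bgraph : wgraph :=
  @WGraph #|VA| #|EA| (fun e => rkV (esrc (evE e))) (fun e => rkV (etgt (evE e))) (fun e => ewt (evE e)).

Lemma jset_card (i : 'I_k) : a i = #|[set p | i \in lset Y p]|. Proof. by rewrite cardJ. Qed.
Definition jpos (i : 'I_k) (n : 'I_(a i)) : T := enum_val (cast_ord (jset_card i) n).
Lemma jposP i (n : 'I_(a i)) : i \in lset Y (jpos n).
Proof. by have := enum_valP (cast_ord (jset_card i) n); rewrite inE. Qed.
Lemma jpos_inj i : injective (@jpos i).
Proof. by move=> n n' /enum_val_inj/cast_ord_inj. Qed.
Lemma jpos_surj i q : i \in lset Y q -> exists n : 'I_(a i), jpos n = q.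
Proof.
move=> iq; have qA : q \in [set p | i \in lset Y p] by rewrite inE.
exists (cast_ord (esym (jset_card i)) (enum_rank_in qA q)).
by rewrite /jpos cast_ordKV enum_rankK_in.
Qed.

(** The last branch for a label is a default value that is never taken: by [bmark_ed] the edge is
    always found. *)
Definition bmark (x : marks a0 a) : elt bgraph :=
  match x with
  | inl p => if isfl Y p then inl (rkV (vfl p))
             else if p \in S1 then inl (rkV (vlf p))
             else if [pick e | evE e == inl p] is Some e then inr e else inl (rkV (vfl (rt Y p0)))
  | inr (existT i n) => inl (rkV (vel (jpos n) i))
  end.

Definition bmg : mgraph a0 a := @MGraph k a0 a bgraph bmark.

Lemma bmark_fl p : isfl Y p -> bmark (inl p) = inl (rkV (vfl p)).
Proof. by rewrite /bmark => ->. Qed.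
Lemma bmark_lf p : p \in S1 -> bmark (inl p) = inl (rkV (vlf p)).
Proof. by move=> pS; rewrite /bmark pS; case: ifP => // /(isfl_S1 okY); rewrite pS. Qed.
Lemma bmark_ed p : ~~ isfl Y p -> p \notin S1 -> exists2 e, bmark (inl p) = inr e & evE e = inl p.
Proof.
move=> fp pS; rewrite /bmark (negbTE fp) (negbTE pS); case: pickP => [e /eqP E|no]; first by exists e.
have [|e E] := @evE_surj (inl p); first by rewrite inlEA.
by have := no e; rewrite E eqxx.
Qed.

Lemma bsrcE (e : 'I_(ne bgraph)) v : (src e == v) = (esrc (evE e) == evV v).
Proof. by rewrite /= eq_rkV // esrcA // evEA. Qed.
Lemma btgtE (e : 'I_(ne bgraph)) v : (tgt e == v) = (etgt (evE e) == evV v).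
Proof. by rewrite /= eq_rkV // etgtA // evEA. Qed.

Lemma bdivE (v : 'I_(nv bgraph)) : divergence v =
  (\sum_(x in EA | etgt x == evV v) ewt x)%N%:Z - (\sum_(x in EA | esrc x == evV v) ewt x)%N%:Z.
Proof.
rewrite /divergence !(big_morph Posz PoszD (erefl _)) !big_enum_val_cond; congr (_ - _).
  by apply: eq_bigl => e; rewrite btgtE.
by apply: eq_bigl => e; rewrite bsrcE.
Qed.

Lemma in_floor q : (\sum_(x in EA | etgt x == vfl q) ewt x =
  \sum_(p | (rt Y p == q) && ~~ isfl Y p) lwt Y p + #|lset Y q|)%N.
Proof.
rewrite big_sumType /=; congr addn.
  by apply: eq_bigl => p; rewrite inE andbC.
rewrite -sum1_card (reindex_onto (fun i => (q, i)) snd) => [|[q' i] /andP[_ /eqP[->]]] //=.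
by apply: eq_bigl => i; rewrite inE !eqxx !andbT.
Qed.

Lemma out_floor q : (\sum_(x in EA | esrc x == vfl q) ewt x = outw Y q)%N.
Proof.
rewrite big_sumType /= [X in (_ + X)%N]big_pred0 ?addn0 => [|[q' i]]; last by rewrite /= ?inE ?andbF.
apply: eq_bigl => p; rewrite inE /isfl; case E : (lsrc Y p) => [s|] /=; last by rewrite /= ?inE ?andbF.
rewrite !(inj_eq Some_inj) (_ : (vfl s == vfl q) = (s == q)); last by apply/eqP/eqP => [[]|->].
by case: (eqVneq s q) => [->|_]; rewrite ?andbF //= andbT eq_sym.
Qed.

Lemma bdiv_floor q v : evV v = vfl q -> divergence (v : 'I_(nv bgraph)) = if isfl Y q then 4 else 2.
Proof.
move=> E; have := evVA v; rewrite E vflA => /eqP rq.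
rewrite bdivE E in_floor out_floor (floor_div okY) ?in_setT //.
by case: ifP => _; rewrite PoszD addrK.
Qed.

Lemma esrc_leaf x p : esrc x = vlf p -> x = inl p /\ lsrc Y p = None.
Proof. by case: x => [p'|[q i]] //=; case E : (lsrc Y p') => [s|] // [<-]. Qed.
Lemma esrc_el x q i : esrc x = vel q i -> x = inr (q, i).
Proof. by case: x => [p'|[q' i']] /=; [case: (lsrc Y p') | case=> -> ->]. Qed.

(** All edges point to floors, so any other vertex is the target of none, and the source codes show
    that it is the source of a single one. *)
Lemma bleaf_of v x : (forall q, evV v <> vfl q) -> x \in EA -> esrc x = evV v ->
  vert_inf (v : 'I_(nv bgraph)) /\ divergence (v : 'I_(nv bgraph)) = - (ewt x)%:Z.
Proof.
move=> nf xA xv; have [e Ee] := evE_surj xA.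
have us y : y \in EA -> (esrc y == evV v) = (y == x).
  move=> yA; apply/eqP/eqP => [|->//]; rewrite -xv.
  have : forall q, esrc x <> vfl q by rewrite xv.
  case: x xA xv Ee => [p|[q i]] _ _ _ /=.
    by case E : (lsrc Y p) => [s|] nfx; [case: (nfx s) | move/esrc_leaf=> []].
  by move=> _ /esrc_el.
have ut y : (etgt y == evV v) = false.
  by apply/eqP => E; case: y E => [p|[q i]] /= /esym; apply: nf.
split; last first.
  rewrite bdivE [X in X%:Z - _]big_pred0 => [|y]; last by rewrite ut andbF.
  rewrite sub0r (big_pred1 x) // => y /=; case: (boolP (y \in EA)) => /= yA; first exact: us.
  by apply/esym/eqP => E; rewrite E xA in yA.
apply/andP; split; last by apply/existsP; exists e; rewrite bsrcE Ee xv.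
apply/eqP; rewrite -(card1 e); apply: eq_card => e'.
rewrite !inE /adjacent bsrcE btgtE ut orbF us ?evEA // -Ee.
exact: (inj_eq evE_inj).
Qed.

Lemma bfloor v q : evV v = vfl q -> ~~ vert_inf (v : 'I_(nv bgraph)).
Proof.
by move=> E; apply/negP => /vert_inf_div; rewrite (bdiv_floor E); case: ifP.
Qed.

Lemma bvert_cases (v : 'I_(nv bgraph)) :
  [\/ exists2 q, evV v = vfl q & rt Y q = q,
      exists2 p, evV v = vlf p & lsrc Y p = None |
      exists q i, evV v = vel q i /\ i \in lset Y q].
Proof.
have := evVA v; case: (evV v) => [[q|p]|[q i]].
- by rewrite vflA => /eqP; constructor 1; exists q.
- by rewrite vlfA => /eqP; constructor 2; exists p.
by rewrite velA; constructor 3; exists q, i.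
Qed.

Lemma nfl_none p : lsrc Y p = None -> ~~ isfl Y p.
Proof. by rewrite /isfl => ->. Qed.

Lemma bleaf_lf v p : evV v = vlf p -> lsrc Y p = None ->
  vert_inf (v : 'I_(nv bgraph)) /\ divergence (v : 'I_(nv bgraph)) = - (lwt Y p)%:Z.
Proof.
move=> E sp; apply: (bleaf_of (x := inl p)); rewrite ?inlEA ?nfl_none ?E /= ?sp //.
Qed.

Lemma bleaf_el v q i : evV v = vel q i -> i \in lset Y q ->
  vert_inf (v : 'I_(nv bgraph)) /\ divergence (v : 'I_(nv bgraph)) = -1.
Proof.
move=> E iq; apply: (bleaf_of (x := inr (q, i))); rewrite ?inrEA ?E //.
Qed.

Lemma bedge_inf (e : 'I_(ne bgraph)) : edge_inf e = (if esrc (evE e) is inl (inl _) then false else true).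
Proof.
apply/existsP/idP => [[v /andP[lv]]|].
  rewrite /adjacent bsrcE btgtE; case/orP => /eqP E.
    case E2 : (esrc (evE e)) => [[q|p]|x] //; rewrite E2 in E.
    by rewrite (negbTE (bfloor (esym E))) in lv.
  by case: (evE e) E => [p|[q i]] /= /esym /bfloor; rewrite lv.
have xA := evEA e => H; exists (rkV (esrc (evE e))).
have vE : evV (rkV (esrc (evE e))) = esrc (evE e) by rewrite rkVK // esrcA.
rewrite /adjacent bsrcE vE eqxx andbT.
apply: (proj1 (bleaf_of (x := evE e) _ _ _)) => // q; rewrite vE => E.
by rewrite E in H.
Qed.


Lemma barrow x : x \in EA -> arrow (rkV (esrc x) : 'I_(nv bgraph)) (rkV (etgt x)).
Proof.
move=> xA; have [e Ee] := evE_surj xA; apply/existsP; exists e.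
by rewrite bsrcE btgtE Ee !rkVK ?esrcA ?etgtA // !eqxx.
Qed.

Lemma bneighborC : symmetric (@neighbor bgraph).
Proof. by move=> u v; rewrite /neighbor orbC. Qed.

Lemma bconnectC : connect_sym (@neighbor bgraph).
Proof. exact/sym_connect_sym/bneighborC. Qed.

Lemma bconn_edge x : x \in EA -> connect (@neighbor bgraph) (rkV (esrc x)) (rkV (etgt x)).
Proof. by move=> xA; apply: connect1; rewrite /neighbor barrow. Qed.

Lemma bconn_floor p q : connect (lnk Y) p q ->
  connect (@neighbor bgraph) (rkV (vfl (rt Y p))) (rkV (vfl (rt Y q))).
Proof.
apply: (connect_map (f := fun p => rkV (vfl (rt Y p)))) => {p q}.
have H p q : (lsrc Y p == Some q) && isfl Y q ->
    connect (@neighbor bgraph) (rkV (vfl (rt Y p))) (rkV (vfl (rt Y q))).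
  case/andP => /eqP pq fq; case: (eqVneq p q) => [->|npq]; first exact: connect0.
  have fp : ~~ isfl Y p by rewrite /isfl pq; apply: contra npq => /eqP[->].
  have := @bconn_edge (inl p); rewrite inlEA /= pq (rt_fl okY fq) bconnectC; exact.
have H' p q : ltgt Y p == q ->
    connect (@neighbor bgraph) (rkV (vfl (rt Y p))) (rkV (vfl (rt Y q))).
  by move/eqP <-; rewrite (rt_tgt okY) connect0.
by move=> p q /or4P[/H|/H|/H'|/H'] //; rewrite bconnectC.
Qed.

(** Strictly increasing along edges, which excludes oriented cycles: leaves lie at 0, a floor of
    degree 2 at its label plus 1, and floors of degree 1, which no edge leaves, above all of
    these. *)
Definition vhgt (x : vcode) : nat :=
  if x is inl (inl q) then (if isfl Y q then (nat_of_ord q).+1 else a0.+2) else 0.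

Lemma rt_isfl p : ~~ isfl Y p -> isfl Y (rt Y p) -> (p \in S1) || (p < rt Y p)%N.
Proof.
move=> fp fr; case: (rt_or Y p) => E; first by rewrite E (negbTE fp) in fr.
by case: (tgt_cases okY (in_setT p) fp) => [[tp _]|[]|[]];
  rewrite -?E ?fr // ; rewrite -E in tp; rewrite tp (negbTE fp) in fr.
Qed.

Lemma vhgt_lt x : x \in EA -> (vhgt (esrc x) < vhgt (etgt x))%N.
Proof.
case: x => [p|[q i]]; rewrite ?inlEA ?inrEA /= => H; last by case: ifP.
case E : (lsrc Y p) => [s|] /=; last by case: ifP.
have fs := src_floor E; have ps : p != s by apply: contraNneq H => ->.
have [_ _ _ _ lsp] := src_fl okY E ps isT.
have pS : p \notin S1 by apply/negP => /(src_S1 okY); rewrite E.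
rewrite fs; case: ifP => [fr|_]; last by rewrite ltnS ltnW // ltnS.
by have := rt_isfl H fr; rewrite (negbTE pS) ltnS => /(ltn_trans lsp).
Qed.

Lemma barrow_hgt (u v : 'I_(nv bgraph)) : arrow u v -> (vhgt (evV u) < vhgt (evV v))%N.
Proof.
case/existsP => e /andP[]; rewrite bsrcE btgtE => /eqP <- /eqP <-.
exact/vhgt_lt/evEA.
Qed.

Lemma bacyclic (v : 'I_(nv bgraph)) p : path (@arrow bgraph) v p -> last v p = v -> p = [::].
Proof.
case: p => // u p pth lst; suff : (vhgt (evV v) < vhgt (evV (last v (u :: p))))%N.
  by rewrite lst ltnn.
move: pth {lst} => /= /andP[/barrow_hgt h pp]; apply: leq_trans h _ => {v}.
elim: p u pp => //= w p IH u /andP[/barrow_hgt h /IH]; apply: leq_trans; exact: ltnW.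
Qed.

Definition bcode (x : elt bgraph) : vcode + ecode :=
  match x with inl v => inl (evV v) | inr e => inr (evE e) end.
Definition ccode (x : marks a0 a) : vcode + ecode :=
  match x with
  | inl p => if isfl Y p then inl (vfl p) else if p \in S1 then inl (vlf p) else inr (inl p)
  | inr (existT i n) => inl (vel (jpos n) i)
  end.

Lemma bcode_inj : injective bcode.
Proof. by case=> [u|e] [v|e'] //= [] => [/evV_inj ->|/evE_inj ->]. Qed.

Lemma S1_src p : p \in S1 -> lsrc Y p = None.
Proof. exact: (src_S1 okY). Qed.

Lemma bcode_mark x : bcode (bmark x) = ccode x.
Proof.
case: x => [p|[i n]]; last by rewrite /= rkVK // velA jposP.
rewrite [ccode _]/=; case: ifP => fp; first by rewrite bmark_fl //= rkVK // vflA (rt_fl okY fp).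
case: ifP => pS; first by rewrite bmark_lf //= rkVK // vlfA S1_src.
by have [|e -> /= ->] := @bmark_ed p _ (negbT pS); rewrite ?fp.
Qed.

Lemma ccode_inj : injective ccode.
Proof.
move=> [p|[i n]] [p'|[i' n']] /=.
- by do 4?case: ifP => ? //; case=> ->.
- by do 2?case: ifP.
- by do 2?case: ifP.
case=> E Ei; subst i'; congr (inr (existT _ _ _)); exact: jpos_inj E.
Qed.

Lemma bmark_inj : injective bmark.
Proof. by move=> x y E; apply: ccode_inj; rewrite -!bcode_mark E. Qed.

Lemma bmarkE x (y : elt (diag bmg)) : (@mark k a0 a bmg x == y) = (ccode x == bcode y).
Proof. by rewrite -(inj_eq bcode_inj) bcode_mark. Qed.

(** Weakly increasing along the orientation and equal to [p] on the element marked by [p]. Together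
    with injectivity this shows that the marking is increasing. *)
Definition clev (x : vcode + ecode) : nat :=
  match x with
  | inl (inl (inl q)) => if isfl Y q then nat_of_ord q else a0
  | inl (inl (inr p)) => nat_of_ord p
  | inr (inl p) => nat_of_ord p
  | _ => 0
  end.

Lemma clev_step x y : elt_step x y -> (clev (bcode x) <= clev (bcode y))%N.
Proof.
case: x y => [v|e] [u|e'] //=; rewrite ?bsrcE ?btgtE => /eqP <-.
  have := evEA e'; case: (evE e') => [p|[q i]] //=; rewrite inlEA => fp.
  case E : (lsrc Y p) => [s|] //=; have fs := src_floor E; rewrite fs.
  have ps : p != s by apply: contraNneq fp => ->.
  by have [_ _ _ _ /ltnW] := src_fl okY E ps isT.
have := evEA e; case: (evE e) => [p|[q i]] //=; rewrite inlEA => fp.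
case: ifP => [fr|_]; last exact: ltnW.
case/orP: (rt_isfl fp fr) => [pS|/ltnW //]; have := isfl_S1 okY fr.
by move: pS; rewrite !inE -leqNgt => /leq_trans h /h /ltnW.
Qed.

Lemma clev_mark p : clev (bcode (bmark (inl p))) = p.
Proof. by rewrite bcode_mark /=; case: ifP => fp /=; [rewrite fp | case: ifP]. Qed.

Lemma bmark_incr p r : elt_lt (bmark (inl r)) (bmark (inl p)) -> (r < p)%N.
Proof.
case/andP => ne /connectP[s pth lst].
have : (clev (bcode (bmark (inl r))) <= clev (bcode (bmark (inl p))))%N.
  rewrite lst; elim: s (bmark (inl r)) pth {lst ne} => //= y s IH x /andP[/clev_step h /IH].
  exact: leq_trans.
rewrite !clev_mark leq_eqVlt => /orP[/eqP/val_inj E|//]; by rewrite E eqxx in ne.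
Qed.

Lemma bleaf_edge (v : 'I_(nv bgraph)) (e : 'I_(ne bgraph)) x :
  (forall q, evV v <> vfl q) -> x \in EA -> esrc x = evV v -> adjacent e v -> evE e = x.
Proof.
move=> nf xA xv; have [/vert_infP[e0 se ue] _] := bleaf_of nf xA xv.
have [e1 Ee] := evE_surj xA; have a1 : @adjacent bgraph e1 v by rewrite /adjacent bsrcE Ee xv eqxx.
by move/ue => ->; rewrite -(ue _ a1).
Qed.

Lemma bvert_inf (v : 'I_(nv bgraph)) : vert_inf v = (if evV v is inl (inl _) then false else true).
Proof.
case: (bvert_cases v) => [[q E _]|[p E sp]|[q [i [E iq]]]]; rewrite E.
- exact/negbTE/(bfloor E).
- by have [] := bleaf_lf E sp.
by have [] := bleaf_el E iq.
Qed.

Definition in_mu2 (x : ecode) : bool := if x is inl p then p \in edge2 None S1 [set: T] Y else false.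
Definition in_mu1 (x : ecode) : bool := if x is inl p then p \in S1 else false.
Definition in_int (x : ecode) : bool := if x is inl p then lsrc Y p != None else false.

Lemma bedge_mu2 (e : 'I_(ne (diag bmg))) : @edge_mu2 k a0 a bmg e = in_mu2 (evE e).
Proof.
rewrite /edge_mu2 bedge_inf; have := evEA e; case E : (evE e) => [p|[q i]]; last first.
  move=> _; apply/existsP => -[p]; rewrite bmarkE /= E; by do 2?case: ifP.
rewrite inlEA [esrc _]/= [in_mu2 _]/= inE in_setT andTb /isleaf orbb => fp.
case: (lsrc Y p) => [s|]; first by rewrite andbF.
rewrite andTb andbT; apply/existsP/idP => [[p']|pS].
  rewrite bmarkE /= E; case: ifP => fp' //; case: ifP => // /negbT pS /eqP[<-] //.
by exists p; rewrite bmarkE /= E (negbTE fp) (negbTE pS).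
Qed.

Lemma bedge_mu1 (e : 'I_(ne (diag bmg))) : @edge_mu1 k a0 a bmg (size vmu1) e = in_mu1 (evE e).
Proof.
apply/existsP/idP => [[p /existsP[v /and3P[pl mv]]]|].
  have pS : p \in S1 by rewrite inE.
  move: mv; rewrite bmarkE /= (negbTE (nfl_none (S1_src pS))) pS => /eqP[Ev].
  by move=> /(@bleaf_edge v e (inl p)) -> //; rewrite ?inlEA ?nfl_none ?S1_src -?Ev //= S1_src.
case E : (evE e) => [p|//] pS0; have pS : p \in S1 by []; exists p; apply/existsP; exists (rkV (vlf p)).
have vE : evV (rkV (vlf p)) = vlf p by rewrite rkVK // vlfA S1_src.
rewrite bmarkE /= (negbTE (nfl_none (S1_src pS))) pS vE eqxx /adjacent bsrcE E /= S1_src //.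
by rewrite vE eqxx /= andbT; move: pS; rewrite inE.
Qed.

Lemma bedge_int (e : 'I_(ne (diag bmg))) : ~~ @edge_inf (diag bmg) e = in_int (evE e).
Proof. by rewrite bedge_inf; case: (evE e) => [p|[q i]] //=; case: (lsrc Y p). Qed.

Lemma bprod (R : Type) (idx : R) (op : Monoid.com_law idx) (P : pred 'I_(ne bgraph))
    (P' : pred ecode) (F : 'I_(ne bgraph) -> R) (F' : ecode -> R) :
  (forall e, P e = P' (evE e)) -> (forall e, F e = F' (evE e)) ->
  \big[op/idx]_(e | P e) F e = \big[op/idx]_(x in EA | P' x) F' x.
Proof.
move=> PE FE; rewrite big_enum_val_cond; apply: eq_big => e; first exact: PE.
by move=> _; exact: FE.
Qed.

Lemma bprod_inl (R : Type) (idx : R) (op : Monoid.com_law idx) (P : pred T) (F : ecode -> R) :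
  (forall p, P p -> ~~ isfl Y p) ->
  \big[op/idx]_(x in EA | if x is inl p then P p else false) F x = \big[op/idx]_(p | P p) F (inl p).
Proof.
move=> H; rewrite big_sumType /= [X in op _ X]big_pred0 ?Monoid.mulm1; last by move=> x; rewrite andbF.
apply: eq_bigl => p; rewrite inlEA; case Pp : (P p); rewrite ?andbF ?andbT //.
exact: H.
Qed.

Lemma bmult : mult_q bmg (size vmu1) = mult S1 [set: T] Y.
Proof.
have n2 p : p \in edge2 None S1 [set: T] Y -> ~~ isfl Y p.
  by rewrite inE in_setT /= /isleaf orbb => /andP[_ /eqP /nfl_none].
have n1 p : p \in S1 -> ~~ isfl Y p by move=> /S1_src/nfl_none.
pose w x := qint (ewt x) / (ewt x)%:R.
rewrite /mult_q (bprod _ (F' := w) bedge_mu2) // (bprod _ (F' := w) bedge_mu1) //.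
rewrite (bprod _ (F' := fun x => (ewt x)%:R) bedge_mu2) //.
rewrite (bprod _ (F' := fun x => qint (ewt x) ^+ 2) bedge_int) //.
rewrite /in_mu1 /in_mu2 /in_int !(bprod_inl _ _ n1) !(bprod_inl _ _ n2).
have -> : \prod_(x in EA | (if x is inl p then lsrc Y p != None else false)) qint (ewt x) ^+ 2 =
  \prod_(p | (lsrc Y p != None) && ~~ isfl Y p) qint (lwt Y p) ^+ 2.
  rewrite big_sumType /= [X in _ * X]big_pred0 ?mulr1; last by move=> x; rewrite andbF.
  by apply: eq_bigl => p; rewrite inlEA andbC.
rewrite (mulrAC (\prod_(p in edge2 None S1 [set: T] Y) _)) -big_split /= (big_mkcond (mem (edge2 _ _ _ _))) (big_mkcond (mem S1)) [X in _ * X]big_mkcond.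
rewrite -!big_split /= /mult [RHS](eq_bigl predT) => [|p]; last by rewrite in_setT.
apply: eq_bigr => p _; rewrite !inE /fac /w /isleaf orbb /= !inE.
case: (boolP (p < size vmu1)%N) => pl /=.
  have pS : p \in S1 by rewrite inE.
  by rewrite S1_src //= mulr1 mul1r.
case: (boolP (isfl Y p)) => fp /=.
  by rewrite andbF (eqP fp) /= !mulr1.
case: (lsrc Y p) => [s|] /=; first by rewrite !mul1r.
rewrite !mulr1 divfK // Kq_natr_neq0 //; exact: (wt_gt0 okY).
Qed.

Lemma sum_pairs_in (F : nat) :
  (\sum_(x : T * 'I_k | x.2 \in lset Y x.1) F = nset [set: T] Y * F)%N.
Proof.
rewrite /nset big_distrl /= [RHS](eq_bigr (fun p => \sum_(i in lset Y p) F)%N) => [|p _].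
  by rewrite pair_big_dep; apply: eq_bigl => -[p i]; rewrite in_setT.
by rewrite sum_nat_const.
Qed.

Lemma card_EA : #|EA| = (#|[set p | ~~ isfl Y p]| + nset [set: T] Y)%N.
Proof.
rewrite -sum1_card big_sumType /= -[nset _ _]muln1 -sum_pairs_in -sum1_card; congr addn.
  by apply: eq_bigl => p; rewrite !inE.
by apply: eq_bigl => -[q i]; rewrite inrEA.
Qed.

Lemma card_VA : #|VA| = (#|[set p | rt Y p == p]| + #|[set p | lsrc Y p == None]| + nset [set: T] Y)%N.
Proof.
rewrite -sum1_card big_sumType big_sumType /= -[nset _ _]muln1 -sum_pairs_in -!sum1_card.
congr (_ + _ + _)%N.
- by apply: eq_bigl => p; rewrite !inE.
- by apply: eq_bigl => p; rewrite !inE.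
by apply: eq_bigl => -[q i]; rewrite velA.
Qed.

Lemma card_nonfloor : #|[set p | ~~ isfl Y p]| = (nint None [set: T] Y + #|[set p | lsrc Y p == None]|)%N.
Proof.
rewrite /nint -!sum1_card (bigID (fun p => lsrc Y p != None)) /=; congr addn; apply: eq_bigl => p.
  by rewrite !inE /isleaf orbb.
by rewrite !inE negbK; case: (eqVneq (lsrc Y p) None) => [/nfl_none ->|]; rewrite ?andbF.
Qed.

Variables (d : H2 k) (g : nat) (vmu2 : seq nat).
Hypotheses (conY : conn [set: T] Y)
  (mu2E : wts (lwt Y) (edge2 None S1 [set: T] Y) = seq_mset vmu2)
  (a0E : a0%:Z = dot d (clsL k) - 1 + g%:Z + (size vmu1)%:Z + (size vmu2)%:Z)
  (aE : forall i, (a i)%:Z = dot d (clsEi i)) (dL : 0 < dot d (clsL k))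
  (sumE : (sumn vmu1)%:Z + (sumn vmu2)%:Z = dot d (clsE k)).

Lemma size_le_a0 : (size vmu1 <= a0)%N.
Proof. move: a0E dL; move: (dot _ _) (size _) (size _) => x y z; lia. Qed.

Lemma bcdeg : (cdeg [set: T] Y)%:Z = dot d (clsL k).
Proof.
have := degree_sum okY eN; rewrite (leafwE okY) nsetE setTI (wts_std1 size_le_a0) mu2E !sumn_mset.
move=> /(congr1 Posz); rewrite PoszM PoszD PoszD sumE (big_morph Posz PoszD (erefl _)).
rewrite (eq_bigr (fun i => - d.2 i)) => [|i _]; last first.
  by rewrite -dotEi -aE -cardJ; congr Posz; apply: eq_card => p; rewrite !inE.
by rewrite sumrN dotE dotL addrK => /mulfI <-.
Qed.

Lemma bgenus : (nint None [set: T] Y)%:Z - #|[set p | rt Y p == p]|%:Z + 1 = g%:Z.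
Proof.
have := card_labels okY eN; have := bcdeg; rewrite /cdeg.
have -> : #|edge2 None S1 [set: T] Y| = size vmu2.
  by rewrite -(size_wts (lwt Y)) mu2E size_of_seq_mset.
have -> : #|[set: T] :\: S1| = (a0 - size vmu1)%N.
  have cS : #|S1| = size vmu1 by rewrite -(size_wts w1) (wts_std1 size_le_a0) size_of_seq_mset.
  by rewrite cardsD setTI cS cardsT card_ord.
have -> : [set f in [set: T] | rt Y f == f] = [set p | rt Y p == p] by apply/setP => p; rewrite !inE.
have le := size_le_a0; move: le a0E; move: (dot _ _) (size _) (size _) (nint _ _ _) (#|_|) (#|_|) => x l1 l2 n f1 f2.
lia.
Qed.

Lemma bconnected (u v : 'I_(nv bgraph)) : connect (@neighbor bgraph) u v.
Proof.
suff H w : exists p, connect (@neighbor bgraph) w (rkV (vfl (rt Y p))).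
  have [[p up] [q vq]] := (H u, H v).
  apply: connect_trans up _; rewrite bconnectC; apply: connect_trans vq _.
  by apply: bconn_floor; have /andP[_ /forall_inP/(_ q (in_setT _))/forall_inP] := conY; apply.
case: (bvert_cases w) => [[q E rq]|[p E sp]|[q [i [E iq]]]]; rewrite -(evVK w) E.
- by exists q; rewrite rq connect0.
- exists p; have := @bconn_edge (inl p); rewrite inlEA /= sp; apply; exact: nfl_none.
exists q; rewrite (lset_fix iq); have := @bconn_edge (inr (q, i)); rewrite inrEA; exact.
Qed.

(** In the Euler characteristic every leaf cancels against its edge. What remains is the number of
    internal edges minus the number of floors plus 1, which the count of labels identifies with
    [g]. *)
Lemma bbetti : betti1 bgraph = g%:Z.
Proof.
rewrite /betti1; have -> : n_comp (@neighbor bgraph) predT = 1%N.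
  have x0 : 'I_(nv bgraph) := rkV (vfl (rt Y p0)).
  rewrite -(n_comp_connect bconnectC x0); apply: eq_n_comp_r => v.
  by rewrite !inE bconnected.
rewrite [ne _]/= [nv _]/= card_EA card_VA card_nonfloor -bgenus.
rewrite !PoszD; move: (nint _ _ _) (#|_|) (#|_|) (nset _ _) => x y z t; lia.
Qed.

Lemma bdiv_sum : \sum_(v : 'I_(nv bgraph) | vert_inf v) divergence v = - (2 * dot d (clsL k)).
Proof.
pose F (x : vcode) : nat := match x with inl (inl _) => 0 | inl (inr p) => lwt Y p | inr _ => 1 end.
have -> : \sum_(v : 'I_(nv bgraph) | vert_inf v) divergence v = - (\sum_(x in VA) F x)%N%:Z.
  rewrite [X in _ = - Posz X]big_enum_val (big_morph Posz PoszD (erefl _)) -sumrN [LHS]big_mkcond; apply: eq_bigr => v _.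
  rewrite bvert_inf; case: (bvert_cases v) => [[q E _]|[p E sp]|[q [i [E iq]]]]; rewrite -/(evV v) E.
  - by rewrite oppr0.
  - by have [_ ->] := bleaf_lf E sp.
  by have [_ ->] := bleaf_el E iq.
rewrite -bcdeg -PoszM -(degree_sum okY eN) big_sumType big_sumType /=; congr (- (Posz _)).
rewrite [X in (X + _ + _)%N]big1 ?add0n //; congr addn.
  by apply: eq_bigl => p; rewrite vlfA in_setT /isleaf orbb.
by rewrite -[RHS]muln1 -sum_pairs_in; apply: eq_bigl => -[q i]; rewrite velA.
Qed.

Lemma bleaf_div (v : 'I_(nv bgraph)) : vert_inf v -> divergence v <= -1.
Proof.
rewrite bvert_inf; case: (bvert_cases v) => [[q E _]|[p E sp]|[q [i [E iq]]]]; rewrite E // => _.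
  have [_ ->] := bleaf_lf E sp; have := wt_gt0 okY (in_setT p) (nfl_none sp); lia.
by have [_ ->] := bleaf_el E iq.
Qed.

Lemma bfloor_code (v : 'I_(nv bgraph)) : ~~ vert_inf v -> exists q, evV v = vfl q.
Proof.
by rewrite bvert_inf; case: (bvert_cases v) => [[q E _]|[p E sp]|[q [i [E iq]]]]; rewrite E //; exists q.
Qed.

Lemma bdiv2 (v : 'I_(nv bgraph)) : divergence v = 2 -> exists2 q, evV v = vfl q & ~~ isfl Y q.
Proof.
move=> dv; have [|q E] := @bfloor_code v; first by apply/negP => /bleaf_div; rewrite dv.
by exists q => //; move: dv; rewrite (bdiv_floor E); case: ifP.
Qed.

Lemma bfloor_diagram : floor_diagram bgraph g (dot d (clsL k)).
Proof.
split; first 1 last.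
- by split; [apply: leq_ltn_trans (ltn_ord (rkV (vfl (rt Y p0)))) | exact: bconnected].
- exact: bacyclic.
- exact: bbetti.
- split; last exact: bdiv_sum.
  + by move=> v /bfloor_code[q E]; rewrite (bdiv_floor E); case: ifP; [right|left].
  + exact: bleaf_div.
  move=> v /bdiv2[q E fq] e; rewrite /adjacent => /orP[|/eqP //].
  rewrite bsrcE E; case: (evE e) => [p|[q' i]] //=; case sp : (lsrc Y p) => [s|] // /eqP[sq].
  by move: fq; rewrite -sq (src_floor sp).
move=> e; rewrite /=; have := evEA e; case: (evE e) => [p|//]; rewrite inlEA => fp /=.
exact: (wt_gt0 okY).
Qed.

Lemma bmarkedE i (u : 'I_(nv (diag bmg))) : @marked_by k a0 a bmg i u ->
  exists2 q, evV u = vel q i & i \in lset Y q.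
Proof.
case/existsP => n; rewrite bmarkE /= => /eqP[E]; exists (jpos n); rewrite ?jposP //.
Qed.

Lemma bmarking : marking bmg vmu1 vmu2.
Proof.
split.
- split; [exact: bmark_inj | exact: bmark_incr |].
  move=> v x _ /bdiv2[q E fq] /eqP; rewrite bmarkE /= E; case: x => [p|[i n]] //=.
  case: ifP => fp; last by case: ifP.
  by move=> /eqP[pq]; move: fq; rewrite -pq fp.
- move=> v e; rewrite bvert_inf; case: (bvert_cases v) => [[q E _]|[p E sp]|[q [i [E iq]]]];
    rewrite E // => _ aev.
    have fp := nfl_none sp; have xA : inl p \in EA by rewrite inlEA.
    have Ee : evE e = inl p by apply: bleaf_edge aev; rewrite ?E //= sp.
    case: (boolP (p \in S1)) => pS.
      left; split; first by exists (inl p); apply/eqP; rewrite bmarkE /= (negbTE fp) pS E.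
      move=> [x /eqP]; rewrite bmarkE /= Ee; case: x => [p'|[i n]] //=.
      by case: ifP => // _; case: ifP => // /negbT pS' /eqP[pp]; rewrite pp pS in pS'.
    right; split; last by exists (inl p); apply/eqP; rewrite bmarkE /= (negbTE fp) (negbTE pS) Ee.
    move=> [x /eqP]; rewrite bmarkE /= E; case: x => [p'|[i n]] //=.
    by case: ifP => // _; case: ifP => // pS' /eqP[pp]; rewrite pp (negbTE pS) in pS'.
  have Ee : evE e = inr (q, i) by apply: bleaf_edge aev; rewrite ?E ?inrEA.
  left; split; first by have [n jn] := jpos_surj iq; exists (inr (existT _ i n)); apply/eqP; rewrite bmarkE /= jn E.
  move=> [x /eqP]; rewrite bmarkE /= Ee; case: x => [p'|[i' n]] //=.
  by do 2?case: ifP.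
- split.
    move=> [i n]; exists (rkV (vel (jpos n) i)) => //.
    by rewrite bvert_inf rkVK // velA jposP.
  apply/predeqP => x; split => [[p pl <-]|[[p _ <-] [v lv E]]].
    have pS : p \in S1 by rewrite inE.
    split; first by exists p.
    exists (rkV (vlf p)); last by apply: esym; exact: bmark_lf.
    by rewrite /= bvert_inf rkVK // vlfA S1_src.
  exists p => //; move/esym/eqP: E; rewrite bmarkE /=; case: ifP => fp.
    by move: lv; rewrite /= bvert_inf => + /eqP[Ev]; rewrite -Ev.
  by case: ifP => // pS _; move: pS; rewrite inE.
- move=> i v /bfloor_code[q E]; apply/card_le1_eqP.
  suff H e : e \in [pred e : 'I_(ne (diag bmg)) | adjacent e v & [exists u, adjacent e u && @marked_by k a0 a bmg i u]] ->
      evE e = inr (q, i) by move=> x y /H Ex /H Ey; apply: evE_inj; rewrite Ex.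
  rewrite inE => /andP[aev /existsP[u /andP[aeu /bmarkedE[q' Eu iq]]]].
  have Ee : evE e = inr (q', i) by apply: bleaf_edge aeu; rewrite ?Eu ?inrEA.
  by move: aev; rewrite /adjacent bsrcE btgtE Ee E /= => /eqP[->].
split.
  move=> p v e pl /eqP; have pS : p \in S1 by rewrite inE.
  rewrite bmarkE /= (negbTE (nfl_none (S1_src pS))) pS => /eqP[E] aev.
  have -> : evE e = inl p by apply: bleaf_edge aev; rewrite -?E ?inlEA ?(nfl_none (S1_src pS)) //= S1_src.
  by rewrite /= (wt_S1 okY).
have pe : perm_eq [seq evE e | e : 'I_(ne (diag bmg)) <- enum [pred e | @edge_mu2 k a0 a bmg e]]
          [seq (inl p : ecode) | p <- enum (edge2 None S1 [set: T] Y)].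
  apply: uniq_perm; rewrite ?map_inj_uniq ?enum_uniq //; [exact: evE_inj | by move=> x y [] |].
  move=> x; apply/mapP/mapP => [[e]|[p]].
    rewrite mem_enum inE bedge_mu2; case: (evE e) => [p|//] /= pE ->; exists p => //.
    by rewrite mem_enum.
  rewrite mem_enum => pE ->; have [|e Ee] := @evE_surj (inl p).
    by rewrite inlEA; move: pE; rewrite inE in_setT /= /isleaf orbb => /andP[_ /eqP/nfl_none].
  by exists e; rewrite // mem_enum inE bedge_mu2 Ee.
move/eq_seq_msetP: mu2E; apply: perm_trans.
by have := perm_map ewt pe; rewrite -!map_comp.
Qed.

Lemma bmarked : marked_diagrams d g vmu1 vmu2 bmg.
Proof. by split; [| |exact: bfloor_diagram|exact: bmarking]. Qed.

End Build.

(** * From marked diagrams to label structures *)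

Lemma n_comp1 (T : finType) (r : rel T) (x : T) :
  symmetric r -> (forall u v, connect r u v) -> n_comp r predT = 1%N.
Proof.
move=> rC conr; rewrite -(n_comp_connect (sym_connect_sym rC) x); apply: eq_n_comp_r => v.
by rewrite !inE conr.
Qed.

Lemma inj_surj_bij (A A' : finType) (f : A -> A') :
  injective f -> (forall y, exists x, f x = y) -> bijective f.
Proof.
move=> fI fS; apply: inj_card_bij => //; rewrite -(card_codom fI); apply: subset_leq_card.
by apply/subsetP => y _; have [x <-] := fS y; apply: codom_f.
Qed.

Section Decode.
Variables (k a0 : nat) (vmu1 vmu2 : seq nat) (a : 'I_k -> nat) (d : H2 k) (g : nat).
Variable X : mgraph a0 a.
Hypotheses (XM : marked_diagrams d g vmu1 vmu2 X) (dL : 0 < dot d (clsL k))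
  (sumE : (sumn vmu1)%:Z + (sumn vmu2)%:Z = dot d (clsE k)).
Local Notation T := 'I_a0.
Local Notation M := ('I_a0 + {i : 'I_k & 'I_(a i)})%type.
Local Notation D := (diag X).
Local Notation m := (@mark k a0 a X).
Local Notation S1 := (std1 a0 (size vmu1)).
Implicit Types (u v : 'I_(nv D)) (e : 'I_(ne D)) (p q : T).

Lemma Dwt e : (0 < wt e)%N.
Proof. by have [_ _ [H _ _ _ _] _] := XM; apply: H. Qed.

Lemma Dacyclic v (s : seq 'I_(nv D)) : path (@arrow D) v s -> last v s = v -> s = [::].
Proof. by have [_ _ [_ _ H _ _] _] := XM; apply: H. Qed.

Lemma Dloop e : src e != tgt e.
Proof.
apply/eqP => E; suff : [:: src e] = [::] by []; apply: (@Dacyclic (src e)) => //=.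
by rewrite andbT; apply/existsP; exists e; rewrite -E eqxx.
Qed.

Lemma Dleaf e e' : vert_inf (src e) -> adjacent e' (src e) -> e' = e.
Proof. by case/vert_infP => e1 _ H /H ->; apply/esym/H; rewrite /adjacent eqxx. Qed.

Lemma edge_infE e : edge_inf e = vert_inf (src e).
Proof.
apply/existsP/idP => [[v /andP[lv aev]]|lv]; last by exists (src e); rewrite lv /adjacent eqxx.
by have [e1 sv H] := vert_infP lv; rewrite (H e aev) sv.
Qed.

Lemma Dtgt e : ~~ vert_inf (tgt e).
Proof.
apply/negP => lv; have [e1 sv H] := vert_infP lv.
have E : e = e1 by apply: H; rewrite /adjacent eqxx orbT.
by have := Dloop e; rewrite E sv -E eqxx.
Qed.

Lemma Dfloor v : ~~ vert_inf v -> divergence v = 2 \/ divergence v = 4.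
Proof. by have [_ _ [_ _ _ _ [H _ _ _]] _] := XM; apply: H. Qed.

Lemma Dsrc e : ~~ vert_inf (src e) -> divergence (src e) = 4.
Proof.
case/Dfloor => // dv; have [_ _ [_ _ _ _ [_ _ H _]] _] := XM.
have := H _ dv e; rewrite /adjacent eqxx => /(_ isT) E; by have := Dloop e; rewrite -E eqxx.
Qed.

Lemma Ddiv_leaf e : vert_inf (src e) -> divergence (src e) = - (wt e)%:Z.
Proof.
move=> lv; rewrite /divergence big_pred0 ?sub0r => [|e']; last first.
  by apply/eqP => E; have := Dtgt e'; rewrite E lv.
rewrite (big_pred1 e) // => e'; apply/eqP/eqP => [E|-> //].
by apply: Dleaf lv _; rewrite /adjacent E eqxx.
Qed.

Lemma Dflow (W : {set 'I_(nv D)}) : \sum_(v in W) divergence v =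
  \sum_(e | tgt e \in W) (wt e)%:Z - \sum_(e | src e \in W) (wt e)%:Z.
Proof.
rewrite /divergence sumrB; congr (_ - _).
  rewrite [RHS](partition_big (@tgt D) (mem W)) //=; apply: eq_bigr => v vW; apply: eq_bigl => e.
  by case: eqP => [->|]; rewrite ?andbF ?vW.
rewrite [RHS](partition_big (@src D) (mem W)) //=; apply: eq_bigr => v vW; apply: eq_bigl => e.
by case: eqP => [->|]; rewrite ?andbF ?vW.
Qed.

Lemma Dleaf_sum : \sum_(v : 'I_(nv D) | vert_inf v) divergence v = - (2 * dot d (clsL k)).
Proof. by have [_ _ [_ _ _ _ [_ _ _ H]] _] := XM. Qed.

Lemma Dfloor_sum : \sum_(v : 'I_(nv D) | ~~ vert_inf v) divergence v = 2 * dot d (clsL k).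
Proof.
have := Dflow [set: 'I_(nv D)].
rewrite [LHS](bigID (@vert_inf D)) /=.
rewrite (eq_bigl (@vert_inf D)) => [|v]; last by rewrite in_setT.
rewrite [X in _ + X](eq_bigl (fun v => ~~ vert_inf v)) => [|v]; last by rewrite in_setT.
rewrite Dleaf_sum [X in _ = X - _](eq_bigl predT) => [|v]; last by rewrite in_setT.
rewrite [X in _ = _ - X](eq_bigl predT) => [|v]; last by rewrite in_setT.
by rewrite subrr addrC => /eqP; rewrite subr_eq0 => /eqP.
Qed.

(** No edge leaves the set of vertices reachable from the target of [e], while [e] enters it; so its
    total divergence is at least the weight of [e]. That total is at most the sum over all floors,
    since leaves contribute nonpositively. The bound allows weights to be stored in ['I_B.+1]. *)
Lemma Dwt_bound e : (wt e)%:Z <= 2 * dot d (clsL k).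
Proof.
pose W := [set v | connect (@arrow D) (tgt e) v].
have Wcl e' : src e' \in W -> tgt e' \in W.
  rewrite !inE => /connect_trans; apply; apply: connect1; apply/existsP; exists e'; by rewrite !eqxx.
have srcW : src e \notin W.
  rewrite inE; apply/negP => /connectP[s pth lst].
  have := @Dacyclic (src e) (tgt e :: s); rewrite /= pth -lst => H.
  suff : tgt e :: s = [::] by [].
  apply: H => //; rewrite andbT; apply/existsP; exists e; by rewrite !eqxx.
have le : \sum_(v in W) divergence v <= 2 * dot d (clsL k).
  rewrite -Dfloor_sum big_mkcond [leRHS]big_mkcond; apply: ler_sum => v _.
  case: (boolP (vert_inf v)) => /= lv; case: ifP => // _; first exact: vert_inf_div.
  by case: (Dfloor lv) => ->.
apply: le_trans le; rewrite Dflow (bigID (fun e' => src e' \in W)) /=.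
rewrite (eq_bigl (fun e' => src e' \in W)) => [|e']; last first.
  by case: (boolP (src e' \in W)) => [/Wcl ->|]; rewrite ?andbF.
rewrite addrAC subrr add0r (bigD1 e) /=; last by rewrite srcW inE connect0.
by rewrite lerDl; apply: sumr_ge0.
Qed.

Lemma Dmark_inj : injective m.
Proof. by have [_ _ _ [[H _ _] _ _ _ _]] := XM. Qed.

Lemma Dmark_leaf p v : m (inl p) = inl v -> vert_inf v = (p \in S1).
Proof.
have [_ _ _ [_ _ [_ /predeqP H] _ _]] := XM; move=> E; apply/idP/idP => [lv|pS].
  have [_ H2] := H (m (inl p)); have [|p' lp' /Dmark_inj[<-]] := H2; last by rewrite inE.
  by split; [exists p | exists v].
have [H1 _] := H (m (inl p)); have [|_ [v' lv']] := H1; first by exists p => //; move: pS; rewrite inE.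
by rewrite E => -[<-].
Qed.

Lemma Dmark_vert p v : m (inl p) = inl v -> (vert_inf v /\ p \in S1) \/ (~~ vert_inf v /\ divergence v = 4).
Proof.
move=> E; case: (boolP (vert_inf v)) => lv; first by left; rewrite -(Dmark_leaf E).
right; split=> //; case: (Dfloor lv) => // dv; have [_ _ _ [[_ _ H] _ _ _ _]] := XM.
by have := H v (inl p) lv dv.
Qed.

Lemma DmarkA y : exists2 v, vert_inf v & m (inr y) = inl v.
Proof. by have [_ _ _ [_ _ [H _] _ _]] := XM; apply: H. Qed.

Lemma DS1 p : p \in S1 -> exists2 v, vert_inf v & m (inl p) = inl v.
Proof.
have [_ _ _ [_ _ [_ /predeqP H] _ _]] := XM; move=> pS.
have [H1 _] := H (m (inl p)); have [|_ [v' lv' E]] := H1; first by exists p => //; move: pS; rewrite inE.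
by exists v'.
Qed.

(** Leaves cancel against leaf edges in the Euler characteristic, so the genus gives the number of
    internal edges in terms of the floors. The degree is the number of floors plus the number of
    those of degree 2. *)
Lemma Dcount : a0 = (#|[set v : 'I_(nv D) | divergence v == 4%:Z]| + #|[set e : 'I_(ne D) | ~~ edge_inf e]| + size vmu1 + size vmu2)%N.
Proof.
have [a0E _ [_ [nv0 conD] _ betti _] _] := XM.
move: betti; rewrite /betti1 (n_comp1 (Ordinal nv0)) => [bt| |//]; last first.
  by move=> u v; rewrite /neighbor orbC.
have cL : #|[set v : 'I_(nv D) | vert_inf v]| = #|[set e : 'I_(ne D) | edge_inf e]|.
  rewrite -(card_in_imset (f := @src D) (D := [set e : 'I_(ne D) | edge_inf e])); last first.
    move=> e e'; rewrite !inE !edge_infE => lv lv' E; apply/esym/(Dleaf lv).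
    by rewrite /adjacent E eqxx.
  apply: eq_card => v; rewrite inE; apply/idP/imsetP => [lv|[e]].
    by have [e sv _] := vert_infP lv; exists e; rewrite // inE edge_infE sv.
  by rewrite inE edge_infE => lv ->.
have nvE : nv D = (#|[set v : 'I_(nv D) | vert_inf v]| + #|[set v : 'I_(nv D) | ~~ vert_inf v]|)%N.
  by rewrite -[LHS]card_ord -(cardC [set v : 'I_(nv D) | vert_inf v]); congr addn; apply: eq_card => v; rewrite !inE.
have neE : ne D = (#|[set e : 'I_(ne D) | edge_inf e]| + #|[set e : 'I_(ne D) | ~~ edge_inf e]|)%N.
  by rewrite -[LHS]card_ord -(cardC [set e : 'I_(ne D) | edge_inf e]); congr addn; apply: eq_card => e; rewrite !inE.
have dLE : dot d (clsL k) = #|[set v : 'I_(nv D) | ~~ vert_inf v]|%:Z + #|[set v : 'I_(nv D) | divergence v == 4%:Z]|%:Z.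
  apply: (@mulfI _ 2) => //; rewrite -Dfloor_sum.
  rewrite (eq_bigr (fun v => 2 + 2 * (divergence v == 4%:Z)%:Z)) => [|v /Dfloor[] -> //].
  rewrite big_split /= -big_distrr /= mulrDr; congr (_ + 2 * _).
    rewrite -sum1_card (big_morph Posz PoszD (erefl _)) big_distrr /=.
    by apply: eq_bigl => v; rewrite inE.
  rewrite -(big_morph Posz PoszD (erefl _)); congr Posz.
  rewrite -sum1_card [RHS]big_mkcond [LHS]big_mkcond /=; apply: eq_bigr => v _; rewrite inE.
  case: (boolP (vert_inf v)) => /= [/vert_inf_div|_]; last by case: eqP.
  by case: eqP => // ->.
move: bt a0E nvE neE; rewrite dLE cL; move: (#|[set e : 'I_(ne D) | edge_inf e]|) (#|[set v : 'I_(nv D) | ~~ vert_inf v]|) (#|[set v : 'I_(nv D) | divergence v == 4%:Z]|) (#|[set e : 'I_(ne D) | ~~ edge_inf e]|) (size vmu1) (size vmu2) => x y z t l1 l2; lia.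
Qed.

(** The image of A_0 is contained in the right-hand side, which by [Dcount] has no more elements
    than A_0. Equality forces every floor of degree 2 and every internal edge to be marked. *)
Lemma Dmarked_set : [set m (inl p) | p : T] =
  (inl @: [set v : 'I_(nv D) | divergence v == 4%:Z]) :|: [set m (inl p) | p in S1] :|:
  (inr @: [set e : 'I_(ne D) | ~~ edge_inf e]) :|: (inr @: [set e | @edge_mu2 k a0 a X e]).
Proof.
apply/eqP; rewrite eqEcard; apply/andP; split.
  apply/subsetP => _ /imsetP[p _ ->]; rewrite !inE; case E : (m (inl p)) => [v|e].
    case: (Dmark_vert E) => [[_ pS]|[_ dv]]; last by rewrite (imset_f inl) // inE dv.
    by rewrite -E (imset_f (fun p => m (inl p)) pS) orbT.
  case: (boolP (edge_inf e)) => ie; last by rewrite (imset_f inr (_ : e \in [set e : 'I_(ne D) | ~~ edge_inf e])) ?orbT // inE.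
  rewrite (imset_f inr (_ : e \in [set e | @edge_mu2 k a0 a X e])) ?orbT // inE /edge_mu2 ie /=.
  by apply/existsP; exists p; rewrite E.
rewrite card_imset; last by move=> p p' /Dmark_inj[].
rewrite card_ord [leqRHS]Dcount.
have c2 : #|[set e | @edge_mu2 k a0 a X e]| = size vmu2.
  have [_ _ _ [_ _ _ _ [_ /perm_size <-]]] := XM; rewrite size_map -cardE.
  by apply: eq_card => e; rewrite !inE.
have c1 : (#|S1| <= size vmu1)%N.
  suff : (size (map (@nat_of_ord a0) (enum S1)) <= size (iota 0 (size vmu1)))%N.
    by rewrite size_map size_iota -cardE.
  apply: uniq_leq_size.
    by rewrite map_inj_uniq ?enum_uniq //; exact: val_inj.
  by move=> _ /mapP[p + ->]; rewrite mem_enum inE mem_iota => /= ->.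
rewrite -c2 (addnAC _ _ (size vmu1)); do 2?[apply: leq_trans (leq_card_setU _ _) _; apply: leq_add; last exact: leq_imset_card].
apply: leq_trans (leq_card_setU _ _) _; apply: leq_add; first exact: leq_imset_card.
exact: leq_trans (leq_imset_card _ _) c1.
Qed.

Lemma Dfloor_marked v : divergence v = 4 -> exists p, m (inl p) = inl v.
Proof.
move=> dv; have : ((inl v : elt D)) \in [set m (inl p) | p : T].
  by rewrite Dmarked_set !inE (imset_f inl) // inE dv.
by case/imsetP => p _ ->; exists p.
Qed.

Lemma Dint_marked e : ~~ edge_inf e -> exists p, m (inl p) = inr e.
Proof.
move=> ie; have : (inr e : elt D) \in [set m (inl p) | p : T].
  by rewrite Dmarked_set !inE (imset_f inr (_ : e \in [set e : 'I_(ne D) | ~~ edge_inf e])) ?orbT // inE.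
by case/imsetP => p _ ->; exists p.
Qed.

Lemma Dhas_edge : exists e : 'I_(ne D), true.
Proof.
have [/existsP //|/existsPn no] := boolP [exists e : 'I_(ne D), true].
have := Dleaf_sum; rewrite big1 => [|v /vert_infP[e]]; last by have := no e.
by move: dL; lia.
Qed.

(** * The edge designated by a mark *)

Variable e0 : 'I_(ne D).

(** A mark that is not on a floor designates an edge, either directly or through its leaf. The
    default [e0] is met only for marks on floors. *)
Definition ed (x : M) : 'I_(ne D) :=
  odflt e0 [pick e | (m x == inr e) || ((m x == inl (src e)) && vert_inf (src e))].
Definition isf p : bool := if m (inl p) is inl v then ~~ vert_inf v else false.
Definition nfx (x : M) : bool := if x is inl p then ~~ isf p else true.

Lemma edP x : nfx x -> m x = inr (ed x) \/ m x = inl (src (ed x)) /\ vert_inf (src (ed x)).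
Proof.
rewrite /ed; case: pickP => [e /orP[/eqP ->|/andP[/eqP -> lv]]|no] nf; [by left|by right|].
have nl v : m x = inl v -> ~~ vert_inf v.
  move=> E; apply/negP => /[dup] lv /vert_infP[e sv _].
  by have := no e; rewrite E sv lv eqxx.
case E : (m x) => [v|e]; last by have := no e; rewrite E eqxx.
case: x nf E no nl => [p|y] /=.
  by rewrite /isf => + E _ /(_ v E); rewrite E => /negP.
by move=> _ E _ /(_ v E); have [v' lv'] := DmarkA y; rewrite E => -[->]; rewrite lv'.
Qed.

Lemma Dexcl x y e : vert_inf (src e) -> m x = inl (src e) -> m y = inr e -> False.
Proof.
move=> lv mx my; have [_ _ _ [_ H _ _ _]] := XM.
have [|[_ []]|[[]]] := H (src e) e lv; rewrite ?/adjacent ?eqxx //; first by exists y.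
by exists x.
Qed.

Lemma ed_inj x y : nfx x -> nfx y -> ed x = ed y -> x = y.
Proof.
move=> /edP hx /edP hy E; rewrite E in hx; apply: Dmark_inj.
case: hx hy => [mx|[mx lv]] [my|[my lv']]; try by rewrite mx my.
  by case: (Dexcl lv' my mx).
by case: (Dexcl lv mx my).
Qed.

Lemma ed_inr x e : m x = inr e -> nfx x /\ ed x = e.
Proof.
move=> E; have nx : nfx x by case: x E => [p|y] //= E; rewrite /isf E.
by split=> //; case: (edP nx) => [|[]]; rewrite E // => -[].
Qed.

Lemma ed_inl x e : m x = inl (src e) -> vert_inf (src e) -> nfx x /\ ed x = e.
Proof.
move=> E lv; have nx : nfx x by case: x E => [p|y] //= E; rewrite /isf E negbK.
split=> //; case: (edP nx) => [|[]]; rewrite E // => -[se _].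
by apply: (Dleaf lv); rewrite /adjacent se eqxx.
Qed.

Lemma ed_surj e : exists2 x, nfx x & ed x = e.
Proof.
case: (boolP (vert_inf (src e))) => lv; last first.
  have [|p /ed_inr[]] := @Dint_marked e; first by rewrite edge_infE.
  by exists (inl p).
have [_ _ _ [_ H _ _ _]] := XM.
have [|[[x mx] _]|[_ [x mx]]] := H (src e) e lv; rewrite ?/adjacent ?eqxx //.
  by have [] := ed_inl mx lv; exists x.
by have [] := ed_inr mx; exists x.
Qed.

Lemma sum_edges (P : pred 'I_(ne D)) (F : 'I_(ne D) -> nat) : (\sum_(e | P e) F e =
  \sum_(p | ~~ isf p && P (ed (inl p))) F (ed (inl p)) + \sum_(y | P (ed (inr y))) F (ed (inr y)))%N.
Proof.
transitivity (\sum_(e in ed @: [set x | nfx x]) if P e then F e else 0)%N.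
  rewrite big_mkcond; apply: eq_bigl => e; apply/esym/imsetP.
  by have [x nx <-] := ed_surj e; exists x; rewrite ?inE.
rewrite big_imset /=; last by move=> x y; rewrite !inE; apply: ed_inj.
rewrite -big_mkcondr big_sumType /=; congr addn; apply: eq_bigl => x; by rewrite !inE.
Qed.

Lemma ed_S1 p : p \in S1 -> ~~ isf p /\ vert_inf (src (ed (inl p))).
Proof.
move=> pS; have [v lv E] := DS1 pS; have [e sv _] := vert_infP lv; rewrite -sv in E lv.
by have [nx ->] := ed_inl E lv.
Qed.

Lemma ed_nS1 p : ~~ isf p -> p \notin S1 -> m (inl p) = inr (ed (inl p)).
Proof. by move=> /(@edP (inl p))[//|[E lv]]; rewrite -(Dmark_leaf E) lv. Qed.

Lemma ed_A y : m (inr y) = inl (src (ed (inr y))) /\ vert_inf (src (ed (inr y))).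
Proof.
have [//|E|//] := @edP (inr y); by have [v _] := DmarkA y; rewrite E.
Qed.

Lemma ed_wt_S1 p : p \in S1 -> wt (ed (inl p)) = nth 0%N vmu1 p.
Proof.
move=> pS; have [np lv] := ed_S1 pS; have [_ _ _ [_ _ _ _ [H _]]] := XM.
case: (@edP (inl p) np) => [E|[E _]]; first by have [v _] := DS1 pS; rewrite E.
by apply: (H _ _ _ _ E); rewrite /adjacent ?eqxx //; move: pS; rewrite inE.
Qed.

Definition mu2set : {set T} := [set p | [&& ~~ isf p, p \notin S1 & vert_inf (src (ed (inl p)))]].

Lemma perm_mu2 : perm_eq [seq wt (ed (inl p)) | p <- enum mu2set] vmu2.
Proof.
have [_ _ _ [_ _ _ _ [_ H]]] := XM; apply: perm_trans H.
rewrite (map_comp (@wt D) (fun p => ed (inl p))); apply: perm_map.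
apply: uniq_perm; rewrite ?enum_uniq //.
  rewrite map_inj_in_uniq ?enum_uniq // => p p'; rewrite !mem_enum !inE => /andP[np _] /andP[np' _].
  by move/(@ed_inj (inl p) (inl p') np np') => [].
move=> e; rewrite mem_enum inE /edge_mu2 edge_infE; apply/mapP/andP => [[p]|[lv /existsP[p /eqP E]]].
  rewrite mem_enum inE => /and3P[np pS lv] ->; split=> //; apply/existsP; exists p.
  by rewrite (ed_nS1 np pS).
have [np eE] := ed_inr E; exists p => //; rewrite mem_enum inE eE lv andbT; apply/andP; split=> //.
by apply/negP => /DS1[v _]; rewrite E.
Qed.

Lemma sum_leaf_wt : (\sum_(e : 'I_(ne D) | edge_inf e) wt e)%N%:Z = 2 * dot d (clsL k).
Proof.
apply: oppr_inj; rewrite -Dleaf_sum (big_morph Posz PoszD (erefl _)) -sumrN.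
rewrite [RHS](eq_bigl (mem (@src D @: [set e : 'I_(ne D) | edge_inf e]))) => [|v]; last first.
  apply/idP/imsetP => [lv|[e]]; last by rewrite inE edge_infE => lv ->.
  by have [e sv _] := vert_infP lv; exists e; rewrite // inE edge_infE sv.
rewrite big_imset /=; last first.
  move=> e e'; rewrite !inE !edge_infE => lv lv' E; apply/esym/(Dleaf lv).
  by rewrite /adjacent E eqxx.
by apply: eq_big => e; rewrite ?inE // edge_infE => /Ddiv_leaf ->.
Qed.

(** The weights of all leaf edges add up to 2 d.[L], that is, |mu_1| + |mu_2| plus the sum of the
    d.[E_i]. So the edges marked by the A_i weigh 1 on average, and none weighs less. *)
Lemma ed_wt_A y : wt (ed (inr y)) = 1%N.
Proof.
have [a0E aE _ _] := XM.
have l1a : (size vmu1 <= a0)%N by rewrite Dcount; lia.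
have sA : (\sum_y wt (ed (inr y)) = \sum_(y : {i : 'I_k & 'I_(a i)}) 1)%N.
  have := sum_leaf_wt; rewrite sum_edges [X in (_ + X)%N](eq_bigl predT) => [|z]; last first.
    by rewrite edge_infE; have [] := ed_A z.
  rewrite (bigID (mem S1)) /=.
  have -> : (\sum_(p | (~~ isf p && edge_inf (ed (inl p))) && (p \in S1)) wt (ed (inl p)) = sumn vmu1)%N.
    rewrite -(sumn_mset vmu1) -(wts_std1 l1a) sumn_wts; apply: eq_big => p.
      by case: (boolP (p \in S1)) => pS; rewrite ?andbF // andbT edge_infE; case: (ed_S1 pS) => -> ->.
    by case/andP => _ pS; rewrite ed_wt_S1.
  have -> : (\sum_(p | (~~ isf p && edge_inf (ed (inl p))) && (p \notin S1)) wt (ed (inl p)) = sumn vmu2)%N.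
    rewrite sumnE -(perm_big _ perm_mu2) big_map big_enum; apply: eq_bigl => p.
    by rewrite edge_infE [RHS]inE andbAC andbA.
  rewrite !PoszD sumE dotE dotL sum1_card card_tagged sumnE big_map.
  have : (\sum_(j <- enum 'I_k) #|'I_(a j)|)%N%:Z = - \sum_i d.2 i.
    rewrite big_enum (big_morph Posz PoszD (erefl _)) -sumrN; apply: eq_bigr => i _.
    by rewrite card_ord aE dotEi.
  move: (\sum_i d.2 i) (\sum_(j <- _) _)%N (\sum_y _)%N => x n n'; lia.
have := sA; rewrite (bigD1 y) //= [in RHS](bigD1 y) //=.
have : (\sum_(i | i != y) 1 <= \sum_(i | i != y) wt (ed (inr i)))%N.
  by apply: leq_sum => z _; apply: Dwt.
have := Dwt (ed (inr y)); move: (wt (ed (inr y))) (\sum_(i | i != y) wt (ed (inr i)))%N (\sum_(i | i != y) 1)%N => x y1 z; lia.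
Qed.

Definition flv p : 'I_(nv D) :=
  if isf p then (if m (inl p) is inl v then v else src e0) else tgt (ed (inl p)).
Definition labV v : option T := [pick p | m (inl p) == inl v].
Definition Jv v : {set 'I_k} := [set i | [exists n : 'I_(a i), tgt (ed (inr (existT _ i n))) == v]].

Lemma flv_nfl p : ~~ isf p -> flv p = tgt (ed (inl p)).
Proof. by rewrite /flv => /negbTE ->. Qed.

Lemma isfP p : isf p -> [/\ m (inl p) = inl (flv p), ~~ vert_inf (flv p) & divergence (flv p) = 4].
Proof.
move=> fp; rewrite /flv fp; move: fp; rewrite /isf; case E : (m (inl p)) => [v|//] lv.
by case: (Dmark_vert E) => [[]|[_ dv]]; first by rewrite (negbTE lv).
Qed.

Lemma flv_floor p : ~~ vert_inf (flv p).
Proof. by case: (boolP (isf p)) => [/isfP[]|/flv_nfl ->] //; apply: Dtgt. Qed.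

Lemma mark_isf p v : m (inl p) = inl v -> ~~ vert_inf v -> isf p /\ flv p = v.
Proof. by move=> E lv; have fp : isf p; rewrite /flv /isf E lv. Qed.

Lemma isf_inj p q : isf p -> isf q -> flv p = flv q -> p = q.
Proof.
by move=> /isfP[mp _ _] /isfP[mq _ _] E; move: mp; rewrite E -mq => /Dmark_inj[].
Qed.

Lemma labVP p v : m (inl p) = inl v -> labV v = Some p.
Proof.
move=> E; rewrite /labV; case: pickP => [q /eqP Eq|no]; last by have := no p; rewrite E eqxx.
by move: Eq; rewrite -E => /Dmark_inj[->].
Qed.

Lemma labVE v p : labV v = Some p -> m (inl p) = inl v.
Proof. by rewrite /labV; case: pickP => // q /eqP E [<-]. Qed.

(** At most one edge marked by A_i enters a given floor, so these edges are counted by their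
    indices, and each has weight 1. *)
Lemma Jv_card v : ~~ vert_inf v ->
  (\sum_(y : {i : 'I_k & 'I_(a i)} | tgt (ed (inr y)) == v) wt (ed (inr y)) = #|Jv v|)%N.
Proof.
move=> lv; have [_ _ _ [_ _ _ H _]] := XM.
transitivity #|[set tag y | y in [pred y : {i : 'I_k & 'I_(a i)} | tgt (ed (inr y)) == v]]|; last first.
  apply: eq_card => i; rewrite inE; apply/imsetP/existsP => [[[i' n] +]|[n En]].
    by rewrite inE /= => En ->; exists n.
  by exists (existT _ i n).
rewrite card_in_imset => [|y y'].
  by rewrite -sum1_card; apply: eq_bigr => y _; rewrite ed_wt_A.
rewrite !inE => ty ty' tg; have /card_le1_eqP H1 := H (tag y) v lv.
have Hy (z : {i : 'I_k & 'I_(a i)}) : tgt (ed (inr z)) == v -> tag z = tag y ->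
    ed (inr z) \in [pred e | adjacent e v & [exists u, adjacent e u && marked_by (X := X) (tag y) u]].
  case: z => i n /= tz <-; rewrite inE /adjacent tz orbT /=.
  apply/existsP; exists (src (ed (inr (existT _ i n)))); rewrite eqxx /=.
  by apply/existsP; exists n; have [-> _] := ed_A (existT _ i n).
by have /ed_inj := H1 _ _ (Hy y ty erefl) (Hy y' ty' (esym tg)) => /(_ isT isT)[].
Qed.

Lemma inflow v : ~~ vert_inf v -> (\sum_(e | tgt e == v) wt e =
  \sum_(p | ~~ isf p && (flv p == v)) wt (ed (inl p)) + #|Jv v|)%N.
Proof.
move=> lv; rewrite sum_edges Jv_card //; congr addn; apply: eq_bigl => p.
by case: (boolP (isf p)) => //= fp; rewrite flv_nfl.
Qed.

Lemma outflow v : ~~ vert_inf v -> (\sum_(e | src e == v) wt e =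
  \sum_(p | ~~ isf p && (src (ed (inl p)) == v)) wt (ed (inl p)))%N.
Proof.
move=> lv; rewrite sum_edges [X in (_ + X)%N]big_pred0 ?addn0 // => y.
by apply/eqP => E; have [_] := ed_A y; rewrite E (negbTE lv).
Qed.

Lemma div_flow v : divergence v = (\sum_(e | tgt e == v) wt e)%N%:Z - (\sum_(e | src e == v) wt e)%N%:Z.
Proof. by rewrite /divergence !(big_morph Posz PoszD (erefl _)). Qed.

Lemma inflow2 v : divergence v = 2 ->
  (\sum_(p | ~~ isf p && (flv p == v)) wt (ed (inl p)) + #|Jv v| = 2)%N.
Proof.
move=> dv; have lv : ~~ vert_inf v by apply/negP => /vert_inf_div; rewrite dv.
have := dv; rewrite div_flow [X in _ - Posz X]big_pred0 => [|e]; last first.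
  by apply/eqP => E; have := @Dsrc e; rewrite E lv dv => /(_ isT).
by rewrite inflow //; lia.
Qed.

Definition etg p : T :=
  if divergence (flv p) == 4 then odflt p (labV (flv p))
  else odflt p [pick q | [&& q != p, ~~ isf q & flv q == flv p]].

Lemma etg4 p : divergence (flv p) = 4 -> isf (etg p) /\ flv (etg p) = flv p.
Proof.
move=> dv; rewrite /etg dv eqxx; have [q mq] := Dfloor_marked dv; rewrite (labVP mq) /=.
exact: (mark_isf mq (flv_floor p)).
Qed.

(** A total incoming weight of 2 admits at most two labelled edges; if there are two, each has
    weight 1 and nothing is left for the A_i. *)
Lemma etg2 p : ~~ isf p -> divergence (flv p) = 2 ->
  [/\ ~~ isf (etg p), flv (etg p) = flv p,
      forall q, ~~ isf q -> flv q = flv p -> q = p \/ q = etg p &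
      if etg p == p then (wt (ed (inl p)) + #|Jv (flv p)| = 2)%N
      else wt (ed (inl p)) = 1%N /\ Jv (flv p) = set0].
Proof.
move=> np dv; have := inflow2 dv; rewrite /etg dv /= (bigD1 p) ?np ?eqxx //=.
have wp := Dwt (ed (inl p)).
case: pickP => [q /and3P[qp nq /eqP fq]|no] /=; last first.
  rewrite eqxx big_pred0 ?addn0 => [E|q]; last first.
    by have := no q; case: eqVneq => //=; rewrite ?andbF ?andbT.
  split=> // q nq fq; left; apply/eqP; apply: contraFT (no q) => ->.
  by rewrite nq fq eqxx.
rewrite (bigD1 q) ?nq ?fq ?eqxx //= (negbTE qp) => E.
have wq := Dwt (ed (inl q)); split=> //; last first.
  have [E1 E2] : wt (ed (inl p)) = 1%N /\ #|Jv (flv p)| = 0%N.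
    by move: E wp wq; move: (wt (ed (inl p))) (wt (ed (inl q))) (#|Jv _|) (\sum_(i | _) _)%N => x y z t; lia.
  by split=> //; apply/eqP; rewrite -cards_eq0 E2.
move=> r nr fr; case: (eqVneq r p) => [|rp]; first by left.
case: (eqVneq r q) => [|rq]; first by right.
move: E; rewrite (bigD1 r) ?nr ?fr ?eqxx ?rp ?rq //= => E; exfalso; move: E wp wq (Dwt (ed (inl r))).
by move: (wt (ed (inl p))) (wt (ed (inl q))) (wt (ed (inl r))) (#|Jv _|) (\sum_(i | _) _)%N => x y z t t'; lia.
Qed.

Lemma flv_etg p : ~~ isf p -> flv (etg p) = flv p.
Proof.
by move=> np; case: (Dfloor (flv_floor p)) => [/(etg2 np)[]|/etg4[]].
Qed.

(** * The label structure of a marked diagram *)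

Variable B : nat.
Hypothesis dB : 2 * dot d (clsL k) <= B%:Z.

(** The weight survives [inord] by [Dwt_bound]. When two labels enter the same floor of degree 1, no
    A_i is attached to it and both store the empty set. *)
Definition enc : str k B T := [ffun p =>
  if isf p then (Some p, p, ord0, Jv (flv p))
  else (if vert_inf (src (ed (inl p))) then None else labV (src (ed (inl p))), etg p,
        inord (wt (ed (inl p))), if etg p == p then Jv (flv p) else set0)].

Lemma enc_src p : lsrc enc p = if isf p then Some p else
  if vert_inf (src (ed (inl p))) then None else labV (src (ed (inl p))).
Proof. by rewrite /lsrc ffunE; case: ifP. Qed.
Lemma enc_tgt p : ltgt enc p = if isf p then p else etg p.
Proof. by rewrite /ltgt ffunE; case: ifP. Qed.
Lemma enc_wt p : lwt enc p = if isf p then 0%N else wt (ed (inl p)).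
Proof.
rewrite /lwt ffunE; case: ifP => // _; rewrite /= inordK // ltnS.
by have := Dwt_bound (ed (inl p)); move: dB; move: (dot _ _) (wt _) => x y; lia.
Qed.
Lemma enc_set p : lset enc p = if isf p || (etg p == p) then Jv (flv p) else set0.
Proof. by rewrite /lset ffunE; case: (isf p). Qed.

Lemma enc_isfl p : isfl enc p = isf p.
Proof.
rewrite /isfl enc_src; case: ifP => [|np]; first by rewrite eqxx.
case: ifP => // lv; apply/eqP => /labVE E; have [] := mark_isf E; rewrite ?np ?lv //.
Qed.

Lemma enc_out p q : ~~ isf q -> isf p -> (lsrc enc q == Some p) = (src (ed (inl q)) == flv p).
Proof.
move=> nq fp; rewrite enc_src (negbTE nq); have [mp lv _] := isfP fp.
case: ifP => ls; first by apply/esym/eqP => E; rewrite E (negbTE lv) in ls.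
apply/eqP/eqP => [/labVE|->]; first by rewrite mp => -[].
exact: labVP.
Qed.

Lemma etg_isf p q : ~~ isf q -> isf p -> (etg q == p) = (flv q == flv p).
Proof.
move=> nq fp; apply/eqP/eqP => [<-|E]; first by rewrite flv_etg.
have [_ _ dv] := isfP fp; rewrite -E in dv; have [fe Ee] := etg4 dv.
by apply: isf_inj => //; rewrite Ee.
Qed.

Lemma Dincr p q : elt_lt (m (inl q)) (m (inl p)) -> (q < p)%N.
Proof. by have [_ _ _ [[_ H _] _ _ _ _]] := XM; apply: H. Qed.

Local Notation ok1 := (ok None S1 (fun p : T => nth 0%N vmu1 p) (fun p : T => nat_of_ord p)).

Lemma enc_okl_fl p : isf p ->
  okl None S1 (fun p : T => nth 0%N vmu1 p) (fun p : T => nat_of_ord p) [set: T] enc p.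
Proof.
move=> fp; rewrite /okl enc_isfl fp enc_tgt fp enc_wt fp enc_set fp /= !eqxx /=.
rewrite (_ : p \notin S1) /=; last by apply/negP => /ed_S1[]; rewrite fp.
have [mp lv dv] := isfP fp.
have -> : inw enc p = (\sum_(q | ~~ isf q && (flv q == flv p)) wt (ed (inl q)))%N.
  rewrite /inw; apply: eq_big => q; rewrite enc_tgt.
    case: (boolP (isf q)) => nq /=; first by case: eqP.
    by rewrite etg_isf //; case: (eqVneq q p) => [E|]; rewrite ?andbT //; move: nq; rewrite E fp.
  by rewrite enc_wt; case: ifP => // _ /andP[->].
have -> : outw enc p = (\sum_(q | ~~ isf q && (src (ed (inl q)) == flv p)) wt (ed (inl q)))%N.
  rewrite /outw; apply: eq_big => q.
    case: (boolP (isf q)) => nq /=.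
      by rewrite enc_src nq (inj_eq Some_inj); case: eqP.
    by rewrite enc_out //; case: (eqVneq q p) => [E|]; rewrite ?andbT //; move: nq; rewrite E fp.
  rewrite enc_wt enc_src; case: ifP => // _ /andP[/eqP[->]]; by rewrite eqxx.
have H (x y z : nat) : (x + y)%N%:Z - z%:Z = 4 -> (x + y == 4 + z)%N by lia.
by apply: H; rewrite -inflow // -outflow // -div_flow.
Qed.

Lemma enc_okl_nfl p : ~~ isf p ->
  okl None S1 (fun p : T => nth 0%N vmu1 p) (fun p : T => nat_of_ord p) [set: T] enc p.
Proof.
move=> np; rewrite /okl enc_isfl (negbTE np) enc_wt (negbTE np) Dwt /=.
apply/and3P; split.
- by apply/implyP => /ed_wt_S1 ->.
- rewrite enc_src (negbTE np); case: ifP => // /negbT lv.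
  have [s ms] := Dfloor_marked (Dsrc lv); rewrite (labVP ms) in_setT enc_isfl /=.
  have [-> _] := mark_isf ms lv.
  have pS : p \notin S1 by apply/negP => /ed_S1[_]; rewrite (negbTE lv).
  rewrite pS /=; apply: Dincr; rewrite ms (ed_nS1 np pS) /elt_lt /=.
  by apply: connect1; rewrite /= eqxx.
rewrite enc_tgt (negbTE np) enc_set (negbTE np) /=.
case: (Dfloor (flv_floor p)) => dv; last first.
  have [fe Ee] := etg4 dv; have ne : etg p == p = false by apply/eqP => E; rewrite -E fe in np.
  rewrite ne in_setT enc_isfl fe eqxx /=; case: (boolP (p \in S1)) => //= pS.
  have [me _ _] := isfP fe; apply: Dincr; rewrite me Ee (ed_nS1 np pS) flv_nfl // /elt_lt /=.
  by apply: connect1; rewrite /= eqxx.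
have [ne Ee He] := etg2 np dv; case: eqP => [_ -> //|/eqP epp [wp Jp]].
rewrite in_setT enc_isfl (negbTE ne) eqxx /= wp eqxx andbT enc_tgt (negbTE ne).
have dv' : divergence (flv (etg p)) = 2 by rewrite Ee.
have [_ _ He' _] := etg2 ne dv'; case: (He' p np (esym Ee)) => [E|<-//].
by rewrite -E eqxx in epp.
Qed.

Lemma enc_ok : ok1 [set: T] enc.
Proof.
apply/forallP => p; rewrite in_setT; case: (boolP (isf p)); [exact: enc_okl_fl|exact: enc_okl_nfl].
Qed.

Lemma flv_tgt p : flv (ltgt enc p) = flv p.
Proof. by rewrite enc_tgt; case: (boolP (isf p)) => // /flv_etg. Qed.

Lemma flv_rt p : flv (rt enc p) = flv p.
Proof. by case: (rt_or enc p) => ->; rewrite ?flv_tgt. Qed.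

Lemma flv_inj p q : flv p = flv q -> rt enc p = rt enc q.
Proof.
move=> E; case: (Dfloor (flv_floor p)) => dv; last first.
  have H r : flv r = flv p -> exists2 s, rt enc r = s & isf s /\ flv s = flv p.
    move=> Er; case: (boolP (isf r)) => fr.
      by exists r; rewrite // (rt_fl enc_ok) // enc_isfl.
    have dr : divergence (flv r) = 4 by rewrite Er.
    have [fe Ee] := etg4 dr; exists (etg r); last by rewrite Ee.
    by rewrite /rt enc_tgt (negbTE fr) enc_isfl fe.
  have [s -> [fs es]] := H p erefl; have [s' -> [fs' es']] := H q (esym E).
  by apply: isf_inj; rewrite // es.
have nf r : flv r = flv p -> ~~ isf r by move=> Er; apply/negP => /isfP[_ _]; rewrite Er dv.
have [_ _ H _] := etg2 (nf p erefl) dv; case: (H q (nf q (esym E)) (esym E)) => -> //.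
by have := rt_tgt enc_ok p; rewrite enc_tgt (negbTE (nf p erefl)) => ->.
Qed.

Lemma enc_set_fix q : rt enc q = q -> lset enc q = Jv (flv q).
Proof.
move=> rq; rewrite enc_set; case: (boolP (isf q)) => //= nq; case: eqP => // /eqP ne.
case: (Dfloor (flv_floor q)) => dv; last first.
  have [fe _] := etg4 dv; move: rq; rewrite /rt enc_tgt (negbTE nq) enc_isfl fe => E.
  by rewrite E eqxx in ne.
by have [_ _ _] := etg2 nq dv; rewrite (negbTE ne) => -[_ ->].
Qed.

Variable p0 : T.

(** If only edges marked by the A_i entered [v], then [v] and their leaves would be closed under
    adjacency and hence form the whole connected diagram, in which the label [p0] would have no
    place. *)
Lemma floor2_label v : divergence v = 2 -> exists2 p, ~~ isf p & flv p = v.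
Proof.
move=> dv; have lv : ~~ vert_inf v by apply/negP => /vert_inf_div; rewrite dv.
case: (pickP (fun p => ~~ isf p && (flv p == v))) => [p /andP[np /eqP]|no]; first by exists p.
have vA e : tgt e = v -> exists y, e = ed (inr y).
  have [[p|y] /= nx <-] := ed_surj e => E; last by exists y.
  by have := no p; rewrite nx flv_nfl // E eqxx.
have vS e : src e != v.
  by apply/eqP => E; have := @Dsrc e; rewrite E lv dv => /(_ isT).
pose W := [pred u | (u == v) || [exists e, (src e == u) && (tgt e == v)]].
have WT u : W u.
  have [_ _ [_ [_ conD] _ _ _] _] := XM.
  apply: (@connect_closed_sub _ (@neighbor D) W v u) (conD v u); last by rewrite /= eqxx.
  move=> x y /orP[/eqP ->|/existsP[e /andP[/eqP <- /eqP te]]].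
    case/orP => /existsP[e /andP[/eqP se /eqP te]]; first by have := vS e; rewrite se eqxx.
    by apply/orP; right; apply/existsP; exists e; rewrite se te !eqxx.
  have [z Ez] := vA e te; have [_ lz] := ed_A z; rewrite -Ez in lz.
  case/orP => /existsP[e' /andP[/eqP se /eqP te']]; last first.
    by have := Dtgt e'; rewrite te' lz.
  have E : e' = e by apply: (Dleaf lz); rewrite /adjacent se eqxx.
  by rewrite /= -te' E te eqxx.
case: (boolP (isf p0)) => f0.
  have [_ l0 d0] := isfP f0; case/orP: (WT (flv p0)) => [/eqP E|/existsP[e /andP[/eqP se /eqP te]]].
    by move: d0; rewrite E dv.
  by have [z Ez] := vA e te; have [_] := ed_A z; rewrite -Ez se (negbTE l0).
case/orP: (WT (src (ed (inl p0)))) => [|/existsP[e /andP[/eqP se /eqP te]]].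
  by rewrite (negbTE (vS _)).
have [z Ez] := vA e te; have [_ lz] := ed_A z; rewrite -Ez in lz.
have E : ed (inl p0) = e by apply: (Dleaf lz); rewrite /adjacent se eqxx.
by have := @ed_inj (inl p0) (inr z) f0 isT; rewrite E -Ez => /(_ erefl).
Qed.

Lemma rep_ex v : ~~ vert_inf v -> exists2 q, rt enc q = q & flv q = v.
Proof.
case/Dfloor => dv; last first.
  have [p mp] := Dfloor_marked dv; have [fp <-] : isf p /\ flv p = v.
    by apply: mark_isf mp _; apply/negP => /vert_inf_div; rewrite dv.
  by exists p; rewrite // (rt_fl enc_ok) // enc_isfl.
have [p _ <-] := floor2_label dv; exists (rt enc p); rewrite ?flv_rt //.
by rewrite (rt_idem enc_ok).
Qed.

Definition rep v : T := odflt p0 [pick q | (rt enc q == q) && (flv q == v)].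

Lemma repP v : ~~ vert_inf v -> rt enc (rep v) = rep v /\ flv (rep v) = v.
Proof.
move=> lv; rewrite /rep; case: pickP => [q /andP[/eqP ? /eqP ?] //|no].
by have [q rq fq] := rep_ex lv; have := no q; rewrite rq fq !eqxx.
Qed.

Lemma rep_flv p : rep (flv p) = rt enc p.
Proof.
by have [rE E] := repP (flv_floor p); rewrite -rE; apply: flv_inj.
Qed.

Lemma connect_rt_enc p : connect (lnk enc) p (rt enc p).
Proof.
case: (rt_or enc p) => ->; first exact: connect0.
by apply: connect1; rewrite /lnk eqxx !orbT.
Qed.

Lemma enc_conn : conn [set: T] enc.
Proof.
apply/andP; split; first by apply/set0Pn; exists p0; rewrite in_setT.
(* A leaf is sent to the label of the floor to which it is attached, so that the two ends of every
   arrow go to connected labels. *)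
pose f v := if vert_inf v then rep (tgt (odflt e0 [pick e | src e == v])) else rep v.
have fsrc e : vert_inf (src e) -> f (src e) = rep (tgt e).
  move=> lv; rewrite /f lv; case: pickP => [e' /eqP se|/(_ e)]; last by rewrite eqxx.
  by rewrite (Dleaf lv (e' := e')) // /adjacent se eqxx.
have ftgt e : f (tgt e) = rep (tgt e) by rewrite /f (negbTE (Dtgt e)).
have arr u v : arrow u v -> connect (lnk enc) (f u) (f v).
  case/existsP => e /andP[/eqP <- /eqP <-]; rewrite ftgt.
  case: (boolP (vert_inf (src e))) => lv; first by rewrite fsrc // connect0.
  have [[p|y] nx ee] := ed_surj e; last by have [_] := ed_A y; rewrite ee (negbTE lv).
  rewrite /f (negbTE lv); have [s ms] := Dfloor_marked (Dsrc lv); have [fs Es] := mark_isf ms lv.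
  rewrite -Es rep_flv -ee -flv_nfl // rep_flv.
  apply: connect_trans (_ : connect (lnk enc) s _); first by rewrite connect_lnkC connect_rt_enc.
  apply: connect_trans (connect_rt_enc p); apply: connect1.
  by rewrite /lnk !enc_isfl fs (enc_out nx fs) ee Es eqxx /= orbT.
have fc u v : connect (lnk enc) (f u) (f v).
  have [_ _ [_ [_ conD] _ _ _] _] := XM; apply: connect_map (conD u v) => x y.
  by case/orP => /arr //; rewrite connect_lnkC.
have fp p : connect (lnk enc) p (f (flv p)).
  by rewrite /f (negbTE (flv_floor p)) rep_flv connect_rt_enc.
apply/forall_inP => p _; apply/forall_inP => q _; apply: connect_trans (fp p) _.
by apply: connect_trans (fc _ (flv q)) _; rewrite connect_lnkC fp.
Qed.

Lemma Jv_uniq v i (n n' : 'I_(a i)) :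
  tgt (ed (inr (existT _ i n))) = v -> tgt (ed (inr (existT _ i n'))) = v -> n = n'.
Proof.
move=> tn tn'; have lv : ~~ vert_inf v by rewrite -tn; apply: Dtgt.
have [_ _ _ [_ _ _ H _]] := XM; have /card_le1_eqP H1 := H i v lv.
have Hy (z : 'I_(a i)) : tgt (ed (inr (existT _ i z))) = v ->
    ed (inr (existT _ i z)) \in [pred e | adjacent e v & [exists u, adjacent e u && marked_by (X := X) i u]].
  move=> tz; rewrite inE /adjacent tz eqxx orbT /=.
  apply/existsP; exists (src (ed (inr (existT _ i z)))); rewrite eqxx /=.
  by apply/existsP; exists z; have [-> _] := ed_A (existT _ i z).
have /ed_inj := H1 _ _ (Hy n tn) (Hy n' tn') => /(_ isT isT)[E].
by have := congr1 (tagged_as (existT (fun i => 'I_(a i)) i n)) E; rewrite !tagged_asE.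
Qed.

Lemma enc_cardJ i : #|[set p | i \in lset enc p]| = a i.
Proof.
rewrite -[RHS]card_ord.
have fI : injective (fun n : 'I_(a i) => rep (tgt (ed (inr (existT _ i n))))).
  move=> n n' E; have [_ E1] := repP (Dtgt (ed (inr (existT _ i n)))).
  by apply: (Jv_uniq (v := tgt (ed (inr (existT _ i n'))))); rewrite // -E1 E; have [] := repP (Dtgt (ed (inr (existT _ i n')))).
rewrite -(card_imset _ fI); apply: eq_card => p; rewrite inE; apply/idP/imsetP => [ip|[n _ ->]].
  have rp : rt enc p = p.
    by apply/eqP; apply: contraTT ip => /(lset_rt enc_ok) ->; rewrite inE.
  move: ip; rewrite enc_set_fix // inE => /existsP[n /eqP tn]; exists n => //.
  by rewrite tn rep_flv rp.
have [rp fp] := repP (Dtgt (ed (inr (existT _ i n)))); rewrite enc_set_fix // fp inE.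
by apply/existsP; exists n.
Qed.

Lemma enc_mu2 : wts (lwt enc) (edge2 None S1 [set: T] enc) = seq_mset vmu2.
Proof.
apply/eq_seq_msetP; apply: perm_trans perm_mu2.
have -> : edge2 None S1 [set: T] enc = mu2set.
  apply/setP => p; rewrite [LHS]inE [RHS]inE in_setT /isleaf orbb enc_src /=.
  case: (boolP (isf p)) => np /=; first by rewrite andbF.
  congr andb; case: (boolP (vert_inf _)) => //= lv.
  by have [s ms] := Dfloor_marked (Dsrc lv); rewrite (labVP ms).
rewrite (_ : [seq lwt enc p | p <- enum mu2set] = [seq wt (ed (inl p)) | p <- enum mu2set]) //.
by apply/eq_in_map => p; rewrite mem_enum inE => /andP[np _]; rewrite enc_wt (negbTE np).
Qed.

Lemma mark_S1 p : p \in S1 -> m (inl p) = inl (src (ed (inl p))).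
Proof.
by move=> pS; have [np _] := ed_S1 pS; have [v _ mv] := DS1 pS; case: (@edP (inl p) np) => [|[]]; rewrite ?mv.
Qed.

Lemma enc_none p : lsrc enc p = None -> ~~ isf p /\ vert_inf (src (ed (inl p))).
Proof.
rewrite enc_src; case: ifP => // np; case: ifP => // /negbT lv.
by have [s ms] := Dfloor_marked (Dsrc lv); rewrite (labVP ms).
Qed.

(** * The isomorphism from the rebuilt diagram *)

Definition phiE (x : ecode k a0) : 'I_(ne D) :=
  match x with
  | inl p => ed (inl p)
  | inr (q, i) =>
    if [pick n : 'I_(a i) | tgt (ed (inr (existT _ i n))) == flv q] is Some n
    then ed (inr (existT _ i n)) else e0
  end.
Definition phiV (x : vcode k a0) : 'I_(nv D) :=
  match x with
  | inl (inl q) => flv q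
  | inl (inr p) => src (ed (inl p))
  | inr (q, i) => src (phiE (inr (q, i)))
  end.

Lemma phiE_inr q i : i \in lset enc q -> exists n : 'I_(a i),
  [/\ rt enc q = q, tgt (ed (inr (existT _ i n))) = flv q & phiE (inr (q, i)) = ed (inr (existT _ i n))].
Proof.
move=> iq; have rq : rt enc q = q.
  by apply/eqP; apply: contraTT iq => /(lset_rt enc_ok) ->; rewrite inE.
move: iq; rewrite enc_set_fix // inE => /existsP[n tn] /=.
by case: pickP => [n' /eqP tn'|/(_ n)]; [exists n' | rewrite tn].
Qed.

Lemma phiE_src x : x \in EA enc -> src (phiE x) = phiV (esrc enc x).
Proof.
case: x => [p|[q i]] //; rewrite inlEA /= => np.
case E : (lsrc enc p) => [s|] //=; rewrite enc_isfl in np.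
move: E; rewrite enc_src (negbTE np); case: ifP => // /negbT lv /labVE ms.
by have [_ ->] := mark_isf ms lv.
Qed.

Lemma phiE_tgt x : x \in EA enc -> tgt (phiE x) = phiV (etgt enc x).
Proof.
case: x => [p|[q i]]; first by rewrite inlEA enc_isfl /= flv_rt => /flv_nfl.
by rewrite inrEA => /phiE_inr[n [_ tn ->]].
Qed.

Lemma phiE_wt x : x \in EA enc -> wt (phiE x) = ewt enc x.
Proof.
case: x => [p|[q i]]; first by rewrite inlEA enc_isfl /= enc_wt => /negbTE ->.
by rewrite inrEA => /phiE_inr[n [_ _ ->]]; rewrite ed_wt_A.
Qed.

Lemma phiE_inj x x' : x \in EA enc -> x' \in EA enc -> phiE x = phiE x' -> x = x'.
Proof.
case: x x' => [p|[q i]] [p'|[q' i']]; rewrite ?inlEA ?inrEA ?enc_isfl.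
- by move=> np np' /(@ed_inj (inl p) (inl p') np np') => -[->].
- by move=> np /phiE_inr[n [_ _ ->]] /(@ed_inj (inl p) (inr _) np isT).
- by move=> /phiE_inr[n [_ _ ->]] np' /(@ed_inj (inr _) (inl p') isT np').
move=> /phiE_inr[n [rq tn ->]] /phiE_inr[n' [rq' tn' ->]] E.
have E2 := @ed_inj (inr _) (inr _) isT isT E; have Ei : i = i' by case: E2.
subst i'; congr (inr (_, _)); rewrite -rq -rq'; apply: flv_inj.
by rewrite -tn -tn' E.
Qed.

Lemma phiE_surj e : exists2 x, x \in EA enc & phiE x = e.
Proof.
have [[p|[i n]] nx <-] := ed_surj e; first by exists (inl p); rewrite // inlEA enc_isfl.
have [rq fq] := repP (Dtgt (ed (inr (existT _ i n)))).
have iq : i \in lset enc (rep (tgt (ed (inr (existT _ i n))))).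
  by rewrite enc_set_fix // fq inE; apply/existsP; exists n.
exists (inr (rep (tgt (ed (inr (existT _ i n)))), i)); first by rewrite inrEA.
have [n' [_ tn' ->]] := phiE_inr iq; rewrite fq in tn'.
by rewrite (Jv_uniq tn' erefl).
Qed.

Lemma phiV_leaf x : x \in VA enc -> (forall q, x <> vfl k q) ->
  exists y, [/\ y \in EA enc, esrc enc y = x & vert_inf (phiV x)].
Proof.
case: x => [[q|p]|[q i]].
- by move=> _ /(_ q).
- rewrite vlfA => /eqP sp _; have [np lv] := enc_none sp; exists (inl p).
  by rewrite inlEA enc_isfl np /= sp lv.
rewrite velA => iq _; exists (inr (q, i)); rewrite inrEA iq; split=> //=.
by have := phiE_inr iq => -[n [_ _]] /= ->; have [] := ed_A (existT _ i n).
Qed.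

Lemma phiV_inj x x' : x \in VA enc -> x' \in VA enc -> phiV x = phiV x' -> x = x'.
Proof.
move=> xA xA' E.
have fl y : y \in VA enc -> (exists q, y = vfl k q) \/ (forall q, y <> vfl k q).
  by case: y => [[q|p]|[q i]] _; [left; exists q|right|right].
case: (fl _ xA) (fl _ xA') => [[q Eq]|nx] [[q' Eq']|nx'].
- move: xA xA' E; rewrite Eq Eq' !vflA /= => /eqP rq /eqP rq' /flv_inj.
  by rewrite rq rq' => ->.
- by have [y [_ _]] := phiV_leaf xA' nx'; rewrite -E Eq /= (negbTE (flv_floor q)).
- by have [y [_ _]] := phiV_leaf xA nx; rewrite E Eq' /= (negbTE (flv_floor q')).
have [y [yA sy lv]] := phiV_leaf xA nx; have [y' [yA' sy' lv']] := phiV_leaf xA' nx'.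
rewrite -sy -sy'; congr (esrc enc _); apply: phiE_inj => //.
have sE : src (phiE y') = phiV x by rewrite phiE_src // sy' E.
have sE' : src (phiE y) = phiV x by rewrite phiE_src // sy.
by apply/esym; apply: Dleaf; rewrite ?sE' // /adjacent sE eqxx.
Qed.

Lemma phiV_surj v : exists2 x, x \in VA enc & phiV x = v.
Proof.
case: (boolP (vert_inf v)) => lv.
  have [e sv _] := vert_infP lv; have [x xA xe] := phiE_surj e.
  exists (esrc enc x); first exact: (esrcA enc_ok).
  by rewrite -phiE_src // xe.
by have [rq fq] := repP lv; exists (vfl k (rep v)); rewrite ?vflA ?rq.
Qed.

(** The permutation [s i] of A_i compares two numberings of the floors entered by an edge marked by
    A_i: the one given by [X] and the enumeration behind [jpos]. *)
Lemma enc_mequiv : mequiv (bmg enc_ok enc_cardJ p0) X.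
Proof.
pose s i (n : 'I_(a i)) : 'I_(a i) :=
  odflt n [pick n' : 'I_(a i) | tgt (ed (inr (existT _ i n'))) == flv (jpos enc_cardJ n)].
have sP i (n : 'I_(a i)) : phiE (inr (jpos enc_cardJ n, i)) = ed (inr (existT _ i (s i n))) /\
    tgt (ed (inr (existT _ i (s i n)))) = flv (jpos enc_cardJ n) /\ rt enc (jpos enc_cardJ n) = jpos enc_cardJ n.
  have [n' [rq tn' _]] := phiE_inr (jposP enc_cardJ n).
  rewrite /s /=; case: pickP => [n2 /eqP t2|/(_ n')]; last by rewrite tn' eqxx.
  by rewrite t2.
exists (fun v : 'I_#|VA enc| => phiV (evV v)), (fun e : 'I_#|EA enc| => phiE (evE e)), s; split.
- apply: inj_surj_bij => [v v' /phiV_inj E|v].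
    by apply: evV_inj; apply: E; apply: evVA.
  by have [x xA <-] := phiV_surj v; exists (rkV enc_ok p0 x); rewrite rkVK.
- apply: inj_surj_bij => [e e' /phiE_inj E|e].
    by apply: evE_inj; apply: E; apply: evEA.
  by have [x xA <-] := phiE_surj e; have [e1 <-] := evE_surj xA; exists e1.
- move=> i; apply: injF_bij => n n' E; have [_ [t1 r1]] := sP i n; have [_ [t2 r2]] := sP i n'.
  apply: (jpos_inj (cardJ := enc_cardJ)); rewrite -r1 -r2; apply: flv_inj.
  by rewrite -t1 -t2 E.
- move=> e; have eA := evEA e; split; last exact: phiE_wt.
    by rewrite phiE_src //= rkVK // (esrcA enc_ok).
  by rewrite phiE_tgt //= rkVK // (etgtA enc_ok).
split=> [p|i n]; last first.
  have [E _] := sP i n; have [-> _] := ed_A (existT _ i (s i n)).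
  transitivity (inl (phiV (evV (rkV enc_ok p0 (vel (jpos enc_cardJ n) i)))) : elt D); last by [].
  by rewrite rkVK ?velA ?jposP // -[phiV _]/(src (phiE (inr (jpos enc_cardJ n, i)))) E.
case: (boolP (isf p)) => fp.
  have [-> _ _] := isfP fp; rewrite [mark _ _](bmark_fl _ enc_cardJ p0) ?enc_isfl //= rkVK // vflA (rt_fl enc_ok) // enc_isfl //.
case: (boolP (p \in S1)) => pS.
  rewrite mark_S1 // [mark (bmg _ _ _) _](bmark_lf _ enc_cardJ p0) //= rkVK // vlfA.
  by rewrite (src_S1 enc_ok).
rewrite ed_nS1 //; have [||e] := @bmark_ed _ _ _ _ _ _ enc_ok enc_cardJ p0 p; rewrite ?enc_isfl //.
by move=> /= -> ->.
Qed.

End Decode.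

(** * Equivalence of marked diagrams *)

Section Mequiv.
Variables (k a0 : nat) (a : 'I_k -> nat).
Implicit Types X Y Z : mgraph a0 a.

Lemma mequiv_refl X : mequiv X X.
Proof.
exists id, id, (fun i => id); split; [by exists id|by exists id|by move=> i; exists id|by []|].
by split=> [p|i p]; case: (mark X _).
Qed.

Lemma mequiv_sym X Y : mequiv X Y -> mequiv Y X.
Proof.
move=> [fV [fE [s [[gV fVK gVK] [gE fEK gEK] bs H [mp mA]]]]].
have sI i : injective (s i) := bij_inj (bs i).
exists gV, gE, (fun i => invF (sI i)); split.
- by exists fV.
- by exists fE.
- by move=> i; exists (s i); [apply: f_invF | apply: invF_f].
- by move=> e; have [E1 E2 E3] := H (gE e); rewrite gEK in E1 E2 E3; rewrite E1 E2 E3 !fVK.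
split=> [p|i p]; first by rewrite mp; case: (mark X _) => [v|e]; rewrite ?fVK ?fEK.
have := mA i (invF (sI i) p); rewrite f_invF => ->.
by case: (mark X _) => [v|e]; rewrite ?fVK ?fEK.
Qed.

Lemma mequiv_trans X Y Z : mequiv X Y -> mequiv Y Z -> mequiv X Z.
Proof.
move=> [fV [fE [s [bV bE bs H [mp mA]]]]] [fV' [fE' [s' [bV' bE' bs' H' [mp' mA']]]]].
exists (fV' \o fV), (fE' \o fE), (fun i => s' i \o s i); split.
- exact: bij_comp.
- exact: bij_comp.
- by move=> i; apply: bij_comp.
- by move=> e /=; have [-> -> ->] := H' (fE e); have [-> -> ->] := H e.
split=> [p|i p]; first by rewrite mp' mp; case: (mark X _).
by rewrite mA' mA; case: (mark X _).
Qed.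

Lemma mrepr_equiv X : mequiv X (mrepr X).
Proof.
by apply: (@xgetPex _ X (fun Y => mequiv X Y)); exists X; apply: mequiv_refl.
Qed.

(** Equivalent diagrams have the same equivalence class as a set, and on a nonempty set [xget] does
    not look at its default. *)
Lemma mrepr_eq X Y : mequiv X Y -> mrepr X = mrepr Y.
Proof.
move=> XY; have E : (fun Z => mequiv X Z) = (fun Z => mequiv Y Z).
  apply/funext => Z; apply/propext; split; first exact/mequiv_trans/mequiv_sym.
  exact: mequiv_trans.
rewrite /mrepr /classical_sets.mkset E /xget; case: pselect => // n.
by case: n; exists Y; apply/asboolP; apply: mequiv_refl.
Qed.

Lemma mult_q_mequiv l1 X Y : mequiv X Y -> mult_q X l1 = mult_q Y l1.
Proof.
move=> [fV [fE [s [bV bE bs H [mp mA]]]]].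
have fVI := bij_inj bV; have fEI := bij_inj bE.
have adj e v : adjacent (fE e) (fV v) = adjacent e v.
  by rewrite /adjacent; have [-> -> _] := H e; rewrite !(inj_eq fVI).
have exE (P : pred 'I_(ne (diag Y))) : [exists e, P e] = [exists e, P (fE e)].
  apply/existsP/existsP => [[e Pe]|[e Pe]]; last by exists (fE e).
  by have [gE _ gK] := bE; exists (gE e); rewrite gK.
have exV (P : pred 'I_(nv (diag Y))) : [exists v, P v] = [exists v, P (fV v)].
  apply/existsP/existsP => [[e Pe]|[e Pe]]; last by exists (fV e).
  by have [gV _ gK] := bV; exists (gV e); rewrite gK.
have vinf v : vert_inf (fV v) = vert_inf v.
  rewrite /vert_inf exE; congr (_ && _); last first.
    by apply: eq_existsb => e; have [-> _ _] := H e; rewrite (inj_eq fVI).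
  congr (_ == _); rewrite -!sum1_card (reindex fE) /=; last exact: onW_bij.
  by apply: eq_bigl => e; rewrite !inE adj.
have einf e : edge_inf (fE e) = edge_inf e.
  by rewrite /edge_inf exV; apply: eq_existsb => v; rewrite vinf adj.
have e2 e : @edge_mu2 _ _ _ Y (fE e) = @edge_mu2 _ _ _ X e.
  rewrite /edge_mu2 einf; congr andb; apply: eq_existsb => p; rewrite mp.
  by case: (mark X _) => [v|e'] //; apply/eqP/eqP => [[/fEI ->]|[->]].
have e1 e : @edge_mu1 _ _ _ Y l1 (fE e) = @edge_mu1 _ _ _ X l1 e.
  rewrite /edge_mu1; apply: eq_existsb => p; rewrite exV; apply: eq_existsb => v.
  rewrite mp adj; case: (mark X _) => [v'|e'] //.
  by congr [&& _, _ & _]; apply/eqP/eqP => [[/fVI ->]|[->]].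
have wtE e : wt (fE e) = wt e by have [] := H e.
rewrite /mult_q; have rE (P : pred 'I_(ne (diag Y))) (F : _ -> Kq) :
    \prod_(e | P e) F e = \prod_(e | P (fE e)) F (fE e).
  by apply: reindex; apply: onW_bij.
rewrite !rE; congr (_ * _ * _ * _); apply: eq_big => e; rewrite ?e1 ?e2 ?einf ?wtE //.
Qed.

End Mequiv.

(** * A structure is determined by its marked diagram *)

Section Injectivity.
Variables (k B a0 : nat) (vmu1 : seq nat) (a : 'I_k -> nat).
Local Notation T := 'I_a0.
Local Notation S1 := (std1 a0 (size vmu1)).
Local Notation ok1 := (ok None S1 (fun p : 'I_a0 => nth 0%N vmu1 p) (fun p : 'I_a0 => nat_of_ord p)).
Implicit Types Y : str k B T.

(** The fibre of [rt] over a floor of degree 2 contains the label of that floor, and over a floor of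
    degree 1 it has at most two elements, which [ltgt] exchanges. So the fibres and [isfl] determine
    [ltgt]. *)
Lemma tgt_determined Y Y' : ok1 [set: T] Y -> ok1 [set: T] Y' -> isfl Y =1 isfl Y' ->
  (forall p q, rt Y p = rt Y q -> rt Y' p = rt Y' q) -> (forall p q, rt Y' p = rt Y' q -> rt Y p = rt Y q) ->
  forall p, ltgt Y p != p -> ltgt Y' p = ltgt Y p.
Proof.
move=> okY okY' fE rE rE' p ne.
have fp : ~~ isfl Y p by apply: contraNN ne => /(isfl_tgt okY) ->.
have E : rt Y' (ltgt Y p) = rt Y' p by apply: rE; rewrite (rt_tgt okY).
case: (tgt_cases okY (in_setT p) fp) => [[E0]|[fq _ _ _]|[fq _ _ _ _]]; first by rewrite E0 eqxx in ne.
  move: E; rewrite (rt_fl okY') -?fE // => E.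
  by case: (rt_or Y' p) => E2; [rewrite E E2 eqxx in ne|rewrite -E2 -E].
set q := ltgt Y p in ne fq E *; set r := rt Y' p.
have fr : ~~ isfl Y r.
  apply/negP => fr; have : rt Y r = rt Y p by apply: rE'; rewrite /r (rt_idem okY').
  rewrite (rt_fl okY fr); case: (rt_or Y p) => -> Er; first by rewrite Er (negbTE fp) in fr.
  by rewrite Er (negbTE fq) in fr.
have rr : rt Y' r = r by apply: (rt_idem okY').
have fr' : ~~ isfl Y' r by rewrite -fE.
have := fix_nfl_rt okY' p rr fr'; have := fix_nfl_rt okY' q rr fr'.
rewrite E -/r eqxx => /esym/orP[/eqP qr|/eqP qt] /esym/orP[/eqP pr|/eqP pt].
- by move: ne; rewrite qr pr eqxx.
- rewrite pt qr; case: (tgt_cases okY' (in_setT r) fr') => [[tr _]|[]|[_ _ _ _ [//]]].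
    by move: ne; rewrite pt qr tr eqxx.
  by rewrite -pt -fE (negbTE fp).
- by rewrite pr qt.
by move: ne; rewrite qt pt eqxx.
Qed.

Variables (Y Y' : str k B T).
Hypotheses (okY : ok1 [set: T] Y) (okY' : ok1 [set: T] Y').
Hypotheses (cJ : forall i, #|[set p | i \in lset Y p]| = a i) (cJ' : forall i, #|[set p | i \in lset Y' p]| = a i).
Variable p0 : T.

(** An isomorphism respects the marks of A_0, hence every labelled edge and every floor that a label
    marks or enters. Comparing sources, targets and weights gives the records, and the marks of the
    A_i give the attached sets. *)
Lemma bmg_inj : mequiv (bmg okY cJ p0) (bmg okY' cJ' p0) -> Y = Y'.
Proof.
move=> [fV [fE [s [bV bE bs H [mp mA]]]]].
have fVI := bij_inj bV.
have fl p : isfl Y p = isfl Y' p.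
  case: (boolP (p \in S1)) => pS.
    by rewrite !(negbTE (nfl_none _)) // ?(src_S1 okY) ?(src_S1 okY').
  have := mp p; case: (boolP (isfl Y p)) => fp; case: (boolP (isfl Y' p)) => fp' //.
    have [e Ee _] := bmark_ed okY' cJ' p0 fp' pS.
    by rewrite [mark _ _]Ee [mark (bmg okY _ _) _](bmark_fl okY cJ p0 fp).
  have [e Ee _] := bmark_ed okY cJ p0 fp pS.
  by rewrite [mark (bmg okY _ _) _]Ee [mark _ _](bmark_fl okY' cJ' p0 fp').
have flV p : isfl Y p -> fV (rkV okY p0 (vfl k p)) = rkV okY' p0 (vfl k p).
  move=> fp; have := mp p; rewrite [mark (bmg okY _ _) _](bmark_fl okY cJ p0 fp).
  by rewrite [mark _ _](bmark_fl okY' cJ' p0) -?fl // => -[].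
have edE p (e : 'I_(ne (bgraph okY p0))) : ~~ isfl Y p -> evE e = inl p -> evE (fE e) = inl p.
  move=> fp Ee; have := mp p; case: (boolP (p \in S1)) => pS.
    rewrite [mark (bmg okY _ _) _](bmark_lf okY cJ p0 pS) [mark _ _](bmark_lf okY' cJ' p0 pS) => -[E].
    have [se _ _] := H e; have : src e = rkV okY p0 (vlf k p) by rewrite /= Ee /= (src_S1 okY).
    move=> Es; move: se; rewrite Es -E => /eqP; rewrite bsrcE rkVK ?vlfA ?(src_S1 okY') // => /eqP.
    by case/esrc_leaf.
  have [e1 Em E1] := bmark_ed okY cJ p0 fp pS.
  have fp' : ~~ isfl Y' p by rewrite -fl.
  have [e2 Em2 E2] := bmark_ed okY' cJ' p0 fp' pS.
  rewrite [mark (bmg okY _ _) _]Em [mark _ _]Em2 => -[E].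
  by rewrite (evE_inj (etrans Ee (esym E1))) -E.
have has_ed p : ~~ isfl Y p -> exists e : 'I_(ne (bgraph okY p0)), evE e = inl p.
  by move=> fp; apply: evE_surj; rewrite inlEA.
have rtV p : fV (rkV okY p0 (vfl k (rt Y p))) = rkV okY' p0 (vfl k (rt Y' p)).
  case: (boolP (isfl Y p)) => fp; first by rewrite (rt_fl okY) // (rt_fl okY') -?fl // flV.
  have [e Ee] := has_ed p fp; have [_ te _] := H e; have Ee' := edE p e fp Ee.
  by move: te; rewrite /= Ee Ee' /= => ->.
have vI p q : rkV okY p0 (vfl k (rt Y p)) = rkV okY p0 (vfl k (rt Y q)) -> rt Y p = rt Y q.
  by move/(congr1 (@evV _ _ _ _)); rewrite !rkVK ?vflA ?(rt_idem okY) // => -[].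
have vI' p q : rkV okY' p0 (vfl k (rt Y' p)) = rkV okY' p0 (vfl k (rt Y' q)) -> rt Y' p = rt Y' q.
  by move/(congr1 (@evV _ _ _ _)); rewrite !rkVK ?vflA ?(rt_idem okY') // => -[].
have r1 p q : rt Y p = rt Y q -> rt Y' p = rt Y' q by move=> E; apply: vI'; rewrite -!rtV E.
have r2 p q : rt Y' p = rt Y' q -> rt Y p = rt Y q by move=> E; apply: vI; apply: fVI; rewrite !rtV E.
have tgE p : ltgt Y p = ltgt Y' p.
  case: (eqVneq (ltgt Y p) p) => [E|ne]; last by rewrite (tgt_determined okY okY' fl r1 r2 ne).
  case: (eqVneq (ltgt Y' p) p) => [->//|ne'].
  by apply: (tgt_determined okY' okY (fun p => esym (fl p)) r2 r1 ne').
have rtE p : rt Y p = rt Y' p by rewrite /rt tgE fl.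
have wtE p : lwt Y p = lwt Y' p.
  case: (boolP (isfl Y p)) => fp; first by rewrite (isfl_wt okY) // (isfl_wt okY') -?fl.
  have [e Ee] := has_ed p fp; have [_ _ we] := H e; have Ee' := edE p e fp Ee.
  by move: we; rewrite /= Ee Ee'.
have srE p : lsrc Y p = lsrc Y' p.
  case: (boolP (isfl Y p)) => fp; first by rewrite (eqP fp); move: fp; rewrite fl => /eqP ->.
  have [e Ee] := has_ed p fp; have [se _ _] := H e; have Ee' := edE p e fp Ee.
  case E : (lsrc Y p) => [q|].
    have fq := src_floor okY E; move: se; rewrite /= Ee Ee' /= E flV // => /(congr1 (@evV _ _ _ _)).
    rewrite !rkVK; [|by rewrite vflA (rt_fl okY') // -fl|]; last first.
      by have := @esrcA _ _ _ _ _ okY' (inl p); rewrite inlEA -fl => /(_ fp).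
    by case: (lsrc Y' p) => [q'|] // [->].
  case E' : (lsrc Y' p) => [q|] //; have fq' := src_floor okY' E'; have fq : isfl Y q by rewrite fl.
  move: se; rewrite /= Ee Ee' /= E E' -flV // => /fVI /(congr1 (@evV _ _ _ _)).
  by rewrite !rkVK ?vflA ?vlfA ?E // (rt_fl okY).
have JE i : [set p | i \in lset Y p] = [set p | i \in lset Y' p].
  (* Both sets have [a i] elements, so one inclusion is enough. *)
  apply/eqP; rewrite eqEcard cJ cJ' leqnn andbT; apply/subsetP => q; rewrite !inE => iq.
  have [n jn] := jpos_surj cJ iq.
  have := mA i n; rewrite /= jn => -[E].
  have [e Ee] : exists e : 'I_(ne (bgraph okY p0)), evE e = inr (q, i) by apply: evE_surj; rewrite inrEA.
  have [se te _] := H e.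
  have Ee' : evE (fE e) = inr (jpos cJ' (s i n), i).
    move/eqP: se; rewrite bsrcE [src e]/= Ee /= -E rkVK ?velA ?jposP // => /eqP.
    exact: esrc_el.
  have fq : fV (rkV okY p0 (vfl k q)) = rkV okY' p0 (vfl k (rt Y' q)) by rewrite -rtV (lset_fix okY iq).
  move: te; rewrite /= Ee Ee' /= fq => /(congr1 (@evV _ _ _ _)).
  rewrite !rkVK ?vflA ?(rt_idem okY') ?(lset_fix okY' (jposP cJ' (s i n))) // -rtE (lset_fix okY iq) => -[<-].
  exact: jposP.
have stE p : lset Y p = lset Y' p.
  by apply/setP => i; have /setP/(_ p) := JE i; rewrite !inE.
by apply: str_ext.
Qed.

End Injectivity.

(** * Initial data *)

Lemma NordE (k : nat) (d : H2 k) g (vmu1 vmu2 : seq nat) a0 :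
  a0%:Z = dot d (clsL k) - 1 + g%:Z + (size vmu1)%:Z + (size vmu2)%:Z -> 0 < dot d (clsL k) ->
  Nord d g vmu1 vmu2 =
  \sum_(X \in classical_sets.image (@marked_diagrams k d g vmu1 vmu2 a0 (fun i => absz (dot d (clsEi i))))
      (fun X => mrepr X)) mult_q X (size vmu1).
Proof.
move=> a0E dL; rewrite /Nord dL.
by have -> : a0 = absz (dot d (clsL k) - 1 + g%:Z + (size vmu1)%:Z + (size vmu2)%:Z) by rewrite -a0E absz_nat.
Qed.

(** Structures correspond bijectively to equivalence classes: [bmg] builds a diagram, [enc_mequiv]
    shows that every class is reached, and [bmg_inj] that it is reached once. If some d.[E_i] is
    negative, both sides are empty sums. *)
Lemma Nord_encode (k B : nat) (d : H2 k) g (vmu1 vmu2 : seq nat) a0 :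
  parts_pos vmu1 -> parts_pos vmu2 ->
  (sumn vmu1)%:Z + (sumn vmu2)%:Z = dot d (clsE k) ->
  0 < dot d (clsL k) -> 2 * dot d (clsL k) <= B%:Z ->
  a0%:Z = dot d (clsL k) - 1 + g%:Z + (size vmu1)%:Z + (size vmu2)%:Z -> (0 < a0)%N ->
  Nord d g vmu1 vmu2 =
  nsum B (std1 a0 (size vmu1)) (fun p => nth 0%N vmu1 p) (fun p => p) [set: 'I_a0]
    (fun i => dot d (clsEi i)) (seq_mset vmu2).
Proof.
move=> _ _ sumE dL dB a0E a0pos; rewrite (NordE a0E dL).
pose p0 : 'I_a0 := Ordinal a0pos.
have [/existsP[i ni]|/existsPn nn] := boolP [exists i, dot d (clsEi i) < 0].
  rewrite fsbig1 => [|Z [X [_ aE _ _] _]]; last by have := aE i; move: ni; move: (dot _ _) => y; lia.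
  rewrite /nsum big_pred0 // => Y; apply/negbTE/negP => /and4P[_ _ /forallP/(_ i) /eqP + _].
  by move: ni; move: (dot _ _) (#|_|) => y n; lia.
have [a [aE ->]] : exists a : 'I_k -> nat, (forall i, (a i)%:Z = dot d (clsEi i)) /\ (fun i => absz (dot d (clsEi i))) = a.
  by exists (fun i => absz (dot d (clsEi i))); split=> // i; have := nn i; move: (dot _ _) => y; lia.
pose V : pred (str k B 'I_a0) := fun Y =>
  [&& ok None (std1 a0 (size vmu1)) (fun p : 'I_a0 => nth 0%N vmu1 p) (fun p : 'I_a0 => nat_of_ord p) [set: 'I_a0] Y,
      conn [set: 'I_a0] Y, [forall i, #|[set p in [set: 'I_a0] | i \in lset Y p]|%:Z == dot d (clsEi i)] &
      wts (lwt Y) (edge2 None (std1 a0 (size vmu1)) [set: 'I_a0] Y) == seq_mset vmu2].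
have VP Y : V Y -> [/\ ok None (std1 a0 (size vmu1)) (fun p : 'I_a0 => nth 0%N vmu1 p) (fun p : 'I_a0 => nat_of_ord p) [set: 'I_a0] Y,
    forall i, #|[set p | i \in lset Y p]| = a i, conn [set: 'I_a0] Y &
    wts (lwt Y) (edge2 None (std1 a0 (size vmu1)) [set: 'I_a0] Y) = seq_mset vmu2].
  case/and4P => okY cY /forallP cJ /eqP mE; split=> // i.
  have /eqP := cJ i; rewrite -aE => -[<-]; apply: eq_card => p; by rewrite !inE.
pose dummy : mgraph a0 a := @MGraph k a0 a (@WGraph 1 0 (fun _ => ord0) (fun _ => ord0) (fun _ => 0%N)) (fun _ => inl ord0).
(* The construction of a diagram takes proofs as arguments. [pselect] turns it into a total function
   of [Y], and by proof irrelevance the choice of proofs does not affect the value. *)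
pose h (Y : str k B 'I_a0) : mgraph a0 a :=
  if pselect (ok None (std1 a0 (size vmu1)) (fun p : 'I_a0 => nth 0%N vmu1 p) (fun p : 'I_a0 => nat_of_ord p) [set: 'I_a0] Y /\
    forall i, #|[set p | i \in lset Y p]| = a i) is left pf
  then mrepr (bmg (proj1 pf) (proj2 pf) p0) else dummy.
have hE (Y : str k B 'I_a0) (okY : ok None (std1 a0 (size vmu1)) (fun p : 'I_a0 => nth 0%N vmu1 p) (fun p : 'I_a0 => nat_of_ord p) [set: 'I_a0] Y)
    (cJ : forall i, #|[set p | i \in lset Y p]| = a i) : h Y = mrepr (bmg okY cJ p0).
  rewrite /h; case: pselect => [pf|n]; last by case: n.
  by rewrite (Prop_irrelevance (proj1 pf) okY) (Prop_irrelevance (proj2 pf) cJ).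
have -> : classical_sets.image (@marked_diagrams k d g vmu1 vmu2 a0 a) (fun X => mrepr X) =
          classical_sets.image (fun Y => is_true (V Y)) h.
  apply/predeqP => Z; split=> [[X XM <-]|[Y /VP[okY cJ cY mE] <-]].
    have [e0 _] := Dhas_edge XM dL sumE.
    exists (enc e0 B); last first.
      by rewrite (hE _ (enc_ok XM dL sumE e0 dB) (enc_cardJ XM dL sumE e0 dB p0)); apply: mrepr_eq; apply: enc_mequiv.
    apply/and4P; split; [exact: (enc_ok XM dL sumE e0 dB) | exact: (enc_conn XM dL sumE e0 dB p0) | |].
      apply/forallP => i; rewrite -aE -(enc_cardJ XM dL sumE e0 dB p0 i); apply/eqP; congr Posz.
      by apply: eq_card => p; rewrite !inE.
    by rewrite (enc_mu2 XM dL sumE e0 dB).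
  exists (bmg okY cJ p0); first exact: bmarked.
  by rewrite hE.
rewrite fsbig_image; last first.
  move=> Y Y'; rewrite !in_setE => /VP[okY cJ _ _] /VP[okY' cJ' _ _].
  rewrite (hE _ okY cJ) (hE _ okY' cJ') => E; apply: (@bmg_inj _ _ _ _ _ _ _ okY okY' cJ cJ' p0).
  apply: mequiv_trans (mrepr_equiv _) _; rewrite E; exact/mequiv_sym/mrepr_equiv.
have AV Y : (Y \in ((fun Y => is_true (V Y)) : classical_sets.set _)) = V Y.
  by apply/idP/idP; rewrite in_setE.
rewrite (@fsbigE _ _ _ _ _ (enum V)); first last.
- by move=> Y VY; rewrite mem_enum => /negP; case.
- by move=> Y /=; rewrite mem_enum.
- exact: enum_uniq.
rewrite big_enum_cond /nsum; apply: eq_big => Y.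
  by rewrite AV; apply/andP/idP => [[]//|VY]; split.
rewrite AV => /andP[_ /VP[okY cJ _ _]].
by rewrite (hE _ okY cJ) -(mult_q_mequiv _ (mrepr_equiv _)) bmult.
Qed.

(** * Diagrams with one or two labels *)

Lemma nsum_pred1 (k B a0 l1 : nat) (w1 rk : 'I_a0 -> nat) (b : 'I_k -> int) mu2 (Y0 : str k B 'I_a0) :
  (forall Y, [&& ok None (std1 a0 l1) w1 rk [set: 'I_a0] Y, conn [set: 'I_a0] Y,
      [forall i, #|[set p in [set: 'I_a0] | i \in lset Y p]|%:Z == b i] &
      wts (lwt Y) (edge2 None (std1 a0 l1) [set: 'I_a0] Y) == mu2] = (Y == Y0)) ->
  nsum B (std1 a0 l1) w1 rk [set: 'I_a0] b mu2 = mult (std1 a0 l1) [set: 'I_a0] Y0.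
Proof. by move=> H; rewrite /nsum (big_pred1 Y0). Qed.

Lemma edge2_full (k B : nat) (T : finType) (S1 : {set T}) (Y : str k B T) :
  (forall p, p \in S1) -> edge2 None S1 [set: T] Y = set0.
Proof. by move=> H; apply/setP => p; rewrite !inE H. Qed.

Lemma seq_mset0 : seq_mset [::] = mset0 :> {mset nat}.
Proof. by apply/msetP => x; rewrite mset_seqE mset0E. Qed.

Lemma card_ord1 (P : pred 'I_1) : #|[set p in [set: 'I_1] | P p]| = P ord0.
Proof.
rewrite -sum1_card big_mkcond big_ord1 !inE /=; by case: (P ord0).
Qed.

(** The only diagram has one floor of degree 1, entered by the marked leaf edge and by one edge for
    each element of [J]. An empty [J] gives the class [L] with mu_1 = (2), a singleton the class [L]
    - [E_i] with mu_1 = (1). *)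
Lemma Nord_one_leaf (k : nat) (d : H2 k) (w : nat) (J : {set 'I_k}) :
  dot d (clsL k) = 1 -> (forall i, dot d (clsEi i) = (i \in J)%:Z) -> (0 < w)%N -> (w + #|J| = 2)%N ->
  Nord d 0 [:: w] [::] = qint w / w%:R.
Proof.
move=> dL dJ w0 wJ.
have sumE : (sumn [:: w])%:Z + (sumn [::])%:Z = dot d (clsE k).
  rewrite dotE -dotL dL (eq_bigr (fun i => - (i \in J)%:Z)) => [|i _]; last by rewrite -dJ dotEi opprK.
  have sJ : (\sum_i (i \in J) = #|J|)%N.
    by rewrite -sum1_card [RHS]big_mkcond; apply: eq_bigr => i _; case: (i \in J).
  by rewrite sumrN -(big_morph Posz PoszD (erefl _)) sJ /=; move: wJ; move: (#|J|) => n; lia.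
rewrite (@Nord_encode k 2 d 0 [:: w] [::] 1) ?dL //; last by rewrite /parts_pos inE eq_sym -lt0n w0.
pose Y0 : str k 2 'I_1 := [ffun p => (None, p, inord w, J)].
have w2 : (w < 3)%N by lia.
have wE p : lwt Y0 p = w by rewrite /lwt ffunE /= inordK.
have sE p : lsrc Y0 p = None by rewrite /lsrc ffunE.
have tE p : ltgt Y0 p = p by rewrite /ltgt ffunE.
have JE p : lset Y0 p = J by rewrite /lset ffunE.
have S1T p : p \in std1 1 1 by rewrite inE ord1.
have fE p : isfl Y0 p = false by rewrite /isfl sE.
rewrite (@nsum_pred1 _ _ _ _ _ _ _ _ Y0) => [|Y].
  rewrite /mult (eq_bigl predT) => [|p]; last by rewrite in_setT.
  by rewrite big_ord1 /fac S1T wE.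
apply/idP/eqP => [/and4P[okY _ /forallP cJ _]|->].
  apply: str_ext => p; rewrite ?sE ?tE ?wE ?JE.
  - exact: (src_S1 okY).
  - by rewrite [LHS]ord1 [RHS]ord1.
  - by rewrite (wt_S1 okY) ?in_setT // ord1.
  apply/setP => i; have /eqP := cJ i; rewrite dJ card_ord1 ord1.
  by case: (i \in lset Y ord0); case: (i \in J).
apply/and4P; split.
- apply/forallP => p; rewrite in_setT /okl fE wE w0 sE tE eqxx JE S1T /= ord1 /= eqxx /=.
  by rewrite wJ.
- apply/andP; split; first by apply/set0Pn; exists ord0; rewrite in_setT.
  by apply/forall_inP => p _; apply/forall_inP => q _; rewrite [p]ord1 [q]ord1 connect0.
- by apply/forallP => i; rewrite dJ card_ord1 JE.
by rewrite edge2_full // wts0 seq_mset0.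
Qed.

(** The only diagram is a floor of degree 1 entered by two leaf edges of weight 1. In its structure
    [ltgt] exchanges the two labels, and on ['I_2] this exchange is [rev_ord]. *)
Lemma Nord_two_leaves (k : nat) (d : H2 k) :
  dot d (clsL k) = 1 -> (forall i, dot d (clsEi i) = 0) -> Nord d 0 [:: 1%N; 1%N] [::] = 1.
Proof.
move=> dL d0.
have sumE : (sumn [:: 1%N; 1%N])%:Z + (sumn [::])%:Z = dot d (clsE k).
  rewrite dotE -dotL dL big1 // => i _; by rewrite -[RHS]oppr0 -(d0 i) dotEi opprK.
rewrite (@Nord_encode k 2 d 0 [:: 1%N; 1%N] [::] 2) ?dL //.
pose Y0 : str k 2 'I_2 := [ffun p => (None, rev_ord p, inord 1, set0)].
have wE p : lwt Y0 p = 1%N by rewrite /lwt ffunE /= inordK.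
have sE p : lsrc Y0 p = None by rewrite /lsrc ffunE.
have tE p : ltgt Y0 p = rev_ord p by rewrite /ltgt ffunE.
have JE p : lset Y0 p = set0 by rewrite /lset ffunE.
have S1T (p : 'I_2) : p \in std1 2 2 by rewrite inE ltn_ord.
have fE p : isfl Y0 p = false by rewrite /isfl sE.
have rne (p : 'I_2) : (rev_ord p == p) = false.
  by apply/eqP => /(congr1 (@nat_of_ord 2)) /=; have := ltn_ord p; lia.
have r2 (p q : 'I_2) : q != p -> q = rev_ord p.
  move=> qp; apply: val_inj; have : (q : nat) != p by []. 
  by have := ltn_ord p; have := ltn_ord q; rewrite /=; lia.
have n1 (p : 'I_2) : nth 0%N [:: 1%N; 1%N] p = 1%N by case: p => [[|[|]]].
rewrite (@nsum_pred1 _ _ _ _ _ _ _ _ Y0) => [|Y].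
  by rewrite /mult big1 // => p _; rewrite /fac S1T wE qint1 divr1.
apply/idP/eqP => [/and4P[okY _ /forallP cJ _]|->].
  have lJ p : lset Y p = set0.
    apply/setP => i; rewrite [RHS]inE; apply/negbTE/negP => ip.
    have /eqP := cJ i; rewrite d0 => -[/eqP]; rewrite cards_eq0 => /eqP/setP/(_ p).
    by rewrite !inE ip.
  have lw p : lwt Y p = 1%N by rewrite (wt_S1 okY) ?in_setT.
  apply: str_ext => p; rewrite ?sE ?tE ?wE ?JE //; first exact: (src_S1 okY).
  have nf : ~~ isfl Y p by rewrite /isfl (src_S1 okY).
  apply: r2; apply/eqP => tp; case: (tgt_cases okY (in_setT p) nf) => [[_]|[_]|[_]].
  - by rewrite lJ lw cards0.
  - by rewrite tp eqxx.
  by rewrite tp eqxx.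
apply/and4P; split.
- apply/forallP => p; rewrite in_setT /okl fE wE sE tE rne JE S1T n1 /= in_setT fE !eqxx /=.
  by rewrite tE rev_ordK eqxx.
- apply/andP; split; first by apply/set0Pn; exists ord0; rewrite in_setT.
  apply/forall_inP => p _; apply/forall_inP => q _; case: (eqVneq q p) => [->|/r2 ->]; first exact: connect0.
  by apply: connect1; rewrite /lnk tE eqxx !orbT.
- apply/forallP => i; rewrite d0 (_ : [set p in _ | _] = set0) ?cards0 //.
  by apply/setP => p; rewrite !inE JE inE.
by rewrite edge2_full // wts0 seq_mset0.
Qed.

(* With [d = L - E_i - E_j] the set [A_0] is empty and the encoding by labels breaks down;
   all marked diagrams are then equivalent. *)
Section NoLabel.
Variables (k : nat) (a : 'I_k -> nat) (d : H2 k) (g : nat).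
Hypotheses (dL : 0 < dot d (clsL k))
  (sumE : (sumn [::])%:Z + (sumn [::])%:Z = dot d (clsE k)).

Lemma ed0 (X : mgraph 0 a) (XM : marked_diagrams d g [::] [::] X) e0 e :
  exists y : {i : 'I_k & 'I_(a i)}, @ed k 0 a X e0 (inr y) = e.
Proof. by have [[[]//|y] _ <-] := ed_surj XM dL sumE e0 e; exists y. Qed.

Lemma src0 (X : mgraph 0 a) (XM : marked_diagrams d g [::] [::] X) e : vert_inf (@src (diag X) e).
Proof.
by have [y <-] := ed0 XM e e; have [] := ed_A XM e y.
Qed.

(** Without labels the degree is 1, so the divergences of the floors add up to 2, and a single floor
    already uses all of it. *)
Lemma floor0 (X : mgraph 0 a) (XM : marked_diagrams d g [::] [::] X) u v :
  ~~ @vert_inf (diag X) u -> ~~ @vert_inf (diag X) v -> u = v.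
Proof.
move=> lu lv; apply/eqP; apply: contraT => uv; have := Dfloor_sum XM.
have dLE : dot d (clsL k) = 1.
  by have [a0E _ _ _] := XM; move: a0E dL; rewrite /=; move: (dot _ _) => x; lia.
have f2 w : ~~ @vert_inf (diag X) w -> 2 <= divergence w by case/(Dfloor XM) => ->.
rewrite dLE (bigD1 u) //= (bigD1 v) ?lv ?(eq_sym v) //= => E.
have : 0 <= \sum_(i | ~~ @vert_inf (diag X) i && (i != u) && (i != v)) divergence i.
  by apply: sumr_ge0 => w /andP[/andP[/f2 + _] _]; lia.
by move: E (f2 u lu) (f2 v lv); move: (divergence u) (divergence v) (\sum_(_ | _) _) => x y z; lia.
Qed.

Lemma card0_le1 (X : mgraph 0 a) (XM : marked_diagrams d g [::] [::] X) i : (a i <= 1)%N.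
Proof.
have [e0 _] := Dhas_edge XM dL sumE; rewrite leqNgt; apply/negP => a1.
have tE (n : 'I_(a i)) : tgt (ed e0 (inr (existT _ i n))) = tgt e0.
  by apply: (floor0 XM); apply: (Dtgt XM).
have := Jv_uniq XM (tE (Ordinal (ltnW a1))) (tE (Ordinal a1)).
by move/(congr1 (@nat_of_ord _)).
Qed.

(** Such a diagram is a star: one floor, entered by leaf edges of weight 1 that the sets A_i number
    bijectively. Matching the numberings gives the isomorphism. *)
Lemma marked0_equiv (X X' : mgraph 0 a) : marked_diagrams d g [::] [::] X ->
  marked_diagrams d g [::] [::] X' -> mequiv X X'.
Proof.
move=> XM XM'; have [e0 _] := Dhas_edge XM dL sumE; have [e1 _] := Dhas_edge XM' dL sumE.
have [idx idxE] : exists idx : 'I_(ne (diag X)) -> {i : 'I_k & 'I_(a i)}, forall e, ed e0 (inr (idx e)) = e.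
  by exists (fun e => sval (cid (ed0 XM e0 e))) => e; case: cid.
have idxK y : idx (ed e0 (inr y)) = y.
  have := @ed_inj _ _ _ _ _ _ _ _ XM e0 (inr (idx (ed e0 (inr y)))) (inr y) isT isT.
  by rewrite idxE => /(_ erefl)[].
pose fE e := ed e1 (inr (idx e)).
have fE_inj : injective fE.
  move=> e e' /(@ed_inj _ _ _ _ _ _ _ _ XM' e1 (inr _) (inr _) isT isT)[E].
  by rewrite -(idxE e) E idxE.
pose fV v := if vert_inf v then src (fE (odflt e0 [pick e | src e == v])) else tgt e1.
have fsrc e : fV (src e) = src (fE e).
  rewrite /fV (src0 XM); case: pickP => [e' /eqP se|/(_ e)]; last by rewrite eqxx.
  by rewrite (Dleaf (src0 XM e) (e' := e')) // /adjacent se eqxx.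
have ftgt v : ~~ vert_inf v -> fV v = tgt e1 by rewrite /fV => /negbTE ->.
exists fV, fE, (fun i => id); split.
- apply: inj_surj_bij => [u v|v].
    case: (boolP (vert_inf u)) (boolP (vert_inf v)) => lu [] lv.
    + have [e <- _] := vert_infP lu; have [e' <- _] := vert_infP lv; rewrite !fsrc => E.
      congr src; apply: fE_inj; apply/esym; apply: (Dleaf (src0 XM' (fE e))).
      by rewrite /adjacent E eqxx.
    + have [e <- _] := vert_infP lu; rewrite fsrc ftgt // => E.
      by have := Dtgt XM' e1; rewrite -E (src0 XM').
    + have [e <- _] := vert_infP lv; rewrite fsrc ftgt // => E.
      by have := Dtgt XM' e1; rewrite E (src0 XM').
    by move=> _; apply: (floor0 XM).
  case: (boolP (vert_inf v)) => lv.
    have [e <- _] := vert_infP lv; have [y <-] := ed0 XM' e1 e.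
    by exists (src (ed e0 (inr y))); rewrite fsrc /fE idxK.
  exists (tgt e0); rewrite ftgt ?(Dtgt XM) //.
  by apply: (floor0 XM') => //; apply: (Dtgt XM').
- apply: inj_surj_bij => // e; have [y <-] := ed0 XM' e1 e.
  by exists (ed e0 (inr y)); rewrite /fE idxK.
- by move=> i; exists id.
- move=> e; split; first by rewrite fsrc.
    rewrite ftgt ?(Dtgt XM) //; by apply: (floor0 XM'); apply: (Dtgt XM').
  by rewrite /fE (ed_wt_A XM' dL sumE) -(idxE e) (ed_wt_A XM dL sumE).
split=> [[]//|i p]; have [-> _] := ed_A XM e0 (existT _ i p); have [-> _] := ed_A XM' e1 (existT _ i p).
by rewrite fsrc /fE idxK.
Qed.

Lemma mult_q0 (X : mgraph 0 a) : marked_diagrams d g [::] [::] X -> mult_q X 0 = 1.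
Proof.
move=> XM; rewrite /mult_q !big_pred0 ?mulr1 // => e.
- by rewrite edge_infE (src0 XM).
- by rewrite /edge_mu2; apply/andP => -[_ /existsP[[]]].
- by apply/existsP => -[[]].
by rewrite /edge_mu2; apply/andP => -[_ /existsP[[]]].
Qed.

End NoLabel.

Lemma Nord_no_label (k : nat) (d : H2 k) g : 0 < dot d (clsL k) ->
  0 = dot d (clsE k) -> dot d (clsL k) - 1 + g%:Z = 0 ->
  classical_sets.nonempty (@marked_diagrams k d g [::] [::] 0 (fun i => absz (dot d (clsEi i)))) ->
  Nord d g [::] [::] = 1.
Proof.
move=> dL sE a0E [X XM].
have sumE : (sumn [::])%:Z + (sumn [::])%:Z = dot d (clsE k) by rewrite -sE.
rewrite (@NordE _ _ _ _ _ 0) ?a0E //.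
have -> : classical_sets.image (@marked_diagrams k d g [::] [::] 0 (fun i => absz (dot d (clsEi i))))
    (fun X => mrepr X) = classical_sets.set1 (mrepr X).
  apply/predeqP => Z; split=> [[X' XM' <-]|->]; last by exists X.
  exact/mrepr_eq/(marked0_equiv dL sumE XM' XM).
by rewrite fsbig_set1 -(mult_q_mequiv _ (mrepr_equiv X)) (mult_q0 dL sumE XM).
Qed.

Lemma Nord_neq0 (k : nat) (d : H2 k) g (vmu1 vmu2 : seq nat) a0 :
  a0%:Z = dot d (clsL k) - 1 + g%:Z + (size vmu1)%:Z + (size vmu2)%:Z -> 0 < dot d (clsL k) ->
  Nord d g vmu1 vmu2 <> 0 ->
  classical_sets.nonempty (@marked_diagrams k d g vmu1 vmu2 a0 (fun i => absz (dot d (clsEi i)))).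
Proof.
move=> a0E dL N0; apply: contrapT => no; apply: N0; rewrite (NordE a0E dL) fsbig1 // => Z [X XM _].
by case: no; exists X.
Qed.

Lemma sum_nat_eq1P (k : nat) (a : 'I_k -> nat) : (\sum_i a i = 1)%N -> exists i, forall j, a j = (j == i).
Proof.
move=> s1; have [i ai] : exists i, (0 < a i)%N.
  apply/existsP; apply: contraT => /existsPn no; have := s1; rewrite big1 // => i _.
  by have := no i; rewrite lt0n negbK => /eqP.
move: s1; rewrite (bigD1 i) //= => s1; exists i => j.
have r0 : (\sum_(l | l != i) a l = 0)%N.
  by move: s1 ai; move: (a i) (\sum_(l | l != i) a l)%N => x y; lia.
case: eqVneq => [->|ji]; first by move: s1; rewrite r0; lia.
by apply/eqP; move/eqP: r0; rewrite sum_nat_eq0 => /forall_inP/(_ j ji).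
Qed.

Lemma sum_nat_eq2P (k : nat) (a : 'I_k -> nat) : (forall i, a i <= 1)%N -> (\sum_i a i = 2)%N ->
  exists i j, i != j /\ forall l, a l = ((l == i) + (l == j))%N.
Proof.
move=> a1 s2; have [i ai] : exists i, (0 < a i)%N.
  apply/existsP; apply: contraT => /existsPn no; have := s2; rewrite big1 // => i _.
  by have := no i; rewrite lt0n negbK => /eqP.
have ai1 : a i = 1%N by have := a1 i; lia.
have [j Hj] : exists j, forall l, (if l == i then 0 else a l)%N = (l == j).
  apply: sum_nat_eq1P; rewrite (bigD1 i) //= eqxx add0n.
  rewrite (eq_bigr a) => [|l /negbTE -> //]; move: s2; rewrite (bigD1 i) //= ai1; lia.
have ij : i != j by have := Hj i; rewrite eqxx; case: eqP.
exists i, j; split=> // l; have := Hj l; case: eqVneq => [->|_ ->//].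
by rewrite (negbTE ij) ai1.
Qed.

Lemma dot_inj (k : nat) (x y : H2 k) : dot x (clsL k) = dot y (clsL k) ->
  (forall i, dot x (clsEi i) = dot y (clsEi i)) -> x = y.
Proof.
rewrite !dotL => E1 E2; rewrite [x]surjective_pairing [y]surjective_pairing E1; congr pair.
by apply/ffunP => i; apply: oppr_inj; rewrite -!dotEi.
Qed.

Lemma dotBl (k : nat) (x y z : H2 k) : dot (x - y) z = dot x z - dot y z.
Proof.
rewrite /dot (eq_bigr (fun i => x.2 i * z.2 i - y.2 i * z.2 i)) => [|i _]; last first.
  by rewrite -[(x - y).2]/(x.2 - y.2) !ffunE mulrBl.
rewrite sumrB -[(x - y).1]/(x.1 - y.1); ring.
Qed.

Lemma dot_clsL (k : nat) (i : 'I_k) : dot (clsL k) (clsEi i) = 0.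
Proof. by rewrite dotEi /clsL /= ffunE oppr0. Qed.

Lemma dot_clsEi (k : nat) (i j : 'I_k) : dot (clsEi i) (clsEi j) = - (j == i)%:Z.
Proof. by rewrite dotEi /clsEi /= ffunE; case: eqP. Qed.

(** In positive degree the assumptions force d.[L] = 1, g = 0 and mu_2 empty, so that |mu_1| and the
    d.[E_i] add up to 2; the cases are the solutions of this equation. When mu_1 is empty, i and j
    are distinct because the single floor is entered by at most one edge marked by a given A_i. *)
Lemma initial_data (k : nat) (g : nat) (d : H2 k) (vmu1 vmu2 : seq nat) :
  parts_pos vmu1 -> parts_pos vmu2 ->
  (sumn vmu1)%:Z + (sumn vmu2)%:Z = dot d (clsE k) ->
  ~ (0 < dot d (clsL k) /\ 0 < dot d (clsL k) - 1 + g%:Z + (size vmu2)%:Z) ->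
  Nord d g vmu1 vmu2 <> 0 ->
  [\/ (d, g, vmu1, vmu2) = (clsL k, 0%N, [:: 2%N], [::]),
      (d, g, vmu1, vmu2) = (clsL k, 0%N, [:: 1%N; 1%N], [::]),
      exists i : 'I_k, (d, g, vmu1, vmu2) = (clsEi i, 0%N, [::], [:: 1%N]) |
      (exists i : 'I_k, (d, g, vmu1, vmu2) = (clsL k - clsEi i, 0%N, [:: 1%N], [::])) \/
      (exists i j : 'I_k, [/\ i != j,
         (d, g, vmu1, vmu2) = (clsL k - clsEi i - clsEi j, 0%N, [::], [::]) &
         Nord d g vmu1 vmu2 = 1])].
Proof.
move=> P1 P2 sumE nn N0; case: (boolP (0 < dot d (clsL k))) => dL; last first.
  move: N0; rewrite /Nord (negbTE dL); case: ifP => // /and4P[/existsP[i /eqP ->] /eqP -> /eqP -> /eqP ->] _.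
  by constructor 3; exists i.
have [dL1 g0 v2] : [/\ dot d (clsL k) = 1, g = 0%N & vmu2 = [::]].
  have : dot d (clsL k) - 1 + g%:Z + (size vmu2)%:Z <= 0.
    by rewrite leNgt; apply/negP => n0; apply: nn.
  move: dL; case: (vmu2) => [|x s] /=; move: (dot _ _) => y; last by lia.
  by split=> //; lia.
subst g vmu2; have a0E : (size vmu1)%:Z = dot d (clsL k) - 1 + 0%N%:Z + (size vmu1)%:Z + (size ([::] : seq nat))%:Z.
  by rewrite dL1 /=; lia.
have ne := Nord_neq0 a0E dL N0.
have [a [aE Ea]] : exists a : 'I_k -> nat, (forall i, (a i)%:Z = dot d (clsEi i)) /\ (fun i => absz (dot d (clsEi i))) = a.
  by have [X [_ aE _ _]] := ne; exists (fun i => absz (dot d (clsEi i))).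
have := ne; rewrite Ea => -[X XM].
have sum2 : (sumn vmu1 + \sum_i a i = 2)%N.
  move: sumE; rewrite dotE -dotL dL1 (eq_bigr (fun i => - (a i)%:Z)) => [|i _]; last by rewrite aE dotEi opprK.
  rewrite sumrN -(big_morph Posz PoszD (erefl _)) /=; move: (sumn _) (\sum_i _)%N => x y; lia.
have aEq (d' : H2 k) : dot d' (clsL k) = 1 -> (forall i, (a i)%:Z = dot d' (clsEi i)) -> d = d'.
  by move=> E1 E2; apply: dot_inj => [|i]; rewrite ?dL1 ?E1 // -aE E2.
have dLL : dot (clsL k) (clsL k) = 1 by rewrite dotL.
have dEL i : dot (clsEi i) (clsL k) = 0 by rewrite dotL.
have a0 : (\sum_i a i = 0)%N -> d = clsL k.
  move/eqP; rewrite sum_nat_eq0 => /forall_inP H; apply: aEq => // i.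
  by rewrite dot_clsL (eqP (H i isT)).
have pos (y : nat) (s : seq nat) : parts_pos s -> y \in s -> (0 < y)%N by case: y => // /negP.
case: vmu1 P1 sumE nn N0 a0E ne X XM sum2 => [|x [|y [|z s]]] P1 sumE nn N0 a0E ne X XM sum2.
- have a1 i : (a i <= 1)%N by apply: (card0_le1 dL sumE XM).
  have [i [j [ij aij]]] := sum_nat_eq2P a1 sum2; constructor 4; right; exists i, j.
  have Ed : d = clsL k - clsEi i - clsEi j.
    apply: aEq => [|l]; first by rewrite !dotBl dLL !dEL !subr0.
    by rewrite !dotBl dot_clsL !dot_clsEi aij; do 2?case: eqP.
  split=> //; first by rewrite {1}Ed.
  apply: (Nord_no_label dL); [by rewrite -sumE | by rewrite dL1 | exact: ne].
- case: x P1 sum2 {sumE nn N0 a0E ne X XM} => [|[|[|x]]] P1 sum2; first by move: P1; rewrite /parts_pos inE.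
  + have [|i ai] := @sum_nat_eq1P _ a; first by move: sum2 => /=; lia.
    constructor 4; left; exists i; congr (_, _, _, _); apply: aEq => [|l]; first by rewrite dotBl dLL dEL subr0.
    by rewrite dotBl dot_clsL dot_clsEi ai; case: eqP.
  + by constructor 1; rewrite a0 //; move: sum2 => /=; lia.
  by exfalso; move: sum2 => /=; lia.
- have [x0 y0] : (0 < x)%N /\ (0 < y)%N.
    by split; apply: (pos _ _ P1); rewrite !inE eqxx ?orbT.
  have [Ex [Ey E0]] : x = 1%N /\ y = 1%N /\ (\sum_i a i = 0)%N by move: sum2 => /=; move: (\sum_i _)%N => t; lia.
  by constructor 2; rewrite a0 // Ex Ey.
exfalso; have [x0 [y0 z0]] : (0 < x)%N /\ (0 < y)%N /\ (0 < z)%N.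
  by split; [|split]; apply: (pos _ _ P1); rewrite !inE eqxx ?orbT.
by move: sum2 => /=; move: (sumn s) (\sum_i _)%N => t t'; lia.
Qed.

From mathcomp Require Import boolp classical_sets cardinality fsbigop.
Local Open Scope classical_set_scope.
Local Open Scope ring_scope.
Local Open Scope mset_scope.

Theorem theorem1p6 (k : nat) :
  (forall (g : nat) (d : H2 k) (vmu1 vmu2 : seq nat),
     let mu1 := seq_mset vmu1 in
     let mu2 := seq_mset vmu2 in
     0 < dot d (clsL k) -> 0 <= dot d (clsE k) ->
     parts_pos vmu1 -> parts_pos vmu2 ->
     (sumn vmu1)%:Z + (sumn vmu2)%:Z = dot d (clsE k) ->
     0 < dot d (clsL k) - 1 + g%:Z + (size vmu2)%:Z ->
     finite_set [set I | admissible d g mu1 mu2 I /\ second_term d g mu1 mu2 I != 0] /\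
     Nord d g vmu1 vmu2 =
       \sum_(w <- finsupp mu2) w%:R * Nq d g (mu1 `+` [mset w]) (mu2 `\ w) +
       \sum_(I \in [set I | admissible d g mu1 mu2 I]) second_term d g mu1 mu2 I) /\
  [/\ Nord (clsL k) 0 [:: 2%N] [::] = qint 2 / 2,
      Nord (clsL k) 0 [:: 1%N; 1%N] [::] = 1,
      forall i : 'I_k, Nord (clsEi i) 0 [::] [:: 1%N] = 1,
      forall i : 'I_k, Nord (clsL k - clsEi i) 0 [:: 1%N] [::] = 1 &
      forall (g : nat) (d : H2 k) (vmu1 vmu2 : seq nat),
        parts_pos vmu1 -> parts_pos vmu2 ->
        (sumn vmu1)%:Z + (sumn vmu2)%:Z = dot d (clsE k) ->
        ~ (0 < dot d (clsL k) /\
           0 < dot d (clsL k) - 1 + g%:Z + (size vmu2)%:Z) ->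
        Nord d g vmu1 vmu2 <> 0 ->
        [\/ (d, g, vmu1, vmu2) = (clsL k, 0%N, [:: 2%N], [::]),
            (d, g, vmu1, vmu2) = (clsL k, 0%N, [:: 1%N; 1%N], [::]),
            exists i : 'I_k, (d, g, vmu1, vmu2) = (clsEi i, 0%N, [::], [:: 1%N]) |
            (exists i : 'I_k,
               (d, g, vmu1, vmu2) = (clsL k - clsEi i, 0%N, [:: 1%N], [::])) \/
            (exists i j : 'I_k, [/\ i != j,
               (d, g, vmu1, vmu2) = (clsL k - clsEi i - clsEi j, 0%N, [::], [::]) &
               Nord d g vmu1 vmu2 = 1])]].
Proof.
split.
  move=> g d vmu1 vmu2 mu1 mu2 dL dE P1 P2 sumE n0.
  (* [B] has to bound the weights of all edges, at most 2 d.[L], as well as the prescribed parts of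
     mu_1. *)
  pose B := (absz (2 * dot d (clsL k))%R + sumn vmu1)%N.
  have dB : 2 * dot d (clsL k) <= B%:Z.
    by rewrite /B PoszD; move: (dot d _) (sumn vmu1) => x s; lia.
  exact: (recursion (@Nord_encode k B) P1 P2 sumE dL dB (leq_addl _ _) n0).
have dLL : dot (clsL k) (clsL k) = 1 by rewrite dotL.
split; last exact: initial_data.
- rewrite (@Nord_one_leaf _ _ _ (@finset.set0 _)) ?cards0 // => i.
  by rewrite dot_clsL finset.in_set0.
- by apply: Nord_two_leaves => // i; rewrite dot_clsL.
- move=> i; rewrite /Nord dotL /= ifT //; apply/andP; split=> //.
  by apply/existsP; exists i.
move=> i; rewrite (@Nord_one_leaf _ _ _ (finset.set1 i)) ?cards1 ?qint1 ?divr1 //.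
  by rewrite dotBl dLL dotL subr0.
by move=> j; rewrite dotBl dot_clsL dot_clsEi finset.in_set1 sub0r opprK.
Qed.
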